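(* Let $n\ge 0$ be an integer and let $C_1, C_2\subset\mathbb{CP}^2$ be two $(n,1)$-arrangements (each consisting of $n$ lines and one conic). The following are equivalent: (1) There exist tubular neighborhoods $T(C_1)$ of $C_1$ and $T(C_2)$ of $C_2$ in $\mathbb{CP}^2$ and a homeomorphism $h:T(C_1)\to T(C_2)$ with $h(C_1)=C_2$. (2) There exist indexings of the lines of $C_1$ and of the lines of $C_2$ by $\{1,\dots,n\}$, and a bijection $b:I(C_1)\to I(C_2)$, such that for every $p\in I(C_1)$: (i) $\operatorname{char}(b(p))=\operatorname{char}(p)$, where the characteristics are taken in $C_2$ and $C_1$ respectively; (ii) the set of indices of lines of $C_1$ passing through $p$ equals the set of indices of lines of $C_2$ passing through $b(p)$; and (iii) if a line of $C_1$ is tangent to the conic at $p$, then the line of $C_2$ with the same index is tangent to the conic of $C_2$ at $b(p)$.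
   Context: An $(n,m)$-arrangement is a reduced plane curve in $\mathbb{CP}^2$ that is the union of $n$ distinct lines and $m$ distinct conics; conics are irreducible (smooth), and the components are these lines and conics. For an $(n,1)$-arrangement $C$, $I(C)$ denotes the set of all intersection points of $C$, i.e. points lying on at least two distinct components. For $p\in I(C)$ the characteristic triple is $\operatorname{char}(p)=(\chi_1,\chi_2,\chi_3)$, where: $\chi_1=1$ if $p$ is a tangency point (some line of $C$ is tangent to the conic at $p$), and $\chi_1=0$ otherwise; $\chi_2=1$ if $p$ lies on the conic, and $\chi_2=0$ otherwise; $\chi_3$ is the number of distinct lines of $C$ through $p$ that are not tangent to the conic at $p$. *)

(* Defs.v *)
From HB Require Import structures.
From mathcomp Require Import all_boot all_order all_algebra generic_quotient.
From mathcomp Require Import finmap complex.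
From mathcomp Require Import all_classical all_reals all_analysis.

Set Implicit Arguments.
Unset Strict Implicit.
Unset Printing Implicit Defensive.

Import Order.TTheory GRing.Theory Num.Theory.
Import numFieldNormedType.Exports.

Local Open Scope classical_set_scope.
Local Open Scope ring_scope.
Local Open Scope complex_scope.
Local Open Scope quotient_scope.

(* The metric topology of C = R[i], i.e. the one every numFieldType carries. *)
HB.instance Definition _ (R : realType) :=
  PseudoPointedMetric.copy R[i] (R[i])^o.

Section ProjectivePlane.
Context {R : realType}.

Definition nonzero_vec : set 'rV[R[i]]_3 := [set v | v != 0].

Definition proportional (u v : nonzero_vec) : bool :=
  `[< exists c : R[i], set_val u = c *: set_val v >].

Lemma proportional_refl : reflexive proportional.
Proof. by move=> u; apply/asboolP; exists 1; rewrite scale1r. Qed.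

Lemma proportional_sym : symmetric proportional.
Proof.
suff sub u v : proportional u v -> proportional v u.
  by move=> u v; apply/idP/idP; exact: sub.
move=> /asboolP[c uv]; apply/asboolP; exists c^-1.
have u0 : set_val u != 0 by have := set_valP u.
have c0 : c != 0 by apply: contraNneq u0 => c0; rewrite uv c0 scale0r.
by rewrite uv scalerA mulVf// scale1r.
Qed.

Lemma proportional_trans : transitive proportional.
Proof.
move=> v u w /asboolP[c uv] /asboolP[d vw]; apply/asboolP.
by exists (c * d); rewrite uv vw scalerA.
Qed.

Canonical proportional_equiv :=
  EquivRel proportional proportional_refl proportional_sym proportional_trans.

End ProjectivePlane.

(* CP^2 with the quotient topology of C^3 \ {0}. *)
Definition CP2 (R : realType) : topologicalType :=
  quotient_topology {eq_quot (@proportional_equiv R)}.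

Section Arrangements.
Context {R : realType}.

Definition hcoord (p : CP2 R) : 'rV[R[i]]_3 := set_val (repr p).

(* The projective zero locus of a linear form, resp. of the quadratic form with
   matrix A; these are homogeneous, so the choice of hcoord is immaterial. *)
Definition line_of (a : 'rV[R[i]]_3) : set (CP2 R) :=
  [set p | hcoord p *m a^T = 0].

Definition conic_of (A : 'M[R[i]]_3) : set (CP2 R) :=
  [set p | hcoord p *m A *m (hcoord p)^T = 0].

Definition is_line (L : set (CP2 R)) : Prop :=
  exists2 a : 'rV[R[i]]_3, a != 0 & L = line_of a.

(* For symmetric A the gradient of v A v^T is 2 v A. *)
Definition smooth_form (A : 'M[R[i]]_3) : Prop :=
  A^T = A /\
  forall v : 'rV[R[i]]_3, v != 0 -> v *m A *m v^T = 0 -> v *m A != 0.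

(* A ternary quadratic form is reducible only as a product of linear forms. *)
Definition irreducible_form (A : 'M[R[i]]_3) : Prop :=
  A != 0 /\
  ~ exists a b : 'rV[R[i]]_3,
      forall v : 'rV[R[i]]_3, v *m A *m v^T = (v *m a^T) *m (v *m b^T).

(* An (n,1)-arrangement. Lines are kept as an unindexed set of n point sets;
   the conic is given by its equation, unique up to a nonzero scalar.
   Over C irreducibility and smoothness of the conic are equivalent. *)
Record arrangement (n : nat) := Arrangement {
  lines : set (set (CP2 R));
  lines_is_line : forall L, lines L -> is_line L;
  card_lines : (lines #= `I_n)%card;
  qform : 'M[R[i]]_3;
  qform_irreducible : irreducible_form qform;
  qform_smooth : smooth_form qform }.

Section OneArrangement.
Context {n : nat} (C : arrangement n).

Definition conic : set (CP2 R) := conic_of (qform C).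

Definition components : set (set (CP2 R)) := lines C `|` [set conic].

Definition curve : set (CP2 R) := \bigcup_(D in components) D.

Definition intersection_points : set (CP2 R) :=
  [set p | exists D1 D2,
     [/\ components D1, components D2, D1 <> D2, D1 p & D2 p]].

(* The projective tangent line of the conic at p is the kernel of the
   gradient, { q | hcoord p A (hcoord q)^T = 0 }. *)
Definition tangent_at (L : set (CP2 R)) (p : CP2 R) : Prop :=
  conic p /\ L = line_of (hcoord p *m qform C).

Definition char (p : CP2 R) : nat * nat * nat :=
  (nat_of_bool `[< exists2 L, lines C L & tangent_at L p >],
   nat_of_bool `[< conic p >],
   #|` fset_set [set L | [/\ lines C L, L p & ~ tangent_at L p]]|%fset).

Definition line_indexing (l : 'I_n -> set (CP2 R)) : Prop :=
  set_bij [set: 'I_n] (lines C) l.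

End OneArrangement.

End Arrangements.

Definition homeomorphism (X Y : topologicalType) (A : set X) (B : set Y)
    (f : X -> Y) : Prop :=
  set_bij A B f /\
  exists g : Y -> X,
    [/\ {in A, cancel f g}, {within A, continuous f}
      & {within B, continuous g}].

Section TubularNeighborhoods.
Context {R : realType}.

Definition frontier (T : set (CP2 R)) : set (CP2 R) := closure T `\` T°.

(* T is, near p, a half-space of R^4 in a chart of the ambient 4-manifold. *)
Definition half_space_chart (T : set (CP2 R)) (p : CP2 R) : Prop :=
  exists (U : set (CP2 R)) (V : set 'rV[R]_4) (f : CP2 R -> 'rV[R]_4),
    [/\ open U, U p, open V, homeomorphism U V f
      & forall q, U q -> (T q <-> 0 <= f q ord0 ord0)].

(* Tubular (regular) neighborhood of a possibly singular compact set S: a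
   compact 4-dimensional submanifold T with boundary dT, containing S in its
   interior, which is the mapping cylinder of a map dT -> S. The cylinder is
   given by H : dT x [0, 1] -> T, with H(-, 0) = id, with H(-, 1) : dT -> S,
   and with H : dT x [0, 1[ -> T \ S bijective (by compactness, this is then a
   homeomorphism and T is the quotient mapping cylinder). *)
Definition tubular_neighborhood (T S : set (CP2 R)) : Prop :=
  [/\ compact T, S `<=` T°,
      forall p, frontier T p -> half_space_chart T p
    & exists H : CP2 R * R -> CP2 R,
      [/\ {within frontier T `*` `[0, 1], continuous H},
          forall p, frontier T p -> H (p, 0) = p,
          set_bij (frontier T `*` `[0, 1[) (T `\` S) H
        & forall p, frontier T p -> S (H (p, 1))]].

End TubularNeighborhoods.

(* Main.v *)
(* (2) => (1). Take for the point (0 : 1 : 0) a generic point of the conic, and for the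
   line at infinity the tangent there. In affine coordinates the components are the graphs of
   x^2 and of a_i x + b_i, and their crossings lie over a finite set P, at most one over each x.
   Two such curves with the same combinatorics have homeomorphic neighborhoods: homeomorphisms
   carrying single components to each other are glued to homeomorphisms near the crossings
   that act on the slopes of the branches. Tubes are constructed after making the conic
   exactly conical near each crossing: the vertical distance to the curve, suitably weighted at
   infinity, then has a flow that scales it, and its sublevel sets are mapping cylinders.

   (1) => (2). Components are closed, meet in finitely many points, and stay connected when
   finitely many points are removed, so h permutes them and preserves incidences. A line is
   tangent to the conic iff it meets it only once, so tangency is preserved if the conics
   correspond. Otherwise let h map the line L to the conic. Every other line then meets the
   conic Q and L exactly once, and no two of them meet on Q or on L. So exchanging Q with L,
   and for each other line its points on Q and L, is an automorphism of the incidence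
   structure; composing h with it makes the conics correspond. *)
From HB Require Import structures.
Require Import Defs.
From mathcomp Require Import all_boot all_order all_algebra perm.
From mathcomp Require Import all_classical all_reals all_analysis.
From mathcomp Require Import generic_quotient complex finmap.
From mathcomp Require Import ring lra.
Set Implicit Arguments.
Unset Strict Implicit.
Unset Printing Implicit Defensive.
Import Order.TTheory GRing.Theory Num.Theory.
Import numFieldNormedType.Exports.
Local Open Scope classical_set_scope.
Local Open Scope ring_scope.
Local Open Scope complex_scope.

(** The obstacle to tubes is a tangency: conic and tangent separate only quadratically there. Near
    each crossing abscissa [X^2] is replaced by [(r / |X|) X^2]; every branch becomes linear along
    rays, and branches through a common point separate at least linearly in [|X|], so tangencies and
    transversal crossings obey the same estimates. The change is undone afterwards by homeomorphisms
    of the whole plane, which must fix all the lines. Tubes are needed inside every neighborhood of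
    the curve, because the homeomorphism between two curves lives only on some open neighborhood: a
    tube inside its domain is carried to a tube. No differentiability enters: the flow is an
    explicit formula, and homogeneity of the distance function takes the place of a regular value in
    the half-space charts. In the normal form all crossing abscissas have modulus at most 1/8, so
    the affine chart [|x| < 1] and the charts [|1/x| < 2] at infinity overlap only where the curve
    is unmodified and its branches are far apart. *)

HB.instance Definition _ (R : realType) := NormedModule.copy R[i] (R[i])^o.

(** * Limits of complex-valued functions *)
Section ComplexTopology.
Variable R : realType.
Implicit Types (z w : R[i]) (a b : R).
(** The norm of [R[i]] has values in [R[i]]; a modulus in [R] keeps later estimates inside the
    ordered field, where [lra] and [nra] apply. *)
Definition cabs z : R := complex.Re `|z|.
Lemma cabsE z : `|z| = (cabs z)%:C.
Proof. by rewrite /cabs normc_def. Qed.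
Lemma lecC a b : (a%:C <= b%:C) = (a <= b).
Proof. by rewrite lecE /= eqxx. Qed.
Lemma ltcC a b : (a%:C < b%:C) = (a < b).
Proof. by rewrite ltcE /= eqxx. Qed.
Lemma cabs_ge0 z : 0 <= cabs z.
Proof. by rewrite -lecC -cabsE; exact: normr_ge0. Qed.
Lemma cabs0 : cabs 0 = 0.
Proof. by rewrite /cabs normr0. Qed.
Lemma cabs_eq0 z : (cabs z == 0) = (z == 0).
Proof. by rewrite -[RHS]normr_eq0 cabsE; apply/eqP/eqP => [->//|[]]. Qed.
Lemma cabs_gt0 z : (0 < cabs z) = (z != 0).
Proof. by rewrite lt_def cabs_ge0 cabs_eq0 andbT. Qed.
Lemma cabsM z w : cabs (z * w) = cabs z * cabs w.
Proof. by apply: (@complexI R); rewrite rmorphM /= -!cabsE normrM. Qed.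
Lemma cabsV z : cabs z^-1 = (cabs z)^-1.
Proof. by apply: (@complexI R); rewrite fmorphV /= -!cabsE normfV. Qed.
Lemma cabsX z n : cabs (z ^+ n) = cabs z ^+ n.
Proof. by apply: (@complexI R); rewrite rmorphXn /= -!cabsE normrX. Qed.
Lemma cabsN z : cabs (- z) = cabs z.
Proof. by rewrite /cabs normrN. Qed.
Lemma cabsB z w : cabs (z - w) = cabs (w - z).
Proof. by rewrite -cabsN opprB. Qed.
Lemma cabsD z w : cabs (z + w) <= cabs z + cabs w.
Proof. by rewrite -lecC rmorphD /= -!cabsE ler_normD. Qed.
Lemma cabs_tri z w u : cabs (z - w) <= cabs (z - u) + cabs (u - w).
Proof. by apply: le_trans (cabsD _ _); rewrite subrKA. Qed.
Lemma cabs_real a : cabs a%:C = `|a|.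
Proof. by rewrite /cabs normc_def /= expr0n /= addr0 sqrtr_sqr. Qed.
Lemma cabs1 : cabs 1 = 1.
Proof. by rewrite (cabs_real 1) normr1. Qed.
Lemma cabs_Re z : `|complex.Re z| <= cabs z.
Proof.
rewrite /cabs normc_def /= -sqrtr_sqr ler_wsqrtr// lerDl sqr_ge0//.
Qed.
Lemma cabs_Im z : `|complex.Im z| <= cabs z.
Proof.
rewrite /cabs normc_def /= -sqrtr_sqr ler_wsqrtr// lerDr sqr_ge0//.
Qed.
Lemma cabs_le z : cabs z <= `|complex.Re z| + `|complex.Im z|.
Proof.
rewrite [X in cabs X]complexE; apply: le_trans (cabsD _ _) _.
rewrite cabsM !cabs_real /= [cabs 'i](_ : _ = 1) ?mul1r//.
by rewrite /cabs normc_def /= expr0n expr1n add0r sqrtr1.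
Qed.
Lemma nbhsC z (A : set R[i]) :
  nbhs z A <-> exists2 e : R, 0 < e & forall w, cabs (w - z) < e -> A w.
Proof.
split.
  move=> /nbhs_ballP[e e0 eA]; exists (complex.Re e).
    by move: e0; rewrite /= ltcE /= => /andP[].
  move=> w we; apply: eA; rewrite -ball_normE /= distrC cabsE.
  move: e0; rewrite /= !ltcE /= => /andP[/eqP -> _]; rewrite eqxx.
  exact: we.
move=> [e e0 eA]; apply/nbhs_ballP; exists e%:C; first by rewrite /= ltcC.
by move=> w; rewrite -ball_normE /= distrC cabsE ltcC; exact: eA.
Qed.
Lemma cvgCP (T : Type) (F : set_system T) {FF : Filter F} (f : T -> R[i]) z :
  f @ F --> z <-> cabs (f t - z) @[t --> F] --> (0 : R).
Proof.
split => fz.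
  apply/cvgrPdist_lt => e e0.
  have /fz : nbhs z [set w | cabs (w - z) < e] by apply/nbhsC; exists e.
  rewrite nbhs_filterE /fmap /=; apply: filterS => t /=.
  by rewrite sub0r normrN ger0_norm ?cabs_ge0.
move=> A /nbhsC[e e0 eA]; have /cvgrPdist_lt/(_ _ e0) := fz.
rewrite nbhs_filterE /fmap /=; apply: filterS => t /=.
by rewrite sub0r normrN ger0_norm ?cabs_ge0// => /eA.
Qed.
Lemma cvg_squeeze0 (T : Type) (F : set_system T) {FF : Filter F} (f g : T -> R) :
  (\forall t \near F, `|f t| <= g t) -> g @ F --> (0 : R) -> f @ F --> (0 : R).
Proof.
move=> fg g0; apply/cvgrPdist_lt => e e0; have /cvgrPdist_lt/(_ _ e0) := g0.
apply: filterS2 fg => t; rewrite !sub0r !normrN => /le_lt_trans h.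
by move/(le_lt_trans (ler_norm _)) => /h.
Qed.
Lemma cvg_cabs_sub (T : Type) (F : set_system T) {FF : Filter F} (f : T -> R) (g : T -> R[i]) a z :
  (forall t, `|f t - a| <= cabs (g t - z)) -> g @ F --> z -> f @ F --> a.
Proof.
move=> h /cvgCP gz; apply/cvgrPdist_lt => e e0; have /cvgrPdist_lt/(_ _ e0) := gz.
apply: filterS => t; rewrite sub0r normrN ger0_norm ?cabs_ge0// distrC.
exact: le_lt_trans.
Qed.
Lemma cvg_cabs (T : Type) (F : set_system T) {FF : Filter F} (f : T -> R[i]) z :
  f @ F --> z -> cabs (f t) @[t --> F] --> cabs z.
Proof.
apply: cvg_cabs_sub => t; rewrite ler_norml; apply/andP; split.
  by rewrite lerBrDl lerBlDr cabsB -[X in cabs X](subrK (f t) z) addrC cabsD.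
by rewrite lerBlDr -[X in cabs X](subrK z (f t)) cabsD.
Qed.
Lemma cvg_Re (T : Type) (F : set_system T) {FF : Filter F} (f : T -> R[i]) z :
  f @ F --> z -> complex.Re (f t) @[t --> F] --> complex.Re z.
Proof. by apply: cvg_cabs_sub => t; rewrite -raddfB cabs_Re. Qed.
Lemma cvg_Im (T : Type) (F : set_system T) {FF : Filter F} (f : T -> R[i]) z :
  f @ F --> z -> complex.Im (f t) @[t --> F] --> complex.Im z.
Proof. by apply: cvg_cabs_sub => t; rewrite -raddfB cabs_Im. Qed.
Lemma cvg_complex (T : Type) (F : set_system T) {FF : Filter F} (f g : T -> R) a b :
  f @ F --> a -> g @ F --> b -> (f t +i* g t) @[t --> F] --> (a +i* b).
Proof.
move=> fa gb; apply/cvgCP.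
apply: (@cvg_squeeze0 _ _ _ _ (fun t => `|f t - a| + `|g t - b|)).
  by near=> t; rewrite ger0_norm ?cabs_ge0//; exact: cabs_le.
rewrite -[X in _ --> X]addr0; apply: cvgD.
  by rewrite -(normr0 R) -[X in `|X|](subrr a); apply: cvg_norm; apply: cvgB => //; exact: cvg_cst.
by rewrite -(normr0 R) -[X in `|X|](subrr b); apply: cvg_norm; apply: cvgB => //; exact: cvg_cst.
Unshelve. all: by end_near. Qed.
Lemma cvg_real (T : Type) (F : set_system T) {FF : Filter F} (f : T -> R) a :
  f @ F --> a -> ((f t)%:C) @[t --> F] --> a%:C.
Proof. by move=> fa; apply: cvg_complex => //; exact: cvg_cst. Qed.
Lemma cvgC_norm0 (T : Type) (F : set_system T) {FF : Filter F} (f : T -> R[i]) (g : T -> R) z :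
  (\forall t \near F, cabs (f t - z) <= g t) -> g @ F --> (0 : R) -> f @ F --> z.
Proof.
move=> h g0; apply/cvgCP; apply: cvg_squeeze0 g0; apply: filterS h => t.
by rewrite ger0_norm ?cabs_ge0.
Qed.

Section Ops.
Variables (T : Type) (F : set_system T).
Context {FF : Filter F}.
Lemma cvgRmax (f g : T -> R) a b : f @ F --> a -> g @ F --> b ->
  Num.max (f t) (g t) @[t --> F] --> Num.max a b.
Proof.
move=> fa gb; rewrite (_ : (fun t => Num.max (f t) (g t)) = fun t => (f t + g t + `|f t - g t|) / 2).
  by rewrite maxr_absE; apply: cvgMl; apply: cvgD; [exact: cvgD|apply: cvg_norm; exact: cvgB].
by apply/funext => t; rewrite maxr_absE.
Qed.
Lemma cvgRmin (f g : T -> R) a b : f @ F --> a -> g @ F --> b ->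
  Num.min (f t) (g t) @[t --> F] --> Num.min a b.
Proof.
move=> fa gb; rewrite (_ : (fun t => Num.min (f t) (g t)) = fun t => (f t + g t - `|f t - g t|) / 2).
  by rewrite minr_absE; apply: cvgMl; apply: cvgB; [exact: cvgD|apply: cvg_norm; exact: cvgB].
by apply/funext => t; rewrite minr_absE.
Qed.
End Ops.
End ComplexTopology.
(* [f @ F --> a] with a rigid head, so that unification never unfolds filters. *)
Definition tends (T : Type) (F : set_system T) (U : topologicalType) (f : T -> U) (a : U) :=
  f @ F --> a.
Arguments tends {T} F {U} f a.

Section Tends.
Variables (R : realType) (T : Type) (F : set_system T).
Context {FF : Filter F}.
Notation C := R[i].
Lemma tends_cst (U : topologicalType) (a : U) : tends F (fun=> a) a.
Proof. exact: cvg_cst. Qed.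
Lemma tends_near (U : topologicalType) (f g : T -> U) a :
  F [set t | g t = f t] -> tends F f a -> tends F g a.
Proof.
move=> fg fa A /fa; rewrite /= !nbhs_filterE /fmap /=.
by apply: (@filterS2 _ F _ _ _ _ _ fg) => t /= ->.
Qed.
Lemma tends_ext (U : topologicalType) (f g : T -> U) a :
  f =1 g -> tends F f a -> tends F g a.
Proof. by move=> /funext ->. Qed.
Lemma tends_comp (U V : topologicalType) (f : T -> U) (g : U -> V) a b :
  tends F f a -> tends (nbhs a) g b -> tends F (fun t => g (f t)) b.
Proof. by move=> fa gb; exact: (cvg_comp f g fa gb). Qed.
Lemma tends_pair (U V : topologicalType) (f : T -> U) (g : T -> V) a b :
  tends F f a -> tends F g b -> tends F (fun t => (f t, g t)) (a, b).
Proof. exact: cvg_pair. Qed.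
Lemma tends_fst (U V : topologicalType) (f : T -> U * V) a :
  tends F f a -> tends F (fun t => (f t).1) a.1.
Proof. by case: a => a b fa; apply: (cvg_comp f fst fa); exact: cvg_fst. Qed.
Lemma tends_snd (U V : topologicalType) (f : T -> U * V) a :
  tends F f a -> tends F (fun t => (f t).2) a.2.
Proof. by case: a => a b fa; apply: (cvg_comp f snd fa); exact: cvg_snd. Qed.
Lemma tendsCD (f g : T -> C) z w : tends F f z -> tends F g w -> tends F (fun t => f t + g t) (z + w).
Proof. exact: cvgD. Qed.
Lemma tendsCN (f : T -> C) z : tends F f z -> tends F (fun t => - f t) (- z).
Proof. exact: cvgN. Qed.
Lemma tendsCM (f g : T -> C) z w : tends F f z -> tends F g w -> tends F (fun t => f t * g t) (z * w).
Proof. exact: cvgM. Qed.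
Lemma tendsCV (f : T -> C) z : z != 0 -> tends F f z -> tends F (fun t => (f t)^-1) z^-1.
Proof. by move=> z0; exact: cvgV. Qed.
Lemma tendsCX (f : T -> C) z n : tends F f z -> tends F (fun t => f t ^+ n) (z ^+ n).
Proof.
move=> fz; elim: n => [|n IH]; first exact: tends_cst.
rewrite exprS (_ : (fun t => _) = fun t => f t * f t ^+ n); first exact: tendsCM.
by apply/funext => t; rewrite exprS.
Qed.
Lemma tendsRD (f g : T -> R) a b : tends F f a -> tends F g b -> tends F (fun t => f t + g t) (a + b).
Proof. exact: cvgD. Qed.
Lemma tendsRN (f : T -> R) a : tends F f a -> tends F (fun t => - f t) (- a).
Proof. exact: cvgN. Qed.
Lemma tendsRM (f g : T -> R) a b : tends F f a -> tends F g b -> tends F (fun t => f t * g t) (a * b).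
Proof. exact: cvgM. Qed.
Lemma tendsRV (f : T -> R) a : a != 0 -> tends F f a -> tends F (fun t => (f t)^-1) a^-1.
Proof. by move=> z0; exact: cvgV. Qed.
Lemma tends_max (f g : T -> R) a b : tends F f a -> tends F g b ->
  tends F (fun t => Num.max (f t) (g t)) (Num.max a b).
Proof. exact: cvgRmax. Qed.
Lemma tends_min (f g : T -> R) a b : tends F f a -> tends F g b ->
  tends F (fun t => Num.min (f t) (g t)) (Num.min a b).
Proof. exact: cvgRmin. Qed.
Lemma tends_cabs (f : T -> C) z : tends F f z -> tends F (fun t => cabs (f t)) (cabs z).
Proof. exact: cvg_cabs. Qed.
Lemma tends_Re (f : T -> C) z : tends F f z -> tends F (fun t => complex.Re (f t)) (complex.Re z).
Proof. exact: cvg_Re. Qed.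
Lemma tends_Im (f : T -> C) z : tends F f z -> tends F (fun t => complex.Im (f t)) (complex.Im z).
Proof. exact: cvg_Im. Qed.
Lemma tends_real (f : T -> R) a : tends F f a -> tends F (fun t => (f t)%:C) a%:C.
Proof. exact: cvg_real. Qed.
Lemma tends_complex (f g : T -> R) a b : tends F f a -> tends F g b ->
  tends F (fun t => f t +i* g t) (a +i* b).
Proof. exact: cvg_complex. Qed.
Lemma tends_sum (I : Type) (s : seq I) (f : I -> T -> C) (a : I -> C) :
  (forall i, tends F (f i) (a i)) -> tends F (fun t => \sum_(i <- s) f i t) (\sum_(i <- s) a i).
Proof.
move=> fa; elim: s => [|i s IH].
  have h : tends F (fun=> 0 : C) 0 by exact: tends_cst.
  by rewrite big_nil; apply: tends_ext h => t; rewrite big_nil.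
by rewrite big_cons; have := tendsCD (fa i) IH; apply: tends_ext => t; rewrite big_cons.
Qed.
End Tends.
Lemma tends_id (U : topologicalType) (x : U) : tends (nbhs x) (fun y => y) x.
Proof. exact: cvg_id. Qed.
Ltac tends_hyp :=
  match goal with H : tends _ ?g _ |- tends _ ?f _ =>
    let f' := eval cbv beta in (fun t => f t) in let g' := eval cbv beta in (fun t => g t) in
    constr_eq f' g'; exact H end.
Ltac is_const_head f :=
  lazymatch f with ?g _ => is_const_head g | ?g => first [is_const g | is_proj g] end.
Ltac tends_step :=
  lazymatch goal with
  | |- tends _ (fun _ => ?a) _ => simple apply tends_cst
  | |- tends _ (fun t => t) _ => first [simple apply tends_id|apply tends_id]
  | |- tends _ (fun t => cabs (@?f t)) _ => apply tends_cabs
  | |- tends _ (fun t => complex.Re (@?f t)) _ => apply tends_Re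
  | |- tends _ (fun t => complex.Im (@?f t)) _ => apply tends_Im
  | |- tends _ (fun t => (@?f t)%:C) _ => apply tends_real
  | |- tends _ (fun t => (@?f t +i* @?g t)) _ => apply tends_complex
  | |- tends _ (fun t => Num.max (@?f t) (@?g t)) _ => apply tends_max
  | |- tends _ (fun t => Num.min (@?f t) (@?g t)) _ => apply tends_min
  | |- tends _ (fun t => (@?f t + @?g t)%R) _ => first [apply tendsCD|apply tendsRD]
  | |- tends _ (fun t => (@?f t * @?g t)%R) _ => first [apply tendsCM|apply tendsRM]
  | |- tends _ (fun t => (- @?f t)%R) _ => first [apply tendsCN|apply tendsRN]
  | |- tends _ (fun t => (@?f t ^-1)%R) _ => first [apply tendsCV|apply tendsRV]
  | |- tends _ (fun t => (@?f t ^+ _)%R) _ => simple apply tendsCX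
  | |- tends _ (fun t => (@?f t, @?g t)) _ => apply tends_pair
  | |- tends _ (fun t => (@?f t).1) _ => apply tends_fst
  | |- tends _ (fun t => (@?f t).2) _ => apply tends_snd
  | |- Filter _ => typeclasses eauto
  | |- tends _ (fun t => _) _ => tends_hyp
  | |- tends ?F ?f ?a => first [tends_hyp | is_const_head f; change (tends F (fun t => f t) a)]
  end.
Ltac tends_in :=
  lazymatch goal with
  | |- cvg_to (nbhs (fmap ?f ?F)) (nbhs ?a) => change (tends F f a)
  | |- continuous_at ?x ?f => change (tends (nbhs x) f (f x))
  | |- prop_for ?x (inPhantom (continuous ?f)) => change (tends (nbhs x) f (f x))
  | |- _ => idtac
  end.
(** Recursion on the head symbol of the function: opaque subterms are closed by hypotheses of the
    form [tends], and nonvanishing conditions of inverted terms are left as goals. *)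
Ltac tendsto := tends_in; repeat tends_step.

(** * The topology of the projective plane *)
Section RowVectors.
Lemma cvg_mx (U : topologicalType) (T : Type) (F : set_system T) {FF : Filter F} m n
    (f : T -> 'M[U]_(m, n)) (M : 'M[U]_(m, n)) :
  (forall i j, f t i j @[t --> F] --> M i j) -> f @ F --> M.
Proof.
move=> fM A [P MP sPA]; rewrite nbhs_filterE /fmap /=.
suff : \forall t \near F, forall i j, P i j (f t i j).
  by apply: filterS => t Pt; exact: sPA.
apply: filter_forall => i; apply: filter_forall => j; exact: fM (MP i j).
Qed.
Lemma cvg_coord (U : topologicalType) (T : Type) (F : set_system T) {FF : Filter F} m n
    (f : T -> 'M[U]_(m, n)) (M : 'M[U]_(m, n)) i j :
  f @ F --> M -> f t i j @[t --> F] --> M i j.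
Proof.
move=> fM A MA; have /fM : nbhs M [set N | A (N i j)].
  exists (fun i' j' => if (i' == i) && (j' == j) then A else setT) => [i' j'|N /=].
    by case: ifP => [/andP[/eqP-> /eqP->]//|_]; exact: filterT.
  by move/(_ i j); rewrite !eqxx.
exact.
Qed.
End RowVectors.

Section ProjectivePlane.
Variable R : realType.
Notation C := R[i].
Implicit Types (u v : 'rV[C]_3) (p q : CP2 R).
Definition mkv (x y w : C) : 'rV[C]_3 :=
  \row_j (if j == 0 then x else if j == 1 then y else w).
Lemma mkv0 x y w : mkv x y w 0 0 = x. Proof. by rewrite mxE. Qed.
Lemma mkv1 x y w : mkv x y w 0 1 = y. Proof. by rewrite mxE. Qed.
Lemma mkv2 x y w : mkv x y w 0 2%:R = w. Proof. by rewrite mxE. Qed.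
Definition mkvE := (mkv0, mkv1, mkv2).
Lemma ord3P (P : 'I_3 -> Prop) : P 0 -> P 1 -> P 2%:R -> forall i, P i.
Proof.
move=> P0 P1 P2 [[|[|[|//]]] h].
- by rewrite (_ : Ordinal h = 0)//; exact: val_inj.
- by rewrite (_ : Ordinal h = 1)//; exact: val_inj.
- by rewrite (_ : Ordinal h = 2%:R)//; exact: val_inj.
Qed.
Lemma sum3 (V : zmodType) (F : 'I_3 -> V) : \sum_i F i = F 0 + F 1 + F 2%:R.
Proof.
rewrite !big_ord_recl big_ord0 addr0 addrA; congr (_ + F _ + F _); exact: val_inj.
Qed.
Lemma row3P u v : u 0 0 = v 0 0 -> u 0 1 = v 0 1 -> u 0 2%:R = v 0 2%:R -> u = v.
Proof. by move=> *; apply/rowP; exact: ord3P. Qed.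
Lemma mkv_eta v : mkv (v 0 0) (v 0 1) (v 0 2%:R) = v.
Proof. by apply: row3P; rewrite mkvE. Qed.
Lemma mkvZ c x y w : c *: mkv x y w = mkv (c * x) (c * y) (c * w).
Proof. by apply: row3P; rewrite mxE !mkvE. Qed.
Lemma mkv_eq0 x y w : (mkv x y w == 0) = [&& x == 0, y == 0 & w == 0].
Proof.
apply/eqP/and3P => [h|[/eqP-> /eqP-> /eqP->]].
  by split; apply/eqP; [rewrite -(mkv0 x y w)|rewrite -(mkv1 x y w)|rewrite -(mkv2 x y w)]; rewrite h mxE.
by apply: row3P; rewrite mkvE mxE.
Qed.
Lemma cvg_mkv (T : Type) (F : set_system T) {FF : Filter F} (f g h : T -> C) x y w :
  f @ F --> x -> g @ F --> y -> h @ F --> w ->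
  mkv (f t) (g t) (h t) @[t --> F] --> mkv x y w.
Proof.
move=> fx gy hw; apply: cvg_mx => i; rewrite ord1; apply: ord3P.
- by rewrite mkvE; apply: cvg_trans fx; apply: near_eq_cvg; near=> t; rewrite mkvE.
- by rewrite mkvE; apply: cvg_trans gy; apply: near_eq_cvg; near=> t; rewrite mkvE.
- by rewrite mkvE; apply: cvg_trans hw; apply: near_eq_cvg; near=> t; rewrite mkvE.
Unshelve. all: by end_near. Qed.
Lemma mkv111 : mkv 1 1 1 \in @nonzero_vec R.
Proof. by apply/mem_set; rewrite /nonzero_vec /= mkv_eq0 oner_eq0. Qed.
(** The junk value (1, 1, 1) at the zero vector makes [proj] total. *)
Definition lift_nz v : @nonzero_vec R :=
  insubd (SigSub mkv111 : @nonzero_vec R) v.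
Lemma lift_nzE v : v != 0 -> set_val (lift_nz v) = v.
Proof. by move=> v0; rewrite /lift_nz [LHS]insubdK//; exact/mem_set. Qed.
Definition proj v : CP2 R := \pi_(CP2 R)%qT (lift_nz v).
Lemma hcoord_neq0 p : hcoord p != 0.
Proof. by have := set_valP (repr p). Qed.
Lemma proj_hcoord p : proj (hcoord p) = p.
Proof.
rewrite /proj -[RHS]reprK; congr (\pi_(CP2 R)%qT _).
by apply: val_inj; apply: lift_nzE; exact: hcoord_neq0.
Qed.
Lemma proj_eqP u v : u != 0 -> v != 0 ->
  proj u = proj v <-> exists2 c, c != 0 & u = c *: v.
Proof.
move=> u0 v0; split=> [/eqmodP/asboolP|[c c0 uv]].
  rewrite !lift_nzE// => -[c uv]; exists c => //.
  by apply: contraNneq u0 => c0; rewrite uv c0 scale0r.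
by apply/eqmodP/asboolP; exists c; rewrite !lift_nzE.
Qed.
Lemma projZ c v : c != 0 -> v != 0 -> proj (c *: v) = proj v.
Proof. by move=> c0 v0; apply/proj_eqP => //; [rewrite scaler_eq0 negb_or c0|exists c]. Qed.
Lemma hcoord_proj v : v != 0 -> exists2 c, c != 0 & hcoord (proj v) = c *: v.
Proof. by move=> v0; apply/proj_eqP => //; rewrite ?hcoord_neq0 ?proj_hcoord. Qed.
Lemma projS p : exists2 v, v != 0 & p = proj v.
Proof. by exists (hcoord p); rewrite ?hcoord_neq0 ?proj_hcoord. Qed.
Lemma coord_neq0 v : v != 0 -> exists i, v 0 i != 0.
Proof.
move=> v0; apply: contrapT => /forallNP h; case/negP: v0; apply/eqP/rowP => i.
by rewrite mxE; apply/eqP/negPn/negP; exact: h.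
Qed.
Lemma cvg_coord_id v i : w 0 i @[w --> v] --> v 0 i.
Proof. by apply: (@cvg_coord C _ (nbhs v) _ _ _ id v 0 i); exact: cvg_id. Qed.
Lemma nbhs_neq0 v : v != 0 -> nbhs v [set u : 'rV[C]_3 | u != 0].
Proof.
move=> v0; have [i vi] := coord_neq0 v0.
have /cvgCP/cvgrPdist_lt := @cvg_coord_id v i.
move=> /(_ (cabs (v 0 i))); rewrite cabs_gt0 => /(_ vi).
apply: (@filterS _ (nbhs v)) => u /=; apply: contraTneq => ->.
by rewrite mxE !sub0r normrN cabsN -leNgt ler_norm.
Qed.
Lemma tends_scale c v : tends (nbhs v) (fun w : 'rV[C]_3 => c *: w) (c *: v).
Proof.
apply: (@cvg_mx _ _ (nbhs v)) => i j; rewrite ord1 mxE.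
have h : tends (nbhs v) (fun w : 'rV[C]_3 => w 0 j) (v 0 j) := @cvg_coord_id v j.
have : tends (nbhs v) (fun w : 'rV[C]_3 => c * w 0 j) (c * v 0 j) by tendsto.
by apply: tends_ext => w; rewrite mxE.
Qed.
(** The projection from nonzero vectors is open as well as continuous, so neighborhoods in the
    quotient can be tested on representatives. *)
Lemma nbhs_proj v (A : set (CP2 R)) : v != 0 ->
  nbhs (proj v) A <-> nbhs v (proj @^-1` A).
Proof.
move=> v0; split=> [|].
  move=> /(@pi_continuous _ _ (lift_nz v)).
  rewrite nbhs_filterE /fmap /= => -[B [ [W oW <-] /= vW] ] WA.
  have : nbhs v W by apply: open_nbhs_nbhs; split => //; rewrite -(lift_nzE v0).
  by apply: (@filterS2 _ (nbhs v)) (nbhs_neq0 v0) => u /= u0 Wu; apply: WA; rewrite /= lift_nzE.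
move=> h; pose W := (proj @^-1` A)°; have oW : open W by exact: open_interior.
have [Wv WA] : W v /\ W `<=` proj @^-1` A by split => //; exact: interior_subset.
suff oS : open [set p | exists2 u : 'rV[C]_3, u != 0 & W u /\ p = proj u].
  apply: (@filterS _ (nbhs (proj v)) _ [set p | exists2 u : 'rV[C]_3, u != 0 & W u /\ p = proj u]).
    by move=> p [u u0 [Wu ->]]; exact: WA.
  by apply: open_nbhs_nbhs; split => //; exists v.
rewrite /open /= /quotient_open.
(* The saturation of [W] is the union of its preimages under all scalings. *)
exists (\bigcup_(c in [set c : C | c != 0]) ((fun u => c *: u) @^-1` W)).
  apply: bigcup_open => c /= c0; apply: open_comp => // u _.
  exact: tends_scale.
have projv (u : @nonzero_vec R) : \pi_(CP2 R)%qT u = proj (set_val u).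
  by congr (\pi_(CP2 R)%qT _); apply: val_inj; rewrite [RHS]lift_nzE//; have := set_valP u.
apply/seteqP; split => [u [c /= c0 Wu]|u /= [u' u'0 [Wu' uu']]] /=;
    have u0 : set_val u != 0 by have := set_valP u.
  exists (c *: set_val u); first by rewrite scaler_eq0 negb_or c0.
  by split => //; rewrite projZ// -projv.
have : proj u' = proj (set_val u) by rewrite -uu' -projv.
by move=> /(proj_eqP u'0 u0)[c c0 uc]; exists c; [exact: c0|move: Wu'; rewrite uc].
Qed.
Lemma cvg_proj v : v != 0 -> proj @ v --> proj v.
Proof. by move=> v0 A /nbhs_proj; exact. Qed.
Lemma continuous_at_proj (Z : topologicalType) (f : CP2 R -> Z) v : v != 0 ->
  (f \o proj) @ v --> f (proj v) -> {for proj v, continuous f}.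
Proof. by move=> v0 fv A /fv h; apply/nbhs_proj. Qed.
Lemma homogeneous_continuous (Z : topologicalType) (g : 'rV[C]_3 -> Z) v :
  (forall c u, c != 0 -> u != 0 -> g (c *: u) = g u) -> v != 0 ->
  {for v, continuous g} -> {for proj v, continuous (g \o @hcoord R)}.
Proof.
move=> gc v0 gv; apply: continuous_at_proj => //=.
have E u : u != 0 -> g (hcoord (proj u)) = g u.
  by move=> u0; have [c c0 ->] := hcoord_proj u0; rewrite gc.
rewrite E//; apply: (tends_near _ gv).
by apply: (@filterS _ (nbhs v)) (nbhs_neq0 v0) => u u0 /=; rewrite E.
Qed.
(** Points are separated by the size of the 2 by 2 minors against a representative of [p], divided
    by the size of the vector: this is continuous, homogeneous of degree zero, and vanishes only at
    [p]. *)
Lemma CP2_hausdorff : hausdorff_space (CP2 R).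
Proof.
rewrite open_hausdorff => p q pq.
pose a := hcoord p.
pose n1 v := cabs (v 0 0) + cabs (v 0 1) + cabs (v 0 2%:R).
pose m (v : 'rV[C]_3) := cabs (v 0 0 * a 0 1 - v 0 1 * a 0 0)
  + cabs (v 0 0 * a 0 2%:R - v 0 2%:R * a 0 0) + cabs (v 0 1 * a 0 2%:R - v 0 2%:R * a 0 1).
pose g (v : 'rV[C]_3) := m v / n1 v.
have n10 v : v != 0 -> n1 v != 0.
  apply: contra_neq => h; have : n1 v = 0 by [].
  move/eqP; rewrite !paddr_eq0 ?addr_ge0 ?cabs_ge0// !cabs_eq0 -andbA => /and3P[/eqP v0 /eqP v1 /eqP v2].
  by apply: row3P; rewrite mxE.
have gc c u : c != 0 -> u != 0 -> g (c *: u) = g u.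
  move=> c0 u0; rewrite /g /m /n1 !mxE -!mulrA -!mulrBr !cabsM -!mulrDr invfM mulrACA divff ?mul1r//.
  by rewrite cabs_eq0.
have cg : continuous (g \o @hcoord R).
  move=> x; have [v v0 ->] := projS x; apply: homogeneous_continuous => //.
  have cc := @cvg_coord_id v.
  have c0 : tends (nbhs v) (fun w : 'rV_3 => w 0 0) (v 0 0) := cc 0.
  have c1 : tends (nbhs v) (fun w : 'rV_3 => w 0 1) (v 0 1) := cc 1.
  have c2 : tends (nbhs v) (fun w : 'rV_3 => w 0 2%:R) (v 0 2%:R) := cc 2%:R.
  have cm : m w @[w --> v] --> m v by rewrite /m; tendsto.
  have cn : n1 w @[w --> v] --> n1 v by rewrite /n1; tendsto.
  change (tends (nbhs v) (fun w => m w * (n1 w)^-1) (m v * (n1 v)^-1)).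
  by apply: tendsRM => //; apply: tendsRV (n10 _ v0) _.
have gp : g (hcoord p) = 0.
  have comm0 (x y : C) : x * y - y * x = 0 by rewrite mulrC subrr.
  by rewrite /g /m /a !comm0 !cabs0 !addr0 mul0r.
have gq : g (hcoord q) != 0.
  rewrite mulf_eq0 invr_eq0 (negPf (n10 _ (hcoord_neq0 q))) orbF.
  apply: contra_neq pq => /eqP; rewrite /m !paddr_eq0 ?addr_ge0 ?cabs_ge0// !cabs_eq0 -andbA !subr_eq0.
  move=> /and3P[/eqP e1 /eqP e2 /eqP e3]; rewrite -(proj_hcoord p) -(proj_hcoord q).
  apply/esym/proj_eqP; rewrite ?hcoord_neq0//.
  have [i ai] := coord_neq0 (hcoord_neq0 p).
  have key j : hcoord q 0 j = hcoord q 0 i / a 0 i * a 0 j.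
    rewrite mulrAC; apply: (canRL (mulfK ai)).
    by move: i j {ai}; do 2 apply: ord3P; rewrite // ?e1 ?e2 ?e3.
  have qE : hcoord q = (hcoord q 0 i / a 0 i) *: a.
    by apply/rowP => j; rewrite mxE -key.
  exists (hcoord q 0 i / a 0 i) => //; apply: contraNneq (hcoord_neq0 q) => c0.
  by rewrite qE c0 scale0r.
have gq0 : 0 < g (hcoord q).
  by rewrite lt_neqAle eq_sym gq /g mulr_ge0 ?invr_ge0 /m /n1 ?addr_ge0 ?cabs_ge0.
exists ([set x | g (hcoord x) < g (hcoord q) / 2], [set x | g (hcoord q) / 2 < g (hcoord x)]) => /=.
  by split; apply/mem_set; rewrite /= ?gp; lra.
split.
- by apply: (@open_comp _ _ (g \o @hcoord R) [set x | x < g (hcoord q) / 2]) => [x _|]; [exact: cg|exact: open_lt].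
- by apply: (@open_comp _ _ (g \o @hcoord R) [set x | g (hcoord q) / 2 < x]) => [x _|]; [exact: cg|exact: open_gt].
- by apply/eqP/seteqP; split => // x /= [a1 a2]; lra.
Qed.
Lemma compact_disk (r : R) : compact [set z : C | `|complex.Re z| <= r /\ `|complex.Im z| <= r].
Proof.
have -> : [set z : C | `|complex.Re z| <= r /\ `|complex.Im z| <= r] =
    (fun p : R * R => p.1 +i* p.2) @` (`[- r, r] `*` `[- r, r]).
  apply/seteqP; split => [[a b] /= [ar br]|_ [[a b] [/= ar br] <-]] /=.
    by exists (a, b) => //=; split; rewrite in_itv /= -ler_norml.
  by move: ar br; rewrite !in_itv /= -!ler_norml.
apply: continuous_compact; last by apply: compact_setX; exact: segment_compact.
apply: continuous_subspaceT => p.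
by apply: (@tends_complex _ _ (nbhs p)); [exact: cvg_fst|exact: cvg_snd].
Qed.
(** Dividing by the coordinate of largest modulus gives a representative with one coordinate equal
    to 1 and the others in a square; three such compact sets cover. *)
Lemma CP2_compact : compact [set: CP2 R].
Proof.
pose K i := [set v : 'rV[C]_3 | forall j, (if j == i then [set 1] else
  [set z : C | `|complex.Re z| <= 1 /\ `|complex.Im z| <= 1]) (v ord0 j)].
have cK i : compact (K i).
  by apply: (@rV_compact (R[i] : ptopologicalType) 3 (fun j => if j == i then [set 1] else
    [set z : C | `|complex.Re z| <= 1 /\ `|complex.Im z| <= 1])) => j; case: ifP => _; [exact: compact_set1|exact: compact_disk].
have K0 i v : K i v -> v != 0.
  move=> /(_ i); rewrite eqxx /= => vi; apply/eqP => v0.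
  by move/eqP: vi; rewrite v0 mxE eq_sym oner_eq0.
have cpK i : compact (proj @` K i).
  apply: continuous_compact => //; apply: continuous_in_subspaceT => v /set_mem Kv.
  exact: cvg_proj (K0 _ _ Kv).
have -> : [set: CP2 R] = proj @` K 0 `|` proj @` K 1 `|` proj @` K 2%:R.
  apply/esym/seteqP; split => // p _; have [v v0 ->] := projS p.
  have K3 i : (forall j, cabs (v 0 j) <= cabs (v 0 i)) -> (proj @` K i) (proj v).
    move=> vi; have i0 : v 0 i != 0.
      apply: contra_neq v0 => vi0; apply/rowP => j; rewrite mxE; apply/eqP.
      by rewrite -cabs_eq0 eq_le cabs_ge0 andbT -cabs0 -vi0.
    exists ((v 0 i)^-1 *: v); last by rewrite projZ// invr_neq0.
    move=> j; rewrite mxE; case: eqP => [->|_] /=; first by rewrite mulVf.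
    have : cabs ((v 0 i)^-1 * v 0 j) <= 1.
      by rewrite cabsM cabsV mulrC ler_pdivrMr ?mul1r// cabs_gt0.
    by move=> h; split; apply: le_trans h; [exact: cabs_Re|exact: cabs_Im].
  have [h01|h01] := lerP (cabs (v 0 0)) (cabs (v 0 1)).
    have [h12|h12] := lerP (cabs (v 0 1)) (cabs (v 0 2%:R)).
      by right; apply: K3; apply: ord3P => //; exact: le_trans h12.
    by left; right; apply: K3; apply: ord3P => //; exact: ltW.
  have [h02|h02] := lerP (cabs (v 0 0)) (cabs (v 0 2%:R)).
    by right; apply: K3; apply: ord3P => //; exact: le_trans (ltW h01) h02.
  by left; left; apply: K3; apply: ord3P => //; exact: ltW.
by do 2 (apply: compactU => //).
Qed.
Definition hom_map (F : 'rV[C]_3 -> 'rV[C]_3) : CP2 R -> CP2 R := fun p => proj (F (hcoord p)).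
Definition homogeneous (F : 'rV[C]_3 -> 'rV[C]_3) :=
  (forall c v, c != 0 -> F (c *: v) = c *: F v) /\ (forall v, v != 0 -> F v != 0).
Lemma hom_map_proj F v : homogeneous F -> v != 0 -> hom_map F (proj v) = proj (F v).
Proof.
by move=> [Fc F0] v0; rewrite /hom_map; have [c c0 ->] := hcoord_proj v0; rewrite Fc// projZ// F0.
Qed.
Lemma hom_map_continuous F : homogeneous F ->
  (forall v, v != 0 -> tends (nbhs v) F (F v)) -> continuous (hom_map F).
Proof.
move=> [Fc F0] cF p; have [v v0 ->] := projS p.
apply: (@homogeneous_continuous _ (fun v => proj (F v))) => //.
  by move=> c u c0 u0; rewrite Fc// projZ// F0.
by move=> A /(cvg_proj (F0 _ v0)) /(cF _ v0).
Qed.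
End ProjectivePlane.

Section CompactHausdorff.
Lemma closed_compact (X : topologicalType) (A : set X) :
  compact [set: X] -> closed A -> compact A.
Proof. by move=> cX cA; apply: subclosed_compact cA cX _. Qed.
Lemma compact_inverse_continuous (X Y : topologicalType) (A : set X) (f : X -> Y) (g : Y -> X) :
  hausdorff_space Y -> compact A -> {within A, continuous f} ->
  (forall x, A x -> g (f x) = x) -> {within f @` A, continuous g}.
Proof.
move=> hY cA cf gf; apply/continuous_closedP => W cW; apply/closed_subspaceP.
exists (f @` (A `&` W)).
  apply: compact_closed => //; apply: continuous_compact.
    exact: continuous_subspaceW cf.
  exact: compact_closedI.
apply/seteqP; split => y /= [H1 H2].
  split => //; case: H1 => x [Ax Wx] <-.
  have h : W (g (f x)) by rewrite gf.
  exact: h.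
split => //; case: H2 => x Ax xy; exists x => //; split => //.
have h : W (g (f x)) by move: H1; rewrite -xy.
by move: h; rewrite gf.
Qed.
End CompactHausdorff.
Lemma within_comp (X Y Z : topologicalType) (A : set X) (B : set Y) (f : X -> Y) (g : Y -> Z) :
  (forall x, A x -> B (f x)) -> (forall x, A x -> {for x, continuous f}) ->
  {within B, continuous g} -> {within A, continuous (g \o f)}.
Proof.
move=> fAB cf /subspace_continuousP cg; apply/subspace_continuousP => x Ax W /(cg _ (fAB _ Ax)).
rewrite /= /within /= !nbhs_simpl /= => /(cf _ Ax); rewrite /fmap /=.
by apply: (@filterS _ (nbhs x)) => y /= h Ay; exact: h (fAB _ Ay).
Qed.
Lemma within_postcomp (X Y Z : topologicalType) (A : set X) (f : X -> Y) (g : Y -> Z) :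
  {within A, continuous f} -> (forall x, A x -> {for f x, continuous g}) ->
  {within A, continuous (g \o f)}.
Proof.
move=> /subspace_continuousP cf cg; apply/subspace_continuousP => x Ax W /(cg _ Ax).
exact: cf.
Qed.

(** * Homeomorphisms between open sets *)
Section OpenHomeo.
Variables X Y : topologicalType.
Implicit Types (U : set X) (V : set Y).
Definition ohomeo U V (f : X -> Y) (k : Y -> X) :=
  [/\ open U, open V, (forall x, U x -> [/\ V (f x), k (f x) = x & {for x, continuous f}])
    & (forall y, V y -> [/\ U (k y), f (k y) = y & {for y, continuous k}])].
Lemma ohomeo_open U V f k W : ohomeo U V f k -> open W -> W `<=` U -> open (f @` W).
Proof.
move=> [oU oV fU kV] oW WU.
have -> : f @` W = V `&` k @^-1` W.
  apply/seteqP; split => [_ [x Wx <-]|y [Vy Wy]].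
    by have [Vf kf _] := fU _ (WU _ Wx); split => //; rewrite /= kf.
  by have [_ fk _] := kV _ Vy; exists (k y).
rewrite openE => y [Vy Wy]; apply: filterI; first by move: oV; rewrite openE; apply.
by have [_ _ ck] := kV _ Vy; apply: ck; apply: open_nbhs_nbhs.
Qed.
Lemma ohomeo_sub U V f k W : ohomeo U V f k -> open W -> W `<=` U -> ohomeo W (f @` W) f k.
Proof.
move=> h oW WU; have oV := ohomeo_open h oW WU; have [_ _ fU kV] := h; split => //.
  by move=> x Wx; have [_ kf cf] := fU _ (WU _ Wx); split => //; exists x.
move=> _ [x Wx <-]; have [Vf kf cf] := fU _ (WU _ Wx); rewrite kf; split => //.
by have [] := kV _ Vf.
Qed.
Lemma ohomeo_homeomorphism U V f k A : ohomeo U V f k -> A `<=` U -> homeomorphism A (f @` A) f.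
Proof.
move=> [oU oV fU kV] AU; split.
  split=> [x Ax|x y /set_mem Ax /set_mem Ay xy|_ [x Ax <-]]; [by exists x| |by exists x].
  by have [_ <- _] := fU _ (AU _ Ax); have [_ <- _] := fU _ (AU _ Ay); rewrite xy.
exists k; split.
- by move=> x /set_mem Ax; have [] := fU _ (AU _ Ax).
- by apply: continuous_in_subspaceT => x /set_mem Ax; have [] := fU _ (AU _ Ax).
- apply: continuous_in_subspaceT => _ /set_mem[x Ax <-].
  by have [Vf _ _] := fU _ (AU _ Ax); have [] := kV _ Vf.
Qed.
Lemma homeomorphism_ohomeo U V f : open U -> open V -> homeomorphism U V f ->
  exists k, ohomeo U V f k.
Proof.
move=> oU oV [[fUV fI fVU] [k [kf cf ck]]]; exists k; split => //.
  move=> x Ux; split; [exact: fUV|by apply: kf; apply/mem_set|].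
  by move: cf; rewrite continuous_open_subspace// => /(_ _ (mem_set Ux)).
move=> y Vy; have [x Ux <-] := fVU _ Vy; rewrite kf ?mem_set//; split => //.
by move: ck; rewrite continuous_open_subspace// => /(_ _ (mem_set (fUV _ Ux))).
Qed.
End OpenHomeo.
Lemma ohomeo_sym (X Y : topologicalType) (U : set X) (V : set Y) f k :
  ohomeo U V f k -> ohomeo V U k f.
Proof. by case=> *; split. Qed.
Lemma ohomeo_comp (X Y Z : topologicalType) (U : set X) (V : set Y) (W : set Z) f k f' k' :
  ohomeo U V f k -> ohomeo V W f' k' -> ohomeo U W (f' \o f) (k \o k').
Proof.
move=> [oU oV fU kV] [_ oW fV kW]; split => //.
  move=> x Ux; have [Vf kf cf] := fU _ Ux; have [Wf kf' cf'] := fV _ Vf.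
  by split; rewrite //= ?kf' ?kf//; apply: continuous_comp.
move=> x Ux; have [Vf kf cf] := kW _ Ux; have [Wf kf' cf'] := kV _ Vf.
by split; rewrite //= ?kf' ?kf//; apply: continuous_comp.
Qed.

Section Germs.
Variable X : topologicalType.
Implicit Types S T : set X.
(** Germs of homeomorphisms along the sets. Being an equivalence relation, it lets normalisations be
    composed before any tube is chosen. *)
Definition nbhd_homeo S1 S2 := exists U V f k, [/\ @ohomeo X X U V f k, S1 `<=` U & f @` S1 = S2].
Lemma nbhd_homeo_sym S1 S2 : nbhd_homeo S1 S2 -> nbhd_homeo S2 S1.
Proof.
move=> [U [V [f [k [h SU fS]]]]]; exists V, U, k, f; have [_ _ fU kV] := h; split.
- exact: ohomeo_sym.
- by rewrite -fS => _ [x /SU Ux <-]; have [] := fU _ Ux.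
- apply/seteqP; rewrite -fS; split => [_ [_ [x Sx <-] <-]|x Sx].
    by have [_ -> _] := fU _ (SU _ Sx).
  by exists (f x); [exists x|have [_ -> _] := fU _ (SU _ Sx)].
Qed.
Lemma nbhd_homeo_trans S1 S2 S3 : nbhd_homeo S1 S2 -> nbhd_homeo S2 S3 -> nbhd_homeo S1 S3.
Proof.
move=> [U [V [f [k [h SU fS]]]]] [U' [V' [f' [k' [h' SU' fS']]]]].
have [oU oV _ _] := h; have [oU' oV' _ _] := h'.
have h1 := ohomeo_sub h' (openI oV oU') (@subIsetr _ _ _).
have h2 := ohomeo_sub (ohomeo_sym h) (openI oV oU') (@subIsetl _ _ _).
have h3 := ohomeo_comp (ohomeo_sym h2) h1.
do 4 eexists; split; first exact: h3.
  move=> x Sx; have [_ _ fU _] := h; have [Vf kf _] := fU _ (SU _ Sx).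
  by exists (f x) => //; split => //; apply: SU'; rewrite -fS; exists x.
by rewrite -fS' -fS image_comp.
Qed.
Lemma bicontinuous_nbhd_homeo S f k : continuous f -> continuous k ->
  cancel f k -> cancel k f -> nbhd_homeo S (f @` S).
Proof.
move=> cf ck fk kf; have h : ohomeo setT setT f k.
  split; [exact: openT|exact: openT| |]; move=> x _; split=> //; first [exact: fk|exact: cf|exact: kf|exact: ck].
by exists setT, setT, f, k; split.
Qed.
End Germs.

(** * Tubular neighborhoods *)
Section Tubes.
Variable R : realType.
Implicit Types (T S U V : set (CP2 R)).
Lemma compact_closed_CP2 T : compact T -> closed T.
Proof. by apply: compact_closed; exact: CP2_hausdorff. Qed.
Lemma ohomeo_interior U V f k T : ohomeo U V f k -> T `<=` U -> (f @` T)° = f @` T°.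
Proof.
move=> h TU; have [_ _ fU kV] := h; apply/seteqP; split.
  have sV : (f @` T)° `<=` V.
    by move=> y /interior_subset[x Tx <-]; have [] := fU _ (TU _ Tx).
  have oi := ohomeo_open (ohomeo_sym h) (@open_interior _ (f @` T)) sV.
  move=> y yi; exists (k y); last by have [] := kV _ (sV _ yi).
  have : k @` (f @` T)° `<=` T.
    move=> _ [_ /interior_subset[x Tx <-] <-].
    by have [_ -> _] := fU _ (TU _ Tx).
  by rewrite open_subsetE//; apply; exists y.
rewrite -open_subsetE; first by apply: image_subset; exact: interior_subset.
apply: (ohomeo_open h); first exact: open_interior.
exact: subset_trans (@interior_subset _ _) TU.
Qed.
Lemma ohomeo_compact U V f k T : ohomeo U V f k -> T `<=` U -> compact T -> compact (f @` T).
Proof.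
move=> [_ _ fU _] TU; apply: continuous_compact; apply: continuous_in_subspaceT.
by move=> x /set_mem /TU /fU [].
Qed.
Lemma frontier_compact T : compact T -> frontier T = T `\` T°.
Proof.
by move=> cT; rewrite /frontier -(closure_id T).1//; exact: compact_closed_CP2.
Qed.
Lemma ohomeo_frontier U V f k T : ohomeo U V f k -> T `<=` U -> compact T ->
  frontier (f @` T) = f @` frontier T.
Proof.
move=> h TU cT; have [_ _ fU _] := h.
rewrite !frontier_compact//; last exact: ohomeo_compact h TU cT.
rewrite (ohomeo_interior h TU); apply/seteqP; split.
  by move=> _ [[x Tx <-] nx]; exists x => //; split => // ix; apply: nx; exists x.
move=> _ [x [Tx nx] <-]; split; first by exists x.
move=> [z iz zx]; apply: nx; suff <- : z = x by [].
have [_ <- _] := fU _ (TU _ (interior_subset iz)).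
by have [_ <- _] := fU _ (TU _ Tx); rewrite zx.
Qed.
(** Every clause is conjugated by [f]; a half-space chart at [f x] is one at [x], restricted to [U]
    and preceded by the inverse. *)
Lemma ohomeo_tubular U V f k T S : ohomeo U V f k -> T `<=` U ->
  tubular_neighborhood T S -> tubular_neighborhood (f @` T) (f @` S).
Proof.
move=> h TU [cT ST charts [H [cH H0 Hbij H1]]].
have [oU oV fU kV] := h.
have cfT := ohomeo_compact h TU cT.
have frE := ohomeo_frontier h TU cT.
have frT : frontier T `<=` T by rewrite frontier_compact// => x [].
have kf x : T x -> k (f x) = x by move=> /TU /fU [].
have kfr y : frontier (f @` T) y -> frontier T (k y) /\ y = f (k y).
  by rewrite frE => -[x xT <-]; rewrite kf//; exact: frT.
have STT : S `<=` T by apply: subset_trans ST _; exact: interior_subset.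
split => //.
- by rewrite (ohomeo_interior h TU); exact: image_subset.
- move=> y; rewrite frE => -[x xT <-]; have [W [Z [c [oW Wx oZ hc cT']]]] := charts _ xT.
  have [c' hc'] := homeomorphism_ohomeo oW oZ hc.
  have xU : U x by apply: TU; exact: frT.
  have oWU := openI oW oU.
  have h1 := ohomeo_sub h oWU (@subIsetr _ _ _).
  have h2 := ohomeo_sub hc' oWU (@subIsetl _ _ _).
  have h3 := ohomeo_comp (ohomeo_sym h1) h2; have [q1 q2 _ _] := h3.
  exists (f @` (W `&` U)), (c @` (W `&` U)), (c \o k); split => //.
  + by exists x.
  + have := ohomeo_homeomorphism h3 (@subset_refl _ _).
    suff -> : (c \o k) @` (f @` (W `&` U)) = c @` (W `&` U) by [].
    rewrite image_comp; apply: eq_imagel => z [_ Uz] /=.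
    by have [_ -> _] := fU _ Uz.
  + move=> _ [z [Wz Uz] <-] /=; have [_ -> _] := fU _ Uz; rewrite -cT'//.
    split; last by exists z.
    move=> [t Tt tz]; suff <- : t = z by [].
    by have [_ <- _] := fU _ Uz; rewrite -tz kf.
- exists (fun pt => f (H (k pt.1, pt.2))); split.
  + have HT : H @` (frontier T `*` `[0, 1]) `<=` U.
      move=> _ [[x s] [/= xT s01] <-].
      have [s1|s1] := eqVneq s 1; first by rewrite s1; apply/TU/STT/H1.
      apply: TU; have [Hm _ _] := Hbij; have [] // := Hm (x, s); split => //=.
      by move: s01; rewrite !in_itv /= lt_neqAle s1.
    pose kk (pt : CP2 R * R) : CP2 R * R := (k pt.1, pt.2).
    have ckk pt : (frontier (f @` T) `*` `[0, 1]) pt -> {for pt, continuous kk}.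
      move: pt => [y s] [/= /kfr[kT yE] _].
      have Vy : V y by rewrite yE; have [] := fU _ (TU _ (frT _ kT)).
      have [_ _ ck] := kV _ Vy.
      apply: (@tends_pair _ (nbhs (y, s)) _ _ _ (fun pt => k pt.1) snd); last exact: cvg_snd.
      by apply: (cvg_comp fst k _ ck); exact: cvg_fst.
    have cHk : {within frontier (f @` T) `*` `[0, 1], continuous (H \o kk)}.
      apply: (@within_comp (CP2 R * R)%type (CP2 R * R)%type (CP2 R) (frontier (f @` T) `*` `[0, 1]) (frontier T `*` `[0, 1]) kk H _ ckk cH).
      by move=> [y s] [/= /kfr[]].
    apply: (@within_postcomp (CP2 R * R)%type _ _ _ (H \o kk) f cHk).
    move=> [y s] [/= /kfr[kT yE] s01]; have /HT : (H @` (frontier T `*` `[0, 1])) (H (k y, s)).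
      by exists (k y, s).
    by case/fU.
  + by move=> y /kfr[kT yE] /=; rewrite H0// -yE.
  + have [Hm Hi Hs] := Hbij; split.
    * move=> [y s] /= [/= /kfr[kT yE] s01].
      have [TH nH] := Hm (k y, s) (conj kT s01); split; first by exists (H (k y, s)).
      move=> [z Sz zE]; apply: nH; suff <- : z = H (k y, s) by [].
      by rewrite -(kf z (STT _ Sz)) zE kf.
    * move=> [y s] [y' s'] /set_mem[/= /kfr[kT yE] s01] /set_mem[/= /kfr[kT' yE'] s01'] e.
      have [TH _] := Hm (k y, s) (conj kT s01); have [TH' _] := Hm (k y', s') (conj kT' s01').
      have e' : H (k y, s) = H (k y', s') by rewrite -(kf _ TH) e kf.
      have : (k y, s) = (k y', s') by apply: Hi => //; apply/mem_set; split.
      by move=> [kk' ->]; rewrite yE yE' kk'.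
    * move=> _ [[z Tz <-] nz]; have [|[x s] [/= xT s01] xz] := Hs z.
        by split => // Sz; apply: nz; exists z.
      exists (f x, s); first by split => //=; rewrite frE; exists x.
      by rewrite /= kf ?xz//; exact: frT.
  + by move=> y /kfr[kT yE] /=; exists (H (k y, 1)) => //; exact: H1.
Qed.
(** Smallness makes the property invariant under [nbhd_homeo]: a tube can be carried along only if
    it lies in the domain of the homeomorphism. *)
Definition small_tubes S := forall U, open U -> S `<=` U ->
  exists2 T, T `<=` U & tubular_neighborhood T S.
Lemma small_tubes_homeo S1 S2 : nbhd_homeo S1 S2 -> small_tubes S1 -> small_tubes S2.
Proof.
move=> [U [V [f [k [h SU fS]]]]] tS1 W oW SW.
have [oU oV fU kV] := h.
have oWV := openI oW oV; have SV : S2 `<=` V by rewrite -fS => _ [x /SU/fU[Vf _ _] <-].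
have okW := ohomeo_open (ohomeo_sym h) oWV (@subIsetr _ _ _).
have kWU : k @` (W `&` V) `<=` U by move=> _ [y [_ /kV[]] + _ _ <-].
have [|T TU tT] := tS1 _ okW.
  move=> x Sx; exists (f x); last by have [] := fU _ (SU _ Sx).
  by split; [apply: SW|apply: SV]; rewrite -fS; exists x.
exists (f @` T); last by rewrite -fS; apply: ohomeo_tubular h _ tT; exact: subset_trans kWU.
by move=> _ [x /TU[y [Wy Vy] <-] <-]; have [_ -> _] := kV _ Vy.
Qed.
Lemma nbhd_homeo_tubular S1 S2 : nbhd_homeo S1 S2 -> small_tubes S1 ->
  exists (T1 T2 : set (CP2 R)) (h : CP2 R -> CP2 R),
     [/\ tubular_neighborhood T1 S1, tubular_neighborhood T2 S2,
         homeomorphism T1 T2 h & h @` S1 = S2].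
Proof.
move=> [U [V [f [k [h SU fS]]]]] tS1; have [oU _ _ _] := h.
have [T TU tT] := tS1 U oU SU; exists T, (f @` T), f; split => //.
  by rewrite -fS; exact: ohomeo_tubular h TU tT.
exact: ohomeo_homeomorphism h TU.
Qed.
End Tubes.

(* In the chart chi k, rho k is a distance to the core and G k s scales it by s. The
   cylinder of the tube rho <= e is (p, t) |-> G (1 - t) p. *)
Section Atlas.
Variables (R : realType) (Z : topologicalType) (K : choiceType).
Variables (chi : K -> Z -> CP2 R) (kap : K -> CP2 R -> Z) (Om : K -> set Z) (V : K -> set (CP2 R)).
Variables (rho : K -> Z -> R) (G : K -> R -> Z -> Z) (e0 : R).
Hypothesis e0_gt0 : 0 < e0.
Hypothesis chiP : forall k, ohomeo (Om k) (V k) (chi k) (kap k).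
Hypothesis compat : forall k l v, V k v -> V l v -> rho k (kap k v) = rho l (kap l v) /\
  forall s, 0 <= s -> s * rho k (kap k v) < e0 -> chi k (G k s (kap k v)) = chi l (G l s (kap l v)).
Hypothesis rhoP : forall k z, Om k z -> [/\ 0 <= rho k z, rho k z < e0 & {for z, continuous (rho k)}].
Hypothesis GP : forall k z s, Om k z -> 0 <= s -> s * rho k z < e0 ->
  [/\ Om k (G k s z), rho k (G k s z) = s * rho k z &
      forall s', 0 <= s' -> s' * s * rho k z < e0 -> G k s' (G k s z) = G k (s' * s) z].
Hypothesis G1 : forall k z, Om k z -> G k 1 z = z.
Hypothesis Gcont : forall k z s, Om k z -> 0 <= s -> s * rho k z < e0 ->
  {for (s, z), continuous (fun sz : R * Z => G k sz.1 sz.2)}.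
Hypothesis HS : forall k z, Om k z -> 0 < rho k z ->
  exists U W (f : Z -> 'rV[R]_4) g, [/\ ohomeo U W f g, U z &
    forall q, U q -> (rho k q <= rho k z <-> 0 <= f q ord0 ord0)].
Hypothesis cpt : forall e, 0 < e < e0 -> compact [set v | exists2 k, V k v & rho k (kap k v) <= e].
(** [rr] and [GG] glue the distances and flows of the charts; the chart is chosen arbitrarily, which
    [compat] makes harmless. *)
Let rr v : R := if pselect (exists k, V k v) is left h then rho (projT1 (cid h)) (kap (projT1 (cid h)) v) else 0.
Let GG s v : CP2 R := if pselect (exists k, V k v) is left h
  then chi (projT1 (cid h)) (G (projT1 (cid h)) s (kap (projT1 (cid h)) v)) else v.
Let rrE k v : V k v -> rr v = rho k (kap k v).
Proof.
move=> Vv; rewrite /rr; case: pselect => [h|[]]; last by exists k.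
by case: cid => l /= Vl; have [] := compat Vl Vv.
Qed.
Let GGE k v s : V k v -> 0 <= s -> s * rr v < e0 -> GG s v = chi k (G k s (kap k v)).
Proof.
move=> Vv s0; rewrite /GG; case: pselect => [h|[]]; last by exists k.
by case: cid => l /= Vl; rewrite (rrE Vl); have [_] := compat Vl Vv; apply.
Qed.
Let Vkap k v : V k v -> Om k (kap k v) /\ chi k (kap k v) = v.
Proof. by move=> Vv; have [_ _ _ /(_ _ Vv)[]] := chiP k. Qed.
Let rr_ge0 k v : V k v -> 0 <= rr v < e0.
Proof. by move=> Vv; have [/rhoP[r0 r1 _] _] := Vkap Vv; rewrite (rrE Vv) r0. Qed.
Let GGP k v s : V k v -> 0 <= s -> s * rr v < e0 ->
  [/\ V k (GG s v), rr (GG s v) = s * rr v &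
    forall s', 0 <= s' -> s' * s * rr v < e0 -> GG s' (GG s v) = GG (s' * s) v].
Proof.
move=> Vv s0 sr; have [Oz zv] := Vkap Vv.
have sr' := sr; rewrite (rrE Vv) in sr'.
have [OG rG GG'] := GP Oz s0 sr'.
have [_ _ /(_ _ OG)[VG kG _] _] := chiP k.
have E := GGE Vv s0 sr; rewrite E.
have rE : rr (chi k (G k s (kap k v))) = s * rr v by rewrite (rrE VG) kG rG (rrE Vv).
split => // s' s'0 s'r.
rewrite (GGE VG) ?rE ?mulrA// kG GG'// -?(rrE Vv)// -(GGE Vv)// mulr_ge0//.
Qed.
Let GG1 k v : V k v -> GG 1 v = v.
Proof.
move=> Vv; have [Oz zv] := Vkap Vv; have /andP[_ r1] := rr_ge0 Vv.
by rewrite (GGE Vv) ?mul1r// G1.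
Qed.
Let rr_open k v a b : V k v -> a < rr v < b -> nbhs v [set w | V k w /\ a < rr w < b].
Proof.
move=> Vv /andP[ar rb]; have [Oz zv] := Vkap Vv; have [_ _ cr] := rhoP Oz.
have [_ oV _ /(_ _ Vv)[_ _ ck]] := chiP k.
have c : {for v, continuous (rho k \o kap k)} by exact: continuous_comp.
have nV : nbhs v (V k) by apply: open_nbhs_nbhs.
have n1 : nbhs v ((rho k \o kap k) @^-1` [set x | a < x]).
  by apply: c; apply: open_nbhs_nbhs; split; [exact: open_gt|rewrite /= -rrE].
have n2 : nbhs v ((rho k \o kap k) @^-1` [set x | x < b]).
  by apply: c; apply: open_nbhs_nbhs; split; [exact: open_lt|rewrite /= -rrE].
apply: (@filterS _ (nbhs v)) (filterI nV (filterI n1 n2)) => w [Vw /= [h1 h2]].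
by split => //; rewrite (rrE Vw) h1.
Qed.
Let GG_cvg k :
  {within [set sv : R * CP2 R | 0 <= sv.1 /\ sv.1 * rr sv.2 < e0 /\ V k sv.2],
    continuous (fun sv => GG sv.1 sv.2)}.
Proof.
apply/subspace_continuousP => -[t w] [/= t0 [tr Vw]].
apply: (@tends_near _ (within [set sv : R * CP2 R | 0 <= sv.1 /\ sv.1 * rr sv.2 < e0 /\ V k sv.2] (nbhs (t, w))) _ _ (fun sv => chi k (G k sv.1 (kap k sv.2)))).
  by apply: (@filterE _ (nbhs (t, w))) => sv [/= sv0 [svr Vsv]]; apply: GGE.
rewrite [X in tends _ _ X](_ : _ = chi k (G k t (kap k w))); last exact: GGE.
have [Oz zv] := Vkap Vw; have tr' := tr; rewrite (rrE Vw) in tr'.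
have [OG _ _] := GP Oz t0 tr'; have [_ _ /(_ _ OG)[_ _ cchi] /(_ _ Vw)[_ _ ckap]] := chiP k.
have c1 : {for (t, w), continuous (fun sv : R * CP2 R => (sv.1, kap k sv.2) : R * Z)}.
  apply: (@tends_pair _ (nbhs (t, w)) _ _ _ fst (fun sv => kap k sv.2)); first exact: cvg_fst.
  by apply: (cvg_comp snd (kap k) _ ckap); exact: cvg_snd.
have c2 := @continuous_comp _ _ _ _ (fun sz : R * Z => G k sz.1 sz.2) (t, w) c1 (Gcont Oz t0 tr').
have c3 := @continuous_comp _ _ _ _ (chi k) (t, w) c2 cchi.
by apply: cvg_trans c3; apply: cvg_app; exact: cvg_within.
Qed.
Lemma tube_atlas : small_tubes [set v | exists2 k, V k v & rho k (kap k v) = 0].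
Proof.
set S := [set v | _].
pose T e := [set v | exists2 k, V k v & rho k (kap k v) <= e].
have SE v : S v <-> exists2 k, V k v & rr v = 0.
  by split=> -[k Vv h]; exists k => //; rewrite -h ?(rrE Vv)// -(rrE Vv).
have TE e v : T e v <-> exists2 k, V k v & rr v <= e.
  by split=> -[k Vv h]; exists k => //; move: h; rewrite (rrE Vv).
(* A point at level exactly [e] is not interior: flowing it outwards by a factor slightly above 1
   leaves the sublevel set but stays near the point. *)
have inT e : 0 < e < e0 -> (T e)° = [set v | exists2 k, V k v & rr v < e].
  move=> /andP[e1 e2]; apply/seteqP; split => v.
    move=> iv; have /TE[k Vv] := interior_subset iv; rewrite le_eqVlt => /orP[/eqP re|]; last by exists k.
    exfalso.
    have [Oz zv] := Vkap Vv; have r1 : 1 * rho k (kap k v) < e0 by rewrite mul1r -rrE// re.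
    have [OG _ _] := GP Oz ler01 r1; have [_ _ /(_ _ OG)[_ _ cchi] _] := chiP k.
    have c1 : {for 1, continuous (fun s : R => (s, kap k v) : R * Z)}.
      by apply: (@tends_pair _ (nbhs (1 : R)) _ _ _ id); [exact: cvg_id|exact: cvg_cst].
    have c2 := @continuous_comp _ _ _ _ (fun sz : R * Z => G k sz.1 sz.2) (1 : R) c1 (Gcont Oz ler01 r1).
    have c3 := @continuous_comp _ _ _ _ (chi k) (1 : R) c2 cchi.
    have : nbhs (chi k (G k 1 (kap k v))) (T e) by rewrite G1// zv.
    move=> /c3 /nbhs_ballP[d /= d0 dT].
    (* Within [d] of 1, where continuity is used, and with [s * e] still below [e0], where the flow
       is defined. *)
    pose s := 1 + Num.min (d / 2) ((e0 / e - 1) / 2).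
    have ee : 1 < e0 / e by rewrite ltr_pdivlMr// mul1r.
    have s1 : 1 < s by rewrite ltrDl lt_min; apply/andP; split; lra.
    have se : s * e < e0.
      rewrite -ltr_pdivlMr//; apply: (@le_lt_trans _ _ (1 + (e0 / e - 1) / 2)); last by lra.
      by rewrite lerD2l ge_min lexx orbT.
    have s0 : 0 <= s by rewrite (le_trans ler01)// ltW.
    have [|_ rG _] := @GGP k v s Vv s0; first by rewrite re.
    have /dT : ball (1 : R) d s.
      rewrite -ball_normE /= distrC gtr0_norm ?subr_gt0//; apply: (@le_lt_trans _ _ (d / 2)); last by lra.
      by rewrite /s addrC addKr ge_min lexx.
    rewrite /= -GGE ?re// => /TE[l _]; rewrite rG re leNgt -{1}[e]mul1r ltr_pM2r//.
    by rewrite s1.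
  move=> [k Vv rv]; have /andP[r0 _] := rr_ge0 Vv.
  apply: (@filterS _ (nbhs v)) (@rr_open k v (-1) e Vv _) => [w [Vw /andP[_ we]]|].
    by apply/TE; exists k => //; exact: ltW.
  by rewrite rv andbT (lt_le_trans _ r0)// ltrN10.
have tubeT e : 0 < e < e0 -> tubular_neighborhood (T e) S.
  move=> e01; have /andP[e1 e2] := e01; have cT := cpt e01.
  have frE v : frontier (T e) v <-> exists2 k, V k v & rr v = e.
    rewrite (frontier_compact cT) inT//; split.
      move=> [/TE[k Vv ve] nv]; exists k => //; apply/eqP; rewrite eq_le ve leNgt.
      by apply/negP => h; apply: nv; exists k.
    move=> [k Vv ve]; split; first by apply/TE; exists k; rewrite ?ve.
    by move=> [_ _]; rewrite ve ltxx.
  have sle s : 0 <= s -> s <= 1 -> s * e < e0.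
    by move=> s0 s1; apply: le_lt_trans e2; rewrite ler_piMl// ltW.
  split => //.
  - move=> v /SE[k Vv v0]; rewrite inT//; exists k => //; by rewrite v0.
  - move=> v /frE[k Vv ve]; have [Oz zv] := Vkap Vv.
    have [|U [W [f [g [h Uz hU]]]]] := HS Oz; first by rewrite -(rrE Vv) ve.
    have [oU _ _ _] := h; have [oO _ _ _] := chiP k.
    have h1 := ohomeo_sub h (openI oU oO) (@subIsetl _ _ _).
    have h2 := ohomeo_sub (chiP k) (openI oU oO) (@subIsetr _ _ _).
    have h3 := ohomeo_comp (ohomeo_sym h2) h1.
    have [q1 q2 F3 _] := h3.
    exists (chi k @` (U `&` Om k)), (f @` (U `&` Om k)), (f \o kap k); split => //.
    + by exists (kap k v).
    + have := ohomeo_homeomorphism h3 (@subset_refl _ _).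
      suff -> : (f \o kap k) @` (chi k @` (U `&` Om k)) = f @` (U `&` Om k) by [].
      rewrite image_comp; apply: eq_imagel => z [_ Oz'] /=.
      by have [_ _ /(_ _ Oz')[_ ->]] := chiP k.
    + move=> _ [z [Uz' Oz'] <-]; have [_ _ /(_ _ Oz')[Vz kz _] _] := chiP k.
      rewrite /= kz -hU// -(rrE Vv) ve; split.
        by move=> /TE[l Vl]; rewrite (rrE Vz) kz.
      by move=> ze; exists k; rewrite ?kz.
  - exists (fun vt => GG (1 - vt.2) vt.1); split.
    + apply/subspace_continuousP => -[v t] [/= /frE[k Vv ve]]; rewrite in_itv /= => /andP[t0 t1].
      have s0 : 0 <= 1 - t by rewrite subr_ge0.
      have sr : (1 - t) * rr v < e0 by rewrite ve; apply: sle => //; rewrite gerBl.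
      have /subspace_continuousP/(_ (1 - t, v)) := @GG_cvg k; move=> /(_ (conj s0 (conj sr Vv))) c W Wc.
      have {Wc} := c W Wc; rewrite /= /within /= !nbhs_simpl /= => Wc.
      have c2 : tends (nbhs (v, t)) snd t by exact: cvg_snd.
      have cm : tends (nbhs (v, t)) (fun vt : CP2 R * R => (1 - vt.2, vt.1)) (1 - t, v).
        by apply: tends_pair; [tendsto|exact: cvg_fst].
      have nV : nbhs (v, t) [set vt : CP2 R * R | V k vt.1].
        have [_ oV _ _] := chiP k.
        by have := @cvg_fst _ _ (nbhs v) (nbhs t) _; apply; apply: open_nbhs_nbhs.
      apply: (@filterS2 _ (nbhs (v, t)) _ _ _ _ _ nV (cm _ Wc)).
      move=> [v' t'] /= Vv' h [/= /frE[k' _ ve']]; rewrite in_itv /= => /andP[t0' t1'].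
      apply: h; split; first by rewrite /= subr_ge0.
      by split => //=; rewrite ve'; apply: sle; rewrite ?subr_ge0// gerBl.
    + by move=> v /frE[k Vv _] /=; rewrite subr0 (GG1 Vv).
    + split.
      * move=> [v t] [/= /frE[k Vv ve]]; rewrite in_itv /= => /andP[t0 t1].
        have s0 : 0 < 1 - t by rewrite subr_gt0.
        have [|VG rG _] := @GGP k v (1 - t) Vv (ltW s0); first by rewrite ve; apply: sle; rewrite ?(ltW s0)// gerBl.
        split; first by apply/TE; exists k => //; rewrite rG ve ler_piMl ?(ltW e1)// gerBl.
        move=> /SE[_ _]; rewrite rG ve => /eqP; rewrite mulf_eq0 !gt_eqF//.
      * move=> [v t] [v' t'] /set_mem[/= /frE[k Vv ve]]; rewrite in_itv /= => /andP[t0 t1].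
        move=> /set_mem[/= /frE[k' Vv' ve']]; rewrite in_itv /= => /andP[t0' t1'] E.
        have s0 : 0 < 1 - t by rewrite subr_gt0.
        have s0' : 0 < 1 - t' by rewrite subr_gt0.
        have [|VG rG G2] := @GGP k v (1 - t) Vv (ltW s0); first by rewrite ve; apply: sle; rewrite ?(ltW s0)// gerBl.
        have [|VG' rG' G2'] := @GGP k' v' (1 - t') Vv' (ltW s0'); first by rewrite ve'; apply: sle; rewrite ?(ltW s0')// gerBl.
        (* The level determines the time; the inverse flow then recovers the point. *)
        have tt' : 1 - t = 1 - t'.
          by move: rG'; rewrite -E rG ve ve' => /mulIf; apply; rewrite gt_eqF.
        have t'E : t = t' by apply: (can_inj (subKr 1)).
        rewrite t'E; congr pair.
        have := G2 (1 - t)^-1; rewrite E t'E G2' ?invr_ge0 ?(ltW s0')//; last by rewrite mulVf ?mul1r ?ve'// gt_eqF.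
        by rewrite mulVf ?gt_eqF// (GG1 Vv) (GG1 Vv') ve mul1r => ->.
      * move=> v [/TE[k Vv ve] nv]; have /andP[r0 r1] := rr_ge0 Vv.
        have rpos : 0 < rr v.
          by rewrite lt_neqAle r0 andbT eq_sym; apply/eqP => v0; apply: nv; apply/SE; exists k.
        have s0 : 0 <= e / rr v by rewrite divr_ge0// ltW.
        have E1 : e / rr v * rr v = e by rewrite divfK ?gt_eqF.
        have [|VG rG G2] := @GGP k v (e / rr v) Vv s0; first by rewrite E1.
        (* The point of the frontier on the flow line of [v], at level [e]; the time records the
           ratio of the two levels. *)
        exists (GG (e / rr v) v, 1 - rr v / e); last first.
          have E2 : rr v / e * (e / rr v) = 1 by rewrite mulrA divfK ?gt_eqF// divff ?gt_eqF.
          have E3 : 0 <= rr v / e by rewrite divr_ge0// ltW.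
          have E4 : rr v / e * (e / rr v) * rr v < e0 by rewrite E2 mul1r.
          by rewrite /= subKr (G2 _ E3 E4) E2 (GG1 Vv).
        split => /=; first by apply/frE; exists k => //; rewrite rG E1.
        by rewrite in_itv /= subr_ge0 ler_pdivrMr// mul1r ve gtrBl divr_gt0.
    + move=> v /frE[k Vv ve]; rewrite /= subrr; have [|VG rG _] := @GGP k v 0 Vv (lexx _).
        by rewrite mul0r (lt_trans e1).
      by apply/SE; exists k => //; rewrite rG mul0r.
move=> U oU SU.
have e2 : 0 < e0 / 2 < e0 by apply/andP; split; move: e0_gt0; lra.
have cK : compact (T (e0 / 2) `&` ~` U) by apply: compact_closedI; [exact: cpt|exact: open_closedC].
(* The part of a tube outside [U] is compact and misses the core, so the distance exceeds some [e]
   on it; the tube of radius [e] then lies in [U]. *)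
have /compact_near_coveringP/(_ R 0^'+ (fun e v => e < rr v)) := cK.
rewrite /near_covering => cov.
have h : 0^'+ [set e | T (e0 / 2) `&` ~` U `<=` [set v | e < rr v]].
  apply: cov => v [/TE[k Vv ve] nU].
  have /andP[r0 r1] := rr_ge0 Vv.
  have rpos : 0 < rr v.
    by rewrite lt_neqAle r0 andbT eq_sym; apply/eqP => v0; apply/nU/SU/SE; exists k.
  have nv := @rr_open k v (rr v / 2) e0 Vv _.
  exists ([set w | rr v / 2 < rr w], [set e | e < rr v / 2]) => /=.
    split; last by apply: nbhs_right_lt; rewrite divr_gt0.
    apply: (@filterS _ (nbhs v)) (nv _) => [w [_ /andP[]]//|]; rewrite r1 andbT.
    by move: rpos; lra.
  by move=> [w e] [/= h1 h2]; exact: lt_trans h1.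
have h2 : 0^'+ [set e : R | 0 < e < e0 / 2].
  have h3 : 0^'+ [set e : R | 0 < e] by exact: nbhs_right_gt.
  have h4 : 0^'+ [set e : R | e < e0 / 2] by apply: nbhs_right_lt; case/andP: e2.
  by apply: (@filterS2 _ 0^'+) h3 h4 => e /= -> ->.
have [e [eK /= /andP[e1 e3]]] := filter_ex (filterI h h2).
exists (T e); last by apply: tubeT; rewrite e1; case/andP: e2 => _; exact: lt_trans.
move=> v /TE[k Vv ve]; apply: contrapT => nU.
suff : e < rr v by rewrite ltNge ve.
by apply: eK; split => //; apply/TE; exists k => //; rewrite (le_trans ve)// ltW.
Qed.
End Atlas.
Lemma ohomeo_compI (X Y Z : topologicalType) (U : set X) (V V' : set Y) (W : set Z) f k f' k' :
  ohomeo U V f k -> ohomeo V' W f' k' ->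
  ohomeo (k @` (V `&` V')) (f' @` (V `&` V')) (f' \o f) (k \o k').
Proof.
move=> h h'; have [_ oV _ _] := h; have [oV' _ _ _] := h'.
have h1 := ohomeo_sub (ohomeo_sym h) (openI oV oV') (@subIsetl _ _ _).
have h2 := ohomeo_sub h' (openI oV oV') (@subIsetr _ _ _).
exact: ohomeo_comp (ohomeo_sym h1) h2.
Qed.

(** * Half-space charts from functions homogeneous in one complex coordinate *)

Section HalfSpace.
Variable R : realType.
Notation C := R[i].
Definition row4 (a b c d : R) : 'rV[R]_4 := \row_(j < 4) nth 0 [:: a; b; c; d] j.
Lemma ord4P (Q : 'I_4 -> Prop) : Q (Ordinal (isT : 0 < 4)%N) -> Q (Ordinal (isT : 1 < 4)%N) ->
  Q (Ordinal (isT : 2 < 4)%N) -> Q (Ordinal (isT : 3 < 4)%N) -> forall j, Q j.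
Proof.
move=> q0 q1 q2 q3 [[|[|[|[|//]]]] h].
- by rewrite (_ : Ordinal h = Ordinal (isT : 0 < 4)%N)//; exact: val_inj.
- by rewrite (_ : Ordinal h = Ordinal (isT : 1 < 4)%N)//; exact: val_inj.
- by rewrite (_ : Ordinal h = Ordinal (isT : 2 < 4)%N)//; exact: val_inj.
- by rewrite (_ : Ordinal h = Ordinal (isT : 3 < 4)%N)//; exact: val_inj.
Qed.
Lemma tends_row4 (T : Type) (F : set_system T) {FF : Filter F} (f0 f1 f2 f3 : T -> R) a b c d :
  tends F f0 a -> tends F f1 b -> tends F f2 c -> tends F f3 d ->
  tends F (fun t => row4 (f0 t) (f1 t) (f2 t) (f3 t)) (row4 a b c d).
Proof.
move=> h0 h1 h2 h3; apply: (@cvg_mx _ _ F) => i; rewrite ord1; apply: ord4P; rewrite mxE /=.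
- by apply: tends_ext h0 => t; rewrite mxE.
- by apply: tends_ext h1 => t; rewrite mxE.
- by apply: tends_ext h2 => t; rewrite mxE.
- by apply: tends_ext h3 => t; rewrite mxE.
Qed.
Lemma tends_coord4 (v : 'rV[R]_4) j : tends (nbhs v) (fun w : 'rV[R]_4 => w 0 j) (v 0 j).
Proof. by apply: (@cvg_coord _ _ (nbhs v)); exact: cvg_id. Qed.

Section Gauge.
Variables (N : C * C -> R) (a0 : C) (e : R).
Hypothesis a00 : a0 != 0.
Hypothesis cN : continuous N.
Hypothesis NZ : forall l a w, 0 < l -> N (l%:C * a, w) = l * N (a, w).
Let j0 := (Ordinal (isT : 0 < 4)%N). Let j1 := (Ordinal (isT : 1 < 4)%N).
Let j2 := (Ordinal (isT : 2 < 4)%N). Let j3 := (Ordinal (isT : 3 < 4)%N).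
(** Directions in the half-plane around [a0], parametrised by the tangent of the angle to [a0]. *)
Let d (v : 'rV[R]_4) : C := a0 * (1 +i* v 0 j1).
Let w (v : 'rV[R]_4) : C := v 0 j2 +i* v 0 j3.
Let U0 := [set z : C * C | 0 < complex.Re (z.1 / a0) /\ 0 < N z].
Let W0 := [set v : 'rV[R]_4 | v 0 j0 < e /\ 0 < N (d v, w v)].
(* Homogeneity makes N a radial coordinate in the half-space of directions near a0. *)
Definition gauge_chart (z : C * C) := row4 (e - N z)
  (complex.Im (z.1 / a0) / complex.Re (z.1 / a0)) (complex.Re z.2) (complex.Im z.2).
Let g0 (v : 'rV[R]_4) : C * C := (((e - v 0 j0) / N (d v, w v))%:C * d v, w v).
Let cdw v : tends (nbhs v) (fun v => (d v, w v)) (d v, w v).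
Proof.
have [h1 h2 h3] := And3 (@tends_coord4 v j1) (@tends_coord4 v j2) (@tends_coord4 v j3).
by rewrite /d /w; tendsto.
Qed.
Let cNdw v : tends (nbhs v) (fun v => N (d v, w v)) (N (d v, w v)).
Proof. exact: (tends_comp (@cdw v) (@cN _)). Qed.
Let cRe z : {for z, continuous (fun z : C * C => complex.Re (z.1 / a0))}.
Proof.
have h : tends (nbhs z) (fun z : C * C => z.1) z.1 by exact: cvg_fst.
by tendsto.
Qed.
Lemma open_fun_gt0 (X : topologicalType) (g : X -> R) : continuous g -> open [set x | 0 < g x].
Proof. by move=> cg; apply: (@open_comp _ _ g [set x | 0 < x]) => [x _|]; [exact: cg|exact: open_gt]. Qed.
Lemma gauge_chartP : ohomeo U0 W0 gauge_chart g0.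
Proof.
split.
- apply: openI; last exact: open_fun_gt0.
  by apply: open_fun_gt0 => z; exact: cRe.
- have -> : W0 = [set v : 'rV[R]_4 | 0 < e - v 0 j0] `&` [set v : 'rV[R]_4 | 0 < N (d v, w v)].
    by apply/seteqP; split => v /=; rewrite subr_gt0.
  apply: openI; last by apply: open_fun_gt0 => v; exact: cNdw.
  apply: open_fun_gt0 => v; have h := @tends_coord4 v j0.
  by tendsto.
- move=> [a u] [/= x0 Na].
  set x := complex.Re (a / a0) in x0 *; set b := complex.Im (a / a0) / x.
  have xC : x%:C != 0 :> C by apply/eqP => -[h]; rewrite h ltxx in x0.
  have dE : a = x%:C * (a0 * (1 +i* b)).
    have -> : x%:C * (a0 * (1 +i* b)) = a0 * (x%:C * (1 +i* b)) by rewrite mulrCA.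
    have -> : x%:C * (1 +i* b) = a / a0.
      have -> : a / a0 = x +i* complex.Im (a / a0) by rewrite /x; case: (a / a0).
      apply/eqP; rewrite eq_complex /= mulr1 !mul0r subr0 eqxx /= addr0 /b mulrCA divff ?mulr1 //.
      by rewrite gt_eqF.
    by rewrite mulrCA divff ?mulr1.
  have g1 : gauge_chart (a, u) 0 j1 = b by rewrite mxE.
  have dg : d (gauge_chart (a, u)) = a0 * (1 +i* b) by rewrite /d g1.
  have wg : w (gauge_chart (a, u)) = u by rewrite /w !mxE /=; case: (u).
  have Nd : N (a, u) = x * N (a0 * (1 +i* b), u) by rewrite {1}dE NZ.
  have Nd0 : 0 < N (a0 * (1 +i* b), u) by rewrite -(pmulr_rgt0 _ x0) -Nd.
  split.
  + by split; rewrite ?dg ?wg// mxE /= ltrBlDr ltrDl.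
  + rewrite /g0 dg wg mxE /= subKr Nd mulfK ?gt_eqF//; congr pair; exact/esym.
  + have hN : tends (nbhs (a, u)) N (N (a, u)) by exact: cN.
    have h1 : tends (nbhs (a, u)) (fun z : C * C => z.1) a by exact: cvg_fst.
    have h2 : tends (nbhs (a, u)) (fun z : C * C => z.2) u by exact: cvg_snd.
    have x1 : complex.Re (a / a0) != 0 by rewrite gt_eqF.
    by apply: tends_row4; tendsto.
- move=> v [/= v0 Nv].
  set l := (e - v 0 j0) / N (d v, w v).
  have l0 : 0 < l by rewrite divr_gt0// subr_gt0.
  have dv : l%:C * d v / a0 = l +i* (l * v 0 j1).
    rewrite /d mulrCA mulrAC divff// mul1r; apply/eqP; rewrite eq_complex /=; apply/andP; split; apply/eqP; ring.
  split.
  + by split; rewrite /= -/l ?dv//= NZ// mulr_gt0.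
  + have gd : N (g0 v) = e - v 0 j0 by rewrite /g0 -/l NZ// /l divfK// gt_eqF.
    apply/rowP; apply: ord4P; rewrite mxE /= ?gd ?subKr -/l ?dv//=.
    by rewrite mulrC mulKf// gt_eqF.
  + have hd : tends (nbhs v) d (d v) by rewrite /d; have h := @tends_coord4 v j1; tendsto.
    have hw : tends (nbhs v) w (w v) by rewrite /w; have h := @tends_coord4 v j2; have h' := @tends_coord4 v j3; tendsto.
    have h0 := @tends_coord4 v j0; have hN := cNdw (v := v).
    have N0 : N (d v, w v) != 0 by rewrite gt_eqF.
    by rewrite /g0; tendsto.
Qed.
End Gauge.
(** In the coordinates [phi] the sublevel set is that of a function positively homogeneous in a
    complex coordinate that is nonzero at the point. Such a function can itself serve as a
    coordinate, in place of an implicit function argument. *)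
Lemma half_space_gauge (Z : topologicalType) (rho : Z -> R) z (U : set Z) V phi psi (N : C * C -> R) :
  ohomeo U V phi psi -> U z -> (phi z).1 != 0 -> continuous N ->
  (forall l a w, 0 < l -> N (l%:C * a, w) = l * N (a, w)) -> 0 < N (phi z) ->
  (forall q, U q -> (rho q <= rho z <-> N (phi q) <= N (phi z))) ->
  exists U W (f : Z -> 'rV[R]_4) g, [/\ ohomeo U W f g, U z &
    forall q, U q -> (rho q <= rho z <-> 0 <= f q ord0 ord0)].
Proof.
move=> h Uz a0 cN NZ Nz hN; have := gauge_chartP (N (phi z)) a0 cN NZ.
set U0 := (X in ohomeo X _ _ _); set W0 := (X in ohomeo _ X _ _); set g0 := (X in ohomeo _ _ _ X).
move=> h'; have [_ _ hU hV] := h; have [Vz kz _] := hU _ Uz.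
do 4 eexists; split; first exact: ohomeo_compI h h'.
  by exists (phi z) => //; split => //; rewrite /U0 /= divff//= ltr01.
move=> _ [y [Vy _] <-]; have [Uy fy _] := hV _ Vy.
by rewrite hN// /= fy mxE /= subr_ge0.
Qed.
End HalfSpace.

(** * Tubes of unions of graphs *)
Section Collapse.
Variables (R : realType) (r : R).
Hypothesis r0 : 0 < r.
(** In the plane of distance [t] and height [k] the flow lines are segments: rays from the origin
    where [t <= k r], and lines through [(r, 1)] beyond. [pull] is the horizontal displacement from
    [(t, k)] to the foot of its segment on [k = 0]. *)
Definition pull (t k : R) := Num.min t (Num.max 0 (k / (1 - k)) * Num.max 0 (r - t)).
Implicit Types (t k s : R).
Lemma pull_out t k : 0 <= t -> r <= t -> pull t k = 0.
Proof. by move=> t0 rt; rewrite /pull [X in _ * X]max_l ?subr_le0// mulr0 min_r. Qed.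
Lemma pull_small t k : 0 <= k -> k <= 1 / 2 -> t <= k * r -> pull t k = t.
Proof.
move=> k0 k1 tk; have k2 : 0 < 1 - k by lra.
have q0 : 0 <= k / (1 - k) by rewrite divr_ge0// ltW.
have tr : t <= r by move: r0; nra.
by rewrite /pull !max_r ?subr_ge0// min_l// mulrAC ler_pdivlMr//; nra.
Qed.
Lemma pull_big t k : 0 <= k -> k <= 1 / 2 -> k * r <= t -> t <= r -> pull t k = k / (1 - k) * (r - t).
Proof.
move=> k0 k1 tk tr; have k2 : 0 < 1 - k by lra.
have q0 : 0 <= k / (1 - k) by rewrite divr_ge0// ltW.
by rewrite /pull !max_r ?subr_ge0// min_r// mulrAC ler_pdivrMr//; nra.
Qed.
Lemma pull_ge0 t k : 0 <= t -> 0 <= pull t k.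
Proof. by move=> t0; rewrite /pull le_min t0 mulr_ge0 ?le_max ?lexx. Qed.
Lemma pull_le t k : pull t k <= t.
Proof. by rewrite /pull ge_min lexx. Qed.
(** The point [(t', s k)] lies on the same segment as [(t, k)], so its displacement is scaled by
    [s]; this gives the semigroup law on the base. By the last clause the flow keeps the region
    beyond the cone. *)
Lemma pull_scale t k s : 0 <= t -> t <= r -> 0 <= k -> k <= 1 / 2 -> 0 <= s -> s * k <= 1 / 2 ->
  let t' := t - (1 - s) * pull t k in
  [/\ 0 <= t', t' <= r, pull t' (s * k) = s * pull t k & k * r <= t -> s * k * r <= t'].
Proof.
move=> t0 tr k0 k1 s0 sk t'; have sk0 : 0 <= s * k by rewrite mulr_ge0.
have [tk|kt] := lerP t (k * r).
  have t'E : t' = s * t by rewrite /t' pull_small//; ring.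
  have t'1 : t' <= s * k * r by rewrite t'E -mulrA ler_wpM2l.
  split; rewrite ?t'E ?mulr_ge0//.
  - by apply: le_trans (_ : s * k * r <= _); [rewrite -t'E|move: r0; nra].
  - by rewrite pull_small -?t'E// pull_small.
  - by move=> h; rewrite -mulrA ler_wpM2l.
have kt' := ltW kt.
set u := pull t k in t' *; have k2 : 0 < 1 - k by lra.
(* Equation of the foot [t - u]: the segment from it passes through [(t, k)] and [(r, 1)]. *)
have uE : u = k * (r - (t - u)).
  have : u * (1 - k) = k * (r - t) by rewrite /u pull_big// mulrAC divfK// gt_eqF.
  by move=> h; lra.
have tu : 0 <= t - u.
  rewrite subr_ge0 /u pull_big// mulrAC ler_pdivrMr//; nra.
have u0 : 0 <= u by exact: pull_ge0.
have t'E : t' = (t - u) * (1 - s * k) + s * k * r.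
  transitivity (t - u + s * (k * (r - (t - u)))); last by ring.
  by rewrite -uE /t'; ring.
have t'l : s * k * r <= t' by rewrite t'E lerDr mulr_ge0//; lra.
have t'r : t' <= r.
  have h : 0 <= (r - (t - u)) * (1 - s * k) by rewrite mulr_ge0//; lra.
  by rewrite t'E; lra.
split => //; first by apply: le_trans t'l; rewrite mulr_ge0// ltW.
rewrite pull_big// t'E {2}uE mulrAC; apply: (canLR (mulfK _)); first by rewrite gt_eqF//; lra.
by ring.
Qed.
End Collapse.

Section Nearest.
Variables (R : realType) (J : finType) (j0 : J).
Notation C := R[i].
Variable f : J -> C -> C.
Definition nearest (z : C * C) : J := [arg min_(j < j0) cabs (z.2 - f j z.1)]%O.
Definition dist_br (z : C * C) : R := cabs (z.2 - f (nearest z) z.1).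
Lemma dist_br_le z j : dist_br z <= cabs (z.2 - f j z.1).
Proof. by rewrite /dist_br /nearest; case: arg_minP => //= i _; apply. Qed.
Lemma dist_br_ge0 z : 0 <= dist_br z. Proof. exact: cabs_ge0. Qed.
Lemma dist_br_eq z j : (forall k, cabs (z.2 - f j z.1) <= cabs (z.2 - f k z.1)) ->
  dist_br z = cabs (z.2 - f j z.1).
Proof. by move=> h; apply/eqP; rewrite eq_le dist_br_le h. Qed.
Hypothesis cf : forall j, continuous (f j).
Lemma nearestP z : \forall w \near z, cabs (z.2 - f (nearest w) z.1) = dist_br z.
Proof.
have cj j : {for z, continuous (fun w : C * C => cabs (w.2 - f j w.1))}.
  have h1 : tends (nbhs z) (fun w : C * C => w.1) z.1 by exact: cvg_fst.
  have h2 : tends (nbhs z) (fun w : C * C => w.2) z.2 by exact: cvg_snd.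
  have h3 : tends (nbhs z) (fun w : C * C => f j w.1) (f j z.1) by apply: tends_comp h1 _; exact: cf.
  by tendsto.
have H j : \forall w \near z, dist_br z < cabs (z.2 - f j z.1) ->
    cabs (w.2 - f (nearest z) w.1) < cabs (w.2 - f j w.1).
  have [h|h] := lerP (cabs (z.2 - f j z.1)) (dist_br z).
    by apply: (@filterE _ (nbhs z)) => w.
  have c : {for z, continuous (fun w : C * C => cabs (w.2 - f j w.1) - cabs (w.2 - f (nearest z) w.1))}.
    by have h1 := cj j; have h2 := cj (nearest z); apply: (@tendsRD _ _ (nbhs z)) => //; exact: tendsRN.
  have : nbhs z ((fun w : C * C => cabs (w.2 - f j w.1) - cabs (w.2 - f (nearest z) w.1)) @^-1` [set x | 0 < x]).
    by apply: c; apply: open_nbhs_nbhs; split; [exact: open_gt|rewrite /= subr_gt0].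
  by apply: (@filterS _ (nbhs z)) => w /=; rewrite subr_gt0 => ->.
have : \forall w \near z, forall j, dist_br z < cabs (z.2 - f j z.1) ->
    cabs (w.2 - f (nearest z) w.1) < cabs (w.2 - f j w.1).
  exact: (@filter_forall _ J (fun j (w : C * C) => dist_br z < cabs (z.2 - f j z.1) ->
    cabs (w.2 - f (nearest z) w.1) < cabs (w.2 - f j w.1)) (nbhs z) _ H).
apply: (@filterS _ (nbhs z)) => w /(_ (nearest w)) h; apply/eqP; rewrite eq_le dist_br_le andbT leNgt.
by apply/negP => /h; rewrite ltNge; have := dist_br_le w (nearest z); rewrite /dist_br => ->.
Qed.
Lemma dist_br_continuous : continuous dist_br.
Proof.
move=> z W Wz; have cj j : tends (nbhs z) (fun w : C * C => cabs (w.2 - f j w.1)) (cabs (z.2 - f j z.1)).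
  have h1 : tends (nbhs z) (fun w : C * C => w.1) z.1 by exact: cvg_fst.
  have h2 : tends (nbhs z) (fun w : C * C => w.2) z.2 by exact: cvg_snd.
  have h3 : tends (nbhs z) (fun w : C * C => f j w.1) (f j z.1) by apply: tends_comp h1 _; exact: cf.
  by tendsto.
have H : \forall w \near z, forall j, cabs (z.2 - f j z.1) = dist_br z -> W (cabs (w.2 - f j w.1)).
  apply: (@filter_forall _ J (fun j (w : C * C) => cabs (z.2 - f j z.1) = dist_br z -> W (cabs (w.2 - f j w.1))) (nbhs z)) => j.
  have [h|h] := pselect (cabs (z.2 - f j z.1) = dist_br z); last first.
    by apply: (@filterE _ (nbhs z)) => w /h.
  have Wj : nbhs (cabs (z.2 - f j z.1)) W by rewrite h.
  by apply: (@filterS _ (nbhs z)) (cj j _ Wj).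
by apply: (@filterS2 _ (nbhs z)) H (nearestP z) => w h1 h2; exact: h1.
Qed.
End Nearest.

(** * Flow and half-space charts over the affine part *)

Section AffTube.
Variables (R : realType) (J : finType) (j0 : J).
Notation C := R[i].
Variables (f : J -> C -> C) (P : seq C) (r d e0 : R).
Hypothesis cf : forall j, continuous (f j).
Hypotheses (r0 : 0 < r) (d0 : 0 < d) (e00 : 0 < e0) (e0r : 2 * e0 <= d * r).
Hypothesis uP : uniq P.
Hypothesis P1 : forall p q, p \in P -> q \in P -> p != q -> 2 * r <= cabs (p - q).
Hypothesis P1' : forall p, p \in P -> cabs p + r < 1.
Hypothesis P2 : forall j p X s, p \in P -> cabs X <= r -> 0 <= s -> s * cabs X <= r ->
  f j (p + s%:C * X) = f j p + s%:C * (f j (p + X) - f j p).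
Hypothesis P3 : forall p X j k, p \in P -> cabs X <= r -> j != k -> f j p = f k p ->
  3 * d * cabs X <= cabs (f j (p + X) - f k (p + X)).
Hypothesis P4 : forall p X j k, p \in P -> cabs X <= r -> f j p != f k p ->
  3 * e0 <= cabs (f j (p + X) - f k (p + X)).
Hypothesis P5 : forall x j k, cabs x < 1 -> (forall p, p \in P -> r <= cabs (x - p)) -> j != k ->
  3 * e0 <= cabs (f j x - f k x).
Let near_br := nearest j0 f.
Let rhoA := dist_br j0 f.
Let rhoA_le := dist_br_le j0 f.
Let rhoA_ge0 := dist_br_ge0 j0 f.
Let rhoA_eq := @dist_br_eq _ _ j0 f.
Let near_brP := @nearestP _ _ j0 f cf.
Let rhoA_continuous := @dist_br_continuous _ _ j0 f cf.
Definition pullC (X : C) (k : R) : C := (pull r (cabs X) k / cabs X)%:C * X.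
(* Scales by s about p in the disc of radius k r around p, and is the identity beyond r. *)
Definition shrink (s k : R) (x : C) : C := x - (1 - s)%:C * \sum_(p <- P) pullC (x - p) k.
(* Vertical scaling towards the graph of f j. Near a crossing the curve is a cone, and the
   base point is scaled too, so that all branches there define the same flow. *)
Definition flow (j : J) (s : R) (z : C * C) : C * C :=
  let x := shrink s (rhoA z / (d * r)) z.1 in (x, f j x + s%:C * (z.2 - f j z.1)).
Definition flowA s z := flow (near_br z) s z.
Definition OmA := [set z : C * C | cabs z.1 < 1 /\ rhoA z < e0].
Let dr0 : 0 < d * r. Proof. exact: mulr_gt0. Qed.
Lemma shrink_out s k x : (forall p, p \in P -> r <= cabs (x - p)) -> shrink s k x = x.
Proof.
move=> h; rewrite /shrink big_seq big1 ?mulr0 ?subr0// => p /h rp.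
by rewrite /pullC pull_out ?cabs_ge0// mul0r mul0r.
Qed.
Lemma disc_or x : (exists2 p, p \in P & cabs (x - p) < r) \/ (forall p, p \in P -> r <= cabs (x - p)).
Proof.
have [h|h] := boolP (has (fun p => cabs (x - p) < r) P); first by left; exact/hasP.
by right => p pP; rewrite leNgt; apply: contraNN h => h; apply/hasP; exists p.
Qed.
Lemma shrink_in s k p X : p \in P -> cabs X <= r ->
  shrink s k (p + X) = p + (1 - (1 - s) * (pull r (cabs X) k / cabs X))%:C * X.
Proof.
move=> pP Xr; rewrite /shrink (bigD1_seq p)//= [p + X - p]addrC addKr big_seq_cond big1 ?addr0.
  by rewrite /pullC !(rmorphB, rmorphM, rmorph1) /=; ring.
move=> q /andP[qP qp]; rewrite /pullC pull_out ?cabs_ge0 ?mul0r// ?mul0r//.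
rewrite -addrAC; have := P1 pP qP; rewrite eq_sym => /(_ qp) h.
have := cabsD (p - q + X) (- X); rewrite addrK cabsN; move: h Xr; lra.
Qed.
Lemma shrink_cabs s k X : 0 <= k -> k <= 1 / 2 -> 0 <= s -> s * k <= 1 / 2 -> cabs X <= r ->
  cabs ((1 - (1 - s) * (pull r (cabs X) k / cabs X))%:C * X) = cabs X - (1 - s) * pull r (cabs X) k.
Proof.
move=> k0 k1 s0 sk Xr; have [->|X0] := eqVneq X 0.
  by rewrite mulr0 cabs0 pull_small ?mulr0 ?subr0 ?mulr_ge0// ltW.
have [h _ _ _] := pull_scale r0 (cabs_ge0 X) Xr k0 k1 s0 sk.
have X1 : 0 < cabs X by rewrite cabs_gt0.
have E : 1 - (1 - s) * (pull r (cabs X) k / cabs X) = (cabs X - (1 - s) * pull r (cabs X) k) / cabs X.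
  by rewrite [RHS]mulrBl divff ?gt_eqF// mulrA.
by rewrite E cabsM cabs_real ger0_norm ?divfK ?gt_eqF// divr_ge0// ltW.
Qed.
Lemma tie_disc z j k : OmA z -> j != k -> cabs (z.2 - f j z.1) = rhoA z ->
  cabs (z.2 - f k z.1) = rhoA z ->
  exists p, [/\ p \in P, f j p = f k p, cabs (z.1 - p) < r & 3 * d * cabs (z.1 - p) <= 2 * rhoA z].
Proof.
move=> [x1 re] jk hj hk.
have fjk : cabs (f j z.1 - f k z.1) <= 2 * rhoA z.
  by apply: le_trans (cabs_tri _ _ z.2) _; rewrite hk cabsB hj mulr2n mulrDl !mul1r.
have rz := rhoA_ge0 z.
have [[p pP xp]|out] := disc_or z.1; last by have := P5 x1 out jk; lra.
have E : z.1 = p + (z.1 - p) by rewrite addrC subrK.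
have fp : f j p = f k p.
  by apply/eqP/negPn/negP => /(P4 pP (ltW xp)); rewrite -E; lra.
by exists p; split => //; have := P3 pP (ltW xp) jk fp; rewrite -E => h; exact: le_trans fjk.
Qed.
(** Both branches are linear along the ray of [X] and agree at [p], so the scaled point does not
    depend on the branch. *)
Lemma flow_disc j k s p X y : p \in P -> f j p = f k p -> cabs X <= r -> 0 <= s -> s * cabs X <= r ->
  f j (p + s%:C * X) + s%:C * (y - f j (p + X)) = f k (p + s%:C * X) + s%:C * (y - f k (p + X)).
Proof. by move=> pP fp Xr s0 sX; rewrite (P2 j pP)// (P2 k pP)// fp; ring. Qed.
Lemma small_kappa z s : 0 <= s -> s * rhoA z < e0 ->
  [/\ 0 <= rhoA z / (d * r) & s * (rhoA z / (d * r)) <= 1 / 2].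
Proof.
move=> s0 sr; split; first by rewrite divr_ge0 ?rhoA_ge0// ltW.
by rewrite mulrA ler_pdivrMr//; move: e0r; lra.
Qed.
(** With height [k = rho / (d r)], the condition [d |X| <= rho] reads [|X| <= k r], the part of
    [pull] where flow lines are rays to the crossing. *)
Lemma shrink_core s z p : p \in P -> cabs (z.1 - p) < r -> d * cabs (z.1 - p) <= rhoA z -> OmA z ->
  0 <= s -> s * rhoA z < e0 -> shrink s (rhoA z / (d * r)) z.1 = p + s%:C * (z.1 - p) /\ s * cabs (z.1 - p) <= r.
Proof.
move=> pP xp dx [_ re] s0 sr; have [k0 sk] := small_kappa s0 sr.
have k1 : rhoA z / (d * r) <= 1 / 2 by have [|_] := @small_kappa z 1 ler01; rewrite !mul1r.
have xk : cabs (z.1 - p) <= rhoA z / (d * r) * r.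
  by rewrite invfM mulrA divfK ?gt_eqF// ler_pdivlMr// mulrC.
have E : z.1 = p + (z.1 - p) by rewrite addrC subrK.
split; last first.
  rewrite -(@ler_pM2l _ d)// mulrCA; apply: le_trans (_ : s * rhoA z <= _); first by rewrite ler_wpM2l.
  by move: e0r e00 sr; lra.
have sE := shrink_in s (rhoA z / (d * r)) pP (ltW xp); rewrite -E in sE; rewrite sE pull_small//.
have [->|x0] := eqVneq (z.1 - p) 0; first by rewrite !mulr0.
by rewrite divff ?mulr1 ?subKr// cabs_eq0.
Qed.
Lemma flowAE s z j : OmA z -> cabs (z.2 - f j z.1) = rhoA z -> 0 <= s -> s * rhoA z < e0 ->
  flowA s z = flow j s z.
Proof.
move=> Oz hj s0 sr; rewrite /flowA; have [-> //|nj] := eqVneq j (near_br z).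
have [p [pP fp xp dx]] := tie_disc Oz nj hj (erefl (rhoA z)).
have dx' : d * cabs (z.1 - p) <= rhoA z by have := rhoA_ge0 z; lra.
have [xE sx] := shrink_core pP xp dx' Oz s0 sr.
rewrite /flow xE; congr pair; have E : z.1 = p + (z.1 - p) by rewrite addrC subrK.
by rewrite {2 4}E; apply/esym; apply: flow_disc => //; exact: ltW.
Qed.
Let flow_snd j s z : (flow j s z).2 - f j (flow j s z).1 = s%:C * (z.2 - f j z.1).
Proof. by rewrite /flow /=; ring. Qed.
(** No other branch overtakes the tracked one. Away from common crossings the gap [3 * e0] suffices;
    in the cone the distances to all branches through the crossing scale alike; beyond the cone the
    linear gap over the new base point dominates. *)
Lemma flow_branch s z j k : OmA z -> cabs (z.2 - f j z.1) = rhoA z -> 0 <= s -> s * rhoA z < e0 ->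
  s * rhoA z <= cabs ((flow j s z).2 - f k (flow j s z).1).
Proof.
move=> Oz hj s0 sr; have [x1 re] := Oz; have [k0 sk] := small_kappa s0 sr.
have k1 : rhoA z / (d * r) <= 1 / 2 by have [|_] := @small_kappa z 1 ler01; rewrite !mul1r.
have rz := rhoA_ge0 z; have srz : 0 <= s * rhoA z by rewrite mulr_ge0.
rewrite /flow /=; set x := shrink _ _ _; set y := f j x + _.
have yj : cabs (y - f j x) = s * rhoA z 
  by have := flow_snd j s z; rewrite /flow /= -/x -/y => ->; rewrite cabsM cabs_real hj ger0_norm.
have [<-|jk] := eqVneq j k; first by rewrite yj.
have gap : 2 * (s * rhoA z) <= cabs (f j x - f k x) -> s * rhoA z <= cabs (y - f k x).
  by move=> g; have := cabs_tri (f j x) (f k x) y; rewrite [X in _ <= X + _]cabsB yj; lra.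
have [[p pP xp]|out] := disc_or z.1; last first.
  by apply: gap; rewrite /x shrink_out//; have := P5 x1 out jk; lra.
have E : z.1 = p + (z.1 - p) by rewrite addrC subrK.
have sE := shrink_in s (rhoA z / (d * r)) pP (ltW xp); rewrite -E in sE.
have sC := shrink_cabs k0 k1 s0 sk (ltW xp).
have [t0 tr _ tk] := pull_scale r0 (cabs_ge0 (z.1 - p)) (ltW xp) k0 k1 s0 sk.
rewrite -sC in t0 tr tk; rewrite -/x in sE.
have [fp|fp] := eqVneq (f j p) (f k p); last first.
  by apply: gap; have := P4 pP tr fp; rewrite -sE; lra.
have kr : rhoA z / (d * r) * r = rhoA z / d by rewrite invfM mulrA divfK// gt_eqF.
have [dx|dx] := lerP (d * cabs (z.1 - p)) (rhoA z).
  have [xE sx] := shrink_core pP xp dx Oz s0 sr.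
  have := @flow_disc j k s p (z.1 - p) z.2 pP fp (ltW xp) s0 sx; rewrite -E -xE -/x -/y => yE.
  rewrite {}yE [X in cabs X](_ : _ = s%:C * (z.2 - f k z.1)); last by ring.
  by rewrite cabsM cabs_real ger0_norm// ler_wpM2l//; exact: rhoA_le.
(* Beyond the cone the new distance to [p] is at least [s k r = s rho / d], so the linear gap is at
   least [3 s rho]. *)
apply: gap; have := P3 pP tr jk fp; rewrite -sE; apply: le_trans.
have /tk : rhoA z / (d * r) * r <= cabs (z.1 - p) by rewrite kr ler_pdivrMr// mulrC ltW.
rewrite -mulrA kr -(ler_pM2l d0) => h.
have h2 : d * (s * (rhoA z / d)) = s * rhoA z by rewrite mulrCA [d * _]mulrC divfK// gt_eqF.
by rewrite -mulrA; move: h; rewrite h2; lra.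
Qed.
Lemma flowA_spec s z : OmA z -> 0 <= s -> s * rhoA z < e0 ->
  [/\ OmA (flowA s z), rhoA (flowA s z) = s * rhoA z
    & forall s', 0 <= s' -> s' * s * rhoA z < e0 -> flowA s' (flowA s z) = flowA (s' * s) z].
Proof.
move=> Oz s0 sr; have [x1 re] := Oz; set j := near_br z; have hj : cabs (z.2 - f j z.1) = rhoA z by [].
have jE : cabs ((flow j s z).2 - f j (flow j s z).1) = s * rhoA z.
  by rewrite flow_snd cabsM cabs_real hj ger0_norm.
have rE : rhoA (flowA s z) = s * rhoA z.
  by rewrite -[flowA s z]/(flow j s z) -jE; apply: rhoA_eq => k; rewrite jE; exact: flow_branch.
have [k0 sk] := small_kappa s0 sr.
have k1 : rhoA z / (d * r) <= 1 / 2 by have [|_] := @small_kappa z 1 ler01; rewrite !mul1r.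
have x1' : cabs (flowA s z).1 < 1.
  rewrite /flowA /flow /=; have [[p pP xp]|out] := disc_or z.1; last by rewrite shrink_out.
  have E : z.1 = p + (z.1 - p) by rewrite addrC subrK.
  rewrite [X in shrink _ _ X]E shrink_in ?(ltW xp)//; apply: le_lt_trans (cabsD _ _) _.
  rewrite shrink_cabs// ?(ltW xp)//; apply: le_lt_trans (P1' pP); rewrite lerD2l.
  by have [] := pull_scale r0 (cabs_ge0 (z.1 - p)) (ltW xp) k0 k1 s0 sk.
have Oz' : OmA (flowA s z) by split; rewrite ?rE.
split => // s' s'0 s'r; have s's0 : 0 <= s' * s by rewrite mulr_ge0.
rewrite (@flowAE s' _ j) ?rE ?mulrA//.
rewrite [RHS](@flowAE _ z j)// /flow rE -/j /=.
have -> : shrink s' (s * rhoA z / (d * r)) (shrink s (rhoA z / (d * r)) z.1) = shrink (s' * s) (rhoA z / (d * r)) z.1.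
  rewrite -mulrA; set k := rhoA z / (d * r) in k0 k1 sk *.
  have [[p pP xp]|out] := disc_or z.1; last by rewrite !(@shrink_out _ _ z.1).
  have E : z.1 = p + (z.1 - p) by rewrite addrC subrK.
  move: (z.1 - p) xp E => X Xr ->; have {}Xr := ltW Xr.
  have [t0 tr tk _] := pull_scale r0 (cabs_ge0 X) Xr k0 k1 s0 sk.
  have sC := shrink_cabs k0 k1 s0 sk Xr; rewrite -sC in t0 tr tk.
  rewrite (shrink_in s k pP Xr) (shrink_in (s' * s) k pP Xr) (shrink_in s' (s * k) pP tr) tk sC.
  congr (p + _); rewrite mulrA -rmorphM /=; have [->|X0] := eqVneq X 0; first by rewrite !mulr0.
  congr (_%:C * _); have t1 : cabs X != 0 by rewrite cabs_eq0.
  set e := pull r (cabs X) k in sC tk *; set t := cabs X in t1 sC *.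
  have tau : 1 - (1 - s) * (e / t) = (t - (1 - s) * e) / t by rewrite [RHS]mulrBl divff// mulrA.
  (* If the base point lands on the crossing, the quotient by its new distance is a division by
     zero; then [s * e = 0] and both sides vanish. *)
  have [t'0|t'0] := eqVneq (t - (1 - s) * e) 0; last by rewrite tau; field; rewrite t1 t'0.
  have se : s * e = 0.
    have sk0 : 0 <= s * k by rewrite mulr_ge0.
    by rewrite -tk sC t'0 /pull min_l// mulr_ge0// le_max lexx.
  rewrite tau t'0 mul0r mulr0; apply/esym/eqP; rewrite subr_eq0 mulrA eq_sym -(inj_eq (mulIf t1)) mul1r divfK//.
  by apply/eqP; move: t'0 se; nra.
by congr pair; ring.
Qed.
Lemma flowA1 z : flowA 1 z = z.
Proof.
rewrite /flowA /flow /shrink subrr mul0r subr0 mul1r [f _ _ + _]addrC subrK.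
by case: z.
Qed.
Lemma pullC_continuous (X : C) k : k < 1 -> {for (X, k), continuous (fun v : C * R => pullC v.1 v.2)}.
Proof.
move=> k1; have h1 : tends (nbhs (X, k)) (fun v : C * R => v.1) X by exact: cvg_fst.
have h2 : tends (nbhs (X, k)) (fun v : C * R => v.2) k by exact: cvg_snd.
have k1' : 1 - k != 0 by rewrite gt_eqF// subr_gt0.
have [X0|X0] := eqVneq X 0; last first.
  have X1 : cabs X != 0 by rewrite cabs_eq0.
  rewrite /pullC /pull; tendsto; [exact: k1'|exact: X1].
have E : pullC X k = 0 by rewrite X0 /pullC mulr0.
suff : tends (nbhs (X, k)) (fun v : C * R => pullC v.1 v.2) 0 by rewrite -E.
apply: (@cvgC_norm0 _ _ (nbhs (X, k)) _ _ (fun v => cabs v.1)); last first.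
  have h := tends_cabs h1; have e : cabs X = 0 by rewrite X0 cabs0.
  by rewrite e in h; exact: h.
apply: (@filterE _ (nbhs (X, k))) => -[Y l] /=; rewrite subr0.
have [->|Y0] := eqVneq Y 0; first by rewrite /pullC mulr0.
have Y1 : 0 < cabs Y by rewrite cabs_gt0.
rewrite /pullC cabsM cabs_real normrM normfV ger0_norm ?pull_ge0 ?cabs_ge0//.
by rewrite gtr0_norm// divfK ?gt_eqF// pull_le.
Qed.
Lemma flow_continuous j s z : rhoA z / (d * r) < 1 ->
  tends (nbhs (s, z)) (fun sz : R * (C * C) => flow j sz.1 sz.2) (flow j s z).
Proof.
move=> k1; have h0 : tends (nbhs (s, z)) (fun sz : R * (C * C) => sz.1) s by exact: cvg_fst.
have hz : tends (nbhs (s, z)) (fun sz : R * (C * C) => sz.2) z by exact: cvg_snd.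
have h1 := tends_fst hz; have h2 := tends_snd hz.
have hr : tends (nbhs (s, z)) (fun sz : R * (C * C) => rhoA sz.2) (rhoA z).
  by apply: tends_comp hz _; exact: rhoA_continuous.
have hk : tends (nbhs (s, z)) (fun sz : R * (C * C) => rhoA sz.2 / (d * r)) (rhoA z / (d * r)) by tendsto.
have hx : tends (nbhs (s, z)) (fun sz : R * (C * C) => shrink sz.1 (rhoA sz.2 / (d * r)) sz.2.1)
    (shrink s (rhoA z / (d * r)) z.1).
  rewrite /shrink; have hS : tends (nbhs (s, z))
      (fun sz : R * (C * C) => \sum_(p <- P) pullC (sz.2.1 - p) (rhoA sz.2 / (d * r)))
      (\sum_(p <- P) pullC (z.1 - p) (rhoA z / (d * r))).
    apply: tends_sum => p; have hp : tends (nbhs (s, z)) (fun sz : R * (C * C) => sz.2.1 - p) (z.1 - p) by tendsto.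
    exact: (tends_comp (tends_pair hp hk) (pullC_continuous k1)).
  by tendsto.
have hf (x : R * (C * C) -> C) a : tends (nbhs (s, z)) x a -> tends (nbhs (s, z)) (fun sz => f j (x sz)) (f j a).
  by move=> xa; apply: tends_comp xa _; exact: cf.
have h3 := hf _ _ hx; have h4 := hf _ _ h1.
by rewrite /flow /=; tendsto.
Qed.
(** Near [z] only branches tied at [z] are used, and by [flowAE] their flows share one value
    there. *)
Lemma flowA_continuous s z : OmA z -> 0 <= s -> s * rhoA z < e0 ->
  {for (s, z), continuous (fun sz : R * (C * C) => flowA sz.1 sz.2)}.
Proof.
move=> Oz s0 sr W Wz; have [x1 re] := Oz.
have k1 : rhoA z / (d * r) < 1.
  by rewrite ltr_pdivrMr// mul1r; apply: lt_le_trans re _; move: e0r e00; lra.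
have H : \forall sz \near (s, z), forall j, cabs (z.2 - f j z.1) = rhoA z -> W (flow j sz.1 sz.2).
  apply: (@filter_forall _ J (fun j (sz : R * (C * C)) => cabs (z.2 - f j z.1) = rhoA z -> W (flow j sz.1 sz.2)) (nbhs (s, z))) => j.
  have [h|h] := pselect (cabs (z.2 - f j z.1) = rhoA z); last first.
    by apply: (@filterE _ (nbhs (s, z))) => sz /h.
  have Wj : nbhs (flow j s z) W by rewrite -flowAE.
  by apply: (@filterS _ (nbhs (s, z))) (@flow_continuous j s z k1 _ Wj).
have H2 : \forall sz \near (s, z), cabs (z.2 - f (near_br sz.2) z.1) = rhoA z.
  have c : tends (nbhs (s, z)) (fun sz : R * (C * C) => sz.2) z by exact: cvg_snd.
  exact: (c _ (near_brP z)).
by apply: (@filterS2 _ (nbhs (s, z))) H H2 => sz h1 h2; exact: h1.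
Qed.
Lemma OmA_open : open OmA.
Proof.
have -> : OmA = [set z : C * C | 0 < 1 - cabs z.1] `&` [set z : C * C | 0 < e0 - rhoA z].
  by apply/seteqP; split => z /=; rewrite !subr_gt0.
apply: openI.
  apply: open_fun_gt0 => z.
  have h1 : tends (nbhs z) (fun w : C * C => w.1) z.1 by exact: cvg_fst.
  by tendsto.
apply: open_fun_gt0 => z; have h1 : tends (nbhs z) rhoA (rhoA z) by exact: rhoA_continuous.
by tendsto.
Qed.
(** The branch near [p], continued from the circle of radius [r] to a homogeneous function on the
    whole plane; at [X = 0] the first factor vanishes. *)
Definition hext j p (X : C) : C := (cabs X / r)%:C * (f j (p + (r / cabs X)%:C * X) - f j p).
Lemma hext_in j p X : p \in P -> cabs X <= r -> hext j p X = f j (p + X) - f j p.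
Proof.
move=> pP Xr; have [->|X0] := eqVneq X 0; first by rewrite /hext cabs0 mul0r mul0r addr0 subrr.
have X1 : 0 < cabs X by rewrite cabs_gt0.
set Y := (r / cabs X)%:C * X.
have E : X = (cabs X / r)%:C * Y.
  by rewrite mulrA -rmorphM /= mulrA divfK ?gt_eqF// divff ?gt_eqF// rmorph1 mul1r.
have Yr : cabs Y = r by rewrite cabsM cabs_real ger0_norm ?divr_ge0 ?ltW// divfK// gt_eqF.
have s0 : 0 <= cabs X / r by rewrite divr_ge0 ?ltW.
have sr : cabs X / r * cabs Y <= r by rewrite Yr divfK ?gt_eqF.
have -> : f j (p + X) = f j p + (cabs X / r)%:C * (f j (p + Y) - f j p) 
  by rewrite {1}E; apply: P2 => //; rewrite Yr.
by rewrite addrC addKr.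
Qed.
Lemma hextZ j p l X : 0 < l -> hext j p (l%:C * X) = l%:C * hext j p X.
Proof.
move=> l0; rewrite /hext cabsM cabs_real gtr0_norm// -mulrA rmorphM -mulrA; congr (_ * (_ * (f j _ - _))).
congr (_ + _); rewrite mulrA -rmorphM /=; have [->|X0] := eqVneq X 0; first by rewrite !mulr0.
congr (_%:C * _); rewrite invfM mulrA mulrAC divfK// gt_eqF//.
Qed.
Lemma hext_continuous j p : p \in P -> continuous (hext j p).
Proof.
move=> pP X; have [X0|X0] := eqVneq X 0; last first.
  have X1 : cabs X != 0 by rewrite cabs_eq0.
  have r1 : r != 0 by rewrite gt_eqF.
  have h : tends (nbhs X) (fun X => p + (r / cabs X)%:C * X) (p + (r / cabs X)%:C * X).
    by tendsto; exact: X1.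
  have h2 := tends_comp h (@cf j _).
  by rewrite /hext; tendsto; exact: h2.
rewrite X0; have E : hext j p 0 = f j (p + 0) - f j p by rewrite hext_in// cabs0 ltW.
suff : tends (nbhs (0 : C)) (hext j p) (f j (p + 0) - f j p) by rewrite -E.
apply: (@tends_near _ (nbhs (0 : C)) _ _ (fun X => f j (p + X) - f j p)).
  by apply/nbhsC; exists r => // w; rewrite subr0 => /ltW; exact: hext_in.
have h : tends (nbhs (0 : C)) (fun X => p + X) (p + 0) by tendsto.
have h2 := tends_comp h (@cf j _).
by tendsto.
Qed.
Lemma half_spaceA_simple z j : OmA z -> 0 < rhoA z -> (nbhs z) [set w | near_br w = j] ->
  exists U W (g : C * C -> 'rV[R]_4) h, [/\ ohomeo U W g h, U z &
    forall q, U q -> (rhoA q <= rhoA z <-> 0 <= g q ord0 ord0)].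
Proof.
move=> Oz rz nj.
pose phi (w : C * C) : C * C := (w.2 - f j w.1, w.1).
pose psi (w : C * C) : C * C := (w.2, f j w.2 + w.1).
have h : ohomeo setT setT phi psi.
  split; [exact: openT|exact: openT| |] => w _; (split; [exact: I| |]).
  - by rewrite /psi /phi /= [f _ _ + _]addrC subrK; case: w.
  - have h1 : tends (nbhs w) (fun w : C * C => w.1) w.1 by exact: cvg_fst.
    have h2 : tends (nbhs w) (fun w : C * C => w.2) w.2 by exact: cvg_snd.
    have h3 := tends_comp h1 (@cf j _).
    by rewrite /phi; tendsto.
  - by rewrite /psi /phi /= addrC addKr; case: w.
  - have h1 : tends (nbhs w) (fun w : C * C => w.1) w.1 by exact: cvg_fst.
    have h2 : tends (nbhs w) (fun w : C * C => w.2) w.2 by exact: cvg_snd.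
    have h3 := tends_comp h2 (@cf j _).
    by rewrite /psi; tendsto.
have h' := ohomeo_sub h (@open_interior _ [set w | near_br w = j]) (@subsetT _ _).
have rE w : near_br w = j -> rhoA w = cabs (phi w).1 by rewrite /rhoA /dist_br -/near_br => ->.
have zj : near_br z = j := nbhs_singleton nj.
apply: (half_space_gauge h' nj (N := fun aw => cabs aw.1)).
- by rewrite -cabs_eq0 -rE// gt_eqF.
- move=> w; have h1 : tends (nbhs w) (fun w : C * C => w.1) w.1 by exact: cvg_fst.
  by tendsto.
- by move=> l a w l0; rewrite /= cabsM cabs_real gtr0_norm.
- by rewrite -rE.
- by move=> q /interior_subset qj; rewrite !rE.
Qed.
(** Near a crossing the distance is homogeneous in [(X, Y)] jointly. In the blow-up coordinates
    [(X, Y / X)] or [(Y, X / Y)] it is homogeneous in the first one alone; off the crossing one of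
    the two is available. *)
Lemma half_spaceA_core z j p (U : set (C * C)) (F : J -> C -> C) : open U -> U z ->
  (forall k, continuous (F k)) -> (forall k l X, 0 < l -> F k (l%:C * X) = l%:C * F k X) ->
  0 < rhoA z -> (forall w, U w -> rhoA w = dist_br j0 F (w.1 - p, w.2 - f j p)) ->
  exists U W (g : C * C -> 'rV[R]_4) h, [/\ ohomeo U W g h, U z &
    forall q, U q -> (rhoA q <= rhoA z <-> 0 <= g q ord0 ord0)].
Proof.
move=> oU Uz cF FZ rz rE; have cN := @dist_br_continuous _ _ j0 F cF.
have NZ l X Y : 0 < l -> dist_br j0 F (l%:C * X, l%:C * Y) = l * dist_br j0 F (X, Y).
  move=> l0; set k := nearest j0 F (X, Y).
  have E i : cabs (l%:C * Y - F i (l%:C * X)) = l * cabs (Y - F i X).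
    by rewrite FZ// -mulrBr cabsM cabs_real gtr0_norm.
  rewrite (@dist_br_eq _ _ j0 F _ k) /= ?E// => i; rewrite !E ler_pM2l//.
  exact: (dist_br_le j0 F (X, Y) i).
have F0 k : F k 0 = 0.
  have l0 : 0 < 1 + 1 :> R by lra.
  have := FZ k _ 0 l0; rewrite mulr0 rmorphD rmorph1 mulrDl mul1r => h.
  by apply: (@addrI _ (F k 0)); rewrite addr0 -h.
have [Y0|Y0] := eqVneq (z.2 - f j p) 0.
  have X0 : z.1 - p != 0.
    apply/negP => /eqP X0; move: rz; rewrite (rE _ Uz) X0 Y0 /dist_br /= F0 subrr cabs0 ltxx//.
  pose phi (w : C * C) : C * C := (w.1 - p, (w.2 - f j p) / (w.1 - p)).
  pose psi (a : C * C) : C * C := (p + a.1, f j p + a.1 * a.2).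
  have h : ohomeo [set w : C * C | 0 < cabs (w.1 - p)] [set a : C * C | 0 < cabs a.1] phi psi.
    split.
    - apply: open_fun_gt0 => w; have h1 : tends (nbhs w) (fun w : C * C => w.1) w.1 by exact: cvg_fst.
      by tendsto.
    - apply: open_fun_gt0 => w; have h1 : tends (nbhs w) (fun w : C * C => w.1) w.1 by exact: cvg_fst.
      by tendsto.
    - move=> w /=; rewrite cabs_gt0 => w0; (split; [by move: w0; rewrite -cabs_gt0| |]).
        by rewrite /psi /phi /= mulrC divfK// [_ + (w.1 - p)]addrC [_ + (w.2 - _)]addrC !subrK; case: (w).
      have h1 : tends (nbhs w) (fun w : C * C => w.1) w.1 by exact: cvg_fst.
      have h2 : tends (nbhs w) (fun w : C * C => w.2) w.2 by exact: cvg_snd.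
      by rewrite /phi; tendsto; exact: w0.
    - move=> a /=; rewrite cabs_gt0 => a0; rewrite /psi /phi /= !(addrC _ (a.1)) !(addrC _ (a.1 * _)) !addrK; split; rewrite ?cabs_gt0//.
        by rewrite mulrAC divff// mul1r; case: (a).
      have h1 : tends (nbhs a) (fun w : C * C => w.1) a.1 by exact: cvg_fst.
      have h2 : tends (nbhs a) (fun w : C * C => w.2) a.2 by exact: cvg_snd.
      by rewrite /psi; tendsto.
  have h' := ohomeo_sub h (openI oU (let: And4 o _ _ _ := h in o)) (@subIsetr _ _ _).
  have pE w : 0 < cabs (w.1 - p) -> dist_br j0 F ((phi w).1, (phi w).1 * (phi w).2) = dist_br j0 F (w.1 - p, w.2 - f j p).
    by rewrite cabs_gt0 => w0; rewrite /phi /= mulrC divfK.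
  apply: (half_space_gauge h' (N := fun a => dist_br j0 F (a.1, a.1 * a.2))) => //.
  - by split => //=; rewrite cabs_gt0.
  - move=> a; apply: (tends_comp (a := (a.1, a.1 * a.2)) _ (cN _)).
    have h1 : tends (nbhs a) (fun w : C * C => w.1) a.1 by exact: cvg_fst.
    have h2 : tends (nbhs a) (fun w : C * C => w.2) a.2 by exact: cvg_snd.
    by tendsto.
  - by move=> l a w l0; rewrite /= -mulrA NZ.
  - by have z0 : 0 < cabs (z.1 - p) by [rewrite cabs_gt0]; rewrite /= pE// -(rE z Uz).
  - by move=> q [Uq q0]; have z0 : 0 < cabs (z.1 - p) by [rewrite cabs_gt0]; rewrite /= !pE// -(rE q Uq) -(rE z Uz).
pose phi (w : C * C) : C * C := (w.2 - f j p, (w.1 - p) / (w.2 - f j p)).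
pose psi (a : C * C) : C * C := (p + a.1 * a.2, f j p + a.1).
have h : ohomeo [set w : C * C | 0 < cabs (w.2 - f j p)] [set a : C * C | 0 < cabs a.1] phi psi.
  split.
  - apply: open_fun_gt0 => w; have h2 : tends (nbhs w) (fun w : C * C => w.2) w.2 by exact: cvg_snd.
    by tendsto.
  - apply: open_fun_gt0 => w; have h1 : tends (nbhs w) (fun w : C * C => w.1) w.1 by exact: cvg_fst.
    by tendsto.
  - move=> w /=; rewrite cabs_gt0 => w0; (split; [by move: w0; rewrite -cabs_gt0| |]).
      by rewrite /psi /phi /= mulrC divfK// [_ + (w.1 - p)]addrC [_ + (w.2 - _)]addrC !subrK; case: (w).
    have h1 : tends (nbhs w) (fun w : C * C => w.1) w.1 by exact: cvg_fst.
    have h2 : tends (nbhs w) (fun w : C * C => w.2) w.2 by exact: cvg_snd.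
    by rewrite /phi; tendsto; exact: w0.
  - move=> a /=; rewrite cabs_gt0 => a0; rewrite /psi /phi /= !(addrC _ (a.1)) !(addrC _ (a.1 * _)) !addrK; split; rewrite ?cabs_gt0//.
      by rewrite mulrAC divff// mul1r; case: (a).
    have h1 : tends (nbhs a) (fun w : C * C => w.1) a.1 by exact: cvg_fst.
    have h2 : tends (nbhs a) (fun w : C * C => w.2) a.2 by exact: cvg_snd.
    by rewrite /psi; tendsto.
have h' := ohomeo_sub h (openI oU (let: And4 o _ _ _ := h in o)) (@subIsetr _ _ _).
have pE w : 0 < cabs (w.2 - f j p) -> dist_br j0 F ((phi w).1 * (phi w).2, (phi w).1) = dist_br j0 F (w.1 - p, w.2 - f j p).
  by rewrite cabs_gt0 => w0; rewrite /phi /= mulrC divfK.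
apply: (half_space_gauge h' (N := fun a => dist_br j0 F (a.1 * a.2, a.1))) => //.
- by split => //=; rewrite cabs_gt0.
- move=> a; apply: (tends_comp (a := (a.1 * a.2, a.1)) _ (cN _)).
  have h1 : tends (nbhs a) (fun w : C * C => w.1) a.1 by exact: cvg_fst.
  have h2 : tends (nbhs a) (fun w : C * C => w.2) a.2 by exact: cvg_snd.
  by tendsto.
- by move=> l a w l0; rewrite /= -mulrA NZ.
- by have z0 : 0 < cabs (z.2 - f j p) by [rewrite cabs_gt0]; rewrite /= pE// -(rE z Uz).
- by move=> q [Uq q0]; have z0 : 0 < cabs (z.2 - f j p) by [rewrite cabs_gt0]; rewrite /= !pE// -(rE q Uq) -(rE z Uz).
Qed.
Lemma half_spaceA z : OmA z -> 0 < rhoA z ->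
  exists U W (g : C * C -> 'rV[R]_4) h, [/\ ohomeo U W g h, U z &
    forall q, U q -> (rhoA q <= rhoA z <-> 0 <= g q ord0 ord0)].
Proof.
move=> Oz rz; set j := near_br z; have hj : cabs (z.2 - f j z.1) = rhoA z by [].
have [[k kj hk]|nk] := pselect (exists2 k, j != k & cabs (z.2 - f k z.1) = rhoA z); last first.
  apply: (half_spaceA_simple (j := j)) => //.
  apply: (@filterS _ (nbhs z)) (near_brP z) => w /= hw; apply/eqP/negPn/negP => wj.
  by apply: nk; exists (near_br w); rewrite // eq_sym.
have [p [pP fp xp dx]] := tie_disc Oz kj hj hk.
(* Branches missing the crossing are never the selected nearest ones in [U]; replacing them by [j]
   keeps the index type. *)
pose F k X := if f k p == f j p then hext k p X else hext j p X.
pose U := [set w : C * C | cabs (w.1 - p) < r] `&` [set w | f (near_br w) p = f j p]°.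
apply: (@half_spaceA_core z j p U F _ _ _ _ rz).
- apply: openI; last exact: open_interior.
  rewrite (_ : mkset _ = [set w : C * C | 0 < r - cabs (w.1 - p)]); last first.
    by apply/seteqP; split => w /=; rewrite subr_gt0.
  apply: open_fun_gt0 => w; have h1 : tends (nbhs w) (fun w : C * C => w.1) w.1 by exact: cvg_fst.
  by tendsto.
- split => //.
  apply: (@filterS _ (nbhs z)) (near_brP z) => w /= hw; apply/eqP/negPn/negP; rewrite eq_sym => fw.
  have [_ re] := Oz; have := P4 pP (ltW xp) fw; rewrite [p + _]addrC subrK => h.
  have := cabs_tri (f j z.1) (f (near_br w) z.1) z.2; rewrite hw [X in _ <= X + _]cabsB hj.
  by move: e00; lra.
- by move=> i; rewrite /F; case: eqP => _; exact: hext_continuous.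
- by move=> i l X l0; rewrite /F; case: eqP => _; exact: hextZ.
- move=> w [/= wp /interior_subset/= nw]; set i := near_br w in nw *.
  have FE k' : f k' p = f j p -> cabs (w.2 - f j p - F k' (w.1 - p)) = cabs (w.2 - f k' w.1).
    move=> fk; rewrite /F fk eqxx hext_in// ?(ltW wp)// [p + _]addrC subrK fk; congr cabs; ring.
  rewrite (@dist_br_eq _ _ j0 F _ i) /= FE// => k'.
  have [fk|fk] := eqVneq (f k' p) (f j p); first by rewrite FE//; exact: rhoA_le.
  have -> : F k' (w.1 - p) = F j (w.1 - p) by rewrite /F (negPf fk) eqxx.
  by rewrite FE//; exact: rhoA_le.
Qed.
End AffTube.

(** * Homeomorphisms of neighborhoods *)
Section TubeLemma.
Variable X : topologicalType.
(** A tube lemma with a filter as one factor, to be used for the neighborhoods of a point and then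
    for those of a compact set. *)
Lemma tube_filter (Y : Type) (F : set_system Y) {FF : ProperFilter F} (S : set X) (O : set (Y * X)) : compact S ->
  (forall v, S v -> exists A V, [/\ F A, open V, V v & forall y x, A y -> V x -> O (y, x)]) ->
  exists A V, [/\ F A, open V, S `<=` V & forall y x, A y -> V x -> O (y, x)].
Proof.
move=> cS h; have /compact_near_coveringP cov := cS.
pose P (A : set Y) (v : X) := \forall v' \near v, forall y, A y -> O (y, v').
have : \forall A \near powerset_filter_from F, S `<=` P A.
  apply: cov => v Sv; have [A [V [FA oV Vv AV]]] := h v Sv.
  exists (V, [set A' | F A' /\ A' `<=` A]); first split.
  - exact: open_nbhs_nbhs.
  - exact: powerset_filter_fromP.
  move=> [v' A'] /= [Vv' [_ A'A]]; apply: (@filterS _ (nbhs v')) (open_nbhs_nbhs (conj oV Vv')).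
  by move=> w Vw y /A'A Ay; exact: AV.
move=> /near_powerset_filter_fromP[|A FA SA].
  by move=> A B AB PB v /PB; apply: (@filterS _ (nbhs v)) => w h' y /AB; exact: h'.
exists A, [set v | P A v]°; split => //; first exact: open_interior.
  move=> v /SA; rewrite /P => Pv.
  exact: nbhs_interior.
by move=> y x Ay /interior_subset /nbhs_singleton; exact.
Qed.
Lemma tube_square (S : set X) (O : set (X * X)) : compact S -> S !=set0 -> open O -> S `*` S `<=` O ->
  exists N, [/\ open N, S `<=` N & N `*` N `<=` O].
Proof.
move=> cS S0 oO SO.
have h u : S u -> exists A V, [/\ nbhs u A, open V, S `<=` V & forall y x, A y -> V x -> O (y, x)].
  move=> Su; apply: tube_filter => // v Sv.
  have : nbhs (u, v) O by apply: open_nbhs_nbhs; split => //; exact: SO.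
  move=> [[A V] /= [nA nV] AV].
  exists A, V°; split => //; first exact: open_interior.
  by move=> y x Ay /interior_subset Vx; exact: (AV (y, x)).
have PF := set_nbhs_pfilter S0.
have [A [V [SA oV SV AV]]] : exists A V, [/\ set_nbhs S A, open V, S `<=` V &
    forall y x, A y -> V x -> [set yx | O (yx.2, yx.1)] (y, x)].
  apply: tube_filter => // u Su; have [A [V [nA oV SV AV]]] := h u Su.
  exists V, A°; split => //; first by apply/set_nbhsP; exists V; split.
  - exact: open_interior.
  - by move=> y x Vy /interior_subset Ax; exact: AV.
have /set_nbhsP[B [oB SB BA]] := SA.
exists (V `&` B); split; [exact: openI|by move=> x Sx; split; [exact: SV|exact: SB]|].
by move=> [x y] [/= [Vx _] [_ /BA Ay]]; exact: AV.
Qed.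
(** Injectivity spreads from [S] to a neighborhood: pairs of [S] with equal images are diagonal and
    local injectivity applies, the others have separated images; so [h] is injective on pairs near
    the square of [S]. *)
Lemma local_homeo_nbhd (h : X -> X) (S : set X) : hausdorff_space X -> compact S -> S !=set0 ->
  (forall v, S v -> exists U V g k, [/\ ohomeo U V g k, U v & {in U, h =1 g}]) ->
  (forall u v, S u -> S v -> h u = h v -> u = v) -> nbhd_homeo S (h @` S).
Proof.
move=> hX cS S0 loc inj.
have loc' v : S v -> exists U, [/\ open U, U v, forall W, open W -> W `<=` U -> open (h @` W),
    forall w, U w -> {for w, continuous h} & forall a b, U a -> U b -> h a = h b -> a = b].
  move=> Sv; have [U [V [g [k [og Uv hg]]]]] := loc v Sv; have [oU oV gU kV] := og.
  have hgE w : U w -> h w = g w by move=> Uw; apply: hg; exact: mem_set.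
  exists U; split => //.
  - move=> W oW WU; have -> : h @` W = g @` W by apply: eq_imagel => w /WU; exact: hgE.
    exact: ohomeo_open og oW WU.
  - move=> w Uw; have [_ _ cg] := gU _ Uw.
    rewrite /prop_for /continuous_at hgE//; apply: (@tends_near _ (nbhs w) _ _ g) => //.
    by apply: (@filterS _ (nbhs w)) (open_nbhs_nbhs (conj oU Uw)) => x /hgE.
  - move=> a b Ua Ub; rewrite !hgE// => E; have [_ <- _] := gU _ Ua; have [_ <- _] := gU _ Ub.
    by rewrite E.
pose Wd := \bigcup_(U in [set U | [/\ open U, forall W, open W -> W `<=` U -> open (h @` W),
    forall w, U w -> {for w, continuous h} & forall a b, U a -> U b -> h a = h b -> a = b]]) U.
have oWd : open Wd by apply: bigcup_open => U [].
have SWd : S `<=` Wd by move=> v /loc'[U [oU Uv H1 H2 H3]]; exists U.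
pose O := [set uv : X * X | h uv.1 = h uv.2 -> uv.1 = uv.2]°.
have [N [oN SN NO]] : exists N, [/\ open N, S `<=` N & N `*` N `<=` O].
  apply: tube_square => //; first exact: open_interior.
  move=> [u v] [/= Su Sv]; have [U [oU Uu Ho Hc Hi]] := loc' u Su; have [V [oV Vv Ho' Hc' Hi']] := loc' v Sv.
  have [E|huv] := pselect (h u = h v).
    have uv := inj _ _ Su Sv E; rewrite -uv.
    exists (U, U) => /=; first by split; exact: open_nbhs_nbhs.
    by move=> [x y] /= [Ux Uy]; exact: Hi.
  have [[A B] /= [/set_mem Au /set_mem Bv] [oA oB AB]] : exists2 AB, (h u \in AB.1 /\ h v \in AB.2) & 
      [/\ open AB.1, open AB.2 & AB.1 `&` AB.2 == set0].
    by move: (hX); rewrite open_hausdorff; apply; apply/eqP.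
  have cu := Hc _ Uu A (open_nbhs_nbhs (conj oA Au)).
  have cv := Hc' _ Vv B (open_nbhs_nbhs (conj oB Bv)).
  exists (h @^-1` A, h @^-1` B) => //=.
  move=> [x y] /= [Ax By] E; exfalso.
  have : (A `&` B) (h x) by split => //; rewrite E.
  by move/eqP : AB => ->.
pose M := N `&` Wd; have oM : open M by exact: openI.
have SM : S `<=` M by move=> x Sx; split; [exact: SN|exact: SWd].
have Minj a b : M a -> M b -> h a = h b -> a = b.
  by move=> [Na _] [Nb _]; have /interior_subset := NO (a, b) (conj Na Nb).
have [x0 Sx0] := S0.
pose k y := if pselect (exists2 x, M x & h x = y) is left e then projT1 (cid2 e) else x0.
have kh x : M x -> k (h x) = x.
  move=> Mx; rewrite /k; case: pselect => [e|[]]; last by exists x.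
  by case: cid2 => y /= My; exact: Minj.
have openM W : open W -> W `<=` M -> open (h @` W).
  move=> oW WM; rewrite openE => _ [x Wx <-].
  have [_ [U [oU Ho _ _] Ux]] := WM _ Wx.
  have : open (h @` (W `&` U)) by apply: Ho; [exact: openI|exact: subIsetr].
  rewrite openE => /(_ (h x)) H; apply: (@filterS _ (nbhs (h x))) (H _); last by exists x.
  by move=> _ [y [Wy _] <-]; exists y.
exists M, (h @` M), h, k; split => //; split => //.
- by apply: openM.
- move=> x Mx; split; [by exists x|exact: kh|].
  by have [_ [U [oU _ Hc _] Ux]] := Mx; exact: Hc.
- move=> _ [x Mx <-]; rewrite kh//; split => //.
  move=> A; rewrite kh// => nA; rewrite /= nbhs_simpl /=.
  have o2 : open (h @` (A° `&` M)) by apply: openM; [apply: openI => //; exact: open_interior|exact: subIsetr].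
  apply: (@filterS _ (nbhs (h x))) (open_nbhs_nbhs (conj o2 _)); last by exists x.
  by move=> _ [y [/interior_subset Ay My] <-]; rewrite /= kh.
Qed.
End TubeLemma.

(** * Homeomorphisms of the whole projective plane *)

Section GlobalHomeo.
Variable R : realType.
Notation C := R[i].
Definition bihomeo (f : CP2 R -> CP2 R) := exists k, [/\ continuous f, continuous k, cancel f k & cancel k f].
Lemma bihomeo_nbhd f S : bihomeo f -> nbhd_homeo S (f @` S).
Proof. by move=> [k [cf ck fk kf]]; apply: bicontinuous_nbhd_homeo ck fk kf. Qed.
Lemma bihomeo_comp f g : bihomeo f -> bihomeo g -> bihomeo (g \o f).
Proof.
move=> [k [cf ck fk kf]] [l [cg cl gl lg]]; exists (k \o l); split.
- by move=> x; apply: continuous_comp; [exact: cf|exact: cg].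
- by move=> x; apply: continuous_comp; [exact: cl|exact: ck].
- exact: can_comp.
- exact: can_comp.
Qed.
Lemma bihomeo_inj f : bihomeo f -> injective f.
Proof. by move=> [k [_ _ fk _]]; exact: can_inj fk. Qed.
(** Continuity of the inverse is automatic on a compact Hausdorff space. *)
Lemma hom_map_bihomeo (F G : 'rV[C]_3 -> 'rV[C]_3) : homogeneous F -> homogeneous G ->
  (forall v : 'rV[C]_3, v != 0 -> tends (nbhs v) F (F v)) -> cancel F G -> cancel G F -> bihomeo (hom_map F).
Proof.
move=> hF hG cF FG GF; exists (hom_map G).
have fk : cancel (hom_map F) (hom_map G).
  by move=> p; have [v v0 ->] := projS p; rewrite hom_map_proj// hom_map_proj ?FG//; case: hF => _; apply.
have kf : cancel (hom_map G) (hom_map F).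
  by move=> p; have [v v0 ->] := projS p; rewrite hom_map_proj// hom_map_proj ?GF//; case: hG => _; apply.
have cf := hom_map_continuous hF cF; split => //.
have : {within hom_map F @` setT, continuous (hom_map G)}.
  apply: compact_inverse_continuous => //; [exact: CP2_hausdorff|exact: CP2_compact|].
  exact: continuous_subspaceT.
have -> : hom_map F @` setT = setT by apply/seteqP; split => // x _; exists (hom_map G x).
by rewrite continuous_open_subspace; [move=> h x; apply: h; first [exact: mem_set|exact: I]|exact: openT].
Qed.
Definition affpt (z : C * C) : CP2 R := proj (mkv z.1 z.2 1).
(* Extends Phi by the identity to the line at infinity; this is continuous if Phi z - z is
   bounded. *)
Definition affF (Phi : C * C -> C * C) (v : 'rV[C]_3) : 'rV[C]_3 :=
  let w := v 0 2%:R in let z := (v 0 0 / w, v 0 1 / w) in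
  mkv (v 0 0 + w * ((Phi z).1 - z.1)) (v 0 1 + w * ((Phi z).2 - z.2)) w.
Lemma affFE Phi z w : w != 0 -> affF Phi (w *: mkv z.1 z.2 1) = w *: mkv (Phi z).1 (Phi z).2 1.
Proof.
move=> w0; rewrite /affF mkvZ !mkvE mulr1 mkvZ ![w * _]mulrC !mulfK// -(surjective_pairing z).
by congr mkv; ring.
Qed.
Lemma affF0 Phi (v : 'rV[C]_3) : v 0 2%:R = 0 -> affF Phi v = v.
Proof. by move=> v0; rewrite /affF v0 !mul0r !addr0 -[RHS]mkv_eta v0. Qed.
Lemma affF_cases (v : 'rV[C]_3) : v 0 2%:R = 0 \/ exists w z, w != 0 /\ v = w *: mkv z.1 z.2 1.
Proof.
have [|w0] := eqVneq (v 0 2%:R) 0; [by left|right].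
exists (v 0 2%:R), (v 0 0 / v 0 2%:R, v 0 1 / v 0 2%:R); split => //.
by rewrite mkvZ /= mulr1 ![v 0 2%:R * _]mulrC !divfK// mkv_eta.
Qed.
Lemma affF_hom Phi : homogeneous (affF Phi).
Proof.
split=> [c v c0|v v0].
  have [v0|[w [z [w0 ->]]]] := affF_cases v; first by rewrite !affF0// mxE v0 mulr0.
  by rewrite scalerA !affFE ?mulf_neq0// scalerA.
have [h|[w [z [w0 ->]]]] := affF_cases v; first by rewrite affF0.
by rewrite affFE// scaler_eq0 negb_or w0 mkv_eq0 oner_eq0 !andbF.
Qed.
Lemma affF_can Phi Psi : cancel Phi Psi -> cancel (affF Phi) (affF Psi).
Proof.
move=> h v; have [v0|[w [z [w0 ->]]]] := affF_cases v; first by rewrite !affF0 ?mxE.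
by rewrite affFE// affFE// h.
Qed.
Lemma affF_cont Phi B v : continuous Phi ->
  (forall z, cabs ((Phi z).1 - z.1) <= B /\ cabs ((Phi z).2 - z.2) <= B) -> tends (nbhs v) (affF Phi) (affF Phi v).
Proof.
move=> cP bP.
have h0 : tends (nbhs v) (fun v : 'rV[C]_3 => v 0 0) (v 0 0) := @cvg_coord_id _ v 0.
have h1 : tends (nbhs v) (fun v : 'rV[C]_3 => v 0 1) (v 0 1) := @cvg_coord_id _ v 1.
have h2 : tends (nbhs v) (fun v : 'rV[C]_3 => v 0 2%:R) (v 0 2%:R) := @cvg_coord_id _ v 2%:R.
have [w0|w0] := eqVneq (v 0 2%:R) 0; last first.
  have hz : tends (nbhs v) (fun v : 'rV[C]_3 => (v 0 0 / v 0 2%:R, v 0 1 / v 0 2%:R)) (v 0 0 / v 0 2%:R, v 0 1 / v 0 2%:R).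
    by tendsto; exact: w0.
  have hP := tends_comp hz (cP _).
  have h3 := tends_fst hP; have h4 := tends_snd hP; have h5 := tends_fst hz; have h6 := tends_snd hz.
  by rewrite /affF; apply: (@cvg_mkv _ _ (nbhs v)); tendsto.
have sq (g : C * C -> C) : (forall z, cabs (g z) <= B) ->
    tends (nbhs v) (fun u : 'rV[C]_3 => u 0 2%:R * g (u 0 0 / u 0 2%:R, u 0 1 / u 0 2%:R)) 0.
  move=> gB; apply: (@cvgC_norm0 _ _ (nbhs v) _ _ (fun u : 'rV[C]_3 => cabs (u 0 2%:R) * B)).
    by apply: (@filterE _ (nbhs v)) => u; rewrite subr0 cabsM ler_wpM2l ?cabs_ge0.
  have : tends (nbhs v) (fun u : 'rV[C]_3 => cabs (u 0 2%:R) * B) (cabs (v 0 2%:R) * B) by tendsto.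
  by rewrite w0 cabs0 mul0r.
rewrite affF0// -[X in tends _ _ X]mkv_eta -[v 0 0]addr0 -[v 0 1]addr0; apply: (@cvg_mkv _ _ (nbhs v)).
- have h := sq (fun z => (Phi z).1 - z.1) (fun z => (bP z).1); exact: (tendsCD h0 h).
- have h := sq (fun z => (Phi z).2 - z.2) (fun z => (bP z).2); exact: (tendsCD h1 h).
- exact: h2.
Qed.
Definition affmap Phi := hom_map (affF Phi).
Lemma affpt_neq0 (z : C * C) : mkv z.1 z.2 1 != 0.
Proof. by rewrite mkv_eq0 oner_eq0 !andbF. Qed.
Lemma affmap_affpt Phi z : affmap Phi (affpt z) = affpt (Phi z).
Proof.
rewrite /affmap /affpt hom_map_proj ?affpt_neq0//; last exact: affF_hom.
by have := @affFE Phi z 1 (oner_neq0 _); rewrite !scale1r => ->.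
Qed.
Lemma affmap_inf Phi (v : 'rV[C]_3) : v != 0 -> v 0 2%:R = 0 -> affmap Phi (proj v) = proj v.
Proof. by move=> v0 h; rewrite /affmap hom_map_proj// ?affF0//; exact: affF_hom. Qed.
Lemma affmap_bihomeo Phi Psi B : continuous Phi -> cancel Phi Psi -> cancel Psi Phi ->
  (forall z, cabs ((Phi z).1 - z.1) <= B /\ cabs ((Phi z).2 - z.2) <= B) -> bihomeo (affmap Phi).
Proof.
move=> cP PK KP bP; apply: (@hom_map_bihomeo _ (affF Psi)); [exact: affF_hom|exact: affF_hom| | |].
- by move=> v _; exact: affF_cont cP bP.
- exact: affF_can.
- exact: affF_can.
Qed.
Lemma affpt_inj : injective affpt.
Proof.
move=> z z' /proj_eqP[||c c0]; rewrite ?affpt_neq0// mkvZ => h.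
have c1 : c = 1 by have := congr1 (fun v : 'rV[C]_3 => v 0 2%:R) h; rewrite !mkvE mulr1.
have := congr1 (fun v : 'rV[C]_3 => v 0 0) h; have := congr1 (fun v : 'rV[C]_3 => v 0 1) h.
by rewrite !mkvE c1 !mul1r; case: z {h} => a b; case: z' => a' b' /= -> ->.
Qed.
Definition linmap (M : 'M[C]_3) := hom_map (fun v : 'rV[C]_3 => v *m M).
Lemma linmap_hom (M : 'M[C]_3) : M \in unitmx -> homogeneous (fun v : 'rV[C]_3 => v *m M).
Proof.
move=> uM; split=> [c v _|v v0]; first by rewrite /= scalemxAl.
by apply: contra_neq v0 => /= h; rewrite -[v](mulmxK uM) h mul0mx.
Qed.
Lemma linmap_bihomeo (M : 'M[C]_3) : M \in unitmx -> bihomeo (linmap M).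
Proof.
move=> uM; apply: (@hom_map_bihomeo _ (fun v : 'rV[C]_3 => v *m invmx M)); [exact: linmap_hom|by apply: linmap_hom; rewrite unitmx_inv| | |].
- move=> v _; apply: (@cvg_mx _ _ (nbhs v)) => i j; rewrite ord1.
  have h k : tends (nbhs v) (fun w : 'rV[C]_3 => w 0 k) (v 0 k) := @cvg_coord_id _ v k.
  have H : tends (nbhs v) (fun w : 'rV[C]_3 => \sum_k w 0 k * M k j) (\sum_k v 0 k * M k j).
    by apply: tends_sum => k; have hk := h k; tendsto.
  have -> : (v *m M) 0 j = \sum_k v 0 k * M k j by rewrite mxE.
  by apply: tends_ext H => w; rewrite mxE.
- by move=> v; rewrite /= mulmxK.
- by move=> v; rewrite /= mulmxKV.
Qed.
End GlobalHomeo.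

(** * Charts of the projective plane *)
Section Charts.
Variable R : realType.
Notation C := R[i].
Lemma tends_hcoord (v : 'rV[C]_3) k : tends (nbhs v) (fun v : 'rV[C]_3 => v 0 k) (v 0 k).
Proof. exact: cvg_coord_id. Qed.
Lemma chart_ohomeo (s : C * C -> 'rV[C]_3) (t : 'rV[C]_3 -> C * C) k :
  continuous s -> (forall z, s z 0 k = 1) -> (forall z, t (s z) = z) ->
  (forall v : 'rV[C]_3, v 0 k != 0 -> [/\ v = v 0 k *: s (t v), {for v, continuous t} &
     forall c, c != 0 -> t (c *: v) = t v]) ->
  ohomeo setT [set p : CP2 R | hcoord p 0 k != 0] (fun z => proj (s z)) (fun p => t (hcoord p)).
Proof.
move=> cs s1 ts tP.
have s0 z : s z != 0 by apply/negP => /eqP h; have := s1 z; rewrite h mxE => /eqP; rewrite eq_sym oner_eq0.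
have kE (v : 'rV[C]_3) : v != 0 -> (hcoord (proj v) 0 k != 0) = (v 0 k != 0).
  by move=> v0; have [c c0 ->] := hcoord_proj v0; rewrite mxE mulf_eq0 (negPf c0).
split; first exact: openT.
- rewrite openE => p pk; have [v v0 pE] := projS p; rewrite pE /interior; apply/(nbhs_proj _ v0).
  have vk : v 0 k != 0 by rewrite -kE// -pE.
  have o1 : open [set z : C | z != 0].
    rewrite (_ : mkset _ = [set z | 0 < cabs z]); last by apply/seteqP; split => z /=; rewrite cabs_gt0.
    by apply: open_fun_gt0 => z; tendsto.
  have h1 := @tends_hcoord v k _ (open_nbhs_nbhs (conj o1 vk)).
  by apply: (@filterS2 _ (nbhs v)) h1 (nbhs_neq0 v0) => w /= wk w0; rewrite kE.
- move=> z _; split.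
  + by rewrite /= kE// s1 oner_neq0.
  + have [c c0 ->] := hcoord_proj (s0 z); have [|_ _ ->//] := tP (s z); first by rewrite s1 oner_neq0.
  + by move=> W Wz; exact: (cs z _ (@cvg_proj _ _ (s0 z) W Wz)).
- move=> p /= pk; have [E ct tZ] := tP _ pk; split => //.
  + by rewrite -[RHS]proj_hcoord [in RHS]E projZ.
  + have [v v0 pE] := projS p; have vk : v 0 k != 0 by rewrite -kE// -pE.
    have [_ ct' tZ'] := tP _ vk; rewrite pE.
    apply: (continuous_at_proj v0).
    have -> : t (hcoord (proj v)) = t v by have [c c0 ->] := hcoord_proj v0; rewrite tZ'.
    apply: (@tends_near _ (nbhs v) _ _ t); last exact: ct'.
    have o1 : open [set z : C | z != 0].
      rewrite (_ : mkset _ = [set z | 0 < cabs z]); last by apply/seteqP; split => z /=; rewrite cabs_gt0.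
      by apply: open_fun_gt0 => z; tendsto.
    have h1 := @tends_hcoord v k _ (open_nbhs_nbhs (conj o1 vk)).
    apply: (@filterS2 _ (nbhs v)) h1 (nbhs_neq0 v0) => w /= wk w0.
    by have [c c0 ->] := hcoord_proj w0; have [_ _ ->] := tP _ wk.
Qed.
Lemma tends_mkv (T : Type) (F : set_system T) {FF : Filter F} (f g h : T -> C) x y w :
  tends F f x -> tends F g y -> tends F h w -> tends F (fun t => mkv (f t) (g t) (h t)) (mkv x y w).
Proof. exact: cvg_mkv. Qed.
Lemma affpt_ohomeo : ohomeo setT [set p : CP2 R | hcoord p 0 2%:R != 0] (@affpt R)
  (fun p => (hcoord p 0 0 / hcoord p 0 2%:R, hcoord p 0 1 / hcoord p 0 2%:R)).
Proof.
apply: (@chart_ohomeo (fun z => mkv z.1 z.2 1) (fun v : 'rV[C]_3 => (v 0 0 / v 0 2%:R, v 0 1 / v 0 2%:R)) 2%:R).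
- move=> z; have h1 : tends (nbhs z) (fun z : C * C => z.1) z.1 by exact: cvg_fst.
  have h2 : tends (nbhs z) (fun z : C * C => z.2) z.2 by exact: cvg_snd.
  by apply: tends_mkv; tendsto.
- by move=> z; rewrite mkvE.
- by case=> x y; rewrite !mkvE !divr1.
- move=> v v0; split.
  + by rewrite mkvZ /= mulr1 ![v 0 2%:R * _]mulrC !divfK// mkv_eta.
  + have h0 := @tends_hcoord v 0; have h1 := @tends_hcoord v 1; have h2 := @tends_hcoord v 2%:R.
    by tendsto; exact: v0.
  + by move=> c c0; rewrite !mxE -!mulf_div divff// !mul1r.
Qed.
Definition affptx (z : C * C) : CP2 R := proj (mkv 1 z.1 z.2).
Definition affpty (z : C * C) : CP2 R := proj (mkv z.1 1 z.2).
Lemma affptx_ohomeo : ohomeo setT [set p : CP2 R | hcoord p 0 0 != 0] affptx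
  (fun p => (hcoord p 0 1 / hcoord p 0 0, hcoord p 0 2%:R / hcoord p 0 0)).
Proof.
apply: (@chart_ohomeo (fun z => mkv 1 z.1 z.2) (fun v : 'rV[C]_3 => (v 0 1 / v 0 0, v 0 2%:R / v 0 0)) 0).
- move=> z; have h1 : tends (nbhs z) (fun z : C * C => z.1) z.1 by exact: cvg_fst.
  have h2 : tends (nbhs z) (fun z : C * C => z.2) z.2 by exact: cvg_snd.
  by apply: tends_mkv; tendsto.
- by move=> z; rewrite mkvE.
- by case=> x y; rewrite !mkvE !divr1.
- move=> v v0; split.
  + by rewrite mkvZ /= mulr1 ![v 0 0 * _]mulrC !divfK// mkv_eta.
  + have h0 := @tends_hcoord v 0; have h1 := @tends_hcoord v 1; have h2 := @tends_hcoord v 2%:R.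
    by tendsto; exact: v0.
  + by move=> c c0; rewrite !mxE -!mulf_div divff// !mul1r.
Qed.
Lemma affpty_ohomeo : ohomeo setT [set p : CP2 R | hcoord p 0 1 != 0] affpty
  (fun p => (hcoord p 0 0 / hcoord p 0 1, hcoord p 0 2%:R / hcoord p 0 1)).
Proof.
apply: (@chart_ohomeo (fun z => mkv z.1 1 z.2) (fun v : 'rV[C]_3 => (v 0 0 / v 0 1, v 0 2%:R / v 0 1)) 1).
- move=> z; have h1 : tends (nbhs z) (fun z : C * C => z.1) z.1 by exact: cvg_fst.
  have h2 : tends (nbhs z) (fun z : C * C => z.2) z.2 by exact: cvg_snd.
  by apply: tends_mkv; tendsto.
- by move=> z; rewrite mkvE.
- by case=> x y; rewrite !mkvE !divr1.
- move=> v v0; split.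
  + by rewrite mkvZ /= mulr1 ![v 0 1 * _]mulrC !divfK// mkv_eta.
  + have h0 := @tends_hcoord v 0; have h1 := @tends_hcoord v 1; have h2 := @tends_hcoord v 2%:R.
    by tendsto; exact: v0.
  + by move=> c c0; rewrite !mxE -!mulf_div divff// !mul1r.
Qed.
(* The curve is tangent to the line at infinity, so a vertical coordinate rescaled by x^-4
   does not extend to a chart there. It is interpolated to one along the weighted scalings
   (c x, c^2 y), which preserve the conic. *)
Definition weighted_twist (m : C -> C) (z : C * C) : C * C :=
  let c := m (z.2 / z.1 ^+ 2) in (c * z.1, c ^+ 2 * z.2).
Lemma weighted_twistK (m m' : C -> C) : (forall k, m k != 0) -> (forall k, m' k * m k = 1) -> cancel (weighted_twist m) (weighted_twist m').
Proof.
move=> m0 mm [x y]; rewrite /weighted_twist /=; have -> : m (y / x ^+ 2) ^+ 2 * y / (m (y / x ^+ 2) * x) ^+ 2 = y / x ^+ 2.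
  set k := m _; have k0 : k != 0 by exact: m0.
  by rewrite exprMn -mulf_div divff ?expf_neq0// mul1r.
congr pair; first by rewrite mulrA mm mul1r.
by rewrite mulrA -exprMn mm expr1n mul1r.
Qed.
(** The delicate points have [x = 0]. Off the origin the ratio [y / x^2] is large nearby, where [m]
    is one; at the origin boundedness of [m] suffices. *)
Lemma weighted_twist_continuous (m : C -> C) B : continuous m -> m 0 = 1 -> (forall k, 1 / 2 <= cabs k -> m k = 1) ->
  (forall k, cabs (m k) <= B) -> continuous (weighted_twist m).
Proof.
move=> cm m0 m1 mB z; have h1 : tends (nbhs z) (fun z : C * C => z.1) z.1 by exact: cvg_fst.
have h2 : tends (nbhs z) (fun z : C * C => z.2) z.2 by exact: cvg_snd.
have [z0|z0] := eqVneq z.1 0; last first.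
  have z02 : z.1 * z.1 != 0 by rewrite mulf_neq0.
  have hk : tends (nbhs z) (fun z : C * C => z.2 / (z.1 * z.1)) (z.2 / (z.1 * z.1)) by tendsto; exact: z02.
  have hm := tends_comp hk (cm _).
  by rewrite /weighted_twist; tendsto.
have [y0|y0] := eqVneq z.2 0; last first.
  (* On the axis [x = 0] the ratio is 0 by the convention for division, and [m 0 = 1]. *)
  have E : weighted_twist m z = z by rewrite /weighted_twist z0 expr0n /= invr0 !mulr0 m0 expr1n mul1r -{1}z0; case: (z).
  apply: (@tends_near _ (nbhs z) _ _ id); last by rewrite E; exact: tends_id.
  have c : {for z, continuous (fun z : C * C => cabs z.2 - cabs z.1 * cabs z.1 / 2)} by tendsto.
  have o : nbhs z ((fun z : C * C => cabs z.2 - cabs z.1 * cabs z.1 / 2) @^-1` [set x | 0 < x]).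
    apply: c; apply: open_nbhs_nbhs; split; first exact: open_gt.
    by rewrite /= z0 cabs0 !mul0r subr0 cabs_gt0.
  apply: (@filterS _ (nbhs z)) o => -[x y] /=; rewrite subr_gt0 => xy.
  have [->|x0] := eqVneq x 0; first by rewrite /weighted_twist /= expr0n /= invr0 !mulr0 m0 expr1n mul1r.
  rewrite /weighted_twist /= m1 ?mul1r ?expr1n ?mul1r//.
  rewrite cabsM cabsV cabsX ler_pdivlMr ?exprn_gt0 ?cabs_gt0//.
  by move: xy; rewrite expr2; lra.
have B0 : 0 <= B by apply: le_trans (mB 0); exact: cabs_ge0.
have E : weighted_twist m z = (0, 0) by rewrite /weighted_twist z0 y0 !mulr0.
suff : tends (nbhs z) (weighted_twist m) (0, 0) by rewrite -E.
apply: (@tends_pair _ (nbhs z)).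
- apply: (@cvgC_norm0 _ _ (nbhs z) _ _ (fun z => B * cabs z.1)).
    by apply: (@filterE _ (nbhs z)) => w; rewrite subr0 cabsM ler_wpM2r ?cabs_ge0.
  have : tends (nbhs z) (fun z : C * C => B * cabs z.1) (B * cabs z.1) by tendsto.
  by rewrite z0 cabs0 mulr0.
- apply: (@cvgC_norm0 _ _ (nbhs z) _ _ (fun z => B ^+ 2 * cabs z.2)).
    by apply: (@filterE _ (nbhs z)) => w; rewrite subr0 cabsM cabsX ler_wpM2r ?cabs_ge0// lerXn2r// ?nnegrE ?cabs_ge0.
  have : tends (nbhs z) (fun z : C * C => B ^+ 2 * cabs z.2) (B ^+ 2 * cabs z.2) by tendsto.
  by rewrite y0 cabs0 mulr0.
Qed.
(** Equal to [1 + k] for small [k] and to 1 for large [k], and within 1/4 of 1 throughout, hence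
    invertible. *)
Definition cq (k : C) : C := 1 + (Num.max 0 (Num.min 1 (2 - 4 * cabs k)))%:C * k.
Lemma cq_bound k : cabs (cq k - 1) <= 1 / 4.
Proof.
rewrite /cq addrC addKr cabsM cabs_real ger0_norm; last by rewrite le_max lexx.
set t := cabs k; have t0 : 0 <= t by exact: cabs_ge0.
have [h1|h1] := lerP 1 (2 - 4 * t); first by rewrite max_r// mul1r; lra.
have [h2|h2] := lerP 0 (2 - 4 * t); last by rewrite mul0r; lra.
by have := sqr_ge0 (2 * t - 1 / 2); nra.
Qed.
Lemma cq_small k : cabs k <= 1 / 4 -> cq k = 1 + k.
Proof. by move=> k4; rewrite /cq min_l ?max_r// ?mul1r//; lra. Qed.
Lemma cq_big k : 1 / 2 <= cabs k -> cq k = 1.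
Proof. by move=> k2; rewrite /cq max_l ?mul0r ?addr0//; rewrite ge_min; apply/orP; right; lra. Qed.
Lemma cq0 : cq 0 = 1. Proof. by rewrite /cq mulr0 addr0. Qed.
Lemma cq_abs k : 3 / 4 <= cabs (cq k) <= 5 / 4.
Proof.
have h := cq_bound k; have h1 := cabsD (cq k - 1) 1; have h2 := cabsD (cq k) (1 - cq k).
rewrite subrK cabs1 in h1; rewrite [cq k + _]addrC subrK cabs1 cabsB in h2.
by apply/andP; split; lra.
Qed.
Lemma cq_neq0 k : cq k != 0.
Proof. by rewrite -cabs_gt0; have /andP[h _] := cq_abs k; lra. Qed.
Lemma cq_continuous : continuous cq.
Proof. by move=> k; rewrite /cq; tendsto. Qed.
Definition chartQ (z : C * C) : CP2 R := let u := weighted_twist (fun k => (cq k)^-1) z in affpty (u.1, u.2 + u.1 ^+ 2).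
Definition kapQ (p : CP2 R) : C * C :=
  let z := (hcoord p 0 0 / hcoord p 0 1, hcoord p 0 2%:R / hcoord p 0 1) in weighted_twist cq (z.1, z.2 - z.1 ^+ 2).
Lemma chartQ_ohomeo : ohomeo setT [set p : CP2 R | hcoord p 0 1 != 0] chartQ kapQ.
Proof.
have h1 : ohomeo setT setT (weighted_twist (fun k => (cq k)^-1)) (weighted_twist cq).
  split; [exact: openT|exact: openT| |] => z _; (split; [exact: I| |]).
  - apply: weighted_twistK => k; rewrite ?invr_neq0 ?cq_neq0// divff// cq_neq0//.
  - apply: (@weighted_twist_continuous _ (4 / 3)).
    + by move=> k; have h := @cq_continuous k; exact: (@tendsCV _ _ (nbhs k) _ _ _ (cq_neq0 k) h).
    + by rewrite cq0 invr1.
    + by move=> k /cq_big ->; rewrite invr1.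
    + move=> k; rewrite cabsV; have /andP[h _] := cq_abs k.
      have -> : 4 / 3 = (3 / 4)^-1 :> R by rewrite invf_div.
      by rewrite lef_pV2 ?posrE//; move: h; lra.
  - by apply: weighted_twistK => k; rewrite ?cq_neq0// mulVf// cq_neq0.
  - apply: (@weighted_twist_continuous _ (5 / 4)); [exact: cq_continuous|exact: cq0|exact: cq_big|].
    by move=> k; have /andP[] := cq_abs k.
have h2 : ohomeo setT setT (fun u : C * C => (u.1, u.2 + u.1 ^+ 2)) (fun z => (z.1, z.2 - z.1 ^+ 2)).
  split; [exact: openT|exact: openT| |] => z _; (split; [exact: I| |]).
  - by rewrite /= addrK; case: z.
  - have h1' : tends (nbhs z) (fun z : C * C => z.1) z.1 by exact: cvg_fst.
    have h2' : tends (nbhs z) (fun z : C * C => z.2) z.2 by exact: cvg_snd.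
    by tendsto.
  - by rewrite /= subrK; case: z.
  - have h1' : tends (nbhs z) (fun z : C * C => z.1) z.1 by exact: cvg_fst.
    have h2' : tends (nbhs z) (fun z : C * C => z.2) z.2 by exact: cvg_snd.
    by tendsto.
exact: ohomeo_comp (ohomeo_comp h1 h2) affpty_ohomeo.
Qed.
(** With [x = 1 / xi], [y = x^2 + ze / xi^4] and [k = ze / xi^2] one finds [x / y = xi / (1 + k)]
    and [1 / y - (x / y)^2 = ze / (1 + k)^2]: the weighted scaling of [(xi, ze)] by
    [1 / (1 + k)]. *)
Lemma chartQE xi ze : xi != 0 -> cabs ze <= cabs xi ^+ 2 / 4 ->
  chartQ (xi, ze) = affpt (xi^-1, xi^-1 ^+ 2 + ze / xi ^+ 4).
Proof.
move=> x0 zx; rewrite /chartQ /weighted_twist /=.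
have kE : cq (ze / xi ^+ 2) = 1 + ze / xi ^+ 2.
  apply: cq_small; rewrite cabsM cabsV cabsX ler_pdivrMr ?exprn_gt0 ?cabs_gt0//; lra.
have k0 := cq_neq0 (ze / xi ^+ 2); set c := cq _ in kE k0 *.
have cx : c * xi ^+ 2 = xi ^+ 2 + ze by rewrite kE mulrDl mul1r divfK ?expf_neq0.
have E : c^-1 ^+ 2 * ze + (c^-1 * xi) ^+ 2 = c^-1 * xi ^+ 2.
  have -> : ze = c * xi ^+ 2 - xi ^+ 2 by rewrite cx addrC addKr.
  by field.
have E2 : xi^-1 ^+ 2 + ze / xi ^+ 4 = c / xi ^+ 2.
  have -> : ze = c * xi ^+ 2 - xi ^+ 2 by rewrite cx addrC addKr.
  by field.
rewrite E E2 /affpty /affpt /=; apply/proj_eqP; rewrite ?mkv_eq0 ?oner_eq0 ?andbF//.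
exists (c^-1 * xi ^+ 2); first by rewrite mulf_neq0 ?invr_neq0 ?expf_neq0.
rewrite mkvZ; congr mkv; field; rewrite ?k0 ?x0//.
Qed.
End Charts.
Lemma tendsRX (R : realType) (T : Type) (F : set_system T) {FF : Filter F} (f : T -> R) z m :
  tends F f z -> tends F (fun t => f t ^+ m) (z ^+ m).
Proof.
move=> h; elim: m => [|m IH]; first by rewrite expr0; apply: tends_cst.
rewrite exprS; by apply: tends_ext (tendsRM h IH) => t; rewrite exprS.
Qed.

(** * Tubes of the model curve *)
Section Model.
Variables (R : realType) (n : nat).
Notation C := R[i].
Notation J := (option 'I_n).
Variables (a b : 'I_n -> C) (P : seq C).
Definition br (j : J) (x : C) : C := if j is Some i then a i * x + b i else x ^+ 2.
Variables (r d g B e0 : R).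
(* Added to X^2, gives (r / |X|) X^2 in the disc of radius r, which is homogeneous under
   positive scaling. *)
Definition cone (X : C) : C := (Num.max 1 (r / cabs X) - 1)%:C * X ^+ 2.
Definition brM (j : J) (x : C) : C := if j is Some i then a i * x + b i else x ^+ 2 + \sum_(p <- P) cone (x - p).
Hypothesis uP : uniq P.
Hypothesis N1 : forall i k, i != k -> exists2 p, p \in P & a i * p + b i = a k * p + b k.
Hypothesis N2 : forall i, exists p q, [/\ p \in P, q \in P, a i = p + q & b i = - (p * q)].
(** With discs of radius at most 1/8 all modifications happen over [|x| <= 1/4], away from the
    overlap [1/2 < |x| < 1] with the charts at infinity. *)
Hypothesis N3 : forall p, p \in P -> cabs p <= 1 / 8.
Hypotheses (r0 : 0 < r) (r8 : r <= 1 / 8) (d0 : 0 < d) (dr : 3 * d <= r).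
Hypothesis P1 : forall p q, p \in P -> q \in P -> p != q -> 2 * r <= cabs (p - q).
Hypothesis da : forall i k, i != k -> 3 * d <= cabs (a i - a k).
Hypotheses (B1 : 1 <= B) (aB : forall i, cabs (a i) + cabs (b i) <= B) (gB : 4 * B * r <= g).
Hypothesis gP : forall p j k, p \in P -> br j p != br k p -> g <= cabs (br j p - br k p).
Hypotheses (e00 : 0 < e0) (e0g : 6 * e0 <= g) (e0r2 : 3 * e0 <= r ^+ 2) (e0dr : 2 * e0 <= d * r).
Hypothesis e0B : 4096 * B ^+ 2 * e0 <= 1.
Implicit Types (i k : 'I_n) (j l : J) (x y p X : C).
Lemma coneE X : cabs X <= r -> X ^+ 2 + cone X = (r / cabs X)%:C * X ^+ 2.
Proof.
move=> Xr; have [->|X0] := eqVneq X 0; first by rewrite /cone expr0n /= !mulr0 addr0.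
have X1 : 0 < cabs X by rewrite cabs_gt0.
rewrite /cone max_r; last by rewrite ler_pdivlMr// mul1r.
by rewrite rmorphB rmorph1 mulrBl mul1r addrC subrK.
Qed.
Lemma cone_out X : r <= cabs X -> cone X = 0.
Proof.
move=> Xr; have X1 : 0 < cabs X by apply: lt_le_trans Xr.
by rewrite /cone max_l ?subrr ?mul0r// ler_pdivrMr// mul1r.
Qed.
Lemma cone_continuous : continuous cone.
Proof.
move=> X; have [X0|X0] := eqVneq X 0; last first.
  by have X1 : cabs X != 0 by [rewrite cabs_eq0]; rewrite /cone; tendsto; exact: X1.
have E : cone X = 0 by rewrite /cone X0 expr0n /= mulr0.
suff : tends (nbhs X) cone 0 by rewrite -E.
apply: (@cvgC_norm0 _ _ (nbhs X) _ _ (fun X => r * cabs X)); last first.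
  have : tends (nbhs X) (fun X => r * cabs X) (r * cabs X) by tendsto.
  by rewrite {2}X0 cabs0 mulr0.
apply: (@filterE _ (nbhs X)) => Y; rewrite subr0; have [->|Y0] := eqVneq Y 0.
  by rewrite /cone expr0n /= mulr0 cabs0 mulr0.
have Y1 : 0 < cabs Y by rewrite cabs_gt0.
rewrite /cone cabsM cabs_real cabsX ger0_norm ?subr_ge0 ?le_max ?lexx//.
rewrite expr2 mulrA ler_wpM2r ?cabs_ge0//.
have q0 : 0 <= r / cabs Y by rewrite divr_ge0 ?ltW.
have : Num.max 1 (r / cabs Y) - 1 <= r / cabs Y.
  by have [h|h] := lerP 1 (r / cabs Y); lra.
by move/(ler_wpM2r (ltW Y1)); rewrite divfK// gt_eqF.
Qed.
Lemma brM_continuous j : continuous (brM j).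
Proof.
case: j => [i|] x; rewrite /brM; first by tendsto.
have h : tends (nbhs x) (fun x => \sum_(p <- P) cone (x - p)) (\sum_(p <- P) cone (x - p)).
  apply: tends_sum => p; have h1 : tends (nbhs x) (fun x => x - p) (x - p) by tendsto.
  exact: (tends_comp h1 (@cone_continuous _)).
by tendsto.
Qed.
Lemma brM_out j x : (forall p, p \in P -> r <= cabs (x - p)) -> brM j x = br j x.
Proof.
case: j => //= h; rewrite big_seq big1 ?addr0// => p /h; exact: cone_out.
Qed.
Lemma brM_in p X : p \in P -> cabs X <= r ->
  brM None (p + X) = p ^+ 2 + 2%:R * p * X + (r / cabs X)%:C * X ^+ 2.
Proof.
move=> pP Xr; rewrite /= (bigD1_seq p)//= [p + X - p]addrC addKr big_seq_cond big1 ?addr0.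
  by rewrite -coneE//; ring.
move=> q /andP[qP qp]; apply: cone_out.
rewrite -addrAC; have := P1 pP qP; rewrite eq_sym => /(_ qp) h.
by have := cabsD (p - q + X) (- X); rewrite addrK cabsN; move: h Xr; lra.
Qed.
Lemma brM_at j p : p \in P -> brM j p = br j p.
Proof.
case: j => // pP; have := @brM_in p 0 pP; rewrite cabs0 addr0 => ->; last exact: ltW.
by rewrite expr0n /= !mulr0 !addr0.
Qed.
Lemma out_discs x : 1 / 4 <= cabs x -> forall p, p \in P -> r <= cabs (x - p).
Proof. by move=> x2 p /N3 p8; have := cabsD (x - p) p; rewrite subrK; move: r8; lra. Qed.
Lemma brM_slope j p X : p \in P -> cabs X <= r -> cabs (brM j (p + X) - br j p) <= B * cabs X.
Proof.
move=> pP Xr; case: j => [i|].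
  rewrite [X in cabs X](_ : _ = a i * X) /=; last by ring.
  by rewrite cabsM ler_wpM2r ?cabs_ge0//; apply: le_trans (aB i); rewrite lerDl cabs_ge0.
rewrite brM_in// [X in cabs X](_ : _ = (p + p + (r / cabs X)%:C * X) * X) /=; last by ring.
rewrite cabsM ler_wpM2r ?cabs_ge0//; apply: le_trans B1.
have h : cabs ((r / cabs X)%:C * X) <= r.
  have [->|X0] := eqVneq X 0; first by rewrite mulr0 cabs0 ltW.
  by rewrite cabsM cabs_real ger0_norm ?divr_ge0 ?cabs_ge0 ?(ltW r0)// divfK// cabs_eq0.
have h1 := cabsD (p + p) ((r / cabs X)%:C * X); have h2 := cabsD p p.
by have := N3 pP; move: r8; lra.
Qed.
(** The line is the chord of the parabola over two abscissas; [p] is one of them, [q] the other, and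
    the slope of the chord is [p + q]. *)
Lemma line_root i p : p \in P -> br (Some i) p = p ^+ 2 -> exists2 q, q \in P & 2%:R * p - a i = p - q.
Proof.
move=> pP; have [p1 [q1 [p1P q1P /= -> ->]]] := N2 i => h.
have : (p - p1) * (p - q1) == 0.
  by apply/eqP; transitivity (p ^+ 2 - ((p1 + q1) * p + - (p1 * q1))); [ring|rewrite h subrr].
rewrite mulf_eq0 => /orP[]; rewrite subr_eq0 => /eqP E.
  by exists q1 => //; rewrite -E; ring.
by exists p1 => //; rewrite -E; ring.
Qed.
Lemma disc_in_unit p : p \in P -> cabs p + r < 1. Proof. by move=> /N3; move: r8; lra. Qed.
Lemma brM_radial j p X s : p \in P -> cabs X <= r -> 0 <= s -> s * cabs X <= r ->
  brM j (p + s%:C * X) = brM j p + s%:C * (brM j (p + X) - brM j p).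
Proof.
move=> pP Xr s0 sX; case: j => [i|]; first by rewrite /=; ring.
have sXE : cabs (s%:C * X) = s * cabs X by rewrite cabsM cabs_real ger0_norm.
rewrite [brM None p]brM_at// !brM_in ?sXE//=.
have -> : (r / (s * cabs X))%:C * (s%:C * X) ^+ 2 = s%:C * ((r / cabs X)%:C * X ^+ 2).
  have [->|s00] := eqVneq s 0; first by rewrite rmorph0 !mul0r expr0n /= mulr0.
  have sC : s%:C != 0 :> C by apply/eqP => -[] /eqP; rewrite (negPf s00).
  have -> : r / (s * cabs X) = s^-1 * (r / cabs X) by rewrite invfM mulrCA.
  rewrite rmorphM fmorphV; set t := (r / cabs X)%:C.
  by transitivity (s%:C^-1 * s%:C * (s%:C * (t * X ^+ 2))); [ring|rewrite mulVf// mul1r].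
by ring.
Qed.
(** The difference is [((p - q) + (r / |X|) X) X] with [q] the other root. For [X != 0] the bracket
    has modulus exactly [r] at a tangency and at least [2 r - r] otherwise: the cone makes both
    cases alike. *)
Lemma brM_line_sep i p X : p \in P -> cabs X <= r -> br (Some i) p = p ^+ 2 ->
  3 * d * cabs X <= cabs (brM None (p + X) - brM (Some i) (p + X)).
Proof.
move=> pP Xr ip; have [q qP pq] := line_root pP ip.
have -> : brM None (p + X) - brM (Some i) (p + X) = ((p - q) + (r / cabs X)%:C * X) * X.
  rewrite brM_in// [brM _ _]/= -pq; set t := (r / cabs X)%:C.
  transitivity (p ^+ 2 - (a i * p + b i) + ((2%:R * p - a i) + t * X) * X); first by ring.
  by move: ip => /= ->; rewrite subrr add0r.
rewrite cabsM; have [->|X0] := eqVneq X 0; first by rewrite cabs0 !mulr0.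
have X1 : 0 < cabs X by rewrite cabs_gt0.
rewrite ler_pM2r//; apply: le_trans dr _.
have h : cabs ((r / cabs X)%:C * X) = r.
  by rewrite cabsM cabs_real ger0_norm ?divr_ge0 ?(ltW X1) ?(ltW r0)// divfK// cabs_eq0.
have [->|npq] := eqVneq p q; first by rewrite subrr add0r h.
have := P1 pP qP npq; have := cabsD (p - q + (r / cabs X)%:C * X) (- ((r / cabs X)%:C * X)).
by rewrite addrK cabsN h; lra.
Qed.
Lemma brM_crossing_sep p X j l : p \in P -> cabs X <= r -> j != l -> brM j p = brM l p ->
  3 * d * cabs X <= cabs (brM j (p + X) - brM l (p + X)).
Proof.
move=> pP Xr; rewrite !(@brM_at _ p)//; case: j l => [i|] [k|] // jl h.
- have -> : brM (Some i) (p + X) - brM (Some k) (p + X) = (a i - a k) * X.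
    move: h => /= h; transitivity (a i * X + (a i * p + b i) - (a k * X + (a k * p + b k))); first by ring.
    by rewrite h; ring.
  by rewrite cabsM ler_wpM2r ?cabs_ge0//; apply: da.
- by rewrite cabsB; exact: brM_line_sep.
- by apply: brM_line_sep.
Qed.
(** Over a disc each branch moves by at most [B r], so a gap [g] at the centre leaves
    [g - 2 B r >= g / 2 >= 3 e0]. *)
Lemma brM_noncrossing_sep p X j l : p \in P -> cabs X <= r -> brM j p != brM l p ->
  3 * e0 <= cabs (brM j (p + X) - brM l (p + X)).
Proof.
move=> pP Xr; rewrite !(@brM_at _ p)// => /(gP pP) h.
have h1 := brM_slope j pP Xr; have h2 := brM_slope l pP Xr.
have h3 := cabs_tri (br j p) (br l p) (brM j (p + X)).
have h4 := cabs_tri (brM j (p + X)) (br l p) (brM l (p + X)).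
rewrite [cabs (br j p - brM _ _)]cabsB in h3.
have BX : B * cabs X <= B * r by rewrite ler_wpM2l//; move: B1; lra.
by move: gB e0g; lra.
Qed.
(** Conic minus line factors as [(x - p) (x - q)], of modulus at least [r^2]; two lines differ by
    the slope difference times the distance to their crossing, at least [3 d r]. *)
Lemma brM_outside_sep x j l : (forall p, p \in P -> r <= cabs (x - p)) -> j != l -> 3 * e0 <= cabs (brM j x - brM l x).
Proof.
move=> out; rewrite !brM_out//.
have Q k : 3 * e0 <= cabs (x ^+ 2 - (a k * x + b k)).
  have [p [q [pP qP -> ->]]] := N2 k.
  rewrite [X in cabs X](_ : _ = (x - p) * (x - q)); last by ring.
  rewrite cabsM; apply: le_trans e0r2 _; rewrite expr2.
  exact: ler_pM (ltW r0) (ltW r0) (out _ pP) (out _ qP).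
case: j l => [i|] [k|] // jl; [|by rewrite cabsB; exact: Q|exact: Q].
have ik : i != k by [].
have [p pP h] := N1 ik.
rewrite [X in cabs X](_ : _ = (a i - a k) * (x - p)); last first.
  move: h => /= h; transitivity (a i * (x - p) + (a i * p + b i) - (a k * (x - p) + (a k * p + b k))) => /=; first by ring.
  by rewrite h; ring.
rewrite cabsM; have h1 := da ik; have h2 := out _ pP.
have : 3 * d * r <= cabs (a i - a k) * cabs (x - p) by apply: ler_pM => //; rewrite ?mulr_ge0// ltW.
by move: e0dr e00; nra.
Qed.
Lemma brM_bound j x : cabs x < 1 -> cabs (brM j x) <= B.
Proof.
move=> x1; case: j => [i|].
  rewrite /=; apply: le_trans (cabsD _ _) _; apply: le_trans (aB i); rewrite lerD2r cabsM.
  by rewrite ler_piMr ?cabs_ge0// ltW.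
apply: le_trans B1.
have [[p pP xp]|out] := @disc_or _ P r x; last first.
  by rewrite brM_out//= cabsX expr_le1 ?cabs_ge0// ltW.
have p8 := N3 pP.
have := @brM_in p (x - p) pP (ltW xp); rewrite [p + _]addrC subrK => ->.
rewrite -mulrA -addrA; apply: le_trans (cabsD _ _) _; apply: le_trans (lerD (lexx _) (cabsD _ _)) _.
rewrite !cabsM cabs_real ger0_norm ?divr_ge0 ?cabs_ge0 ?(ltW r0)//.
have -> : cabs (2%:R : C) = 2 by rewrite -(rmorph_nat (real_complex R)) cabs_real ger0_norm.
have h : r / cabs (x - p) * (cabs (x - p) * cabs (x - p)) <= 1 / 8.
  have [->|x0] := eqVneq (cabs (x - p)) 0; first by rewrite !mulr0.
  rewrite mulrA divfK//; move: (ltW xp) (cabs_ge0 (x - p)) r8 r0; nra.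
have := cabs_ge0 p; have := cabs_ge0 (x - p).
by move: h p8 (ltW xp) r8; nra.
Qed.
Let j0 : J := None.
Let rhoA := dist_br j0 brM.
Let OA := OmA j0 brM e0.
Let cM := @brM_continuous.
Let brM_outside_sep' x j l : cabs x < 1 -> (forall p, p \in P -> r <= cabs (x - p)) -> j != l -> 3 * e0 <= cabs (brM j x - brM l x).
Proof. by move=> _; exact: brM_outside_sep. Qed.
(** With [xi = 1 / x], the product [(y - br j x) xi ^ deg j] is the coordinate [ze] of the chart at
    infinity. *)
Definition deg j : nat := if j is Some _ then 1 else 4.
(** Makes [|ze| / wgt] the vertical distance for [|xi| >= 1], where the affine chart overlaps, and
    [|ze|] near infinity. It depends on [xi] alone, so scaling [ze] scales the quotient. *)
Definition wgt j (z : C * C) : R := Num.max 1 (cabs z.1) ^+ deg j.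
Definition OmI j := [set z : C * C | cabs z.1 < 2 /\ cabs z.2 < e0 * wgt j z].
Definition rhoI j (z : C * C) : R := cabs z.2 / wgt j z.
Definition chartI j (z : C * C) : CP2 R :=
  if j is Some i then affptx (a i + b i * z.1 + z.2, z.1) else chartQ z.
Definition kapI j (p : CP2 R) : C * C :=
  if j is Some i then let y := hcoord p 0 1 / hcoord p 0 0 in let x := hcoord p 0 2%:R / hcoord p 0 0 in (x, y - (a i + b i * x))
  else kapQ p.
Let m1 z : 1 <= Num.max 1 (cabs z) :> R. Proof. by rewrite le_max lexx. Qed.
Lemma wgt_ge1 j z : 1 <= wgt j z. Proof. by rewrite /wgt exprn_ege1. Qed.
Lemma wgt_gt0 j z : 0 < wgt j z. Proof. exact: lt_le_trans (wgt_ge1 j z). Qed.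
Lemma wgt_le j z : cabs z.1 < 2 -> wgt j z <= 16.
Proof.
move=> z2; have h : Num.max 1 (cabs z.1) <= 2 by rewrite ge_max; apply/andP; split; [lra|exact: ltW].
rewrite /wgt; case: j => [i|]; rewrite /deg; first by rewrite expr1; lra.
have -> : 16 = 2 ^+ 4 :> R by rewrite -natrX.
by rewrite lerXn2r// nnegrE ?ler0n// (le_trans ler01).
Qed.
Lemma wgt_continuous j : continuous (wgt j).
Proof.
move=> z; have h1 : tends (nbhs z) (fun z : C * C => z.1) z.1 by exact: cvg_fst.
have h : tends (nbhs z) (fun z : C * C => Num.max 1 (cabs z.1)) (Num.max 1 (cabs z.1)) by tendsto.
exact: tendsRX.
Qed.
Lemma OmI_open j : open (OmI j).
Proof.
have -> : OmI j = [set z : C * C | 0 < 2 - cabs z.1] `&` [set z : C * C | 0 < e0 * wgt j z - cabs z.2].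
  by apply/seteqP; split => z /=; rewrite !subr_gt0.
apply: openI; apply: open_fun_gt0 => z.
  have h1 : tends (nbhs z) (fun z : C * C => z.1) z.1 by exact: cvg_fst.
  by tendsto.
have h1 : tends (nbhs z) (fun z : C * C => z.2) z.2 by exact: cvg_snd.
have h2 : tends (nbhs z) (wgt j) (wgt j z) by exact: wgt_continuous.
by tendsto.
Qed.
Lemma rhoI_lt j z : (rhoI j z < e0) = (cabs z.2 < e0 * wgt j z).
Proof. by rewrite /rhoI ltr_pdivrMr ?wgt_gt0. Qed.
Lemma rhoI_ge0 j z : 0 <= rhoI j z. Proof. by rewrite divr_ge0 ?cabs_ge0 ?(ltW (wgt_gt0 _ _)). Qed.
Lemma e0_small : e0 <= 1 / 4096.
Proof.
have B2 : 1 <= B ^+ 2 by rewrite exprn_ege1.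
have : 0 <= (B ^+ 2 - 1) * e0 by rewrite mulr_ge0 ?subr_ge0// ltW.
by move: e0B; lra.
Qed.
Lemma chartI_ohomeo j : exists V, ohomeo setT V (chartI j) (kapI j).
Proof.
case: j => [i|]; last by eexists; exact: chartQ_ohomeo.
have h : ohomeo setT setT (fun z : C * C => (a i + b i * z.1 + z.2, z.1)) (fun u => (u.2, u.1 - (a i + b i * u.2))).
  split; [exact: openT|exact: openT| |] => z _; (split; [exact: I| |]).
  - by rewrite /= [_ + z.2]addrC addrK; case: z.
  - have h1 : tends (nbhs z) (fun z : C * C => z.1) z.1 by exact: cvg_fst.
    have h2 : tends (nbhs z) (fun z : C * C => z.2) z.2 by exact: cvg_snd.
    by tendsto.
  - by rewrite /= [_ + (z.1 - _)]addrC subrK; case: z.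
  - have h1 : tends (nbhs z) (fun z : C * C => z.1) z.1 by exact: cvg_fst.
    have h2 : tends (nbhs z) (fun z : C * C => z.2) z.2 by exact: cvg_snd.
    by tendsto.
eexists; exact: ohomeo_comp h (@affptx_ohomeo R).
Qed.
Definition far j (xi ze : C) := j = None -> cabs ze <= cabs xi ^+ 2 / 4.
Lemma chartIE j xi ze : xi != 0 -> far j xi ze -> chartI j (xi, ze) = affpt (xi^-1, br j xi^-1 + ze / xi ^+ deg j).
Proof.
case: j => [i|] x0 f; last by rewrite /chartI chartQE//; exact: f.
rewrite /chartI /affptx /affpt /=; apply/proj_eqP; rewrite ?mkv_eq0 ?oner_eq0 ?andbF//.
by exists xi => //; rewrite mkvZ; congr mkv; rewrite ?expr1; field.
Qed.
Lemma big_far j xi ze : OmI j (xi, ze) -> 1 <= cabs xi -> far j xi ze.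
Proof.
move=> [/= x2 zw] x1 jN; subst j; rewrite /wgt /deg /= max_r// in zw.
have E4 : cabs xi ^+ 4 = cabs xi ^+ 2 * cabs xi ^+ 2 by rewrite -exprD.
rewrite E4 in zw; apply: ltW; apply: lt_le_trans zw _.
have := e0_small; set t := cabs xi ^+ 2 => e4.
have t0 : 0 <= t by exact: sqr_ge0.
have t4 : t <= 4 by rewrite /t expr2; nra.
by move: e00; nra.
Qed.
Lemma affpt_affptx x y u v : affpt (x, y) = affptx (u, v) :> CP2 R -> v != 0.
Proof.
move=> /proj_eqP[||c c0]; rewrite ?mkv_eq0 ?oner_eq0 ?andbF//= mkvZ => /(congr1 (fun v : 'rV[C]_3 => v 0 2%:R)).
by rewrite !mkvE => h; apply/negP => /eqP v0; move: h; rewrite v0 mulr0 => /eqP; rewrite oner_eq0.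
Qed.
(** For the conic, [|y| <= 2 B] in the affine tube while the chart gives [c^2 = y (ze + xi^2)] with
    [|c| >= 3/4], so [ze + xi^2] is at least of order [1 / B]; [4096 B^2 e0 <= 1] makes [ze] small
    against this. *)
Lemma aff_far j xi ze x y : OA (x, y) -> OmI j (xi, ze) -> affpt (x, y) = chartI j (xi, ze) -> xi != 0 /\ far j xi ze.
Proof.
case: j => [i|]; first by move=> _ _ /affpt_affptx.
move=> [/= x1 re] [/= x2 zw] E.
have zB : cabs ze <= 16 * e0.
  apply: ltW; apply: lt_le_trans zw _; rewrite mulrC ler_pM2r//; exact: (@wgt_le None (xi, ze)).
have yB : cabs y <= 2 * B.
  have h : cabs (y - brM (nearest j0 brM (x, y)) x) < e0 := re.
  have h1 := brM_bound (nearest j0 brM (x, y)) x1.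
  have := cabsD (y - brM (nearest j0 brM (x, y)) x) (brM (nearest j0 brM (x, y)) x); rewrite subrK.
  by have := e0_small; move: h h1 B1; lra.
move: E; rewrite /chartI /chartQ /weighted_twist /= /affpt /affpty; set c := cq _.
have /andP[c1 c2] := cq_abs (ze / xi ^+ 2); rewrite -/c in c1 c2.
have c0 : c != 0 by exact: cq_neq0.
move=> /proj_eqP[||s s0]; rewrite ?mkv_eq0 ?oner_eq0 ?andbF//= mkvZ mulr1 => h.
have h1 := congr1 (fun v : 'rV[C]_3 => v 0 1) h; have h2 := congr1 (fun v : 'rV[C]_3 => v 0 2%:R) h.
rewrite !mkvE in h1 h2; move: h1 h2 => {h} ys h2.
have h3 : c ^+ 2 = y * (ze + xi ^+ 2).
  rewrite ys -[LHS]mulr1 [in LHS]h2; field => //.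
have h4 : 9 / 16 <= 2 * B * (cabs ze + cabs xi ^+ 2).
  have : cabs (c ^+ 2) <= cabs y * (cabs ze + cabs xi ^+ 2).
    by rewrite h3 cabsM ler_wpM2l ?cabs_ge0// -cabsX; exact: cabsD.
  have : cabs y * (cabs ze + cabs xi ^+ 2) <= 2 * B * (cabs ze + cabs xi ^+ 2).
    by rewrite ler_wpM2r// addr_ge0 ?cabs_ge0 ?sqr_ge0.
  by rewrite cabsX expr2; nra.
have zB2 : B * cabs ze <= 1 / 256.
  have : B * cabs ze <= B * (16 * e0) by rewrite ler_wpM2l//; move: B1; lra.
  by move: e0B B1 e00; nra.
have h5 : 1 / 4 <= B * cabs xi ^+ 2 by rewrite mulrDr in h4; lra.
have B0 : 0 < B by move: B1; lra.
split=> [|_]; first by apply/negP => /eqP x0; move: h5; rewrite x0 cabs0 expr0n /= mulr0; lra.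
by rewrite -(ler_pM2l B0); lra.
Qed.
Lemma rhoI_aff j xi ze : 1 <= cabs xi -> rhoI j (xi, ze) = cabs (ze / xi ^+ deg j).
Proof. by move=> x1; rewrite /rhoI /wgt /= max_r// cabsM cabsV cabsX. Qed.
(** The overlap lies over [1/2 < |x| < 1], outside all discs, where one branch is nearest and the
    base does not move; both flows scale the same vertical displacement. *)
Lemma aff_inf j xi ze x y : OA (x, y) -> OmI j (xi, ze) -> affpt (x, y) = chartI j (xi, ze) ->
  rhoA (x, y) = rhoI j (xi, ze) /\ forall s, 0 <= s -> s * rhoA (x, y) < e0 ->
    affpt (flowA j0 brM P r d s (x, y)) = chartI j (xi, s%:C * ze).
Proof.
move=> Oz Oi E; have [x0 f] := aff_far Oz Oi E.
move: E; rewrite chartIE// => /affpt_inj [xE yE].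
have [/= x1 re] := Oz.
have xi1 : 1 < cabs xi.
  have xp : 0 < cabs xi by rewrite cabs_gt0.
  by move: x1; rewrite xE cabsV invf_lt1.
have xi2 : cabs xi < 2 by case: Oi.
have x2 : 1 / 4 <= cabs x.
  rewrite xE cabsV; have : cabs xi * (cabs xi)^-1 = 1 by rewrite divff// gt_eqF ?cabs_gt0.
  have : 0 < (cabs xi)^-1 by rewrite invr_gt0 cabs_gt0.
  by move: xi2 xi1; nra.
have outx := out_discs x2.
have fE l : brM l x = br l x by exact: brM_out.
have rE : cabs (y - brM j x) = rhoI j (xi, ze).
  by rewrite fE yE xE [br _ _ + _]addrC addrK rhoI_aff// ltW.
have rlt : rhoI j (xi, ze) < e0 by rewrite rhoI_lt; case: Oi.
have rA : rhoA (x, y) = rhoI j (xi, ze).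
  rewrite -rE; apply: (@dist_br_eq _ _ j0 brM (x, y) j) => k /=.
  have [->//|jk] := eqVneq j k; have := brM_outside_sep outx jk; have := cabs_tri (brM j x) (brM k x) y.
  by rewrite [cabs (brM j x - y)]cabsB rE; move: rlt e00; lra.
split => // s s0 sr.
have hj : cabs ((x, y).2 - brM j (x, y).1) = rhoA (x, y) by rewrite /= rE rA.
rewrite (flowAE r0 d0 e00 e0dr uP P1 brM_radial brM_crossing_sep brM_noncrossing_sep brM_outside_sep' Oz hj s0 sr) /flow /= shrink_out//.
rewrite chartIE//.
  by rewrite fE yE [br _ _ + _ - _]addrC xE addKr mulrA.
apply: big_far; last exact: ltW.
split => //=; rewrite -[X in _ < X](_ : e0 * wgt j (xi, ze) = _)//.
rewrite cabsM cabs_real ger0_norm// -ltr_pdivrMr ?wgt_gt0// -mulrA -/(rhoI j (xi, ze)).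
by rewrite -rA.
Qed.
Let Bp : 0 < B. Proof. by move: B1; lra. Qed.
Lemma unit_gap p xi : p \in P -> cabs xi < 2 -> 3 / 4 <= cabs (1 - p * xi).
Proof.
move=> /N3 p8 x2; have := cabsD (1 - p * xi) (p * xi); rewrite subrK cabs1 cabsM.
by move: (cabs_ge0 p) (cabs_ge0 xi); nra.
Qed.
(** A common point would give [(1 - p xi) (1 - q xi) = ze' xi - ze / xi^2], the equation of the
    crossings seen from infinity. The left side is at least 9/16, the right side at most slightly
    above 1/4. *)
Lemma line_Q_disjoint i z w : OmI (Some i) z -> OmI None w -> chartI (Some i) z <> chartI None w.
Proof.
case: z w => xi' ze' [xi ze] [/= x'2 z'w] [/= x2 zw] E.
have zB : cabs ze <= 16 * e0.
  apply: ltW; apply: lt_le_trans zw _; rewrite mulrC ler_pM2r//; exact: (@wgt_le None (xi, ze)).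
have z'B : cabs ze' <= 2 * e0.
  apply: ltW; apply: lt_le_trans z'w _; rewrite mulrC ler_pM2r// /wgt /deg expr1 /= ge_max.
  by apply/andP; split; [lra|exact: ltW].
have [al aE aB'] : exists2 al, al = a i + b i * xi' + ze' & cabs al <= 4 * B.
  eexists; first by [].
  have h1 := cabsD (a i + b i * xi') ze'; have h2 := cabsD (a i) (b i * xi'); rewrite cabsM in h2.
  have h3 := aB i; have h4 := cabs_ge0 (a i); have h5 := cabs_ge0 (b i).
  have h6 : cabs (b i) * cabs xi' <= cabs (b i) * 2 by rewrite ler_wpM2l// ltW.
  by have := e0_small; move: B1; lra.
have f : xi != 0 /\ far None xi ze.
  move: (E); rewrite /chartI /chartQ /weighted_twist /= /affptx /affpty /= -aE; set c := cq _.
  have /andP[c1 c2] := cq_abs (ze / xi ^+ 2); rewrite -/c in c1 c2.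
  have c0 : c != 0 by exact: cq_neq0.
  move=> /proj_eqP[||s s0]; rewrite ?mkv_eq0 ?oner_eq0 ?andbF//= mkvZ mulr1 => h.
  have h1 := congr1 (fun v : 'rV[C]_3 => v 0 0) h; have h2 := congr1 (fun v : 'rV[C]_3 => v 0 1) h.
  rewrite !mkvE in h1 h2; rewrite -h2 in h1.
  have h3 : c = al * xi by rewrite -[LHS]mulr1 h1; field.
  have h4 : 3 / 4 <= 4 * B * cabs xi.
    apply: le_trans c1 _; rewrite h3 cabsM ler_wpM2r ?cabs_ge0//.
  split=> [|_]; first by apply/negP => /eqP x0; move: h4; rewrite x0 cabs0 mulr0; lra.
  have h5 : (3 / 4) ^+ 2 <= (4 * B * cabs xi) ^+ 2 by rewrite lerXn2r// nnegrE; lra.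
  have h6 : B ^+ 2 * cabs ze <= B ^+ 2 * (16 * e0) by rewrite ler_wpM2l// sqr_ge0.
  rewrite !exprMn in h5; have B2 : 0 < B ^+ 2 by rewrite exprn_gt0.
  by rewrite -(ler_pM2l B2); move: h5 h6 e0B; rewrite (expr2 4) (expr2 3); lra.
have [x0 fz] := f; move: E; rewrite -[chartQ _]/(chartI None (xi, ze)) (chartIE x0 fz) => /esym E.
have x'0 := affpt_affptx E; move: E; rewrite -/(chartI (Some i) (xi', ze')) chartIE// => /affpt_inj[/invr_inj xE].
rewrite -xE /br /deg expr1 => yE.
have [p [q [pP qP apq bpq]]] := N2 i.
have key : (1 - p * xi) * (1 - q * xi) = ze' * xi - ze / xi ^+ 2.
  transitivity (xi ^+ 2 * (xi^-1 ^+ 2 + ze / xi ^+ 4 - (a i / xi + b i) - ze / xi ^+ 4)).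
    by rewrite apq bpq; field.
  by rewrite yE; field.
have h1 : 9 / 16 <= cabs (1 - p * xi) * cabs (1 - q * xi).
  rewrite (_ : 9 / 16 = 3 / 4 * (3 / 4)); last by field.
  by apply: ler_pM => //; exact: unit_gap.
have h2 : cabs (ze / xi ^+ 2) <= 1 / 4.
  rewrite cabsM cabsV cabsX ler_pdivrMr ?exprn_gt0 ?cabs_gt0// mulrC.
  by have := fz (erefl _); rewrite mul1r.
have h3 : cabs (ze' * xi) <= 2 * e0 * 2 by rewrite cabsM ler_pM ?cabs_ge0// ltW.
rewrite -cabsM key in h1; have := cabsD (ze' * xi) (- (ze / xi ^+ 2)); rewrite cabsN.
by have := e0_small; lra.
Qed.
(** Here [(a i - a k) (1 - p xi) = ze' - ze], of modulus at least [9 d / 4] against at most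
    [4 e0 <= d / 4]. *)
Lemma lines_disjoint i k z w : i != k -> OmI (Some i) z -> OmI (Some k) w -> chartI (Some i) z <> chartI (Some k) w.
Proof.
case: z w => xi ze [xi' ze'] ik [/= x2 zw] [/= x'2 z'w] E.
have [_ _ ix _] := affptx_ohomeo R.
have := congr1 (fun p : CP2 R => (hcoord p 0 1 / hcoord p 0 0, hcoord p 0 2%:R / hcoord p 0 0)) E.
have [_ /= -> _] := ix (a i + b i * xi + ze, xi) I.
have [_ /= -> _] := ix (a k + b k * xi' + ze', xi') I.
move=> [yE xE]; rewrite -xE in yE z'w.
have zB u : cabs u < e0 * wgt (Some i) (xi, u) -> cabs u <= 2 * e0.
  move=> uw; apply: ltW; apply: lt_le_trans uw _; rewrite mulrC ler_pM2r// /wgt /deg expr1 /= ge_max.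
  by apply/andP; split; [lra|exact: ltW].
have h1 := zB _ zw; have h2 := zB _ z'w.
have [p pP pE] := N1 ik; have h3 := unit_gap pP x2; have h4 := da ik.
have key : (a i - a k) * (1 - p * xi) = ze' - ze.
  transitivity (a i + b i * xi + ze - (a k + b k * xi) - ze - xi * (a i * p + b i) + xi * (a k * p + b k)); first by ring.
  by rewrite yE pE; ring.
have h5 : 3 * d * (3 / 4) <= cabs (a i - a k) * cabs (1 - p * xi) by apply: ler_pM => //; rewrite mulr_ge0// ltW.
rewrite -cabsM key in h5; have := cabsD ze' (- ze); rewrite cabsN.
by move: e0dr d0 r8 h5 h1 h2 r0; nra.
Qed.
Let K : choiceType := option J.
(** Index [None] is the affine part, [Some j] the end of branch [j] at infinity. *)
Definition tchart (k : option J) : C * C -> CP2 R := if k is Some j then chartI j else @affpt R.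
Definition tkap (k : option J) (p : CP2 R) : C * C :=
  if k is Some j then kapI j p else (hcoord p 0 0 / hcoord p 0 2%:R, hcoord p 0 1 / hcoord p 0 2%:R).
Definition tdom (k : option J) : set (C * C) := if k is Some j then OmI j else OA.
Definition trho (k : option J) : C * C -> R := if k is Some j then rhoI j else rhoA.
Definition tflow (k : option J) (s : R) (z : C * C) : C * C :=
  if k is Some j then (z.1, s%:C * z.2) else flowA j0 brM P r d s z.
Lemma tchart_ohomeo (k : option J) : ohomeo (tdom k) (tchart k @` tdom k) (tchart k) (tkap k).
Proof.
case: k => [j|].
  have [V h] := chartI_ohomeo j.
  by have h' := ohomeo_sub h (@OmI_open j) (@subsetT _ (OmI j)); exact: h'.
by have h' := ohomeo_sub (affpt_ohomeo R) (@OmA_open _ _ j0 _ e0 cM) (@subsetT _ OA); exact: h'.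
Qed.
Lemma tkapK (k : option J) z : tdom k z -> tkap k (tchart k z) = z.
Proof. by move=> Oz; have [_ _ /(_ _ Oz)[]] := tchart_ohomeo k. Qed.
Lemma tcompat (k l : option J) z w : tdom k z -> tdom l w -> tchart k z = tchart l w ->
  trho k z = trho l w /\ forall s, 0 <= s -> s * trho k z < e0 -> tchart k (tflow k s z) = tchart l (tflow l s w).
Proof.
move=> Oz Ow E; have [kl|kl] := eqVneq k l.
  by subst l; have <- : z = w by rewrite -(tkapK Oz) -(tkapK Ow) E.
case: k l kl Oz Ow E => [j|] [l|] // kl Oz Ow E.
- case: j l kl Oz Ow E => [i|] [m|] // kl Oz Ow E; exfalso.
  + by apply: (@lines_disjoint i m z w) E; first by apply: contra_neq kl => ->.
  + exact: (@line_Q_disjoint i z w).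
  + exact: (@line_Q_disjoint m w z Ow Oz (esym E)).
- case: z w Oz Ow E => xi ze [x y] Oz Ow /esym E; have [h1 h2] := aff_inf Ow Oz E.
  by split=> [|s s0 sr]; [exact/esym|apply/esym/h2; rewrite // h1].
- by case: z w Oz Ow E => x y [xi ze] Oz Ow E; exact: (aff_inf Oz Ow E).
Qed.
Lemma trhoP (k : option J) z : tdom k z -> [/\ 0 <= trho k z, trho k z < e0 & {for z, continuous (trho k)}].
Proof.
case: k => [j|] [z1 z2] /=; last first.
  by split=> //; [exact: dist_br_ge0|exact: dist_br_continuous].
split; [exact: rhoI_ge0|by rewrite rhoI_lt|].
have h1 : tends (nbhs z) (fun z : C * C => z.2) z.2 by exact: cvg_snd.
have h2 : tends (nbhs z) (wgt j) (wgt j z) by exact: wgt_continuous.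
have w0 : wgt j z != 0 by rewrite gt_eqF// wgt_gt0.
by rewrite /rhoI; tendsto; exact: w0.
Qed.
Lemma tflowP (k : option J) z s : tdom k z -> 0 <= s -> s * trho k z < e0 ->
  [/\ tdom k (tflow k s z), trho k (tflow k s z) = s * trho k z &
      forall s', 0 <= s' -> s' * s * trho k z < e0 -> tflow k s' (tflow k s z) = tflow k (s' * s) z].
Proof.
case: k => [j|] Oz s0 sr; last first.
  exact: (flowA_spec r0 d0 e00 e0dr uP P1 disc_in_unit brM_radial brM_crossing_sep brM_noncrossing_sep brM_outside_sep' Oz s0 sr).
case: z Oz sr => xi ze [/= x2 zw]; rewrite -/(rhoI j (xi, ze)) => sr.
have rE : rhoI j (xi, s%:C * ze) = s * rhoI j (xi, ze).
  by rewrite /rhoI /wgt /= cabsM cabs_real ger0_norm// mulrA.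
split => //=; first by split => //; move: sr; rewrite -rE rhoI_lt.
by move=> s' _ _; rewrite rmorphM mulrA.
Qed.
Lemma tflow1 (k : option J) z : tflow k 1 z = z.
Proof. by case: k => [j|]; [rewrite /= rmorph1 mul1r; case: z|exact: flowA1]. Qed.
Lemma tflow_continuous (k : option J) z s : tdom k z -> 0 <= s -> s * trho k z < e0 ->
  {for (s, z), continuous (fun sz : R * (C * C) => tflow k sz.1 sz.2)}.
Proof.
case: k => [j|] Oz s0 sr; last exact: (flowA_continuous cM r0 d0 e00 e0dr uP P1 brM_radial brM_crossing_sep brM_noncrossing_sep brM_outside_sep' Oz s0 sr).
have h1 : tends (nbhs (s, z)) (fun sz : R * (C * C) => sz.1) s by exact: cvg_fst.
have h2 : tends (nbhs (s, z)) (fun sz : R * (C * C) => sz.2) z by exact: cvg_snd.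
have h3 := tends_fst h2; have h4 := tends_snd h2.
by rewrite /tflow; tendsto.
Qed.
Lemma t_half_space (k : option J) z : tdom k z -> 0 < trho k z ->
  exists U W (f : C * C -> 'rV[R]_4) h, [/\ ohomeo U W f h, U z &
    forall q, U q -> (trho k q <= trho k z <-> 0 <= f q ord0 ord0)].
Proof.
case: k => [j|] Oz r1; last exact: (half_spaceA cM r0 e00 brM_radial brM_crossing_sep brM_noncrossing_sep brM_outside_sep' Oz r1).
have h : ohomeo setT setT (fun z : C * C => (z.2, z.1)) (fun z => (z.2, z.1)).
  have c (w : C * C) : {for w, continuous (fun z : C * C => (z.2, z.1))}.
    have h1 : tends (nbhs w) (fun z : C * C => z.1) w.1 by exact: cvg_fst.
    have h2 : tends (nbhs w) (fun z : C * C => z.2) w.2 by exact: cvg_snd.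
    by tendsto.
  by split; [exact: openT|exact: openT| |] => -[x y] _; split; first [exact: I|exact: c|by []].
have cN (u : C * C) : tends (nbhs u) (fun a : C * C => rhoI j (a.2, a.1)) (rhoI j (u.2, u.1)).
  have h1 : tends (nbhs u) (fun z : C * C => z.1) u.1 by exact: cvg_fst.
  have h2 : tends (nbhs u) (fun z : C * C => z.2) u.2 by exact: cvg_snd.
  have h3 : tends (nbhs u) (fun z : C * C => wgt j (z.2, z.1)) (wgt j (u.2, u.1)).
    have hp : tends (nbhs u) (fun z : C * C => (z.2, z.1)) (u.2, u.1) by tendsto.
    have hq := @wgt_continuous j (u.2, u.1).
    exact: (tends_comp hp hq).
  have w0 : wgt j (u.2, u.1) != 0 by rewrite gt_eqF// wgt_gt0.
  by rewrite /rhoI; tendsto; exact: w0.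
apply: (half_space_gauge h (N := fun a => rhoI j (a.2, a.1)) _ _ cN).
- exact: I.
- rewrite /= -cabs_gt0; move: r1; rewrite /= /rhoI pmulr_lgt0// invr_gt0; exact: wgt_gt0.
- by move=> l u w l0; rewrite /rhoI /wgt /= cabsM cabs_real gtr0_norm// mulrA.
- by case: z {Oz} r1.
- by case: z {Oz r1} => z1 z2 [q1 q2] _.
Qed.
Lemma compact_cabs (t : R) : compact [set z : C | cabs z <= t].
Proof.
apply: (subclosed_compact _ (@compact_disk R t)); last first.
  by move=> z /= zt; split; [apply: le_trans zt; exact: cabs_Re|apply: le_trans zt; exact: cabs_Im].
have -> : [set z : C | cabs z <= t] = ~` [set z : C | 0 < cabs z - t].
  apply/seteqP; split => z /=; rewrite subr_gt0; first by move=> h; apply/negP; rewrite -leNgt.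
  by move=> /negP; rewrite -leNgt.
by apply: open_closedC; apply: open_fun_gt0 => z; tendsto.
Qed.
Lemma compact_finite_union (X : topologicalType) (T : finType) (A : T -> set X) :
  (forall t, compact (A t)) -> compact [set x | exists t, A t x].
Proof.
move=> cA; suff h (s : seq T) : compact [set x | exists2 t, t \in s & A t x].
  have -> : [set x | exists t, A t x] = [set x | exists2 t, t \in enum T & A t x].
    by apply/seteqP; split => x [t]; [exists t; rewrite ?mem_enum|exists t].
  exact: h.
elim: s => [|t s IH].
  rewrite (_ : mkset _ = set0); first exact: compact0.
  by apply/seteqP; split => // x [].
rewrite (_ : mkset _ = A t `|` [set x | exists2 t, t \in s & A t x]); first exact: compactU.
apply/seteqP; split => x; first by move=> [u]; rewrite inE => /orP[/eqP-> Ax|us Ax]; [left|right; exists u].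
by move=> [Ax|[u us Ax]]; [exists t; rewrite ?mem_head|exists u; rewrite // inE us orbT].
Qed.
(** The chart domains are open; cutting down to [|x| <= 3/4] and [|xi| <= 3/2] loses nothing because
    [2/3 < 3/4], and the tube becomes a finite union of images of compact bidiscs. *)
Lemma tubes_compact e : 0 < e < e0 ->
  compact [set v | exists2 k, (tchart k @` tdom k) v & trho k (tkap k v) <= e].
Proof.
move=> /andP[e1 e2].
pose D t := [set z : C | cabs z <= t].
pose gA j (z : C * C) : CP2 R := affpt (z.1, brM j z.1 + z.2).
pose gI j (z : C * C) : CP2 R := chartI j (z.1, (wgt j (z.1, 0))%:C * z.2).
have cA j : compact (gA j @` (D (3 / 4) `*` D e)).
  apply: continuous_compact; last by apply: compact_setX; exact: compact_cabs.
  apply: continuous_subspaceT => z.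
  have h1 : tends (nbhs z) (fun z : C * C => z.1) z.1 by exact: cvg_fst.
  have h2 : tends (nbhs z) (fun z : C * C => z.2) z.2 by exact: cvg_snd.
  have h3 : tends (nbhs z) (fun z : C * C => brM j z.1) (brM j z.1) := tends_comp h1 (@cM j _).
  have h4 : tends (nbhs z) (fun z : C * C => (z.1, brM j z.1 + z.2)) (z.1, brM j z.1 + z.2) by tendsto.
  have [_ _ /(_ (z.1, brM j z.1 + z.2) I)[_ _ ci] _] := affpt_ohomeo R.
  exact: (tends_comp h4 ci).
have cI j : compact (gI j @` (D (3 / 2) `*` D e)).
  apply: continuous_compact; last by apply: compact_setX; exact: compact_cabs.
  apply: continuous_subspaceT => z.
  have h1 : tends (nbhs z) (fun z : C * C => z.1) z.1 by exact: cvg_fst.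
  have h2 : tends (nbhs z) (fun z : C * C => z.2) z.2 by exact: cvg_snd.
  have h0 : tends (nbhs z) (fun z : C * C => (z.1, 0 : C)) (z.1, 0 : C) by tendsto.
  have h3 : tends (nbhs z) (fun z : C * C => wgt j (z.1, 0)) (wgt j (z.1, 0)) := tends_comp h0 (@wgt_continuous j _).
  have h4 : tends (nbhs z) (fun z : C * C => (z.1, (wgt j (z.1, 0))%:C * z.2)) (z.1, (wgt j (z.1, 0))%:C * z.2) by tendsto.
  have [V [_ _ /(_ (z.1, (wgt j (z.1, 0))%:C * z.2) I)[_ _ ci] _]] := chartI_ohomeo j.
  exact: (tends_comp h4 ci).
suff -> : [set v | exists2 k, (tchart k @` tdom k) v & trho k (tkap k v) <= e] =
    [set v | exists j, (gA j @` (D (3 / 4) `*` D e) `|` gI j @` (D (3 / 2) `*` D e)) v].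
  by apply: compact_finite_union => j; exact: compactU.
have wp j xi : 0 < wgt j (xi, 0) by exact: wgt_gt0.
apply/seteqP; split => v.
  move=> [k [z Oz <-]]; rewrite tkapK//; case: k Oz => [j|] /=.
    case: z => xi ze Oz re; have [/= x2 zw] := Oz; exists j.
    have E : (wgt j (xi, 0))%:C * (ze / (wgt j (xi, 0))%:C) = ze.
      by rewrite mulrC divfK//; apply/eqP => -[] /eqP; rewrite gt_eqF.
    have [xi32|xi32] := lerP (cabs xi) (3 / 2).
      right; exists (xi, ze / (wgt j (xi, 0))%:C); last by rewrite /gI /= E.
      by split => //=; rewrite /D /= cabsM cabsV cabs_real gtr0_norm.
    have x1 : 1 <= cabs xi by lra.
    have x0 : xi != 0 by rewrite -cabs_gt0; lra.
    left; exists (xi^-1, ze / xi ^+ deg j).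
      split; rewrite /D /=; last by rewrite -rhoI_aff.
      by rewrite cabsV invf_ple ?posrE//; lra.
    rewrite chartIE//; last exact: big_far.
    rewrite /gA /= brM_out//; apply: out_discs; rewrite cabsV.
    by apply: le_trans (_ : 2^-1 <= _); [lra|rewrite lef_pV2 ?posrE; lra].
  case: z => x y [/= x1 re0] re.
  set j := nearest j0 brM (x, y); have hj : cabs (y - brM j x) = rhoA (x, y) by [].
  exists j; have [x34|x34] := lerP (cabs x) (3 / 4).
    by left; exists (x, y - brM j x); [split; rewrite /D /= ?hj|rewrite /gA /= addrC subrK].
  have x0 : x != 0 by rewrite -cabs_gt0; lra.
  have xi1 : 1 <= cabs x^-1 by rewrite cabsV invf_ge1 ?cabs_gt0// ltW.
  have wE : wgt j (x^-1, 0) = cabs x^-1 ^+ deg j by rewrite /wgt max_r.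
  right; exists (x^-1, (y - brM j x) * x^-1 ^+ deg j / (wgt j (x^-1, 0))%:C).
    split; rewrite /D /=.
      by rewrite cabsV invf_ple ?posrE//; lra.
    rewrite !cabsM cabsX !cabsV cabs_real gtr0_norm// wE cabsV mulfK ?hj//.
    by rewrite expf_neq0// invr_neq0// gt_eqF// cabs_gt0.
  have E : (wgt j (x^-1, 0))%:C * ((y - brM j x) * x^-1 ^+ deg j / (wgt j (x^-1, 0))%:C) = (y - brM j x) * x^-1 ^+ deg j.
    by rewrite mulrC divfK//; apply/eqP => -[] /eqP; rewrite gt_eqF.
  have outx : brM j x = br j x by apply: brM_out; apply: out_discs; lra.
  rewrite /gI /= E chartIE ?invr_neq0//.
    by rewrite invrK mulfK ?expf_neq0 ?invr_neq0// outx [br _ _ + _]addrC subrK.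
  apply: big_far => //; split => /=.
    by rewrite cabsV invf_plt ?posrE//; lra.
  rewrite [X in _ < e0 * X](_ : _ = wgt j (x^-1, 0))// wE cabsM cabsX hj ltr_pM2r//.
  by rewrite exprn_gt0// (lt_le_trans _ xi1).
move=> [j [[[x eta] [/= x34 ee] <-]|[[xi eta] [/= xi32 ee] <-]]].
  have re : rhoA (x, brM j x + eta) <= e.
    apply: le_trans (dist_br_le j0 brM _ j) _; by rewrite /= addrC addKr.
  have Oz : OA (x, brM j x + eta) by split; [by apply: le_lt_trans x34 _; lra|exact: le_lt_trans re e2].
  exists None; first by exists (x, brM j x + eta).
  by rewrite -[gA j _]/(tchart None (x, brM j x + eta)) tkapK.
have rE : rhoI j (xi, (wgt j (xi, 0))%:C * eta) = cabs eta.
  rewrite /rhoI cabsM cabs_real gtr0_norm// [X in _ / X](_ : _ = wgt j (xi, 0))// mulrC mulKf//.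
  by rewrite gt_eqF.
have Oz : OmI j (xi, (wgt j (xi, 0))%:C * eta).
  split; first by apply: le_lt_trans xi32 _; lra.
  by rewrite -rhoI_lt rE; exact: le_lt_trans e2.
exists (Some j); first by eexists; first exact: Oz.
by rewrite -[gI j _]/(tchart (Some j) (xi, (wgt j (xi, 0))%:C * eta)) tkapK//= rE.
Qed.
(** [chartI j (0, 0)] is the point at infinity of the branch: [(1 : a i : 0)] for a line and
    [(0 : 1 : 0)] for the conic. *)
Definition curve_of (f : J -> C -> C) : set (CP2 R) :=
  [set v | exists j, (exists x, v = affpt (x, f j x)) \/ v = chartI j (0, 0)].
Lemma model_tubes : small_tubes (curve_of brM).
Proof.
have compat (k l : option J) v : (tchart k @` tdom k) v -> (tchart l @` tdom l) v ->
    trho k (tkap k v) = trho l (tkap l v) /\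
    forall s, 0 <= s -> s * trho k (tkap k v) < e0 -> tchart k (tflow k s (tkap k v)) = tchart l (tflow l s (tkap l v)).
  by move=> [z Oz zv] [w Ow wv]; rewrite -{1 3 4}zv -wv !tkapK//; apply: tcompat => //; rewrite wv.
have := @tube_atlas R _ K tchart tkap tdom (fun k : option J => tchart k @` tdom k) trho tflow e0 e00
  tchart_ohomeo compat trhoP tflowP (fun (k : option J) z _ => tflow1 k z) tflow_continuous t_half_space tubes_compact.
suff -> : [set v | exists2 k, (tchart k @` tdom k) v & trho k (tkap k v) = 0] = curve_of brM by [].
apply/seteqP; split => v.
  move=> [k [z Oz <-]]; rewrite tkapK//; case: k Oz => [j|] /=; case: z => [x y] Oz re.
    have y0 : y = 0.
      apply/eqP; rewrite -cabs_eq0; move: re => /eqP; rewrite /rhoI mulf_eq0 => /orP[//|].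
      by rewrite invr_eq0 gt_eqF// wgt_gt0.
    exists j; rewrite y0; have [->|x0] := eqVneq x 0; [by right|left; exists x^-1].
    rewrite chartIE//; last by move=> _; rewrite cabs0 divr_ge0// sqr_ge0.
    rewrite mul0r addr0 brM_out//; apply: out_discs; rewrite cabsV; case: Oz => /= x2 _.
    have xp : 0 < cabs x by rewrite cabs_gt0.
    by apply: le_trans (_ : 2^-1 <= _); [lra|rewrite lef_pV2 ?posrE// ltW].
  exists (nearest j0 brM (x, y)); left; exists x; congr (affpt (_, _)); apply/eqP.
  by rewrite -subr_eq0 -cabs_eq0; apply/eqP.
have cz j xi : cabs xi < 2 -> OmI j (xi, 0).
  by move=> x2; split => //=; rewrite cabs0 mulr_gt0// wgt_gt0.
have rz j xi : rhoI j (xi, 0) = 0 by rewrite /rhoI cabs0 mul0r.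
move=> [j [[x ->]|->]]; last first.
  have O0 : tdom (Some j) (0, 0) by apply: cz; rewrite cabs0.
  by exists (Some j); [exists (0, 0)|rewrite -[chartI j _]/(tchart (Some j) (0, 0)) tkapK//=; exact: rz].
have [x1|x1] := ltP (cabs x) 1.
  have re : rhoA (x, brM j x) = 0.
    by apply/eqP; rewrite eq_le dist_br_ge0 andbT; apply: le_trans (dist_br_le j0 brM _ j) _; rewrite /= subrr cabs0.
  have Oz : tdom None (x, brM j x) by split => //; rewrite -/rhoA re.
  by exists None; [exists (x, brM j x)|rewrite -[affpt _]/(tchart None (x, brM j x)) tkapK].
have xp : 0 < cabs x by apply: lt_le_trans x1.
have x0 : x^-1 != 0 by rewrite invr_neq0// -cabs_gt0.
have O0 : tdom (Some j) (x^-1, 0).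
  by apply: cz; apply: le_lt_trans (_ : 1 < 2); [rewrite cabsV invf_le1|lra].
have E : affpt (x, brM j x) = tchart (Some j) (x^-1, 0).
  rewrite /= chartIE//; last by move=> _; rewrite cabs0 divr_ge0// sqr_ge0.
  by rewrite invrK mul0r addr0 brM_out//; apply: out_discs; lra.
exists (Some j); first by exists (x^-1, 0).
by rewrite E tkapK//=; exact: rz.
Qed.
End Model.

(** * From the model curve to the arrangement *)
Section Ramp.
Variable R : realType.
Implicit Types (A tau z v : R).
(** For [0 <= tau <= 1] and [z >= 0]: slope [tau] up to [A / 2], slope [2 - tau] from there to [A],
    the identity beyond. The form with [min] and [max] makes joint continuity immediate. *)
Definition ramp A tau z := Num.max (tau * z) (Num.min z (A - (2 - tau) * (A - z))).
Definition ramp_inv A tau v := if v <= tau * A / 2 then v / tau else if v <= A then A - (A - v) / (2 - tau) else v.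
Lemma ramp1 A tau z : 0 <= tau <= 1 -> 0 <= z -> 2 * z <= A -> ramp A tau z = tau * z.
Proof.
move=> /andP[t0 t1] z0 zA; rewrite /ramp max_l// ge_min; apply/orP; right.
have : 0 <= (1 - tau) * (A - 2 * z) by rewrite mulr_ge0// subr_ge0.
by lra.
Qed.
Lemma ramp2 A tau z : 0 <= tau <= 1 -> A <= 2 * z -> z <= A -> ramp A tau z = A - (2 - tau) * (A - z).
Proof.
move=> /andP[t0 t1] z0 zA.
have h1 : 0 <= (1 - tau) * (2 * z - A) by rewrite mulr_ge0// subr_ge0.
have h2 : 0 <= (1 - tau) * (A - z) by rewrite mulr_ge0// subr_ge0.
by rewrite /ramp min_r ?max_r//; lra.
Qed.
Lemma ramp3 A tau z : 0 <= tau <= 1 -> 0 <= z -> A <= z -> ramp A tau z = z.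
Proof.
move=> /andP[t0 t1] z0 zA; have h1 : 0 <= (1 - tau) * (z - A) by rewrite mulr_ge0// subr_ge0.
have h2 : 0 <= (1 - tau) * z by rewrite mulr_ge0// subr_ge0.
by rewrite /ramp min_l ?max_r//; lra.
Qed.
Lemma ramp_bound A tau z : 0 <= tau <= 1 -> 0 <= A -> 0 <= z -> [/\ 0 <= ramp A tau z, ramp A tau z <= z & z - ramp A tau z <= A].
Proof.
move=> t01 A0 z0; have /andP[t0 t1] := t01.
have tz : tau * z <= z by rewrite ler_piMl.
have [h|h] := lerP (2 * z) A; first by rewrite ramp1// mulr_ge0//; split => //; have := mulr_ge0 t0 z0; lra.
have [h2|h2] := lerP z A; last by rewrite ramp3// ?subrr// ltW.
rewrite ramp2// ?(ltW h)//; have : 0 <= (1 - tau) * (A - z) by rewrite mulr_ge0// subr_ge0.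
have h3 : 0 <= tau * (A - z) by rewrite mulr_ge0// subr_ge0.
move=> h4; split; lra.
Qed.
(** At [tau = 0] the first piece would collapse; the side condition allows this only when [A = 0]
    reduces that piece to the origin. *)
Lemma rampK A tau z : 0 <= tau <= 1 -> (0 < tau) || (A == 0) -> 0 <= A -> 0 <= z -> ramp_inv A tau (ramp A tau z) = z.
Proof.
move=> t01 tA A0 z0; have /andP[t0 t1] := t01; rewrite /ramp_inv.
have [h|h] := lerP (2 * z) A.
  rewrite ramp1// ifT; last by have : 0 <= tau * (A - 2 * z) by [rewrite mulr_ge0// subr_ge0]; lra.
  have [t00|t00] := eqVneq tau 0; last by rewrite mulrAC divff// mul1r.
  by move: tA h; rewrite t00 ltxx /= => /eqP ->; lra.
have [h2|h2] := lerP z A.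
  rewrite ramp2// ?(ltW h)//.
  have h3 : 0 < (2 - tau) * (2 * z - A) by rewrite mulr_gt0//; lra.
  rewrite ifF; last by apply/negbTE; rewrite -ltNge; lra.
  rewrite ifT; last by rewrite gerBl mulr_ge0//; lra.
  by rewrite subKr mulrC mulKf ?subKr//; lra.
rewrite ramp3// ?(ltW h2)// ifF; last first.
  by apply/negbTE; rewrite -ltNge; have : 0 <= (1 - tau) * A by [rewrite mulr_ge0// subr_ge0]; lra.
by rewrite ifF//; apply/negbTE; rewrite -ltNge.
Qed.
Lemma ramp_invK A tau v : 0 <= tau <= 1 -> (0 < tau) || (A == 0) -> 0 <= A -> 0 <= v ->
  ramp A tau (ramp_inv A tau v) = v /\ 0 <= ramp_inv A tau v.
Proof.
move=> t01 tA A0 v0; have /andP[t0 t1] := t01; rewrite /ramp_inv.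
have [h|h] := lerP v (tau * A / 2).
  have [t00|t00] := eqVneq tau 0.
    move: tA h; rewrite t00 ltxx /= => /eqP -> h; have -> : v = 0 by lra.
    by rewrite mul0r ramp1 ?mulr0 ?lexx//; lra.
  have tp : 0 < tau by rewrite lt_neqAle eq_sym t00.
  have h1 : 0 <= v / tau by rewrite divr_ge0.
  split => //; rewrite ramp1//; first by rewrite mulrC divfK.
  by rewrite mulrC -ler_pdivlMr// ler_pdivrMr// mulrC mulrA.
have t2 : 0 < 2 - tau by lra.
have [h2|h2] := lerP v A.
  have h3 : 0 <= (A - v) / (2 - tau) by apply: divr_ge0; lra.
  have h4 : (A - v) / (2 - tau) <= A / 2.
    by rewrite ler_pdivrMr//; move: h; rewrite (_ : A / 2 * (2 - tau) = A - tau * A / 2); [lra|field].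
  split; last by lra.
  rewrite ramp2//; [|lra|lra]; by rewrite subKr mulrC divfK ?subKr// gt_eqF.
by split; [rewrite ramp3// ltW|].
Qed.
End Ramp.

Section Unfold.
Variables (R : realType) (n : nat).
Notation C := R[i].
Notation J := (option 'I_n).
Variables (a b : 'I_n -> C) (P : seq C) (r g B : R).
Hypothesis uP : uniq P.
Hypothesis N2 : forall i, exists p q, [/\ p \in P, q \in P, a i = p + q & b i = - (p * q)].
Hypothesis N3 : forall p, p \in P -> cabs p <= 1 / 8.
Hypotheses (r0 : 0 < r) (r8 : r <= 1 / 8).
Hypothesis P1 : forall p q, p \in P -> q \in P -> p != q -> 2 * r <= cabs (p - q).
Hypotheses (B1 : 1 <= B) (aB : forall i, cabs (a i) + cabs (b i) <= B) (gB : 4 * B * r <= g).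
Hypothesis gP : forall p j k, p \in P -> br a b j p != br a b k p -> g <= cabs (br a b j p - br a b k p).
(* Maps the circle of radius r t to the circle of radius t^2, so (r / |X|) X^2 to X^2 for
   |X| = t, and fixes everything outside radius 2 r t. *)
Definition radial (t : R) (Z : C) : C := (ramp (2 * r * t) (Num.min t r / r) (cabs Z) / cabs Z)%:C * Z.
Definition radial_inv (t : R) (Z : C) : C := (ramp_inv (2 * r * t) (Num.min t r / r) (cabs Z) / cabs Z)%:C * Z.
Let tau01 t : 0 <= t -> 0 <= Num.min t r / r <= 1.
Proof.
move=> t0; rewrite divr_ge0 ?ler_pdivrMr ?mul1r//= ?ge_min ?lexx ?orbT// ?le_min ?t0 ?ltW//.
Qed.
Let tauA t : 0 <= t -> (0 < Num.min t r / r) || (2 * r * t == 0).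
Proof.
move=> t0; have [->|tn] := eqVneq t 0; first by rewrite mulr0 eqxx orbT.
by rewrite divr_gt0// lt_min r0 andbT lt_neqAle eq_sym tn.
Qed.
Let A0 t : 0 <= t -> 0 <= 2 * r * t. Proof. by move=> t0; rewrite !mulr_ge0// ltW. Qed.
Let radialN (h : R -> R) (Z : C) : Z != 0 -> 0 <= h (cabs Z) -> cabs ((h (cabs Z) / cabs Z)%:C * Z) = h (cabs Z).
Proof.
move=> Z0 h0; rewrite cabsM cabs_real ger0_norm ?divr_ge0 ?cabs_ge0// divfK// cabs_eq0//.
Qed.
Lemma radialK t : 0 <= t -> cancel (radial t) (radial_inv t).
Proof.
move=> t0 Z; have [->|Z0] := eqVneq Z 0; first by rewrite /radial_inv /radial !mulr0.
have [h1 h2 _] := ramp_bound (tau01 t0) (A0 t0) (cabs_ge0 Z).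
have K := rampK (tau01 t0) (tauA t0) (A0 t0) (cabs_ge0 Z).
rewrite /radial_inv {1 2}/radial radialN// K /radial mulrA -rmorphM /=.
set m := ramp _ _ _ in K *; have m0 : m != 0.
  apply/eqP => mE; move: K; rewrite mE => /eqP; rewrite /ramp_inv ifT ?mul0r; last first.
    by apply: divr_ge0 => //; apply: mulr_ge0; [case/andP: (tau01 t0)|exact: A0].
  by rewrite eq_sym cabs_eq0 (negPf Z0).
by rewrite mulrA divfK// divff ?cabs_eq0// mul1r.
Qed.
Lemma radial_invK t : 0 <= t -> cancel (radial_inv t) (radial t).
Proof.
move=> t0 Z; have [->|Z0] := eqVneq Z 0; first by rewrite /radial_inv /radial !mulr0.
have [K h1] := ramp_invK (tau01 t0) (tauA t0) (A0 t0) (cabs_ge0 Z).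
rewrite /radial {1 2}/radial_inv radialN// K /radial_inv mulrA -rmorphM /=.
set m := ramp_inv _ _ _ in K *; have m0 : m != 0.
  apply/eqP => mE; move: K; rewrite mE ramp1 ?mulr0 ?A0 ?tau01// => /eqP.
  by rewrite eq_sym cabs_eq0 (negPf Z0).
by rewrite mulrA divfK// divff ?cabs_eq0// mul1r.
Qed.
Lemma radial_big t Z : 0 <= t -> r <= t \/ 2 * r * t <= cabs Z -> radial t Z = Z.
Proof.
move=> t0 h; have [->|Z0] := eqVneq Z 0; first by rewrite /radial mulr0.
suff -> : radial t Z = (cabs Z / cabs Z)%:C * Z by rewrite divff ?cabs_eq0// mul1r.
rewrite /radial; congr ((_ / _)%:C * _); case: h => h; last by apply: ramp3; rewrite ?tau01 ?cabs_ge0.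
rewrite min_r// divff ?gt_eqF// /ramp mul1r (_ : 2 * r * t - _ = cabs Z); last by ring.
by rewrite minxx maxxx.
Qed.
(** The uniform bound is what lets [unfold] extend by the identity to infinity. *)
Lemma radial_dist t Z : 0 <= t -> cabs (radial t Z - Z) <= 2 * r ^+ 2.
Proof.
move=> t0; have r2 : 0 <= 2 * r ^+ 2 by rewrite mulr_ge0// sqr_ge0.
have [h|h] := lerP r t; first by rewrite radial_big ?subrr ?cabs0//; left.
have [->|Z0] := eqVneq Z 0; first by rewrite /radial mulr0 subrr cabs0.
have [h1 h2 h3] := ramp_bound (tau01 t0) (A0 t0) (cabs_ge0 Z).
have Zp : 0 < cabs Z by rewrite cabs_gt0.
have -> : radial t Z - Z = ((ramp (2 * r * t) (Num.min t r / r) (cabs Z) - cabs Z) / cabs Z)%:C * Z.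
  by rewrite mulrBl divff ?gt_eqF// rmorphB rmorph1 mulrBl mul1r.
rewrite cabsM cabs_real normrM normfV (ger0_norm (cabs_ge0 Z)) divfK ?gt_eqF// distrC ger0_norm ?subr_ge0//.
by apply: le_trans h3 _; rewrite expr2 -!mulrA ler_wpM2l// ler_wpM2l// ltW.
Qed.
Definition unfold p (z : C * C) : C * C := let X := z.1 - p in let l := p ^+ 2 + 2%:R * p * X in (z.1, l + radial (cabs X) (z.2 - l)).
Definition unfold_inv p (z : C * C) : C * C := let X := z.1 - p in let l := p ^+ 2 + 2%:R * p * X in (z.1, l + radial_inv (cabs X) (z.2 - l)).
Lemma unfoldK p : cancel (unfold p) (unfold_inv p).
Proof. by move=> [x y]; rewrite /unfold /unfold_inv /= [_ + radial _ _]addrC addrK radialK ?cabs_ge0// addrC subrK. Qed.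
Lemma unfold_invK p : cancel (unfold_inv p) (unfold p).
Proof. by move=> [x y]; rewrite /unfold /unfold_inv /= [_ + radial_inv _ _]addrC addrK radial_invK ?cabs_ge0// addrC subrK. Qed.
Lemma radial_continuous (t : R) (Z : C) : 0 <= t -> tends (nbhs (t, Z)) (fun u : R * C => radial `|u.1| u.2) (radial t Z).
Proof.
move=> t0; have h1 : tends (nbhs (t, Z)) (fun u : R * C => u.1) t by exact: cvg_fst.
have h2 : tends (nbhs (t, Z)) (fun u : R * C => u.2) Z by exact: cvg_snd.
have h3' : tends (nbhs (t, Z)) (fun u : R * C => cabs u.1%:C) (cabs t%:C).
  by apply: tends_cabs; apply: tends_real; exact: h1.
have tE : cabs t%:C = t by rewrite cabs_real ger0_norm.
rewrite tE in h3'.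
have h3 : tends (nbhs (t, Z)) (fun u : R * C => `|u.1|) t by apply: tends_ext h3' => u; rewrite cabs_real.
have rn : r != 0 by rewrite gt_eqF.
have [Z0|Z0] := eqVneq Z 0; last first.
  have Z1 : cabs Z != 0 by rewrite cabs_eq0.
  by rewrite /radial /ramp; tendsto; exact: Z1.
have -> : radial t Z = 0 by rewrite /radial Z0 mulr0.
apply: (@cvgC_norm0 _ _ (nbhs (t, Z)) _ _ (fun u : R * C => cabs u.2)); last first.
  have : tends (nbhs (t, Z)) (fun u : R * C => cabs u.2) (cabs Z) by tendsto.
  by rewrite {2}Z0 cabs0.
apply: (@filterE _ (nbhs (t, Z))) => -[t' Z']; rewrite subr0 /=.
have [->|Z1] := eqVneq Z' 0; first by rewrite /radial mulr0 cabs0.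
have [h4 h5 _] := ramp_bound (tau01 (normr_ge0 t')) (A0 (normr_ge0 t')) (cabs_ge0 Z').
by rewrite /radial radialN.
Qed.
Lemma unfold_bihomeo p : bihomeo (affmap (unfold p)).
Proof.
apply: (affmap_bihomeo (B := 2 * r ^+ 2) _ (unfoldK p) (unfold_invK p)).
  move=> z; have h1 : tends (nbhs z) (fun z : C * C => z.1) z.1 by exact: cvg_fst.
  have h2 : tends (nbhs z) (fun z : C * C => z.2) z.2 by exact: cvg_snd.
  have h3 : tends (nbhs z) (fun z : C * C => (cabs (z.1 - p), z.2 - (p ^+ 2 + 2%:R * p * (z.1 - p)))) (cabs (z.1 - p), z.2 - (p ^+ 2 + 2%:R * p * (z.1 - p))) by tendsto.
  have h4 := tends_comp h3 (@radial_continuous (cabs (z.1 - p)) (z.2 - (p ^+ 2 + 2%:R * p * (z.1 - p))) (cabs_ge0 (z.1 - p))).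
  have h5 : tends (nbhs z) (fun z : C * C => radial (cabs (z.1 - p)) (z.2 - (p ^+ 2 + 2%:R * p * (z.1 - p)))) 
     (radial (cabs (z.1 - p)) (z.2 - (p ^+ 2 + 2%:R * p * (z.1 - p)))).
    by apply: tends_ext h4 => u; rewrite /= ger0_norm ?cabs_ge0.
  by rewrite /unfold; tendsto.
move=> z; rewrite /unfold /= subrr cabs0; split; first by rewrite mulr_ge0// sqr_ge0.
set l := p ^+ 2 + _; rewrite (_ : l + _ - z.2 = radial (cabs (z.1 - p)) (z.2 - l) - (z.2 - l)); last by ring.
by apply: radial_dist; exact: cabs_ge0.
Qed.
(** Relative to the tangent at [p], a line over the disc is the tangent itself, or crosses it at [p]
    with slope difference at least [2 r], or misses the crossing by a gap; so it lies at zero or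
    beyond the radius [2 r |X|], where [radial] is the identity. *)
Lemma unfold_line p i x : p \in P -> unfold p (x, br a b (Some i) x) = (x, br a b (Some i) x).
Proof.
move=> pP; rewrite /unfold /=; congr pair; set X := x - p.
have E : a i * x + b i - (p ^+ 2 + 2%:R * p * X) = (a i * p + b i - p ^+ 2) - (2%:R * p - a i) * X.
  have xE : x = X + p by rewrite subrK.
  by clearbody X; rewrite xE; ring.
set Z := a i * x + b i - _ in E *.
suff -> : radial (cabs X) Z = Z by rewrite addrC subrK.
have [h|h] := lerP r (cabs X); first by apply: radial_big; [exact: cabs_ge0|left].
have [ip|ip] := eqVneq (br a b (Some i) p) (br a b None p).
  have [q qP pq] := line_root N2 pP ip.
  move: ip => /= ip; rewrite ip subrr sub0r pq in E.
  have [pq0|npq] := eqVneq p q; first by rewrite E pq0 subrr mul0r oppr0 /radial mulr0.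
  apply: radial_big; first exact: cabs_ge0.
  by right; rewrite E cabsN cabsM ler_wpM2r ?cabs_ge0// P1.
apply: radial_big; first exact: cabs_ge0.
right; have := gP pP ip; rewrite /= => h1.
have h2 : cabs ((2%:R * p - a i) * X) <= 2 * B * r.
  rewrite cabsM; apply: ler_pM => //; rewrite ?cabs_ge0//; last exact: ltW.
  have h3 := cabsD (2%:R * p) (- a i); have h4 := cabsD p p; have h5 := N3 pP; have h6 := aB i; have h7 := cabs_ge0 (b i).
  rewrite -[p + p]mulr2n -[p *+ 2]mulr_natl in h4; rewrite cabsN in h3.
  by move: B1; lra.
have h3 := cabsD Z ((2%:R * p - a i) * X); rewrite {1}E subrK in h3.
by move: gB B1 r0 r8 (cabs_ge0 X) (ltW h); nra.
Qed.
(** The cone lies on the circle [|Z| = r |X|], where [radial] multiplies by [|X| / r] and so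
    restores [X^2]; the other cones vanish over this disc. *)
Lemma unfold_conic p s x : p \in P -> {subset s <= P} -> p \notin s -> uniq s ->
  unfold p (x, brM a b (p :: s) r None x) = (x, brM a b s r None x).
Proof.
move=> pP sP ps us; rewrite /unfold; congr pair => /=; rewrite big_cons; set X := x - p.
have [h|h] := lerP r (cabs X).
  rewrite radial_big ?cabs_ge0//; last by left.
  by rewrite cone_out// add0r addrC subrK.
have -> : \sum_(q <- s) cone r (x - q) = 0.
  rewrite big_seq big1// => q qs; apply: cone_out => //.
  have pq : p != q by apply: contraNneq ps => ->.
  have h1 := P1 pP (sP _ qs) pq; have h2 := cabs_tri p q x; have h3 := cabsB p x.
  by move: h h1 h2 h3; rewrite -/X; lra.
have xE : x = X + p by rewrite subrK.
have E : x ^+ 2 + (cone r X + 0) - (p ^+ 2 + 2%:R * p * X) = (r / cabs X)%:C * X ^+ 2.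
  by rewrite -coneE ?ltW// addr0; clearbody X; rewrite xE; ring.
rewrite E; have [X0|X0] := eqVneq X 0.
  rewrite X0 expr0n /= !mulr0 /radial mulr0 !addr0.
  by move/eqP: X0; rewrite subr_eq0 => /eqP ->.
have X1 : 0 < cabs X by rewrite cabs_gt0.
have Zn : cabs ((r / cabs X)%:C * X ^+ 2) = r * cabs X.
  by rewrite cabsM cabs_real cabsX ger0_norm ?divr_ge0 ?(ltW r0) ?(ltW X1)// expr2 mulrA divfK// gt_eqF.
have tE : Num.min (cabs X) r / r = cabs X / r by rewrite min_l// ltW.
rewrite /radial Zn tE ramp1.
- have -> : cabs X / r * (r * cabs X) = cabs X * cabs X by rewrite mulrA divfK// gt_eqF.
  rewrite mulrA -rmorphM /= [X in X%:C](_ : _ = 1); last by field; rewrite !gt_eqF.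
  by rewrite mul1r addr0; clearbody X; rewrite xE; ring.
- by rewrite divr_ge0 ?ler_pdivrMr ?mul1r ?(ltW r0) ?(ltW X1)//= ltW.
- by rewrite mulr_ge0 ?ltW.
- by rewrite mulrA.
Qed.
Lemma unfold_curve p s : p \in P -> {subset s <= P} -> p \notin s -> uniq s ->
  affmap (unfold p) @` curve_of a b (brM a b (p :: s) r) = curve_of a b (brM a b s r).
Proof.
move=> pP sP ps us.
have E j x : unfold p (x, brM a b (p :: s) r j x) = (x, brM a b s r j x).
  by case: j => [i|]; [exact: unfold_line|exact: unfold_conic].
have E0 j : affmap (unfold p) (chartI a b j (0, 0)) = chartI a b j (0, 0).
  case: j => [i|] /=.
    rewrite /affptx /= affmap_inf ?mkvE// mkv_eq0 oner_eq0//.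
  have -> : chartQ (0, 0) = affpty (0, 0) :> CP2 R by rewrite /chartQ /weighted_twist /= !mulr0 expr0n addr0.
  by rewrite /affpty /= affmap_inf ?mkvE ?mkv_eq0 ?oner_eq0 ?andbF.
apply/seteqP; split => v.
  move=> [_ [j [[x ->]|->]] <-]; exists j; last by right.
  by left; exists x; rewrite affmap_affpt E.
move=> [j [[x ->]|->]].
  by exists (affpt (x, brM a b (p :: s) r j x)); [exists j; left; exists x|rewrite affmap_affpt E].
by exists (chartI a b j (0, 0)) => //; exists j; right.
Qed.
Lemma nbhd_homeo_refl (X : topologicalType) (S : set X) : nbhd_homeo S S.
Proof.
exists setT, setT, id, id; split; [|by []|by rewrite image_id].
by split; [exact: openT|exact: openT| |] => x _; split => //; exact: cvg_id.
Qed.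
Lemma unfold_nbhd : nbhd_homeo (curve_of a b (brM a b P r)) (curve_of a b (br a b)).
Proof.
have -> : br a b = brM a b [::] r.
  by apply/funext => -[i|]; apply/funext => x //=; rewrite big_nil addr0.
suff h s : {subset s <= P} -> uniq s -> nbhd_homeo (curve_of a b (brM a b s r)) (curve_of a b (brM a b [::] r)).
  exact: h.
elim: s => [|p s IH] sP; first by move=> _; exact: nbhd_homeo_refl.
move=> /andP[ps us]; have sP' : {subset s <= P} by move=> q qs; apply: sP; rewrite inE qs orbT.
have pP : p \in P by apply: sP; exact: mem_head.
apply: nbhd_homeo_trans (IH sP' us); rewrite -(unfold_curve pP sP' ps us).
by apply: bihomeo_nbhd; exact: unfold_bihomeo.
Qed.
End Unfold.

Section PosLowerBound.
Variable R : realType.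
Lemma pos_lower_bound (s : seq R) : exists2 m, 0 < m <= 1 & forall x, x \in s -> 0 < x -> m <= x.
Proof.
elim: s => [|x s [m /andP[m0 m1] ms]]; first by exists 1 => //; rewrite ltr01 lexx.
have [x0|x0] := ltP 0 x; last first.
  exists m; first by rewrite m0.
  by move=> y; rewrite inE => /orP[/eqP->|/ms//]; rewrite ltNge x0.
exists (Num.min m x); first by rewrite lt_min m0 x0 ge_min m1.
by move=> y; rewrite inE => /orP[/eqP-> _|ys y0]; rewrite ge_min ?lexx ?orbT// ms.
Qed.
End PosLowerBound.

Section Constants.
Variables (R : realType) (n : nat).
Notation C := R[i].
Notation J := (option 'I_n).
(** The equations [a i = p + q], [b i = - (p * q)] say that line [i] is the chord of the parabola
    over [p] and [q], or the tangent if [p = q]. *)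
Definition normal_lines (a b : 'I_n -> C) (P : seq C) := [/\ uniq P,
  forall i k, i != k -> a i != a k /\ exists2 p, p \in P & a i * p + b i = a k * p + b k,
  forall i, exists p q, [/\ p \in P, q \in P, a i = p + q & b i = - (p * q)]
  & forall p, p \in P -> cabs p <= 1 / 8].
Lemma normal_tubes a b P : normal_lines a b P -> small_tubes (curve_of a b (br a b)).
Proof.
move=> [uP N1 N2 N3].
(* The curve fixes the gaps [g] over crossing abscissas, the distances [m1] of these, the slope
   differences [m2] and the bound [B]. Then the disc radius [r], the separation rate [d] and the
   tube width [e0] are chosen in turn, each small against what precedes it. *)
have [g /andP[g0 g1] gP] := pos_lower_bound [seq cabs (br a b j.1 p - br a b j.2 p) | p <- P, j <- enum {: J * J}].
have [m1 /andP[m10 m11] m1P] := pos_lower_bound [seq cabs (p - q) | p <- P, q <- P].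
have [m2 /andP[m20 m21] m2P] := pos_lower_bound [seq cabs (a i - a k) | i <- enum 'I_n, k <- enum 'I_n].
pose B : R := 1 + \sum_i (cabs (a i) + cabs (b i)).
have S0 i : 0 <= cabs (a i) + cabs (b i) by rewrite addr_ge0 ?cabs_ge0.
have B1 : 1 <= B by rewrite lerDl sumr_ge0.
have aB i : cabs (a i) + cabs (b i) <= B.
  by rewrite /B (bigD1 i)//= addrCA lerDl addr_ge0// sumr_ge0.
have B0 : 0 < B by exact: lt_le_trans B1.
pose r := Num.min (1 / 8) (Num.min (m1 / 2) (g / (4 * B))).
have r0 : 0 < r by rewrite !lt_min !divr_gt0 ?mulr_gt0.
have r8 : r <= 1 / 8 by rewrite ge_min lexx.
have rm : r <= m1 / 2 by rewrite !ge_min lexx !orbT.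
have rg : 4 * B * r <= g.
  have : r <= g / (4 * B) by rewrite !ge_min lexx !orbT.
  by rewrite ler_pdivlMr ?mulr_gt0// mulrC.
pose d := Num.min r m2 / 3.
have d0 : 0 < d by rewrite divr_gt0// lt_min r0.
have d3 : 3 * d = Num.min r m2 by rewrite mulrC divfK.
have [kB [k0 kE]] : exists k, 0 < k /\ k = 4096 * B ^+ 2.
  exists (4096 * B ^+ 2); split; last by [].
  by apply: mulr_gt0; [lra|exact: exprn_gt0].
pose e0 := Num.min (Num.min (g / 6) (r ^+ 2 / 3)) (Num.min (d * r / 2) kB^-1).
have e00 : 0 < e0.
  rewrite !lt_min invr_gt0 k0 andbT; apply/andP; split; first apply/andP; first split.
  - exact: divr_gt0.
  - by apply: divr_gt0 => //; exact: exprn_gt0.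
  - by apply: divr_gt0 => //; exact: mulr_gt0.
have e1 : 6 * e0 <= g.
  have : e0 <= g / 6 by rewrite !ge_min lexx.
  lra.
have e2 : 3 * e0 <= r ^+ 2.
  have : e0 <= r ^+ 2 / 3 by rewrite !ge_min lexx !orbT.
  lra.
have e3 : 2 * e0 <= d * r.
  have : e0 <= d * r / 2 by rewrite !ge_min lexx !orbT.
  lra.
have e4 : 4096 * B ^+ 2 * e0 <= 1.
  rewrite -kE mulrC -ler_pdivlMr// div1r; by rewrite !ge_min lexx !orbT.
have P1 p q : p \in P -> q \in P -> p != q -> 2 * r <= cabs (p - q).
  move=> pP qP pq; have : m1 <= cabs (p - q).
    by apply: m1P; [exact: (allpairs_f (fun p q => cabs (p - q)))|rewrite cabs_gt0 subr_eq0].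
  by move: rm; lra.
have da i k : i != k -> 3 * d <= cabs (a i - a k).
  move=> /N1[ik _]; have h : m2 <= cabs (a i - a k).
    by apply: m2P; [apply: (allpairs_f (fun i k => cabs (a i - a k))); rewrite mem_enum|rewrite cabs_gt0 subr_eq0].
  by rewrite d3; apply: le_trans h; rewrite ge_min lexx orbT.
have dr : 3 * d <= r by rewrite d3 ge_min lexx.
have gP' p j k : p \in P -> br a b j p != br a b k p -> g <= cabs (br a b j p - br a b k p).
  move=> pP jk; apply: gP; last by rewrite cabs_gt0 subr_eq0.
  by apply: (allpairs_f (fun p (j : J * J) => cabs (br a b j.1 p - br a b j.2 p)) pP (_ : (j, k) \in _)); rewrite mem_enum.
have N1' i k : i != k -> exists2 p, p \in P & a i * p + b i = a k * p + b k by move=> /N1[].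
have h1 := model_tubes uP N1' N2 N3 r0 r8 d0 dr P1 da B1 aB rg gP' e00 e1 e2 e3 e4.
exact: small_tubes_homeo (unfold_nbhd uP N2 N3 r0 r8 P1 B1 aB rg gP') h1.
Qed.
End Constants.

(** * Moving finitely many points *)
Section Config.
Variable R : realType.
Notation C := R[i].
Definition bump (e t : R) := Num.max 0 (Num.min 1 (2 - `|t| / e)).
Lemma bump_bound e t : 0 <= bump e t <= 1.
Proof. by rewrite /bump le_max lexx /= ge_max ler01 ge_min lexx. Qed.
Lemma bump1 e t : 0 < e -> `|t| <= e -> bump e t = 1.
Proof. by move=> e0 te; rewrite /bump min_l ?max_r//; have : `|t| / e <= 1 by [rewrite ler_pdivrMr// mul1r]; lra. Qed.
Lemma bump0 e t : 0 < e -> 2 * e <= `|t| -> bump e t = 0.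
Proof.
move=> e0 te; have h : 2 <= `|t| / e by rewrite ler_pdivlMr.
by rewrite /bump max_l// ge_min; apply/orP; right; lra.
Qed.
Lemma tends_normr (T : Type) (F : set_system T) {FF : Filter F} (f : T -> R) a : tends F f a -> tends F (fun t => `|f t|) `|a|.
Proof.
move=> h; have h1 : tends F (fun t => cabs (f t)%:C) (cabs a%:C) by apply: tends_cabs; apply: tends_real.
by rewrite cabs_real in h1; apply: tends_ext h1 => t; rewrite cabs_real.
Qed.
Lemma bump_continuous (T : Type) (F : set_system T) {FF : Filter F} (f : T -> R) a e :
  tends F f a -> tends F (fun t => bump e (f t)) (bump e a).
Proof. by move=> h; have h1 : tends F (fun t => `|f t|) `|a| by [apply: tends_normr]; rewrite /bump; tendsto. Qed.
(** The value at a new point is corrected by a bump. Its plateau radius [d] is at most a third of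
    the distance to the other points, so their plateaus avoid its support of radius [2 d]. *)
Lemma step_function (T : seq R) (c : R -> R) : exists g e G M, [/\ continuous g, 0 < e,
  forall t x, t \in T -> `|x| <= e -> g (t + x) = c t, forall t, `|g t| <= G & forall t, M <= `|t| -> g t = 0].
Proof.
elim: T => [|t0 T [g [e [G [M [cg e0 gT gG gM]]]]]].
  exists (fun=> 0), 1, 0, 0; split => //; first by move=> x; exact: cvg_cst.
  by move=> t; rewrite normr0.
have [t0T|t0T] := boolP (t0 \in T).
  by exists g, e, G, M; split => // t x; rewrite inE => /orP[/eqP->|tT]; exact: gT.
have [m /andP[m0 _] mP] := pos_lower_bound [seq `|t - t0| | t <- T].
pose d := Num.min e (m / 3); have d0 : 0 < d by rewrite lt_min e0 divr_gt0.
have de : d <= e by rewrite ge_min lexx.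
have dm : d <= m / 3 by rewrite ge_min lexx orbT.
exists (fun t => g t + (c t0 - g t) * bump d (t - t0)), d, (G + (`|c t0| + G)), (Num.max M (`|t0| + 2 * d)); split => //.
- move=> t; have hg : tends (nbhs t) g (g t) := cg t.
  have h1 : tends (nbhs t) (fun t => t - t0) (t - t0) by tendsto.
  have h2 : tends (nbhs t) (fun t => bump d (t - t0)) (bump d (t - t0)) by apply: bump_continuous.
  by tendsto.
- move=> t x; rewrite inE => /orP[/eqP->|tT] xd.
    by rewrite addrAC subrr add0r bump1// mulr1 addrC subrK.
  rewrite bump0 ?mulr0 ?addr0//; first by apply: gT => //; exact: le_trans de.
  have tm : m <= `|t - t0|.
    apply: mP; first exact: (map_f (fun t => `|t - t0|)).
    by rewrite normr_gt0 subr_eq0; apply: contraNneq t0T => <-.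
  have := ler_normD (t + x - t0) (- x); rewrite normrN (_ : t + x - t0 - x = t - t0); last by ring.
  by lra.
- move=> t; have /andP[b0 b1] := bump_bound d (t - t0); apply: le_trans (ler_normD _ _) _; apply: lerD => //.
  rewrite normrM (ger0_norm b0); apply: le_trans (_ : `|c t0 - g t| <= _); first by rewrite ler_piMr.
  by apply: le_trans (ler_normB _ _) _; rewrite lerD2l.
- move=> t; rewrite ge_max => /andP[tM td]; rewrite gM// bump0 ?mulr0 ?addr0//.
  by have := ler_normD (t - t0) t0; rewrite subrK; lra.
Qed.
Lemma section_in (S T : eqType) (x0 : S) (s : seq S) (f : S -> T) : {in s &, injective f} ->
  exists h, forall x, x \in s -> h (f x) = x.
Proof.
move=> fI; exists (fun t => nth x0 s (index t (map f s))) => x xs.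
have fs : f x \in map f s by exact: map_f.
have i_s : (index (f x) (map f s) < size s)%N by rewrite -(size_map f) index_mem.
apply: fI => //; first exact: mem_nth.
by rewrite -(nth_map x0 (f x0))// nth_index.
Qed.
Definition chomeo (phi : C -> C) := [/\ continuous phi, exists psi, cancel phi psi /\ cancel psi phi
  & exists K, forall x, K <= cabs x -> phi x = x].
(** A translation near each point, not merely a prescribed value: this preserves the quadratic term
    of the conic at a crossing. *)
Definition moves (Z : seq C) (w phi : C -> C) := exists2 e, 0 < e & forall z X, z \in Z -> cabs X <= e -> phi (z + X) = w z + X.
Lemma bij_inverse (S T : Type) (f : S -> T) : injective f -> (forall y, exists x, f x = y) ->
  exists g, cancel f g /\ cancel g f.
Proof. by move=> fI /choice[g gf]; exists g; split => // x; apply: fI; rewrite gf. Qed.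
Definition cutoff (M L s : R) := Num.max 0 (Num.min 1 ((M + L - `|s|) / L)).
Lemma cutoff_lip M L s t : 0 < L -> `|cutoff M L s - cutoff M L t| <= `|s - t| / L.
Proof.
move=> L0; rewrite /cutoff; set u := (M + L - `|s|) / L; set v := (M + L - `|t|) / L.
have uv : `|u - v| <= `|s - t| / L.
  rewrite (_ : u - v = (`|t| - `|s|) / L); last by rewrite /u /v -mulrBl; congr (_ / _); ring.
  rewrite normrM (gtr0_norm (_ : 0 < L^-1)) ?invr_gt0// ler_pM2r ?invr_gt0//.
  by rewrite distrC; exact: ler_dist_dist.
apply: le_trans uv.
have clip (x y : R) : x <= y -> 0 <= Num.max 0 (Num.min 1 y) - Num.max 0 (Num.min 1 x) <= y - x.
  move=> xy; have [y1|y1] := lerP 1 y; have [x1|x1] := lerP 1 x; rewrite ?(max_r ler01).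
  - by apply/andP; split; lra.
  - by have [x0|x0] := lerP 0 x; apply/andP; split; lra.
  - by exfalso; lra.
  - by have [x0|x0] := lerP 0 x; have [y0|y0] := lerP 0 y; apply/andP; split; lra.
have [h|h] := lerP u v.
  by have /andP[h1 h2] := clip _ _ h; rewrite distrC ger0_norm.
by have /andP[h1 h2] := clip _ _ (ltW h); rewrite ger0_norm.
Qed.
Lemma cutoff_bound M L s : 0 <= cutoff M L s <= 1.
Proof. by rewrite /cutoff le_max lexx /= ge_max ler01 ge_min lexx. Qed.
Lemma cutoff_continuous (T : Type) (F : set_system T) {FF : Filter F} (f : T -> R) a M L :
  tends F f a -> tends F (fun t => cutoff M L (f t)) (cutoff M L a).
Proof. by move=> h; have h1 : tends F (fun t => `|f t|) `|a| by [apply: tends_normr]; rewrite /cutoff; tendsto. Qed.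
(** The cutoff has Lipschitz constant [1 / L], so the map differs from the identity by a contraction
    of factor 1/2 and is injective; surjectivity is the intermediate value theorem. *)
Lemma cutoff_shear_bij M L c : 0 < L -> 2 * `|c| <= L ->
  injective (fun s => s + c * cutoff M L s) /\ forall v, exists s, s + c * cutoff M L s = v.
Proof.
move=> L0 cL; split=> [s t E|v].
  have h : `|s - t| <= `|s - t| / 2.
    rewrite (_ : s - t = c * (cutoff M L t - cutoff M L s)); last by rewrite mulrBr; move: E; lra.
    rewrite {1}normrM; apply: le_trans (ler_wpM2l (normr_ge0 c) (cutoff_lip M t s L0)) _.
    rewrite -(_ : s - t = c * (cutoff M L t - cutoff M L s)); last by rewrite mulrBr; move: E; lra.
    rewrite distrC mulrA mulrAC [leRHS]mulrC ler_wpM2r//.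
    by rewrite ler_pdivrMr//; lra.
  by apply/eqP; rewrite -subr_eq0 -normr_le0; have := normr_ge0 (s - t); lra.
have hc s : `|c * cutoff M L s| <= `|c|.
  by have /andP[c0 c1] := cutoff_bound M L s; rewrite normrM (ger0_norm c0) ler_piMr.
have cont : {within `[v - `|c|, v + `|c|], continuous (fun s => s + c * cutoff M L s)}.
  apply: continuous_subspaceT => s.
  have h0 : tends (nbhs s) (fun s : R => s) s by exact: tends_id.
  have h1 : tends (nbhs s) (cutoff M L) (cutoff M L s) by apply: cutoff_continuous h0.
  by tendsto.
have ab : v - `|c| <= v + `|c| by have := normr_ge0 c; lra.
have [|s _ sE] := IVT ab cont (v := v); last by exists s.
have := hc (v - `|c|); have := hc (v + `|c|); rewrite !ler_norml => /andP[h1 h2] /andP[h3 h4].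
by rewrite ge_min le_max; apply/andP; split; apply/orP; [left|right]; lra.
Qed.
(** Points at different heights are shifted horizontally by independent amounts, a step function of
    the height, cut off far away. *)
Lemma shear_pushing (Z : seq C) (w : C -> C) : {in Z &, injective (@complex.Im R)} ->
  (forall z, z \in Z -> complex.Im (w z) = complex.Im z) -> exists2 phi, chomeo phi & moves Z w phi.
Proof.
move=> ImI Imw; have [h hP] := section_in 0 ImI.
pose c t := complex.Re (w (h t)) - complex.Re (h t).
have [g [e [G [Mg [cg e0 gT gG gM]]]]] := step_function [seq complex.Im z | z <- Z] c.
pose M := 1 + \sum_(z <- Z) cabs z.
have MP z : z \in Z -> cabs z + 1 <= M.
  move=> zZ; rewrite /M addrC lerD2l (big_rem z zZ) /= lerDl sumr_ge0// => *; exact: cabs_ge0.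
have G0 : 0 <= G by apply: le_trans (gG 0).
pose L := 2 * G + 1; have L0 : 0 < L by rewrite /L; lra.
have bij t := @cutoff_shear_bij M L (g t) L0 (ltac:(have := gG t; rewrite /L; lra)).
pose phi (z : C) : C := (complex.Re z + g (complex.Im z) * cutoff M L (complex.Re z)) +i* complex.Im z.
exists phi; first split.
- suff cphi (z : C) : tends (nbhs z) phi (phi z) by move=> z; exact: cphi.
  have h0 : tends (nbhs z) (fun z : C => z) z by exact: tends_id.
  have h1 : tends (nbhs z) (fun z : C => complex.Re z) (complex.Re z) by tendsto.
  have h2 : tends (nbhs z) (fun z : C => complex.Im z) (complex.Im z) by tendsto.
  have h3 : tends (nbhs z) (fun z : C => cutoff M L (complex.Re z)) (cutoff M L (complex.Re z)) by apply: cutoff_continuous h1.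
  have h4 : tends (nbhs z) (fun z : C => g (complex.Im z)) (g (complex.Im z)) := tends_comp h2 (cg _).
  by rewrite /phi; tendsto.
- apply: bij_inverse => [[x y] [x' y'] [E Ey]|[x y]].
    by rewrite Ey /= in E *; have [I _] := bij y'; rewrite (I _ _ E).
  by have [_ /(_ x)[s sE]] := bij y; exists (s +i* y); rewrite /phi /= sE.
- exists (Mg + (M + L)) => -[x y] xy; rewrite /phi /=.
  have [yM|yM] := lerP Mg `|y|; first by rewrite gM// mul0r addr0.
  suff -> : cutoff M L x = 0 by rewrite mulr0 addr0.
  have hx : M + L <= `|x|.
    have := cabsD x%:C (0 +i* y); rewrite (_ : x%:C + (0 +i* y) = x +i* y); last by rewrite /=; apply/eqP; rewrite eq_complex /= addr0 add0r !eqxx.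
    have yE : cabs (0 +i* y) = `|y| by rewrite /cabs normc_def /= expr0n /= add0r sqrtr_sqr.
    by rewrite cabs_real yE; lra.
  rewrite /cutoff max_l// ge_min; apply/orP; right.
  by rewrite pmulr_lle0 ?invr_gt0//; lra.
exists (Num.min e 1); first by rewrite lt_min e0 ltr01.
move=> z X zZ; rewrite le_min => /andP[Xe X1].
have ImX := cabs_Im X; have ReX := cabs_Re X; have Rez := cabs_Re z.
have cE : cutoff M L (complex.Re (z + X)) = 1.
  rewrite /cutoff min_l ?max_r// ler_pdivlMr// mul1r.
  by rewrite raddfD /=; have := ler_normD (complex.Re z) (complex.Re X); have := MP z zZ; lra.
have gE : g (complex.Im (z + X)) = complex.Re (w z) - complex.Re z.
  rewrite raddfD /= gT; [by rewrite /c hP|exact: map_f|exact: le_trans ImX Xe].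
rewrite /phi cE gE; apply/eqP; rewrite eq_complex /= !raddfD /= Imw// eqxx andbT; apply/eqP; ring.
Qed.
Lemma chomeo_comp phi psi : chomeo phi -> chomeo psi -> chomeo (psi \o phi).
Proof.
move=> [c1 [f1 [k1 l1]] [K1 h1]] [c2 [f2 [k2 l2]] [K2 h2]]; split.
- by move=> x; apply: continuous_comp; [exact: c1|exact: c2].
- by exists (f1 \o f2); split; exact: can_comp.
- by exists (Num.max K1 K2) => x; rewrite ge_max => /andP[x1 x2]; rewrite /= h1// h2.
Qed.
Lemma moves_comp Z w w' phi psi : moves Z w phi -> moves (map w Z) w' psi -> moves Z (w' \o w) (psi \o phi).
Proof.
move=> [e e0 h] [e' e'0 h']; exists (Num.min e e'); first by rewrite lt_min e0.
by move=> z X zZ; rewrite le_min => /andP[Xe Xe']; rewrite /= h// h'//; exact: map_f.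
Qed.
Lemma pushing_conj (T T' : C -> C) (k : R) Z w phi : 0 < k -> (forall x, cabs (T x) = k * cabs x) -> {morph T : x y / x + y} ->
  continuous T -> continuous T' -> cancel T T' -> cancel T' T ->
  chomeo phi -> moves (map T Z) (T \o w \o T') phi -> chomeo (T' \o phi \o T) /\ moves Z w (T' \o phi \o T).
Proof.
move=> k0 Tk TD cT cT' TK T'K [c [f [fk kf]] [K hK]] [e e0 h]; split; first split.
- move=> x; apply: continuous_comp; first exact: cT.
  by apply: continuous_comp; [exact: c|exact: cT'].
- exists (T' \o f \o T); split => x /=; by rewrite T'K ?fk ?kf TK.
- by exists (K / k) => x; rewrite ler_pdivrMr// mulrC => xK; rewrite /= hK ?Tk// TK.
exists (e / k); first by rewrite divr_gt0.
move=> z X zZ; rewrite ler_pdivlMr// mulrC => Xe.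
by rewrite /= TD h ?Tk//; [rewrite /= TK -TD TK|exact: map_f].
Qed.
Definition cswap (z : C) : C := complex.Im z +i* complex.Re z.
(** After multiplication by a suitable [om] the sources have distinct imaginary and the targets
    distinct real parts. A horizontal shear gives each point the real part of its target; a vertical
    one, obtained by conjugating with [cswap], then adjusts the imaginary part. *)
Lemma point_pushing Z w : {in Z &, injective w} -> exists2 phi, chomeo phi & moves Z w phi.
Proof.
move=> wI.
pose bad (d : C) := [:: - complex.Re d / complex.Im d; complex.Im d / complex.Re d].
pose bads := flatten [seq bad (z.1 - z.2) ++ bad (w z.1 - w z.2) | z <- [seq (x, y) | x <- Z, y <- Z]].
(* Avoids the finitely many values for which two of these real or imaginary parts coincide after
   multiplication by [tau + i]. *)
pose tau := 1 + \sum_(x <- bads) `|x|.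
have tauP x : x \in bads -> x != tau.
  move=> xb; apply/eqP => E; have : `|x| < tau by rewrite /tau (big_rem x xb) /= addrCA ltrDl ltr_wpDr// sumr_ge0.
  by rewrite E; have := ler_norm tau; lra.
pose om : C := tau +i* 1.
have om0 : om != 0 by apply/eqP => -[_ /eqP]; rewrite oner_eq0.
have zbad z z' x : z \in Z -> z' \in Z -> x \in bad (z - z') ++ bad (w z - w z') -> x != tau.
  move=> zZ z'Z xb; apply: tauP; apply/flatten_mapP; exists (z, z') => //.
  exact: (allpairs_f (fun x y => (x, y))).
have ImG d : d != 0 -> - complex.Re d / complex.Im d != tau -> complex.Im (om * d) != 0.
  case: d => x y; rewrite eq_complex /= => d0 dt; rewrite mul1r; have [y0|y0] := eqVneq y 0.
    by move: d0; rewrite y0 eqxx andbT mulr0 add0r.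
  by apply: contraNneq dt => E; apply/eqP; apply: (canLR (mulfK y0)); move: E; lra.
have ReG d : d != 0 -> complex.Im d / complex.Re d != tau -> complex.Re (om * d) != 0.
  case: d => x y; rewrite eq_complex /= => d0 dt; rewrite mul1r; have [x0|x0] := eqVneq x 0.
    by move: d0; rewrite x0 eqxx /= mulr0 sub0r oppr_eq0.
  by apply: contraNneq dt => E; apply/eqP; apply: (canLR (mulfK x0)); move: E; lra.
have Im_sub (x y : C) : complex.Im (x - y) = complex.Im x - complex.Im y by case: x; case: y.
have Re_sub (x y : C) : complex.Re (x - y) = complex.Re x - complex.Re y by case: x; case: y.
have MB (x y : C) : om * (x - y) = om * x - om * y by exact: mulrBr.
have ImI z z' : z \in Z -> z' \in Z -> complex.Im (om * z) = complex.Im (om * z') -> z = z'.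
  move=> zZ z'Z E; apply/eqP/negPn/negP; rewrite -subr_eq0 => d0.
  have := ImG _ d0; rewrite MB (Im_sub (om * z)) E subrr eqxx => h; have /h : - complex.Re (z - z') / complex.Im (z - z') != tau; last by [].
  by apply: (zbad z z'); rewrite // mem_cat inE eqxx.
have ReI z z' : z \in Z -> z' \in Z -> complex.Re (om * w z) = complex.Re (om * w z') -> z = z'.
  move=> zZ z'Z E; apply: wI => //; apply/eqP/negPn/negP; rewrite -subr_eq0 => d0.
  have := ReG _ d0; rewrite MB (Re_sub (om * w z)) E subrr eqxx => h; have /h : complex.Im (w z - w z') / complex.Re (w z - w z') != tau; last by [].
  by apply: (zbad z z'); rewrite // mem_cat !inE eqxx !orbT.
pose T x := om * x; pose T' x := om^-1 * x.
have cM (k : C) : continuous (fun x : C => k * x) by move=> x; tendsto.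
have TK : cancel T T' by move=> x; rewrite /T /T' mulKf.
have T'K : cancel T' T by move=> x; rewrite /T /T' mulVKf.
have k0 : 0 < cabs om by rewrite cabs_gt0.
suff [phi hphi mphi] : exists2 phi, chomeo phi & moves (map T Z) (T \o w \o T') phi.
  have [h1 h2] := @pushing_conj T T' (cabs om) Z w phi k0 (fun x => cabsM om x) (mulrDr om) (@cM om) (@cM om^-1) TK T'K hphi mphi.
  by exists (T' \o phi \o T).
pose w1 (x : C) : C := complex.Re (T (w (T' x))) +i* complex.Im x.
have [phi1 hphi1 mphi1] : exists2 phi, chomeo phi & moves (map T Z) w1 phi.
  apply: shear_pushing => [_ _ /mapP[z zZ ->] /mapP[z' z'Z ->]|//].
  by move=> /(ImI _ _ zZ z'Z) ->.
have ReI' : {in Z &, injective (fun z => complex.Re (om * w z))} by move=> z z' zZ z'Z; exact: ReI.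
have [h hP] := section_in 0 ReI'.
pose w2 (x : C) : C := T (w (h (complex.Re x))).
have w21 x : x \in map T Z -> w2 (w1 x) = T (w (T' x)).
  by move=> /mapP[z zZ ->]; rewrite /w2 /= TK hP.
pose S := cswap.
have SK : cancel S S by case.
have SD : {morph S : x y / x + y} by move=> [a b] [c d].
have cS : continuous S.
  move=> x; have h0 : tends (nbhs x) (fun z : C => z) x by exact: tends_id.
  by have h1 := tends_Re h0; have h2 := tends_Im h0; rewrite /S /cswap; tendsto.
have Sk x : cabs (S x) = 1 * cabs x by rewrite mul1r /cabs !normc_def /= addrC.
have [phi2 hphi2 mphi2] : exists2 phi, chomeo phi & moves (map w1 (map T Z)) w2 phi.
  have [phi hphi mphi] : exists2 phi, chomeo phi & moves (map S (map w1 (map T Z))) (S \o w2 \o S) phi.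
    apply: shear_pushing => [_ _ /mapP[_ /mapP[_ /mapP[z zZ ->] ->] ->] /mapP[_ /mapP[_ /mapP[z' z'Z ->] ->] ->]|_ /mapP[_ /mapP[_ /mapP[z zZ ->] ->] ->]].
      by rewrite /= !TK => E; rewrite (ReI _ _ zZ z'Z E).
    by rewrite /= SK w21 ?map_f //= TK.
  have [h1 h2] := @pushing_conj S S 1 _ _ phi ltr01 Sk SD cS cS SK SK hphi mphi.
  by exists (S \o phi \o S).
exists (phi2 \o phi1); first exact: chomeo_comp.
have [e e0 he] := moves_comp mphi1 mphi2; exists e => // z X zZ Xe.
by rewrite he//= w21.
Qed.
Lemma chomeo_bound phi : chomeo phi -> exists B, forall x, cabs (phi x) <= cabs x + B.
Proof.
move=> [_ [f [fk kf]] [K hK]]; exists (`|K|) => x; have K1 := ler_norm K.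
have [h|h] := lerP K (cabs x); first by rewrite hK// lerDl.
have [h2|h2] := lerP K (cabs (phi x)); last by have := cabs_ge0 x; lra.
have : phi x = x by apply: (can_inj fk); apply: hK.
by move=> E; rewrite E in h2; move: h; rewrite ltNge h2.
Qed.
End Config.

(** * Transport between normal forms *)
Section Glue.
Variable R : realType.
Notation X := (CP2 R).
Lemma bihomeo_ohomeo (f : X -> X) U : bihomeo f -> open U -> exists V k, ohomeo U V f k.
Proof.
move=> [k [cf ck fk kf]] oU; have h : ohomeo setT setT f k.
  split; [exact: openT|exact: openT| |]; move=> x _; split=> //; first [exact: fk|exact: cf|exact: kf|exact: ck].
by exists (f @` U), k; exact: ohomeo_sub h oU (@subsetT _ U).
Qed.
Variables (I Pt : finType) (D : I -> set X) (W : Pt -> set X) (Hm : I -> X -> X) (Km : Pt -> X -> X).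
Hypothesis cD : forall i, compact (D i).
Hypothesis hH : forall i, bihomeo (Hm i).
Hypothesis hK : forall p, bihomeo (Km p).
Hypothesis oW : forall p, open (W p).
Hypothesis dW : forall p q v, W p v -> W q v -> p = q.
Hypothesis DW : forall i j v, i != j -> D i v -> D j v -> exists p, W p v.
(** Serves at the boundary of [W p], where both definitions of the glued map occur nearby. *)
Hypothesis KH_near : forall i p v, D i v -> (forall q, ~ W q v) -> \forall w \near v, W p w -> Km p w = Hm i w.
Hypothesis KH : forall i p v, D i v -> W p v -> Km p v = Hm i v.
Hypothesis HI : forall i j v w, D i v -> D j w -> Hm i v = Hm j w -> v = w.
Hypothesis D0 : exists i v, D i v.
(** The map is [Km p] in [W p], and elsewhere the [Hm i] of the one component nearby. It is locally
    a homeomorphism along the compact union and injective on it, so [local_homeo_nbhd] applies. *)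
Lemma glue : nbhd_homeo (\bigcup_i D i) (\bigcup_i (Hm i @` D i)).
Proof.
pose E i := D i `&` ~` (\bigcup_p W p).
have oWs : open (\bigcup_p W p) by apply: bigcup_open => p _; exact: oW.
have clE i : closed (E i) by apply: closedI; [exact: compact_closed_CP2|exact: open_closedC].
(* Outside the crossing neighborhoods the components are disjoint closed sets, and normality
   separates them. *)
have /choice[V VP] : forall i, exists A : set X, (forall v, E i v -> nbhs v A) /\
    forall j, j != i -> forall v, E j v -> ~ closure A v.
  move=> i.
  have nX : normal_space X by apply: compact_normal; [exact: CP2_hausdorff|exact: CP2_compact].
  pose O := ~` [set v | exists2 j, j != i & E j v].
  have oO : open O.
    have -> : O = [set v | forall j, j != i -> ~ E j v].
      by apply/seteqP; split => v /= h; [move=> j ji Ej; apply: h; exists j|move=> [j ji Ej]; exact: (h j)].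
    rewrite openE => v /= h; rewrite /interior.
    have h2 j : \forall w \near v, j != i -> ~ E j w.
      have [->|ji] := eqVneq j i; first by apply: (@filterE _ (nbhs v)).
      have : nbhs v (~` E j) by apply: open_nbhs_nbhs; split; [exact: closed_openC|exact: h].
      by apply: (@filterS _ (nbhs v)) => w nw _.
    exact: (@filter_forall _ I (fun j w => j != i -> ~ E j w) (nbhs v) _ h2).
  have SO : set_nbhs (E i) O.
    apply/set_nbhsP; exists O; split => // v Ev [j ji Ej].
    have ij : i != j by rewrite eq_sym.
    by have [p Wp] := DW ij Ev.1 Ej.1; case: Ev => _; apply; exists p.
  have [A /set_nbhsP[B [oB EB BA]] AO] := nX (E i) (clE i) O SO.
  exists A; split=> [v Ev|j ji v Ej cv]; last by apply: (AO _ cv); exists j.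
  by apply: (@filterS _ (nbhs v)) (open_nbhs_nbhs (conj oB (EB _ Ev))).
(* At most one [i] is selected at each point, and [i] is selected on a neighborhood of [E i]. *)
pose sel i (w : X) := V i w /\ forall j, j != i -> ~ closure (V j) w.
have sel_uniq i j w : sel i w -> sel j w -> i = j.
  move=> [Vi _] [_ h]; apply/eqP/negPn/negP => ij; apply: (h i ij); exact: subset_closure.
have sel_near i v : E i v -> \forall w \near v, sel i w.
  move=> Ev; have [VE _] := VP i.
  have h j : \forall w \near v, j != i -> ~ closure (V j) w.
    have [->|ji] := eqVneq j i; first by apply: (@filterE _ (nbhs v)).
    have : nbhs v (~` closure (V j)).
      apply: open_nbhs_nbhs; split; first by apply: closed_openC; exact: closed_closure.
      by have [_ h] := VP j; apply: (h i) Ev; rewrite eq_sym.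
    by apply: (@filterS _ (nbhs v)) => w nw _.
  have h2 : \forall w \near v, forall j, j != i -> ~ closure (V j) w.
    exact: (@filter_forall _ I (fun j w => j != i -> ~ closure (V j) w) (nbhs v) _ h).
  by apply: (@filterS2 _ (nbhs v) _ _ _ _ _ (VE _ Ev) h2) => w; split.
pose h v : X := if pselect (exists p, W p v) is left e then Km (projT1 (cid e)) v
  else if pselect (exists i, sel i v) is left e then Hm (projT1 (cid e)) v else v.
have hW p v : W p v -> h v = Km p v.
  move=> Wv; rewrite /h; case: pselect => [e|[]]; last by exists p.
  by case: cid => q /= Wq; rewrite (dW Wq Wv).
have hS i v : (forall p, ~ W p v) -> sel i v -> h v = Hm i v.
  move=> nW sv; rewrite /h; case: pselect => [[p /nW]//|_]; case: pselect => [e|[]]; last by exists i.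
  by case: cid => j /= sj; rewrite (sel_uniq _ _ _ sj sv).
have h_near i v : E i v -> \forall w \near v, h w = Hm i w.
  move=> Ev; have nW q : ~ W q v by move=> Wq; case: Ev => _; apply; exists q.
  have h1 : \forall w \near v, forall p, W p w -> Km p w = Hm i w.
    exact: (@filter_forall _ Pt (fun p w => W p w -> Km p w = Hm i w) (nbhs v) _ (fun p => KH_near p Ev.1 nW)).
  apply: (@filterS2 _ (nbhs v)) (sel_near _ _ Ev) h1 => w sw KW.
  have [[p Wp]|nWw] := pselect (exists p, W p w); first by rewrite (hW p)// KW.
  by apply: hS => // p Wp; apply: nWw; exists p.
have hD i v : D i v -> h v = Hm i v.
  move=> Dv; have [[p Wp]|nWv] := pselect (exists p, W p v); first by rewrite (hW p)// (@KH i).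
  have Ev : E i v by split => // -[p _ Wp]; apply: nWv; exists p.
  exact: (nbhs_singleton (h_near i v Ev)).
have -> : \bigcup_i (Hm i @` D i) = h @` (\bigcup_i D i).
  apply/seteqP; split => [_ [i _ [v Dv <-]]|_ [v [i _ Dv] <-]]; first by exists v; [exists i|exact: hD].
  by exists i => //; exists v => //; rewrite (hD i).
apply: local_homeo_nbhd.
- exact: CP2_hausdorff.
- have -> : \bigcup_i D i = [set v | exists2 i, i \in enum I & D i v].
    by apply/seteqP; split => v [i _ Dv]; exists i; rewrite // mem_enum.
  elim: (enum I) => [|i s IH].
    rewrite (_ : mkset _ = set0); first exact: compact0.
    by apply/seteqP; split => // v [].
  rewrite (_ : mkset _ = D i `|` [set v | exists2 i, i \in s & D i v]); first exact: compactU.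
  apply/seteqP; split => v; first by move=> [j]; rewrite inE => /orP[/eqP-> Dv|js Dv]; [left|right; exists j].
  by move=> [Dv|[j js Dv]]; [exists i; rewrite ?mem_head|exists j; rewrite // inE js orbT].
- by have [i [v Dv]] := D0; exists v; exists i.
- move=> v [i _ Dv]; have [[p Wp]|nWv] := pselect (exists p, W p v).
    have [V' [k hk]] := bihomeo_ohomeo (hK p) (oW p); exists (W p), V', (Km p), k; split => //.
    by move=> w /set_mem; exact: hW.
  have Ev : E i v by split => // -[p _ Wp]; apply: nWv; exists p.
  have [V' [k hk]] := bihomeo_ohomeo (hH i) (@open_interior _ [set w | h w = Hm i w]).
  exists ([set w | h w = Hm i w]°), V', (Hm i), k; split => //; first exact: h_near.
  by move=> w /set_mem /interior_subset.
- by move=> u v [i _ Du] [j _ Dv]; rewrite (hD i)// (hD j)//; exact: HI.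
Qed.
End Glue.

Section Branches.
Variables (R : realType) (n : nat).
Notation C := R[i].
Notation J := (option 'I_n).
Lemma simple_bihomeo (F G : 'rV[C]_3 -> 'rV[C]_3) : (forall c v, F (c *: v) = c *: F v) -> (forall c v, G (c *: v) = c *: G v) ->
  (forall v : 'rV[C]_3, tends (nbhs v) F (F v)) -> cancel F G -> cancel G F -> homogeneous F /\ bihomeo (hom_map F).
Proof.
move=> FZ GZ cF FG GF.
have hom (F' G' : 'rV[C]_3 -> 'rV[C]_3) : (forall c v, F' (c *: v) = c *: F' v) -> cancel F' G' -> homogeneous F'.
  move=> F'Z F'G'; split=> [c v _|v]; first exact: F'Z.
  apply: contra_neq => Fv; apply: (can_inj F'G'); rewrite Fv.
  by have := F'Z 0 0; rewrite !scale0r.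
split; first exact: hom FZ FG.
by apply: (@hom_map_bihomeo _ F G); [exact: hom FZ FG|exact: hom GZ GF|move=> v _; exact: cF| |].
Qed.
Definition shearF (c e : C) (v : 'rV[C]_3) : 'rV[C]_3 := mkv (v 0 0) (v 0 1 + c * v 0 0 + e * v 0 2%:R) (v 0 2%:R).
Definition translF (p q : C) (v : 'rV[C]_3) : 'rV[C]_3 := mkv (v 0 0 + p * v 0 2%:R) (v 0 1 + q * v 0 2%:R) (v 0 2%:R).
(** Exchanges the line [x = 0] with the line at infinity; slopes at the origin become ordinates. *)
Definition swapF (v : 'rV[C]_3) : 'rV[C]_3 := mkv (v 0 2%:R) (v 0 1) (v 0 0).
Let c0 v := @tends_hcoord R v 0.
Let c1 v := @tends_hcoord R v 1.
Let c2 v := @tends_hcoord R v 2%:R.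
Lemma shear_bihomeo c e : homogeneous (shearF c e) /\ bihomeo (hom_map (shearF c e)).
Proof.
apply: (@simple_bihomeo _ (shearF (- c) (- e))).
- by move=> k v; rewrite /shearF !mxE mkvZ; congr mkv; ring.
- by move=> k v; rewrite /shearF !mxE mkvZ; congr mkv; ring.
- by move=> v; have h0 := @c0 v; have h1 := @c1 v; have h2 := @c2 v; rewrite /shearF; apply: tends_mkv; tendsto.
- by move=> v; rewrite /shearF !mkvE -[RHS]mkv_eta; congr mkv; ring.
- by move=> v; rewrite /shearF !mkvE -[RHS]mkv_eta; congr mkv; ring.
Qed.
Lemma transl_bihomeo p q : homogeneous (translF p q) /\ bihomeo (hom_map (translF p q)).
Proof.
apply: (@simple_bihomeo _ (translF (- p) (- q))).
- by move=> k v; rewrite /translF !mxE mkvZ; congr mkv; ring.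
- by move=> k v; rewrite /translF !mxE mkvZ; congr mkv; ring.
- by move=> v; have h0 := @c0 v; have h1 := @c1 v; have h2 := @c2 v; rewrite /translF; apply: tends_mkv; tendsto.
- by move=> v; rewrite /translF !mkvE -[RHS]mkv_eta; congr mkv; ring.
- by move=> v; rewrite /translF !mkvE -[RHS]mkv_eta; congr mkv; ring.
Qed.
Lemma swap_bihomeo : homogeneous swapF /\ bihomeo (hom_map swapF).
Proof.
apply: (@simple_bihomeo _ swapF).
- by move=> k v; rewrite /swapF !mxE mkvZ.
- by move=> k v; rewrite /swapF !mxE mkvZ.
- by move=> v; have h0 := @c0 v; have h1 := @c1 v; have h2 := @c2 v; rewrite /swapF; apply: tends_mkv; tendsto.
- by move=> v; rewrite /swapF !mkvE -[RHS]mkv_eta.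
- by move=> v; rewrite /swapF !mkvE -[RHS]mkv_eta.
Qed.
Lemma shear_affpt c e x y : hom_map (shearF c e) (affpt (x, y)) = affpt (x, y + c * x + e).
Proof.
by rewrite /affpt hom_map_proj ?affpt_neq0//; [rewrite /shearF !mkvE mulr1|have [] := shear_bihomeo c e].
Qed.
Lemma transl_affpt p q x y : hom_map (translF p q) (affpt (x, y)) = affpt (x + p, y + q).
Proof.
by rewrite /affpt hom_map_proj ?affpt_neq0//; [rewrite /translF !mkvE !mulr1|have [] := transl_bihomeo p q].
Qed.
Lemma swap_affpt x y : x != 0 -> hom_map swapF (affpt (x, y)) = affpt (x^-1, y / x).
Proof.
move=> x0; rewrite /affpt hom_map_proj ?affpt_neq0//; last by have [] := swap_bihomeo.
rewrite /swapF !mkvE /=; apply/proj_eqP; rewrite ?mkv_eq0 ?oner_eq0 ?andbF//.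
by exists x => //; rewrite mkvZ divff// mulr1 mulrC divfK.
Qed.
Definition branch (a b : 'I_n -> C) (j : J) : set (CP2 R) :=
  [set v | (exists x, v = affpt (x, br a b j x)) \/ v = chartI a b j (0, 0)].
Lemma curve_of_branch a b : curve_of a b (br a b) = \bigcup_j branch a b j.
Proof. by apply/seteqP; split => v [j]; [exists j|exists j]. Qed.
Definition eqn (a b : 'I_n -> C) (j : J) (v : 'rV[C]_3) : C :=
  if j is Some i then v 0 1 - a i * v 0 0 - b i * v 0 2%:R else v 0 1 * v 0 2%:R - v 0 0 ^+ 2.
Lemma chartQ0 : chartQ (0, 0) = affpty (0, 0) :> CP2 R.
Proof. by rewrite /chartQ /weighted_twist /= !mulr0 expr0n addr0. Qed.
Lemma eqnZ a b j c v : c != 0 -> (eqn a b j (c *: v) == 0) = (eqn a b j v == 0).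
Proof.
move=> cn0; case: j => [i|] /=; rewrite !mxE.
  by rewrite (_ : _ - _ = c * eqn a b (Some i) v) /=; [rewrite mulf_eq0 (negPf cn0)|ring].
by rewrite (_ : _ - _ = c ^+ 2 * eqn a b None v) /=; [rewrite mulf_eq0 expf_eq0 (negPf cn0)|ring].
Qed.
Lemma closed_zero_locus (F : 'rV[C]_3 -> C) : (forall v, tends (nbhs v) F (F v)) ->
  (forall c v, c != 0 -> (F (c *: v) == 0) = (F v == 0)) -> closed [set p : CP2 R | F (hcoord p) = 0].
Proof.
move=> cF FZ; have -> : [set p : CP2 R | F (hcoord p) = 0] = ~` [set p | F (hcoord p) != 0].
  by apply/seteqP; split => p /=; [move=> ->; rewrite eqxx|move=> /negP; rewrite negbK => /eqP].
apply: open_closedC; rewrite openE => p /= Fp; have [v v0 pE] := projS p; rewrite pE; apply/(nbhs_proj _ v0).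
have FE u : u != 0 -> (F (hcoord (proj u)) == 0) = (F u == 0).
  by move=> u0; have [c cn0 ->] := hcoord_proj u0; exact: FZ.
have Fv : F v != 0 by rewrite -FE// -pE.
have o1 : open [set z : C | 0 < cabs z] by apply: open_fun_gt0 => z; tendsto.
have h1 := cF v _ (open_nbhs_nbhs (conj o1 (_ : _ (F v)))).
apply: (@filterS2 _ (nbhs v)) (h1 _) (nbhs_neq0 v0) => [w /= Fw w0|]; last by rewrite /= cabs_gt0.
by rewrite FE// -cabs_gt0.
Qed.
Lemma branchE a b j : branch a b j = [set p | eqn a b j (hcoord p) = 0].
Proof.
have eqv v : v != 0 -> (eqn a b j (hcoord (proj v)) == 0) = (eqn a b j v == 0).
  by move=> v0; have [c cn0 ->] := hcoord_proj v0; exact: eqnZ.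
apply/seteqP; split => p /=.
  move=> [[x ->]|->].
    apply/eqP; rewrite /affpt eqv ?affpt_neq0//; case: j {eqv} => [i|] /=; rewrite !mkvE; apply/eqP; ring.
  case: j eqv => [i|] eqv; rewrite /chartI ?chartQ0 /affptx /affpty; apply/eqP; rewrite eqv ?mkv_eq0 ?oner_eq0 ?andbF//= !mkvE; apply/eqP; ring.
have [v v0 ->] := projS p; move=> /eqP; rewrite eqv// => {eqv} /eqP.
have [w0|w0] := eqVneq (v 0 2%:R) 0; last first.
  move=> E; left; exists (v 0 0 / v 0 2%:R); rewrite /affpt; apply/proj_eqP; rewrite ?affpt_neq0//.
  exists (v 0 2%:R) => //; rewrite mkvZ mulr1 /= mulrC divfK// -[LHS]mkv_eta; congr mkv.
  case: j E => [i|] /= E.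
    have -> : v 0 1 = a i * v 0 0 + b i * v 0 2%:R by apply/eqP; rewrite -subr_eq0 opprD addrA E.
    by field.
  have E' : v 0 1 * v 0 2%:R = v 0 0 ^+ 2 by apply/eqP; rewrite -subr_eq0 E.
  by rewrite exprMn -E'; field.
case: j => [i|] /= E; right.
  rewrite /affptx /=; apply/proj_eqP; rewrite ?mkv_eq0 ?oner_eq0//.
  have y0 : v 0 1 = a i * v 0 0 by move: E; rewrite w0 mulr0 subr0 => /eqP; rewrite subr_eq0 => /eqP.
  exists (v 0 0); last by rewrite mkvZ mulr1 !mulr0 !addr0 mulrC -y0 -w0 mkv_eta.
  by apply: contraNneq v0 => x0; rewrite -[v]mkv_eta y0 x0 w0 mulr0 mkv_eq0 eqxx.
rewrite /chartI chartQ0 /affpty /=; apply/proj_eqP; rewrite ?mkv_eq0 ?oner_eq0 ?andbF//.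
have x0 : v 0 0 = 0 by move: E; rewrite w0 mulr0 sub0r => /eqP; rewrite oppr_eq0 expf_eq0 => /eqP.
exists (v 0 1); last by rewrite mkvZ mulr1 !mulr0 -[LHS]mkv_eta x0 w0.
by apply: contraNneq v0 => y0; rewrite -[v]mkv_eta y0 x0 w0 mkv_eq0 eqxx.
Qed.
Lemma branch_compact a b j : compact (branch a b j).
Proof.
rewrite branchE; apply: closed_compact; first exact: CP2_compact.
apply: closed_zero_locus => [v|c v]; last exact: eqnZ.
have h0 := @c0 v; have h1 := @c1 v; have h2 := @c2 v; case: j => [i|]; rewrite /eqn; tendsto.
Qed.
End Branches.

Section Crossings.
Variables (R : realType) (n : nat).
Notation C := R[i].
Notation J := (option 'I_n).
Variables (a b : 'I_n -> C) (P : seq C).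
Hypothesis nl : normal_lines a b P.
Definition slope (j : J) (x : C) : C := if j is Some i then a i else 2%:R * x.
Lemma br_shift j p X : br a b j (p + X) = br a b j p + slope j p * X + (if j is None then X ^+ 2 else 0).
Proof. by case: j => [i|] /=; ring. Qed.
Lemma crossing_in j k x : j != k -> br a b j x = br a b k x -> x \in P.
Proof.
have [_ N1 N2 _] := nl.
have Q i : a i * x + b i = x ^+ 2 -> x \in P.
  have [p [q [pP qP -> ->]]] := N2 i => E.
  have : (x - p) * (x - q) == 0.
    by apply/eqP; transitivity (x ^+ 2 - ((p + q) * x + - (p * q))); [ring|rewrite E subrr].
  by rewrite mulf_eq0 !subr_eq0 => /orP[/eqP->|/eqP->].
case: j k => [i|] [k|] //= jk E; [|exact: Q E|exact: (Q k)].
have ik : i != k by [].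
have [aik [p pP pE]] := N1 _ _ ik.
suff -> : x = p by [].
apply/eqP; rewrite -subr_eq0; have : (a i - a k) * (x - p) == 0.
  apply/eqP; transitivity (a i * x + b i - (a k * x + b k) - (a i * p + b i - (a k * p + b k))); first by ring.
  by rewrite E pE !subrr.
by rewrite mulf_eq0 !subr_eq0 (negPf aik).
Qed.
Lemma chartI_inj0 j k : chartI a b j (0, 0) = chartI a b k (0, 0) -> j = k.
Proof.
have [_ N1 _ _] := nl.
have h (i : 'I_n) : affptx (a i + b i * 0 + 0, 0) <> chartQ (0, 0).
  rewrite chartQ0 /affptx /affpty /= => /proj_eqP[||c c0]; rewrite ?mkv_eq0 ?oner_eq0 ?andbF//.
  by rewrite mkvZ => /(congr1 (fun v : 'rV[C]_3 => v 0 0)); rewrite !mkvE mulr0 => /eqP; rewrite oner_eq0.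
case: j k => [i|] [k|] //=; [|by move=> /h|by move=> /esym/h].
rewrite /affptx /= => /proj_eqP[||c c0]; rewrite ?mkv_eq0 ?oner_eq0//.
rewrite mkvZ => E; have := congr1 (fun v : 'rV[C]_3 => v 0 0) E; have := congr1 (fun v : 'rV[C]_3 => v 0 1) E.
rewrite !mkvE mulr1 => h1 h2; rewrite -h2 mul1r !mulr0 !addr0 in h1.
by have [->//|/N1[]] := eqVneq i k; rewrite h1 eqxx.
Qed.
Lemma affpt_chartI0 j x y : affpt (x, y) <> chartI a b j (0, 0).
Proof.
suff h (v : 'rV[C]_3) : v != 0 -> v 0 2%:R = 0 -> affpt (x, y) <> proj v.
  by case: j => [i|] /=; rewrite ?chartQ0 /affptx /affpty; apply: h; rewrite ?mkvE ?mkv_eq0 ?oner_eq0 ?andbF.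
move=> v0 w0 /proj_eqP[||c c0 E]; rewrite ?affpt_neq0//.
by have := congr1 (fun v : 'rV[C]_3 => v 0 2%:R) E; rewrite mkvE mxE w0 mulr0 => /eqP; rewrite oner_eq0.
Qed.
End Crossings.

Section Transport.
Variables (R : realType) (n : nat).
Notation C := R[i].
Notation J := (option 'I_n).
Variables (a b a' b' : 'I_n -> C) (P P' : seq C) (s y y' : C -> C).
Hypotheses (nl : normal_lines a b P) (nl' : normal_lines a' b' P').
Hypothesis sI : {in P &, injective s}.
Hypothesis sS : forall p', p' \in P' -> exists2 p, p \in P & s p = p'.
Notation f := (br a b).
Notation f' := (br a' b').
Hypothesis Y1 : forall p j k, p \in P -> j != k -> f j p = f k p -> f j p = y p.
Hypothesis Y1' : forall p j k, p \in P' -> j != k -> f' j p = f' k p -> f' j p = y' p.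
Hypothesis Y2 : forall p j, p \in P -> f j p = y p <-> f' j (s p) = y' (s p).
Hypothesis Y3 : forall p i, p \in P -> f (Some i) p = y p -> f None p = y p ->
  a i = 2%:R * p <-> a' i = 2%:R * s p.
Notation sl := (slope a).
Notation sl' := (slope a').
(** Distinct lines have distinct slopes in both normal forms, so two branches share a slope only at
    a tangency, which [Y3] preserves. *)
Lemma slope_iff p j k : p \in P -> f j p = y p -> f k p = y p -> sl j p = sl k p <-> sl' j (s p) = sl' k (s p).
Proof.
move=> pP jp kp; have [_ N1 _ _] := nl; have [_ N1' _ _] := nl'.
have [->//|jk] := eqVneq j k.
case: j k jk jp kp => [i|] [k|] // jk jp kp.
- have ik : i != k by [].
  have [/eqP h _] := N1 _ _ ik; have [/eqP h' _] := N1' _ _ ik; split => //.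
- exact: Y3.
- by split=> E; apply/esym; apply/(Y3 pP kp jp); apply/esym.
Qed.
Lemma slope_pushing p : p \in P -> exists2 psi, chomeo psi & exists2 e, 0 < e &
  forall j X, f j p = y p -> cabs X <= e -> psi (sl j p + X) = sl' j (s p) + X.
Proof.
move=> pP; pose Z := [seq sl j p | j <- enum {: J} & f j p == y p].
pose w m := if [pick j | (f j p == y p) && (sl j p == m)] is Some j then sl' j (s p) else 0.
have wE j : f j p = y p -> w (sl j p) = sl' j (s p).
  move=> jp; rewrite /w; case: pickP => [k /andP[/eqP kp /eqP kj]|/(_ j)]; last by rewrite jp !eqxx.
  by apply/(slope_iff pP kp jp).
have memZ z : z \in Z -> exists2 j, f j p = y p & z = sl j p.
  by move=> /mapP[j]; rewrite mem_filter => /andP[/eqP jp _] ->; exists j.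
have [psi h [e e0 m]] : exists2 phi, chomeo phi & moves Z w phi.
  apply: point_pushing => z z' /memZ[j jp ->] /memZ[k kp ->]; rewrite !wE// => E.
  by apply/(slope_iff pP jp kp).
exists psi => //; exists e => // j X jp Xe; rewrite m// ?wE//.
by apply/mapP; exists j; rewrite // mem_filter jp eqxx mem_enum.
Qed.

Section Maps.
Variables (phi : C -> C).
Hypothesis hphi : chomeo phi.
Definition qpart (j : J) (x : C) : C := if j is Some i then a i * x else x ^+ 2.
(* Carries the graph of qpart j to itself over psi. *)
Definition slide (psi : C -> C) (j : J) (z : C * C) : C * C := (psi z.1, z.2 - qpart j z.1 + qpart j (psi z.1)).
(** The slide has bounded displacement and so extends to infinity; the change of coefficients of a
    line is unbounded and is done by a projective shear. *)
Definition Hmap (j : J) : CP2 R -> CP2 R :=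
  if j is Some i then hom_map (shearF (a' i - a i) (b' i - b i)) \o affmap (slide phi j) else affmap (slide phi j).
Lemma qpart_continuous j : continuous (qpart j).
Proof.
case: j => [i|] x; rewrite /qpart; first by tendsto.
suff h (z : C) : tends (nbhs z) (fun x : C => x ^+ 2) (z ^+ 2) by exact: h.
by tendsto.
Qed.
Lemma slide_bihomeo j : bihomeo (affmap (slide phi j)).
Proof.
have [cphi [psi [fk kf]] [K hK]] := hphi; have [B hB] := chomeo_bound hphi.
pose M := `|K| + `|K| + B.
have KK : K <= cabs (`|K|%:C) by rewrite cabs_real ger0_norm// ler_norm.
have B0 : 0 <= B by have := hB (`|K|%:C); rewrite hK// lerDl.
have MP x : cabs (phi x - x) <= M /\ cabs (phi x) <= M \/ phi x = x.
  have [xK|xK] := lerP K (cabs x); [by right; exact: hK|left].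
  have h1 := hB x; have h2 := ler_norm K; have h3 := cabsD (phi x) (- x); rewrite cabsN in h3.
  by rewrite /M; have := normr_ge0 K; split; lra.
pose N := (if j is Some i then cabs (a i) * M else M * (M + M)) + M.
have M0 : 0 <= M by rewrite /M !addr_ge0.
have N0 : M <= N by rewrite /N lerDr; case: (j) => [i|]; rewrite mulr_ge0 ?cabs_ge0// addr_ge0.
apply: (affmap_bihomeo (B := N) (Psi := slide psi j)).
- move=> z; have h1 : tends (nbhs z) (fun z : C * C => z.1) z.1 by exact: cvg_fst.
  have h2 : tends (nbhs z) (fun z : C * C => z.2) z.2 by exact: cvg_snd.
  have h3 : tends (nbhs z) (fun z : C * C => phi z.1) (phi z.1) := tends_comp h1 (cphi _).
  have h4 : tends (nbhs z) (fun z : C * C => qpart j z.1) (qpart j z.1) := tends_comp h1 (@qpart_continuous j _).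
  have h5 : tends (nbhs z) (fun z : C * C => qpart j (phi z.1)) (qpart j (phi z.1)) := tends_comp h3 (@qpart_continuous j _).
  by rewrite /slide; tendsto.
- by move=> [x z]; rewrite /slide /= fk; congr pair; ring.
- by move=> [x z]; rewrite /slide /= kf; congr pair; ring.
- move=> [x z]; rewrite /slide /= (_ : z - _ + _ - z = qpart j (phi x) - qpart j x); last by ring.
  have [[h1 h2]|->] := MP x; last by rewrite !subrr cabs0; split; lra.
  split; first exact: le_trans h1 N0.
  apply: (le_trans (y := N - M)); last by lra.
  rewrite /N addrK; case: j {N N0} => [i|] /=.
    by rewrite -mulrBr cabsM ler_wpM2l ?cabs_ge0.
  rewrite (_ : _ - _ = (phi x - x) * (phi x + (phi x - (phi x - x)))); last by ring.
  rewrite cabsM; apply: ler_pM; rewrite ?cabs_ge0//; apply: le_trans (cabsD _ _) _; apply: lerD => //.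
  rewrite subKr; have := cabsD (phi x) (- (phi x - x)); rewrite subKr cabsN.
  have [xK|xK] := lerP K (cabs x); first by rewrite -(hK x xK).
  by have := ler_norm K; have := normr_ge0 K; rewrite /M; lra.
Qed.
Lemma Hmap_bihomeo j : bihomeo (Hmap j).
Proof.
case: j => [i|]; last exact: slide_bihomeo.
by apply: bihomeo_comp; [exact: slide_bihomeo|have [] := shear_bihomeo (a' i - a i) (b' i - b i)].
Qed.
Lemma Hmap_affpt j x z : Hmap j (affpt (x, z)) = affpt (phi x, z - f j x + f' j (phi x)).
Proof.
case: j => [i|] /=; rewrite affmap_affpt /slide /=; last by [].
by rewrite shear_affpt; congr (affpt (_, _)); ring.
Qed.
Lemma Hmap_inf j : Hmap j (chartI a b j (0, 0)) = chartI a' b' j (0, 0).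
Proof.
case: j => [i|] /=; last first.
  by rewrite chartQ0 /affpty affmap_inf ?mkvE ?mkv_eq0 ?oner_eq0 ?andbF.
rewrite /affptx /= affmap_inf ?mkvE ?mkv_eq0 ?oner_eq0//.
rewrite hom_map_proj ?mkv_eq0 ?oner_eq0//; last by have [] := shear_bihomeo (a' i - a i) (b' i - b i).
rewrite /shearF !mkvE; suff -> : a i + b i * 0 + 0 + (a' i - a i) * 1 + (b' i - b i) * 0 = a' i + b' i * 0 + 0 by [].
ring.
Qed.
Lemma Hmap_branch j : Hmap j @` branch a b j = branch a' b' j.
Proof.
have [_ [psi [fk kf]] _] := hphi.
apply/seteqP; split => v.
  move=> [_ [[x ->]|->] <-]; last by right; exact: Hmap_inf.
  by left; exists (phi x); rewrite Hmap_affpt addrC subrr addr0.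
move=> [[x ->]|->]; last by exists (chartI a b j (0, 0)); [right|exact: Hmap_inf].
exists (affpt (psi x, f j (psi x))); first by left; exists (psi x).
by rewrite Hmap_affpt subrr add0r kf.
Qed.
End Maps.
(* The swapped coordinates about the crossing (p, q) are (1 / X, Y / X); psi acts on the slope. *)
Definition Kmap (p q p' q' : C) (psi : C -> C) : CP2 R -> CP2 R :=
  hom_map (translF p' q') \o hom_map (@swapF R) \o affmap (fun z => (z.1, psi z.2)) \o hom_map (@swapF R) \o hom_map (translF (- p) (- q)).
Lemma Kmap_bihomeo p q p' q' psi : chomeo psi -> bihomeo (Kmap p q p' q' psi).
Proof.
move=> hpsi; have [cpsi [g [fk kf]] [K hK]] := hpsi; have [B hB] := chomeo_bound hpsi.
have [_ t1] := transl_bihomeo (- p) (- q); have [_ t2] := transl_bihomeo p' q'; have [_ t3] := swap_bihomeo R.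
apply: (bihomeo_comp t1); apply: (bihomeo_comp t3); apply: (bihomeo_comp _ (bihomeo_comp t3 t2)).
pose M := `|K| + `|K| + `|B|.
have M0 : 0 <= M by rewrite /M !addr_ge0.
apply: (affmap_bihomeo (B := M) (Psi := fun z => (z.1, g z.2))).
- move=> z; have h1 : tends (nbhs z) (fun z : C * C => z.1) z.1 by exact: cvg_fst.
  have h2 : tends (nbhs z) (fun z : C * C => z.2) z.2 by exact: cvg_snd.
  have h3 : tends (nbhs z) (fun z : C * C => psi z.2) (psi z.2) := tends_comp h2 (cpsi _).
  by tendsto.
- by move=> [u v] /=; rewrite fk.
- by move=> [u v] /=; rewrite kf.
- move=> [u v] /=; rewrite subrr cabs0; split => //.
  have [vK|vK] := lerP K (cabs v); first by rewrite hK// subrr cabs0.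
  have h1 := hB v; have h2 := ler_norm K; have h3 := cabsD (psi v) (- v); rewrite cabsN in h3.
  by rewrite /M; have := normr_ge0 K; have := ler_norm B; lra.
Qed.
Lemma Kmap_affpt p q p' q' psi X Y : X != 0 -> Kmap p q p' q' psi (affpt (p + X, q + Y)) = affpt (p' + X, q' + X * psi (Y / X)).
Proof.
move=> X0; have XV0 : X^-1 != 0 by rewrite invr_neq0.
have E : hom_map (translF (- p) (- q)) (@affpt R (p + X, q + Y)) = @affpt R (X, Y).
  by rewrite transl_affpt [p + X]addrC [q + Y]addrC !addrK.
have -> : Kmap p q p' q' psi (@affpt R (p + X, q + Y)) = hom_map (translF p' q') (hom_map (@swapF R)
    (affmap (fun z => (z.1, psi z.2)) (hom_map (@swapF R) (@affpt R (X, Y))))) by rewrite -E.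
have E2 : hom_map (@swapF R) (affpt (X, Y)) = affpt (X^-1, Y / X) := swap_affpt Y X0.
have E3 : affmap (fun z => (z.1, psi z.2)) (affpt (X^-1, Y / X)) = affpt (X^-1, psi (Y / X)) := affmap_affpt _ _.
have E4 : hom_map (@swapF R) (affpt (X^-1, psi (Y / X))) = affpt (X^-1^-1, psi (Y / X) / X^-1) := swap_affpt _ XV0.
rewrite E2 E3 E4 invrK transl_affpt.
by rewrite [X + p']addrC [_ + q']addrC [psi _ * X]mulrC.
Qed.
Lemma Kmap_center p q p' q' psi : Kmap p q p' q' psi (affpt (p, q)) = affpt (p', q').
Proof.
rewrite /Kmap /= transl_affpt !subrr /affpt /=.
have [hs _] := swap_bihomeo R.
rewrite hom_map_proj ?mkv_eq0 ?oner_eq0 ?andbF//= /swapF !mkvE.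
rewrite affmap_inf ?mkvE ?mkv_eq0 ?oner_eq0// hom_map_proj ?mkv_eq0 ?oner_eq0//= /swapF !mkvE.
by rewrite -/(affpt (0, 0)) transl_affpt !add0r.
Qed.
Lemma near_affpt (z : C * C) (Q : CP2 R -> Prop) : (\forall u \near z, Q (affpt u)) -> \forall v \near affpt z, Q v.
Proof.
move=> h; have [_ oV hU hV] := affpt_ohomeo R; have [Vz kz _] := hU z I; have [_ _ ck] := hV _ Vz.
have h' : nbhs ((fun p : CP2 R => (hcoord p 0 0 / hcoord p 0 2%:R, hcoord p 0 1 / hcoord p 0 2%:R)) (affpt z)) [set u | Q (affpt u)].
  by rewrite kz.
apply: (@filterS2 _ (nbhs (affpt z)) _ _ _ _ _ (ck _ h') (open_nbhs_nbhs (conj oV Vz))) => v /= Qv /hV[_ E _].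
by rewrite -E.
Qed.
(** [phi] sends each crossing abscissa to its partner and is a translation nearby; [psi i] does the
    same with the slopes at the crossing. The maps [Hmap] and [Kmap] built from them agree along the
    branches and are glued. *)
Lemma normal_transport : nbhd_homeo (curve_of a b f) (curve_of a' b' f').
Proof.
have [uP N1 N2 N3] := nl.
have [phi hphi [ephi ephi0 mphi]] := point_pushing sI.
pose pt (i : 'I_(size P)) : C := P`_i.
have ptP i : pt i \in P by exact: mem_nth.
have ptS p : p \in P -> exists i, pt i = p.
  by move=> pP; have h : (index p P < size P)%N by [rewrite index_mem]; exists (Ordinal h); exact: nth_index.
have ptI i k : pt i = pt k -> i = k.
  by move=> /eqP; rewrite nth_uniq// => /eqP; exact: val_inj.
have /choice[psi psiP] : forall i, exists pe : (C -> C) * R, [/\ chomeo pe.1, 0 < pe.2 &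
    forall j X, f j (pt i) = y (pt i) -> cabs X <= pe.2 -> pe.1 (sl j (pt i) + X) = sl' j (s (pt i)) + X].
  by move=> i; have [psi h [e e0 m]] := slope_pushing (ptP i); exists (psi, e).
have [epsi /andP[epsi0 _] epsiP] := pos_lower_bound [seq (psi i).2 | i <- enum 'I_(size P)].
have epsi_le i : epsi <= (psi i).2.
  by apply: epsiP; [apply: (map_f (fun i => (psi i).2)); rewrite mem_enum|have [] := psiP i].
have [m1 /andP[m10 _] m1P] := pos_lower_bound [seq cabs (p - q) | p <- P, q <- P].
have [g /andP[g0 _] gP] := pos_lower_bound [seq cabs (f j p - y p) | p <- P, j <- enum {: J}].
pose B : R := 3 + \sum_i cabs (a i).
have B3 : 3 <= B by rewrite lerDl sumr_ge0// => i _; exact: cabs_ge0.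
have aB i : cabs (a i) <= B.
  by rewrite /B (bigD1 i)//= addrCA lerDl addr_ge0// sumr_ge0// => k _; exact: cabs_ge0.
have B0 : 0 < B by move: B3; lra.
(* At this radius the discs are disjoint, the pushing maps are translations where used, and over a
   disc the branches through the crossing stay within [B eps] of it in height while the others stay
   outside the box of height [2 B eps]. *)
pose eps := Num.min (Num.min (1 / 2) (m1 / 2)) (Num.min (ephi / 2) (Num.min (epsi / 2) (g / (4 * B)))).
have eps0 : 0 < eps.
  rewrite !lt_min; apply/and3P; split; [by apply/andP; split; exact: divr_gt0|exact: divr_gt0|].
  by apply/andP; split; apply: divr_gt0 => //; exact: mulr_gt0.
have epsm : eps <= m1 / 2 by rewrite !ge_min lexx !orbT.
have eps1 : eps <= 1 / 2 by rewrite !ge_min lexx.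
have epsphi : eps <= ephi / 2 by rewrite !ge_min lexx !orbT.
have epspsi : eps <= epsi / 2 by rewrite !ge_min lexx !orbT.
have epsg : 4 * B * eps <= g.
  have : eps <= g / (4 * B) by rewrite !ge_min lexx !orbT.
  by rewrite ler_pdivlMr ?mulr_gt0// mulrC.
have Beps : 0 < B * eps by exact: mulr_gt0.
have lip i j X : cabs X <= eps -> cabs (f j (pt i + X) - f j (pt i)) <= B * cabs X.
  move=> Xe; rewrite br_shift; case: j => [k|].
    by rewrite addr0 addrC addKr cabsM; apply: ler_wpM2r; [exact: cabs_ge0|exact: aB].
  rewrite (_ : _ - _ = (2%:R * pt i + X) * X); last by rewrite /slope; ring.
  rewrite cabsM ler_wpM2r ?cabs_ge0//; apply: le_trans (cabsD _ _) _.
  have h1 := cabsD (pt i) (pt i); have h2 := N3 _ (ptP i).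
  by rewrite -[pt i + pt i]mulr2n -[_ *+ 2]mulr_natl in h1; lra.
have cluster i j x : cabs (x - pt i) <= eps -> cabs (f j x - y (pt i)) <= 2 * (B * eps) -> f j (pt i) = y (pt i).
  move=> xe fe; apply/eqP/negPn/negP => ne.
  have h1 := lip i j _ xe; rewrite [pt i + _]addrC subrK in h1.
  have h2 : g <= cabs (f j (pt i) - y (pt i)).
    apply: gP; last by rewrite cabs_gt0 subr_eq0.
    by apply: (allpairs_f (fun p j => cabs (f j p - y p)) (ptP i)); rewrite mem_enum.
  have h3 := cabs_tri (f j (pt i)) (y (pt i)) (f j x); rewrite [cabs (f j (pt i) - f j x)]cabsB in h3.
  have h4 : B * cabs (x - pt i) <= B * eps by rewrite ler_pM2l.
  by lra.
pose W i := @affpt R @` [set z : C * C | cabs (z.1 - pt i) < eps /\ cabs (z.2 - y (pt i)) < 2 * (B * eps)].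
pose Km i := Kmap (pt i) (y (pt i)) (s (pt i)) (y' (s (pt i))) (psi i).1.
(* In a wedge around branch [j] both maps send the relative ordinate [Y] to [sl' X + (Y - sl X)];
   the quadratic term of the conic is the same before and after, and cancels. *)
have agree i j x z : f j (pt i) = y (pt i) -> 0 < cabs (x - pt i) -> cabs (x - pt i) <= 2 * eps ->
    cabs (z - y (pt i) - sl j (pt i) * (x - pt i)) <= epsi * cabs (x - pt i) -> Km i (affpt (x, z)) = Hmap phi j (affpt (x, z)).
  move=> jp; set X := x - pt i; set Y := z - y (pt i) => X0 Xe Ye.
  have xE : x = pt i + X by rewrite addrC subrK.
  have zE : z = y (pt i) + Y by rewrite addrC subrK.
  have X00 : X != 0 by rewrite -cabs_gt0.
  have [_ _ ps] := psiP i.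
  have sE : Y / X = sl j (pt i) + (Y - sl j (pt i) * X) / X by rewrite [(Y - _) / X]mulrBl mulfK// addrC subrK.
  rewrite Hmap_affpt /Km xE zE Kmap_affpt// mphi//; last by lra.
  have psE : (psi i).1 (Y / X) = sl' j (s (pt i)) + (Y - sl j (pt i) * X) / X.
    rewrite {1}sE ps// cabsM cabsV ler_pdivrMr//; apply: le_trans Ye _.
    by rewrite ler_wpM2r ?cabs_ge0.
  congr (affpt (_, _)); rewrite psE !br_shift jp ((Y2 j (ptP i)).1 jp).
  by case: (j) => [k|] /=; field.
have cW i : open (W i).
  have [_ _ _ _] := affpt_ohomeo R; apply: (ohomeo_open (affpt_ohomeo R)) => //.
  have -> : [set z : C * C | cabs (z.1 - pt i) < eps /\ cabs (z.2 - y (pt i)) < 2 * (B * eps)] =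
      [set z : C * C | 0 < eps - cabs (z.1 - pt i)] `&` [set z : C * C | 0 < 2 * (B * eps) - cabs (z.2 - y (pt i))].
    by apply/seteqP; split => z /=; rewrite !subr_gt0.
  apply: openI; apply: open_fun_gt0 => z.
    have h1 : tends (nbhs z) (fun z : C * C => z.1) z.1 by exact: cvg_fst.
    by tendsto.
  have h1 : tends (nbhs z) (fun z : C * C => z.2) z.2 by exact: cvg_snd.
  by tendsto.
rewrite !curve_of_branch; have -> : \bigcup_j branch a' b' j = \bigcup_j (Hmap phi j @` branch a b j).
  by apply: eq_bigcupr => j _; rewrite Hmap_branch.
apply: (@glue R _ _ (branch a b) W (Hmap phi) Km).
- exact: branch_compact.
- exact: Hmap_bihomeo.
- by move=> i; apply: Kmap_bihomeo; have [] := psiP i.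
- exact: cW.
- move=> i k _ [z [z1 _] <-] [z' [z'1 _]] /affpt_inj zz; rewrite zz in z'1; apply: ptI.
  apply/eqP/negPn/negP => ik; have : m1 <= cabs (pt i - pt k).
    by apply: m1P; [exact: (allpairs_f (fun p q => cabs (p - q)))|rewrite cabs_gt0 subr_eq0].
  by have := cabs_tri (pt i) (pt k) z.1; rewrite [cabs (pt i - z.1)]cabsB; lra.
- move=> j k v jk [[x ->]|->] [[x' E]|E].
  + move/affpt_inj: E => [xx E]; rewrite -xx in E.
    have xP := crossing_in nl jk E; have [i iE] := ptS _ xP; exists i, (x, f j x) => //=.
    by rewrite iE (Y1 xP jk E) !subrr cabs0; split => //; rewrite mulr_gt0.
  + by case: (affpt_chartI0 E).
  + by case: (affpt_chartI0 (esym E)).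
  + by move: jk; rewrite (chartI_inj0 nl E) eqxx.
- move=> j i v [[x ->]|->] nW.
    apply: near_affpt.
    have c1 : tends (nbhs (x, f j x)) (fun z : C * C => z.1) x by exact: cvg_fst.
    have c2 : tends (nbhs (x, f j x)) (fun z : C * C => z.2) (f j x) by exact: cvg_snd.
    have near_gt (h : C * C -> R) : tends (nbhs (x, f j x)) h (h (x, f j x)) -> 0 < h (x, f j x) -> \forall u \near (x, f j x), 0 < h u.
      by move=> ch h0; apply: (ch [set t | 0 < t]); apply: open_nbhs_nbhs; split => //; exact: open_gt.
    have [xe|xe] := ltP eps (cabs (x - pt i)).
      have h : \forall u \near (x, f j x), 0 < cabs (u.1 - pt i) - eps.
        by apply: near_gt; [tendsto|rewrite subr_gt0].
      apply: (@filterS _ (nbhs (x, f j x))) h => u h [z [z1 _] /affpt_inj zu]; exfalso.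
      by move: h z1; rewrite zu subr_gt0; lra.
    have [fe|fe] := ltP (2 * (B * eps)) (cabs (f j x - y (pt i))).
      have h : \forall u \near (x, f j x), 0 < cabs (u.2 - y (pt i)) - 2 * (B * eps).
        by apply: near_gt; [tendsto|rewrite subr_gt0].
      apply: (@filterS _ (nbhs (x, f j x))) h => u h [z [_ z2] /affpt_inj zu]; exfalso.
      by move: h z2; rewrite zu subr_gt0; lra.
    have jp := cluster i j x xe fe.
    have l1 := lip i j _ xe; rewrite [pt i + _]addrC subrK jp in l1.
    (* The branch stays well inside the box vertically, so its points outside [W i] over the closed
       disc lie over the bounding circle. *)
    have xE : cabs (x - pt i) = eps.
      apply/eqP; rewrite eq_le xe leNgt; apply/negP => lt; apply: (nW i); exists (x, f j x) => //; split => //=.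
      have : B * cabs (x - pt i) <= B * eps by rewrite ler_pM2l.
      by move: Beps l1; lra.
    have Ye : cabs (f j x - y (pt i) - sl j (pt i) * (x - pt i)) < epsi * cabs (x - pt i).
      rewrite -jp; have := br_shift a b j (pt i) (x - pt i); rewrite [pt i + _]addrC subrK => ->.
      rewrite (_ : _ - _ - _ = if j is None then (x - pt i) ^+ 2 else 0); last by case: (j) => [k|] /=; ring.
      rewrite xE; case: (j) => [k|]; first by rewrite cabs0 mulr_gt0.
      by rewrite cabsX xE expr2 ltr_pM2r//; move: epspsi epsi0; lra.
    have h1 : \forall u \near (x, f j x), 0 < cabs (u.1 - pt i).
      by apply: near_gt; [tendsto|rewrite xE].
    have h2 : \forall u \near (x, f j x), 0 < 2 * eps - cabs (u.1 - pt i).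
      by apply: near_gt; [tendsto|rewrite /= xE; lra].
    have h3 : \forall u \near (x, f j x), 0 < epsi * cabs (u.1 - pt i) - cabs (u.2 - y (pt i) - sl j (pt i) * (u.1 - pt i)).
      by apply: near_gt; [tendsto|rewrite subr_gt0].
    apply: (@filterS3 _ (nbhs (x, f j x)) _ _ _ _ _ _ h1 h2 h3) => -[u1 u2] /= k1 k2 k3 _.
    by apply: agree => //; lra.
  (* The sets [W i] lie in a compact box, whose complement is a neighborhood of the point at
     infinity. *)
  pose M := 2 * (B * eps) + \sum_i cabs (y (pt i)).
  pose Kc := @affpt R @` ([set z | cabs z <= 2] `*` [set z | cabs z <= M]).
  have cK : compact Kc.
    apply: continuous_compact; last by apply: compact_setX; exact: compact_cabs.
    by apply: continuous_subspaceT => z; have [_ _ /(_ z I)[]] := affpt_ohomeo R.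
  have oK : open (~` Kc) by apply: closed_openC; exact: compact_closed_CP2.
  apply: (@filterS _ (nbhs (chartI a b j (0, 0)))) (open_nbhs_nbhs (conj oK _)) => [w nK [z [z1 z2] zw]|]; last first.
    by move=> [[u1 u2] _ E]; exact: (affpt_chartI0 E).
  exfalso; apply: nK; exists z => //; split => /=.
    have := cabsD (z.1 - pt i) (pt i); rewrite subrK; have := N3 _ (ptP i); lra.
  have := cabsD (z.2 - y (pt i)) (y (pt i)); rewrite subrK => h; apply: le_trans h _; apply: lerD; first exact: ltW.
  by rewrite (bigD1 i)//= lerDl sumr_ge0// => k _; exact: cabs_ge0.
- move=> j i v [[x ->]|->] [[u1 u2] [z1 z2] E]; last by case: (affpt_chartI0 E).
  move/affpt_inj: E => [E1 E2]; move: z1 z2; rewrite /= E1 E2 => z1 z2.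
  have jp := cluster i j x (ltW z1) (ltW z2).
  have [x0|x0] := eqVneq (x - pt i) 0.
    have xp : x = pt i by apply/eqP; rewrite -subr_eq0 x0.
    rewrite xp jp /Km Kmap_center Hmap_affpt jp subrr add0r.
    have -> : phi (pt i) = s (pt i) by rewrite -[pt i]addr0 mphi ?addr0// cabs0 ltW.
    by rewrite ((Y2 j (ptP i)).1 jp).
  apply: agree => //; [by rewrite cabs_gt0|lra|].
  rewrite -jp; have := br_shift a b j (pt i) (x - pt i); rewrite [pt i + _]addrC subrK => ->.
  rewrite (_ : _ - _ - _ = if j is None then (x - pt i) ^+ 2 else 0); last by case: (j) => [k|] /=; ring.
  case: (j) => [k|]; first by rewrite cabs0 mulr_ge0 ?cabs_ge0 ?ltW.
  by rewrite cabsX expr2 ler_wpM2r ?cabs_ge0//; move: epspsi epsi0; lra.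
- have bI j : injective (Hmap phi j) := bihomeo_inj (Hmap_bihomeo hphi j).
  move=> j k v w Dv Dw E; have [jk|jk] := eqVneq j k; first by subst k; exact: (bI j).
  have [_ [psi' [fk kf]] _] := hphi.
  case: Dv Dw E => [[x ->]|->] [[x' ->]|->].
  + rewrite !Hmap_affpt !subrr !add0r => /affpt_inj[/(can_inj fk) xx]; rewrite -xx => E.
    have pP' := crossing_in nl' jk E; have [p pP pE] := sS pP'.
    have mp : phi p = s p by rewrite -[p]addr0 mphi ?addr0// cabs0 ltW.
    have xp : x = p by apply: (can_inj fk); rewrite mp.
    have yj := Y1' pP' jk E; have kj : k != j by rewrite eq_sym.
    have yk := Y1' pP' kj (esym E); rewrite xp mp in yj yk *.
    by rewrite ((Y2 j pP).2 yj) ((Y2 k pP).2 yk).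
  + by rewrite Hmap_affpt Hmap_inf => /affpt_chartI0.
  + by rewrite Hmap_affpt Hmap_inf => /esym/affpt_chartI0.
  + by rewrite !Hmap_inf => /(chartI_inj0 nl') kj; rewrite kj eqxx in jk.
- by exists None, (affpt (0, f None 0)); left; exists 0.
Qed.
End Transport.

(** * Normal form of an arrangement *)
Section Frames.
Variable R : realType.
Notation C := R[i].
Implicit Types (u v w : 'rV[C]_3).
Definition dt u v : C := u 0 0 * v 0 0 + u 0 1 * v 0 1 + u 0 2%:R * v 0 2%:R.
Lemma dtE u v : u *m v^T = (dt u v)%:M.
Proof. by apply/matrixP => i j; rewrite !ord1 !mxE sum3 !mxE. Qed.
Lemma dt_eq0 u v : (u *m v^T == 0) = (dt u v == 0).
Proof.
rewrite dtE; apply/eqP/eqP => [/(congr1 (fun m : 'M[C]_1 => m 0 0))|->]; last by rewrite raddf0.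
by rewrite !mxE eqxx.
Qed.
Lemma dtC u v : dt u v = dt v u. Proof. by rewrite /dt; ring. Qed.
Lemma dtDl u u' v : dt (u + u') v = dt u v + dt u' v. Proof. by rewrite /dt !mxE; ring. Qed.
Lemma dtZl c u v : dt (c *: u) v = c * dt u v. Proof. by rewrite /dt !mxE; ring. Qed.
Lemma dtDr u v v' : dt u (v + v') = dt u v + dt u v'. Proof. by rewrite !(dtC u) dtDl. Qed.
Lemma dtZr c u v : dt u (c *: v) = c * dt u v. Proof. by rewrite !(dtC u) dtZl. Qed.
Lemma dt0 u : dt u 0 = 0. Proof. by rewrite /dt !mxE; ring. Qed.
Lemma dt0l u : dt 0 u = 0. Proof. by rewrite dtC dt0. Qed.
Lemma dt_neq0 u : u != 0 -> exists v, dt u v != 0.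
Proof.
move=> /coord_neq0[k uk]; exists (\row_j (j == k)%:R).
suff -> : dt u (\row_j (j == k)%:R) = u 0 k by [].
by rewrite /dt !mxE; move: k {uk}; apply: ord3P; rewrite /=; ring.
Qed.
Definition crossv u v := mkv (u 0 1 * v 0 2%:R - u 0 2%:R * v 0 1) (u 0 2%:R * v 0 0 - u 0 0 * v 0 2%:R) (u 0 0 * v 0 1 - u 0 1 * v 0 0).
Lemma crs_dtl u v : dt u (crossv u v) = 0. Proof. by rewrite /dt /crossv !mkvE; ring. Qed.
Lemma crs_dtr u v : dt v (crossv u v) = 0. Proof. by rewrite /dt /crossv !mkvE; ring. Qed.
Lemma crs_eq0 u v : u != 0 -> crossv u v = 0 -> exists k, v = k *: u.
Proof.
move=> /coord_neq0[k uk] E.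
have e0 := congr1 (fun w : 'rV[C]_3 => w 0 0) E; have e1 := congr1 (fun w : 'rV[C]_3 => w 0 1) E.
have e2 := congr1 (fun w : 'rV[C]_3 => w 0 2%:R) E; rewrite !mkvE !mxE in e0 e1 e2.
exists (v 0 k / u 0 k); apply/rowP => j; rewrite mxE; apply: (mulIf uk); rewrite [RHS]mulrAC divfK//.
move/eqP: e0; move/eqP: e1; move/eqP: e2; rewrite !subr_eq0 => /eqP e2 /eqP e1 /eqP e0.
move: k j {uk}; apply: ord3P; apply: ord3P => //; rewrite [LHS]mulrC [RHS]mulrC; 
  first [exact: e0|exact: esym e0|exact: e1|exact: esym e1|exact: e2|exact: esym e2].
Qed.
Lemma two_lines u v w : crossv u v != 0 -> dt w u = 0 -> dt w v = 0 -> exists k, w = k *: crossv u v.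
Proof.
move=> c0 wu wv; apply: crs_eq0 => //.
apply: row3P; rewrite [RHS]mxE /crossv !mkvE.
- transitivity (v 0 0 * dt w u - u 0 0 * dt w v); first by rewrite /dt; ring.
  by rewrite wu wv !mulr0 subrr.
- transitivity (v 0 1 * dt w u - u 0 1 * dt w v); first by rewrite /dt; ring.
  by rewrite wu wv !mulr0 subrr.
- transitivity (v 0 2%:R * dt w u - u 0 2%:R * dt w v); first by rewrite /dt; ring.
  by rewrite wu wv !mulr0 subrr.
Qed.
Lemma line_ofE (al : 'rV[C]_3) v : v != 0 -> line_of al (proj v) <-> dt v al = 0.
Proof.
move=> v0; have [c c0 E] := hcoord_proj v0; rewrite /line_of /= E -scalemxAl; split.
  by move=> /eqP; rewrite scaler_eq0 (negPf c0) /= dt_eq0 => /eqP.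
by move=> h; apply/eqP; rewrite scaler_eq0 dt_eq0 h eqxx orbT.
Qed.
Lemma line_of_scale (al : 'rV[C]_3) c : c != 0 -> line_of (c *: al) = line_of al.
Proof.
move=> c0; apply/seteqP; split => p; have [v v0 ->] := projS p => /(line_ofE _ v0); rewrite ?dtZr => E; apply/(line_ofE _ v0).
  by move/eqP: E; rewrite mulf_eq0 (negPf c0) => /eqP.
by rewrite dtZr E mulr0.
Qed.

Section Quadric.
Variable A : 'M[C]_3.
Hypothesis sA : smooth_form A.
Definition Bf u v := dt (u *m A) v.
Lemma BfC u v : Bf u v = Bf v u.
Proof.
have [AT _] := sA; suff : (Bf u v)%:M = (Bf v u)%:M :> 'M[C]_1.
  by move=> /(congr1 (fun m : 'M[C]_1 => m 0 0)); rewrite !mxE.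
have E : (v *m A *m u^T)^T = u *m A *m v^T by rewrite !trmx_mul trmxK AT mulmxA.
by rewrite -[LHS]dtE -E dtE tr_scalar_mx.
Qed.
Lemma BfDl u u' v : Bf (u + u') v = Bf u v + Bf u' v. Proof. by rewrite /Bf mulmxDl dtDl. Qed.
Lemma BfZl c u v : Bf (c *: u) v = c * Bf u v. Proof. by rewrite /Bf -scalemxAl dtZl. Qed.
Lemma BfDr u v v' : Bf u (v + v') = Bf u v + Bf u v'. Proof. by rewrite /Bf dtDr. Qed.
Lemma BfZr c u v : Bf u (c *: v) = c * Bf u v. Proof. by rewrite /Bf dtZr. Qed.
Lemma conic_ofE v : v != 0 -> conic_of A (proj v) <-> Bf v v = 0.
Proof.
move=> v0; have [c c0 E] := hcoord_proj v0; rewrite /conic_of /= dtE E.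
have -> : dt (c *: v *m A) (c *: v) = c ^+ 2 * Bf v v by rewrite -scalemxAl dtZl dtZr /Bf; ring.
split=> [/(congr1 (fun m : 'M[C]_1 => m 0 0))|->]; last by rewrite mulr0 raddf0.
by rewrite !mxE eqxx => /eqP; rewrite mulr1n mulf_eq0 expf_eq0 (negPf c0) => /eqP.
Qed.
Lemma nondeg v : v *m A = 0 -> v = 0.
Proof.
have [_ h] := sA; move=> vA; apply/eqP/negPn/negP => v0.
by have := h v v0; rewrite vA mul0mx eqxx => /(_ erefl).
Qed.
Definition frame_mx (r o q : 'rV[C]_3) : 'M[C]_3 := \matrix_(i, j) (if i == 0 then r 0 j else if i == 1 then o 0 j else q 0 j).
Lemma mul_frame r o q v : v *m frame_mx r o q = v 0 0 *: r + v 0 1 *: o + v 0 2%:R *: q.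
Proof. by apply/rowP => j; rewrite !mxE sum3 !mxE. Qed.
(** [o] and a second isotropic vector span a hyperbolic plane, [r] spans its orthogonal complement,
    and the second vector is rescaled so that the form becomes a multiple of [x^2 - y w]. *)
Lemma frame (o : 'rV[C]_3) : o != 0 -> Bf o o = 0 -> exists M kp, [/\ M \in unitmx, mkv 0 1 0 *m M = o, kp != 0 &
  forall u v, Bf (u *m M) (v *m M) = kp * (2%:R * u 0 0 * v 0 0 - u 0 1 * v 0 2%:R - u 0 2%:R * v 0 1)].
Proof.
move=> o0 oo.
have oA : o *m A != 0 by apply: contra_neq o0; exact: nondeg.
have [z oz] := dt_neq0 oA; rewrite -/(Bf o z) in oz.
have two0 : 2%:R != 0 :> C by rewrite pnatr_eq0.
(* The multiple of [o] that makes [z] isotropic without changing its product with [o]. *)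
pose q := z - (Bf z z / (2%:R * Bf o z)) *: o.
have qq : Bf q q = 0.
  rewrite /q -scaleNr !(BfDl, BfDr, BfZl, BfZr) oo (BfC z o); field; exact: oz.
have oq : Bf o q = Bf o z by rewrite /q -scaleNr BfDr BfZr oo mulr0 addr0.
pose r := crossv (o *m A) (q *m A).
have or0 : Bf o r = 0 by exact: crs_dtl.
have qr0 : Bf q r = 0 by exact: crs_dtr.
have r0 : r != 0.
  apply/negP => /eqP rE; have [k kE] := crs_eq0 oA rE.
  have : Bf q q = k * Bf o q by rewrite {1}/Bf kE dtZl.
  rewrite qq => /esym/eqP; rewrite mulf_eq0 oq (negPf oz) orbF => /eqP k0.
  by move: oz; rewrite -oq BfC /Bf kE k0 scale0r dt0l eqxx.
have uM q' : Bf o q' != 0 -> Bf q' q' = 0 -> Bf q' r = 0 -> frame_mx r o q' \in unitmx.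
  move=> oq' qq' qr'; rewrite -row_free_unit; apply/inj_row_free => v; rewrite mul_frame => E.
  have h w : dt 0 w = v 0 0 * dt r w + v 0 1 * dt o w + v 0 2%:R * dt q' w by rewrite -E !dtDl !dtZl.
  have v2 : v 0 2%:R = 0.
    have := h (o *m A); rewrite dt0l !(dtC _ (o *m A)) -!/(Bf o _) or0 oo !mulr0 !add0r => /esym/eqP.
    by rewrite mulf_eq0 (negPf oq') orbF => /eqP.
  have v1 : v 0 1 = 0.
    have := h (q' *m A); rewrite dt0l !(dtC _ (q' *m A)) -!/(Bf q' _) qr' qq' !mulr0 add0r addr0 => /esym/eqP.
    by rewrite mulf_eq0 BfC (negPf oq') orbF => /eqP.
  move: E; rewrite v1 v2 !scale0r !addr0 => /eqP; rewrite scaler_eq0 (negPf r0) orbF => /eqP v00.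
  by apply: row3P; rewrite mxE.
have rr : Bf r r != 0.
  apply/negP => /eqP rr; case/negP: r0; apply/eqP; apply: nondeg; apply/eqP/negPn/negP => rA.
  have [w] := dt_neq0 rA; rewrite -/(Bf r w); have uq := uM q; rewrite oq in uq.
  rewrite -[w](mulmxKV (uq oz qq qr0)) mul_frame !BfDr !BfZr rr (BfC r o) or0 (BfC r q) qr0.
  by rewrite !mulr0 !addr0 eqxx.
pose t := - (Bf r r / 2%:R) / Bf o q; pose q' := t *: q.
have oqn : Bf o q != 0 by rewrite oq.
have t0 : t != 0 by rewrite mulf_neq0 ?invr_neq0// oppr_eq0 mulf_neq0// invr_neq0.
have oq' : Bf o q' = - (Bf r r / 2%:R) by rewrite BfZr divfK.
have qq' : Bf q' q' = 0 by rewrite BfZl BfZr qq !mulr0.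
have qr' : Bf q' r = 0 by rewrite BfZl qr0 mulr0.
clearbody q'.
exists (frame_mx r o q'), (Bf r r / 2%:R); split.
- by apply: uM => //; rewrite oq' oppr_eq0 mulf_neq0// invr_neq0.
- by rewrite mul_frame !mkvE !scale0r scale1r add0r addr0.
- by rewrite mulf_neq0// invr_neq0.
- move=> u v; rewrite !mul_frame !(BfDl, BfDr, BfZl, BfZr) (BfC r o) or0 (BfC r q') qr' oo qq' (BfC q' o) oq'.
  by field.
Qed.
Lemma isotropic : exists2 o, o != 0 & Bf o o = 0.
Proof.
pose u : 'rV[C]_3 := mkv 1 0 0; pose v : 'rV[C]_3 := mkv 0 1 0.
have v0 : v != 0 by rewrite mkv_eq0 oner_eq0 andbF.
have [vv|vv] := eqVneq (Bf v v) 0; first by exists v.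
pose p : {poly C} := (Bf v v) *: 'X^2 + (2%:R * Bf u v) *: 'X + (Bf u u)%:P.
have sp : size p != 1%N.
  rewrite /p -addrA size_addl size_scale// size_polyXn//.
  apply: leq_ltn_trans (size_polyD _ _) _; rewrite gtn_max; apply/andP; split.
    by apply: leq_ltn_trans (size_scale_leq _ _) _; rewrite size_polyX.
  by apply: leq_ltn_trans (size_polyC_leq1 _) _.
have [t /rootP pt] := closed_rootP p sp.
exists (u + t *: v).
  apply/negP => /eqP /(congr1 (fun w : 'rV[C]_3 => w 0 0)); rewrite !mxE /= mulr0 addr0 => /eqP.
  by rewrite oner_eq0.
rewrite !(BfDl, BfDr, BfZl, BfZr) (BfC v u); move: pt.
rewrite /p !(hornerD, hornerZ, hornerXn, hornerX, hornerC) => E; rewrite -[RHS]E; ring.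
Qed.
(* Each form has at most two zeros among the points (t, t^2, 1) M of the conic. *)
Lemma isotropic_avoiding (cs : seq 'rV[C]_3) : {in cs, forall c, c != 0} -> exists o, [/\ o != 0, Bf o o = 0 & {in cs, forall c, dt o c != 0}].
Proof.
move=> cs0; have [b0 b00 bb] := isotropic; have [M [kp [uM _ kp0 BM]]] := frame b00 bb.
pose pt (t : C) : 'rV[C]_3 := mkv t (t ^+ 2) 1 *m M.
have ptP t : pt t != 0 /\ Bf (pt t) (pt t) = 0.
  split; last by rewrite BM !mkvE; ring.
  rewrite /pt; apply/negP => /eqP /(congr1 (mulmx^~ (invmx M))); rewrite mulmxK// mul0mx => /eqP.
  by rewrite mkv_eq0 oner_eq0 !andbF.
pose pl (c : 'rV[C]_3) : {poly C} := let d := c *m M^T in (d 0 1) *: 'X^2 + (d 0 0) *: 'X + (d 0 2%:R)%:P.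
have plE c t : (pl c).[t] = dt (pt t) c.
  have -> : dt (pt t) c = dt (mkv t (t ^+ 2) 1) (c *m M^T).
    suff : (dt (pt t) c)%:M = (dt (mkv t (t ^+ 2) 1) (c *m M^T))%:M :> 'M[C]_1.
      by move=> /(congr1 (fun m : 'M[C]_1 => m 0 0)); rewrite !mxE.
    by rewrite -!dtE trmx_mul trmxK mulmxA.
  by rewrite /pl !(hornerD, hornerZ, hornerXn, hornerX, hornerC) /dt !mkvE; ring.
have pl0 c : c \in cs -> pl c != 0.
  move=> /cs0 c0; apply/negP => /eqP E.
  have d0 : c *m M^T != 0.
    have uMT : M^T \in unitmx by rewrite unitmx_tr.
    by apply: contra_neq c0 => h; rewrite -[c](mulmxK uMT) h mul0mx.
  have e k : (pl c)`_k = 0 by rewrite E coef0.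
  case/negP: d0; apply/eqP; apply: row3P; rewrite [RHS]mxE.
  - by have := e 1%N; rewrite /pl !coefE /= mulr0 mulr1 add0r addr0.
  - by have := e 2%N; rewrite /pl !coefE /= mulr0 mulr1 !addr0.
  - by have := e 0%N; rewrite /pl !coefE /= !mulr0 !add0r.
pose p := \prod_(c <- cs) pl c.
have p0 : p != 0.
  by rewrite /p prodf_seq_neq0; apply/allP => c ccs; apply/implyP => _; exact: pl0.
have [t pt0] : exists t, ~~ root p t.
  have := max_poly_roots p0; move=> h.
  pose s := mkseq (fun k => k%:R : C) (size p).
  have us : uniq s by apply: mkseq_uniq => k l /eqP; rewrite eqr_nat => /eqP.
  apply: contrapT => /forallNP nr; have := h s _ us; rewrite size_mkseq ltnn => H.
  suff : false by []; apply: H; apply/allP => x _; apply/negPn/negP; exact: nr.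
exists (pt t); have [h1 h2] := ptP t; split => // c ccs; rewrite -plE; apply: contra pt0 => h.
by rewrite rootE /p horner_prod prodf_seq_eq0; apply/hasP; exists c.
Qed.
End Quadric.
End Frames.

Section NormalForm.
Variables (R : realType) (n : nat).
Notation C := R[i].
Notation J := (option 'I_n).
Implicit Types (u v : 'rV[C]_3).
Definition comp (Ca : arrangement (R := R) n) (l : 'I_n -> set (CP2 R)) (j : J) : set (CP2 R) :=
  if j is Some i then l i else conic Ca.
Lemma quad_split (a b : C) : exists p q, a = p + q /\ b = - (p * q).
Proof.
pose f : {poly C} := 'X^2 - a *: 'X - b%:P.
have sf : size f != 1%N.
  rewrite /f -addrA size_addl size_polyXn// -opprD size_opp.
  apply: leq_ltn_trans (size_polyD _ _) _; rewrite gtn_max; apply/andP; split.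
    by apply: leq_ltn_trans (size_scale_leq _ _) _; rewrite size_polyX.
  by apply: leq_ltn_trans (size_polyC_leq1 _) _.
have [p /rootP fp] := closed_rootP f sf; exists p, (a - p); split; first by ring.
move: fp; rewrite /f !(hornerD, hornerN, hornerZ, hornerXn, hornerX, hornerC) => fp.
rewrite -[LHS]addr0 -fp; ring.
Qed.
Lemma dt_mulmx v (d : 'rV[C]_3) (M : 'M[C]_3) : dt (v *m M) d = dt v (d *m M^T).
Proof.
suff : (dt (v *m M) d)%:M = (dt v (d *m M^T))%:M :> 'M[C]_1.
  by move=> /(congr1 (fun m : 'M[C]_1 => m 0 0)); rewrite !mxE.
by rewrite -!dtE trmx_mul trmxK mulmxA.
Qed.
Lemma line_param (d : 'rV[C]_3) v : d 0 1 != 0 ->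
  dt v d = d 0 1 * (v 0 1 - (- d 0 0 / d 0 1) * v 0 0 - (- d 0 2%:R / d 0 1) * v 0 2%:R).
Proof. by move=> d1; rewrite /dt; field. Qed.
(* In the basis M the conic is y w = x^2; P lists the abscissas of the crossings and y x is
   the ordinate of the crossing over x. *)
Record nform (Ca : arrangement (R := R) n) (l : 'I_n -> set (CP2 R)) (M : 'M[C]_3) (kp : C) (a b : 'I_n -> C) (P : seq C) (y : C -> C) : Prop := NForm {
  nf_unit : M \in unitmx;
  nf_kp : kp != 0;
  nf_Bf : forall u v, Bf (qform Ca) (u *m M) (v *m M) = kp * (2%:R * u 0 0 * v 0 0 - u 0 1 * v 0 2%:R - u 0 2%:R * v 0 1);
  nf_comp : forall j v, v != 0 -> comp Ca l j (proj (v *m M)) <-> eqn a b j v = 0;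
  nf_uniq : uniq P;
  nf_N1 : forall i k, i != k -> a i != a k /\ exists2 p, p \in P & a i * p + b i = a k * p + b k;
  nf_N2 : forall i, exists p q, [/\ p \in P, q \in P, a i = p + q & b i = - (p * q)];
  nf_Y1 : forall p j k, p \in P -> j != k -> br a b j p = br a b k p -> br a b j p = y p;
  nf_cross : forall p, p \in P -> exists j k, [/\ j != k, br a b j p = y p & br a b k p = y p] }.
Variables (Ca : arrangement (R := R) n) (l : 'I_n -> set (CP2 R)).
Hypothesis hl : line_indexing Ca l.
Let A := qform Ca.
Let sA : smooth_form A := qform_smooth Ca.
Lemma nonzero_mul (M : 'M[C]_3) v : M \in unitmx -> v != 0 -> v *m M != 0.
Proof. by move=> uM; apply: contra_neq => h; rewrite -[v](mulmxK uM) h mul0mx. Qed.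
Lemma covectors : exists al : 'I_n -> 'rV[C]_3, [/\ forall i, al i != 0, forall i, l i = line_of (al i) &
  forall i k, i != k -> crossv (al i) (al k) != 0].
Proof.
have [lC lI _] := hl.
have /choice[al alP] : forall i, exists al : 'rV[C]_3, al != 0 /\ l i = line_of al.
  by move=> i; have [al a0 E] := lines_is_line (lC i I); exists al.
exists al; split; [by move=> i; have [] := alP i|by move=> i; have [] := alP i|].
move=> i k ik; apply/negP => /eqP E; have [ai0 li] := alP i; have [ak0 lk] := alP k.
have [c cE] := crs_eq0 ai0 E.
have c0 : c != 0 by apply: contraNneq ak0 => c0; rewrite cE c0 scale0r.
have : l i = l k by rewrite li lk cE line_of_scale.
by move=> /(lI i k (mem_set I) (mem_set I)) /eqP; rewrite (negPf ik).
Qed.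
(** The first frame only serves to list representatives [L] of all crossings. The second is based at
    a point of the conic off the lines, off the polars of the crossings and off the lines joining
    two crossings: so no line is vertical, no crossing is at infinity, and distinct crossings have
    distinct abscissas. *)
Lemma nform0 : exists M kp a b P y, nform Ca l M kp a b P y.
Proof.
have [al [al0 lE alI]] := covectors.
pose on j v := if j is Some i then dt v (al i) = 0 else Bf A v v = 0.
have compE j v : v != 0 -> comp Ca l j (proj v) <-> on j v.
  move=> v0; case: j => [i|]; last exact: conic_ofE.
  by rewrite /comp lE; exact: line_ofE.
have onZ j v c : on j v -> on j (c *: v).
  by case: j => [i|] /=; rewrite ?dtZl ?BfZl ?BfZr => ->; rewrite !mulr0.
have frm (o : 'rV[C]_3) M kp : M \in unitmx -> mkv 0 1 0 *m M = o -> kp != 0 -> (forall i, dt o (al i) != 0) ->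
    (forall u v, Bf A (u *m M) (v *m M) = kp * (2%:R * u 0 0 * v 0 0 - u 0 1 * v 0 2%:R - u 0 2%:R * v 0 1)) ->
    exists a b, forall j v, on j (v *m M) <-> eqn a b j v = 0.
  move=> uM Mo kp0 oal BM; pose d i := al i *m M^T.
  have d1 i : d i 0 1 != 0.
    have := oal i; rewrite -Mo dt_mulmx -/(d i) /dt !mkvE mul1r !mul0r addr0 add0r; exact.
  exists (fun i => - d i 0 0 / d i 0 1), (fun i => - d i 0 2%:R / d i 0 1) => j v; case: j => [i|] /=.
    rewrite dt_mulmx -/(d i) line_param//; split=> [/eqP|->]; last by rewrite mulr0.
    by rewrite mulf_eq0 (negPf (d1 i)) => /eqP.
  rewrite BM; have -> : 2%:R * v 0 0 * v 0 0 - v 0 1 * v 0 2%:R - v 0 2%:R * v 0 1 = - 2%:R * (v 0 1 * v 0 2%:R - v 0 0 ^+ 2) by ring.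
  split=> [/eqP|->]; last by rewrite !mulr0.
  by rewrite mulf_eq0 (negPf kp0) /= mulf_eq0 oppr_eq0 pnatr_eq0 => /eqP.
pose als := [seq al i | i <- enum 'I_n].
have als0 : {in als, forall c, c != 0} by move=> c /mapP[i _ ->].
have alsP i : al i \in als by rewrite map_f// mem_enum.
have [z1 [z10 zz1 zal1]] := isotropic_avoiding sA als0.
have [M1 [kp1 [uM1 Mo1 kp10 BM1]]] := frame sA z10 zz1.
have [a1 [b1 on1]] := frm z1 M1 kp1 uM1 Mo1 kp10 (fun i => zal1 _ (alsP i)) BM1.
have /choice[pq pqP] : forall i, exists pq : C * C, a1 i = pq.1 + pq.2 /\ b1 i = - (pq.1 * pq.2).
  by move=> i; have [p [q [h1 h2]]] := quad_split (a1 i) (b1 i); exists (p, q).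
pose cp (t : C) : 'rV[C]_3 := mkv t (t ^+ 2) 1 *m M1.
(* Proportional vectors may occur; they give the same abscissa, and [undup] removes it later. *)
pose L := [seq crossv (al ik.1) (al ik.2) | ik <- enum {: 'I_n * 'I_n} & ik.1 != ik.2] ++
  [seq cp (pq i).1 | i <- enum 'I_n] ++ [seq cp (pq i).2 | i <- enum 'I_n].
have cp0 t : cp t != 0 by apply: nonzero_mul; rewrite // mkv_eq0 oner_eq0 !andbF.
have Lcross c : c \in L -> c != 0 /\ exists j k, [/\ j != k, on j c & on k c].
  rewrite !mem_cat => /or3P[/mapP[[i k]]|/mapP[i _ ->]|/mapP[i _ ->]].
  - rewrite mem_filter /= => /andP[ik _] ->; split; first exact: alI.
    by exists (Some i), (Some k); split => //=; rewrite dtC ?crs_dtl ?crs_dtr.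
  - split => //; exists (Some i), None; split => //; apply/on1; rewrite /= !mkvE; last by ring.
    by have [-> ->] := pqP i; ring.
  - split => //; exists (Some i), None; split => //; apply/on1; rewrite /= !mkvE; last by ring.
    by have [-> ->] := pqP i; ring.
have CFQ i v : v != 0 -> on (Some i) v -> on None v -> exists2 c, c \in L & exists k, v = k *: c.
  move=> v0; rewrite -[v](mulmxKV uM1); set u := v *m invmx M1 => k1 k2.
  have h1 := (on1 (Some i) u).1 k1; have h2 := (on1 None u).1 k2; rewrite /= in h1 h2.
  have w0 : u 0 2%:R != 0.
    apply/negP => /eqP w0; move: h2; rewrite w0 mulr0 sub0r => /eqP; rewrite oppr_eq0 expf_eq0 /= => /eqP x0.
    move: h1; rewrite w0 x0 !mulr0 !subr0 => y0; case/negP: v0; rewrite -[v](mulmxKV uM1) -/u -[u]mkv_eta x0 y0 w0.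
    by apply/eqP/eqP; rewrite (_ : mkv 0 0 0 = 0) ?mul0mx//; apply/eqP; rewrite mkv_eq0 eqxx.
  pose X := u 0 0 / u 0 2%:R; have uE : u = u 0 2%:R *: mkv X (X ^+ 2) 1.
    rewrite mkvZ mulr1 -[LHS]mkv_eta; congr mkv; first by rewrite mulrC divfK.
    have h2' : u 0 1 * u 0 2%:R = u 0 0 ^+ 2 by apply/eqP; rewrite -subr_eq0 h2.
    by rewrite /X expr_div_n -h2'; field.
  have vE : u *m M1 = u 0 2%:R *: cp X by rewrite {1}uE -scalemxAl.
  have [aE bE] := pqP i.
  have : (X - (pq i).1) * (X - (pq i).2) == 0.
    have : u 0 2%:R * ((X - (pq i).1) * (X - (pq i).2)) = 0.
      rewrite -[RHS]h1 uE mkvZ !mkvE aE bE; ring.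
    by move=> /eqP; rewrite mulf_eq0 (negPf w0).
  rewrite mulf_eq0 !subr_eq0 => /orP[/eqP XE|/eqP XE]; exists (cp X); try by exists (u 0 2%:R).
    by rewrite !mem_cat XE (map_f (fun i => cp (pq i).1)) ?mem_enum ?orbT.
  by rewrite !mem_cat XE (map_f (fun i => cp (pq i).2)) ?mem_enum ?orbT.
have CF j k v : v != 0 -> j != k -> on j v -> on k v -> exists2 c, c \in L & exists k, v = k *: c.
  move=> v0; case: j k => [i|] [k|] // jk h1 h2; [|exact: CFQ h1 h2|exact: CFQ h2 h1].
  have ik : i != k by [].
  exists (crossv (al i) (al k)); last exact: two_lines (alI _ _ ik) h1 h2.
  by rewrite !mem_cat; apply/orP; left; apply/mapP; exists (i, k) => //; rewrite mem_filter /= ik mem_enum.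
pose cs := als ++ [seq c *m A | c <- L] ++ [seq crossv cc.1 cc.2 | cc <- [seq (c, c') | c <- L, c' <- L] & crossv cc.1 cc.2 != 0].
have cs0 : {in cs, forall c, c != 0}.
  move=> c; rewrite !mem_cat => /or3P[/als0//|/mapP[d dL ->]|/mapP[cc]].
    by have [d0 _] := Lcross _ dL; apply: contra_neq d0; exact: nondeg.
  by rewrite mem_filter => /andP[h _] ->.
have [z2 [z20 zz2 zal2]] := isotropic_avoiding sA cs0.
have [M [kp [uM Mo kp0 BM]]] := frame sA z20 zz2.
have oal i : dt z2 (al i) != 0 by apply: zal2; rewrite mem_cat alsP.
have [a [b onM]] := frm z2 M kp uM Mo kp0 oal BM.
pose co (c : 'rV[C]_3) := c *m invmx M.
have coK c : co c *m M = c by exact: mulmxKV.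
have co2 c : c \in L -> co c 0 2%:R != 0.
  move=> cL; have : dt z2 (c *m A) != 0.
    by apply: zal2; rewrite !mem_cat (map_f (fun c : 'rV[C]_3 => c *m A) cL) orbT.
  rewrite dtC -/(Bf A c z2) -Mo -[c in Bf A c _]coK BM !mkvE; apply: contraNneq => ->.
  by apply/eqP; ring.
pose X c := co c 0 0 / co c 0 2%:R; pose Y c := co c 0 1 / co c 0 2%:R.
have coE c : c \in L -> c = co c 0 2%:R *: (mkv (X c) (Y c) 1 *m M).
  move=> cL; rewrite scalemxAl mkvZ mulr1 ![co c 0 2%:R * _]mulrC !divfK ?co2// mkv_eta coK//.
have coZ c c' k : c' = k *: c -> c' != 0 -> X c' = X c /\ Y c' = Y c.
  move=> E c0; have k0 : k != 0 by apply: contraNneq c0 => k0; rewrite E k0 scale0r.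
  by rewrite /X /Y /co E -scalemxAl !mxE -!mulf_div divff// !mul1r.
(* After normalisation two crossings over one abscissa differ by a multiple of [z2]; if they were
   distinct, [z2] would lie on the line joining them. *)
have XY c c' : c \in L -> c' \in L -> X c = X c' -> Y c = Y c'.
  move=> cL c'L XX; have [c0 _] := Lcross _ cL; have [c'0 _] := Lcross _ c'L.
  have [E|nE] := eqVneq (crossv c c') 0.
    by have [k kE] := crs_eq0 c0 E; have [_ ->] := coZ _ _ _ kE c'0.
  have dn : dt z2 (crossv c c') != 0.
    apply: zal2; rewrite !mem_cat; apply/or3P/Or33/mapP; exists (c, c') => //.
    by rewrite mem_filter nE (allpairs_f (fun c c' => (c, c'))).
  have e : (co c 0 2%:R)^-1 *: c - (co c' 0 2%:R)^-1 *: c' = (Y c - Y c') *: z2.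
    rewrite {2}(coE _ cL) {2}(coE _ c'L) !scalerA !mulVf ?co2// !scale1r -Mo scalemxAl -mulmxBl; congr (_ *m _).
    by rewrite mkvZ XX; apply: row3P; rewrite !mxE /=; ring.
  have := congr1 (fun v : 'rV[C]_3 => dt v (crossv c c')) e; rewrite /= -scaleNr dtDl !dtZl crs_dtl crs_dtr !mulr0 addr0 => /esym/eqP.
  by rewrite mulf_eq0 (negPf dn) orbF subr_eq0 => /eqP.
pose P := undup [seq X c | c <- L].
pose yy p := Y (nth 0 L (find (fun c => X c == p) L)).
have yyE c : c \in L -> yy (X c) = Y c.
  move=> cL; have hs : has (fun c' => X c' == X c) L by apply/hasP; exists c.
  apply: XY => //; [by rewrite mem_nth// -has_find|exact/eqP/(nth_find 0 hs)].
have brE j c : c \in L -> on j c -> br a b j (X c) = Y c.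
  move=> cL; rewrite -[c in on _ c]coK => k1; have h := (onM j _).1 k1; have c2 := co2 _ cL; move: h {k1}.
  case: j => [i|] /= h; rewrite /X /Y.
    have -> : co c 0 1 = a i * co c 0 0 + b i * co c 0 2%:R by apply/eqP; rewrite -subr_eq0 opprD addrA h.
    by field.
  have h' : co c 0 1 * co c 0 2%:R = co c 0 0 ^+ 2 by apply/eqP; rewrite -subr_eq0 h.
  by rewrite expr_div_n -h'; field.
have cross j k x : j != k -> br a b j x = br a b k x -> x \in P /\ br a b j x = yy x.
  move=> jk E; pose u : 'rV[C]_3 := mkv x (br a b j x) 1.
  have u0 : u != 0 by rewrite mkv_eq0 oner_eq0 !andbF.
  have eq0 m z : br a b m x = z -> eqn a b m (mkv x z 1) = 0.
    by case: m => [i|] /= <-; rewrite !mkvE; ring.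
  have [c cL [k0 vE]] := CF j k _ (nonzero_mul uM u0) jk ((onM j u).2 (eq0 _ _ erefl)) ((onM k u).2 (eq0 _ _ (esym E))).
  have [h1 h2] := coZ _ _ _ vE (nonzero_mul uM u0).
  have uE : co (u *m M) = u by exact: mulmxK.
  rewrite /X /Y uE !mkvE !divr1 in h1 h2.
  by rewrite h2 h1 mem_undup (map_f X cL) yyE.
exists M, kp, a, b, P, yy; split => //.
- by move=> j v v0; have h := onM j v; rewrite -h; apply: compE; exact: nonzero_mul.
- exact: undup_uniq.
- move=> i k ik; have cL : crossv (al i) (al k) \in L.
    by rewrite !mem_cat; apply/orP; left; apply/mapP; exists (i, k) => //; rewrite mem_filter /= ik mem_enum.
  have e1 := brE (Some i) _ cL; have e2 := brE (Some k) _ cL; rewrite /= dtC crs_dtl in e1; rewrite /= dtC crs_dtr in e2.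
  have E : a i * X (crossv (al i) (al k)) + b i = a k * X (crossv (al i) (al k)) + b k by rewrite e1// e2.
  split; last by exists (X (crossv (al i) (al k))); rewrite // mem_undup (map_f X cL).
  apply/negP => /eqP aik; have bik : b i = b k by move: E; rewrite aik => /addrI.
  have [lC lI _] := hl; have : l i = l k.
    apply/seteqP; split => p; have [v v0 ->] := projS p; rewrite -[v](mulmxKV uM) => h.
      have w0 := v0; rewrite -[v](mulmxKV uM) in w0.
      have h1 := (onM _ _).1 ((compE (Some i) _ w0).1 h); apply/(compE (Some k) _ w0)/onM.
      by move: h1; rewrite /= aik bik.
    have w0 := v0; rewrite -[v](mulmxKV uM) in w0.
    have h1 := (onM _ _).1 ((compE (Some k) _ w0).1 h); apply/(compE (Some i) _ w0)/onM.
    by move: h1; rewrite /= aik bik.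
  by move=> /(lI i k (mem_set I) (mem_set I)) /eqP; rewrite (negPf ik).
- move=> i; have [p [q [aE bE]]] := quad_split (a i) (b i); exists p, q; split => //.
    by have [] := @cross (Some i) None p; rewrite //= aE bE; ring.
  by have [] := @cross (Some i) None q; rewrite //= aE bE; ring.
- by move=> p j k _ jk E; have [] := cross _ _ _ jk E.
- move=> p; rewrite mem_undup => /mapP[c cL ->]; have [_ [j [k [jk hj hk]]]] := Lcross _ cL.
  by exists j, k; rewrite yyE// !brE.
Qed.
End NormalForm.

Section Combinatorics.
Variables (R : realType) (n : nat).
Notation C := R[i].
Notation J := (option 'I_n).
Implicit Types (u v : 'rV[C]_3).
(** Preserves the conic [y w = x^2]; it serves to bring all abscissas within 1/8. *)
Definition scale_mx (k : C) : 'M[C]_3 := frame_mx (mkv k^-1 0 0) (mkv 0 (k^-1 ^+ 2) 0) (mkv 0 0 1).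
Lemma mul_scale k v : v *m scale_mx k = mkv (k^-1 * v 0 0) (k^-1 ^+ 2 * v 0 1) (v 0 2%:R).
Proof. by rewrite mul_frame; apply: row3P; rewrite !mxE /=; ring. Qed.
Lemma scale_unit k : k != 0 -> scale_mx k \in unitmx.
Proof.
move=> k0; rewrite -row_free_unit; apply/inj_row_free => v; rewrite mul_scale => /eqP.
rewrite mkv_eq0 !mulf_eq0 !invr_eq0 (negPf k0) /= => /and3P[/eqP v0 /eqP v1 /eqP v2].
by apply: row3P; rewrite mxE.
Qed.

Section OneForm.
Variables (Ca : arrangement (R := R) n) (l : 'I_n -> set (CP2 R)).
Hypothesis hl : line_indexing Ca l.
Lemma nform_scale M kp a b P y k : k != 0 -> nform Ca l M kp a b P y ->
  nform Ca l (scale_mx k *m M) (kp / k ^+ 2) (fun i => k * a i) (fun i => k ^+ 2 * b i) [seq k * p | p <- P] (fun x => k ^+ 2 * y (x / k)).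
Proof.
move=> k0 [uM kp0 BM cM uP N1 N2 Y1 X].
have brk j p : br (fun i => k * a i) (fun i => k ^+ 2 * b i) j (k * p) = k ^+ 2 * br a b j p.
  by case: j => [i|] /=; ring.
have k2 : k ^+ 2 != 0 by rewrite expf_neq0.
split.
- by rewrite unitmx_mul scale_unit.
- by rewrite mulf_neq0// invr_neq0.
- by move=> u v; rewrite !mulmxA BM !mul_scale !mkvE; field.
- move=> j v v0; rewrite mulmxA cM; last by apply: nonzero_mul => //; exact: scale_unit.
  rewrite mul_scale; have -> : eqn a b j (mkv (k^-1 * v 0 0) (k^-1 ^+ 2 * v 0 1) (v 0 2%:R)) =
      k^-1 ^+ 2 * eqn (fun i => k * a i) (fun i => k ^+ 2 * b i) j v.
    by case: j => [i|] /=; rewrite !mkvE; field.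
  split=> [/eqP|->]; last by rewrite mulr0.
  by rewrite mulf_eq0 expf_eq0 invr_eq0 (negPf k0) /= => /eqP.
- by rewrite map_inj_uniq//; exact: mulfI.
- move=> i i' ii; have [aii [p pP E]] := N1 _ _ ii; split; first by rewrite (inj_eq (mulfI k0)).
  exists (k * p); first exact: map_f.
  by have := brk (Some i) p; have := brk (Some i') p => /= -> ->; rewrite E.
- move=> i; have [p [q [pP qP -> ->]]] := N2 i; exists (k * p), (k * q); split; try exact: map_f; ring.
- move=> _ j j' /mapP[p pP ->] jj; rewrite !brk => /(mulfI k2) E; congr (_ * _).
  have -> : k * p / k = p by rewrite mulrAC divff// mul1r.
  exact: Y1 pP jj E.
- move=> _ /mapP[p pP ->]; have [j [j' [jj E1 E2]]] := X p pP; exists j, j'.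
  have -> : k * p / k = p by rewrite mulrAC divff// mul1r.
  by rewrite !brk E1 E2.
Qed.
Lemma normal_form : exists M kp a b P y, nform Ca l M kp a b P y /\ normal_lines a b P.
Proof.
have [M [kp [a [b [P [y nf]]]]]] := nform0 hl.
pose S : R := \sum_(p <- P) cabs p.
have S0 : 0 <= S by apply: sumr_ge0 => p _; exact: cabs_ge0.
pose t : R := (8 * (1 + S))^-1; have t0 : 0 < t by rewrite invr_gt0 mulr_gt0// ltr_pwDl.
have k0 : t%:C != 0 by apply/eqP => -[] /eqP; rewrite gt_eqF.
have nf' := nform_scale k0 nf; do 6 eexists; split; first exact: nf'.
split; [exact: nf_uniq nf'|exact: nf_N1 nf'|exact: nf_N2 nf'|].
move=> _ /mapP[p pP ->]; rewrite cabsM cabs_real gtr0_norm// /t.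
rewrite mulrC ler_pdivrMr; last by rewrite mulr_gt0// ltr_pwDl.
have pS : cabs p <= S.
  by rewrite /S (big_rem p pP) /= lerDl sumr_ge0// => q _; exact: cabs_ge0.
lra.
Qed.
Variables (M : 'M[C]_3) (kp : C) (a b : 'I_n -> C) (P : seq C) (y : C -> C).
Hypothesis nf : nform Ca l M kp a b P y.
Hypothesis nl : normal_lines a b P.
Let uM : M \in unitmx := nf_unit nf.
Lemma curve_comp p : curve Ca p <-> exists j, comp Ca l j p.
Proof.
have [lC lI lS] := hl; split.
  move=> [D [CD|->] Dp]; last by exists None.
  by have [i _ E] := lS _ CD; exists (Some i); rewrite /= E.
move=> [[i|] /= h]; first by exists (l i) => //; left; exact: lC.
by exists (conic Ca) => //; right.
Qed.
Lemma linmap_proj v : v != 0 -> linmap M (proj v) = proj (v *m M).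
Proof. by move=> v0; rewrite /linmap hom_map_proj//; exact: linmap_hom. Qed.
Lemma comp_branch j : comp Ca l j = linmap M @` branch a b j.
Proof.
have E v : v != 0 -> comp Ca l j (proj (v *m M)) <-> branch a b j (proj v).
  move=> v0; rewrite (nf_comp nf)// branchE /=; have [c c0 ->] := hcoord_proj v0.
  by split=> /eqP h; apply/eqP; move: h; rewrite eqnZ.
apply/seteqP; split => p; last first.
  by move=> [q hq <-]; have [v v0 qE] := projS q; rewrite qE linmap_proj//; apply/E; rewrite // -qE.
have [v v0 ->] := projS p => h.
have w0 : v *m invmx M != 0 by apply: nonzero_mul; rewrite // unitmx_inv.
have vE : v *m invmx M *m M = v by exact: mulmxKV.
exists (proj (v *m invmx M)); last by rewrite linmap_proj// vE.
by apply/E; rewrite // vE.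
Qed.
Lemma nform_curve : linmap M @` curve_of a b (br a b) = curve Ca.
Proof.
rewrite curve_of_branch image_bigcup; apply/seteqP; split => p.
  by move=> [j _]; rewrite -comp_branch => h; apply/curve_comp; exists j.
by move=> /curve_comp[j]; rewrite comp_branch; exists j.
Qed.
Definition vpt (p : C) : CP2 R := proj (mkv p (y p) 1 *m M).
Let pt0 (x z : C) : mkv x z 1 != 0. Proof. by rewrite mkv_eq0 oner_eq0 !andbF. Qed.
Lemma affine_comp j x z : comp Ca l j (proj (mkv x z 1 *m M)) <-> br a b j x = z.
Proof.
rewrite (nf_comp nf) ?pt0//; case: j => [i|] /=; rewrite !mkvE !mulr1 ?mulr0.
  split=> [E|<-]; last by ring.
  by apply/eqP; rewrite eq_sym -subr_eq0 opprD addrA E.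
split=> [/eqP|->]; last by rewrite subrr.
by rewrite subr_eq0 => /eqP.
Qed.
Lemma vpt_comp j p : comp Ca l j (vpt p) <-> br a b j p = y p.
Proof. exact: affine_comp. Qed.
Lemma vpt_inj : injective vpt.
Proof.
move=> p q /proj_eqP[||c c0]; rewrite ?nonzero_mul ?pt0//.
rewrite scalemxAl => /(congr1 (mulmx^~ (invmx M))); rewrite !mulmxK// mkvZ mulr1 => E.
have := congr1 (fun v : 'rV[C]_3 => v 0 2%:R) E; have := congr1 (fun v : 'rV[C]_3 => v 0 0) E.
by rewrite !mkvE => -> <-; rewrite mul1r.
Qed.
Lemma comp_inj j k : comp Ca l j = comp Ca l k -> j = k.
Proof.
have [lC lI _] := hl.
have h i : comp Ca l (Some i) <> comp Ca l None.
  have v0 : mkv 0 1 0 != 0 :> 'rV[C]_3 by rewrite mkv_eq0 oner_eq0 andbF.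
  have := nf_comp nf (Some i) v0; have := nf_comp nf None v0; rewrite /= !mkvE => h1 h2 E.
  have : conic Ca (proj (mkv 0 1 0 *m M)) by apply/h1; ring.
  rewrite -[conic Ca]E => /h2 /eqP; rewrite !mulr0 !subr0 oner_eq0//.
case: j k => [i|] [k|] //; [|by move=> /h|by move=> /esym/h].
by move=> /= E; congr Some; apply: (lI i k (mem_set I) (mem_set I)).
Qed.
Lemma intersection_comp p : intersection_points Ca p <-> exists j k, [/\ j != k, comp Ca l j p & comp Ca l k p].
Proof.
have [lC _ lS] := hl.
have cP D : components Ca D <-> exists j, D = comp Ca l j.
  split=> [[/lS[i _ <-]|->]|[[i|] ->]]; [by exists (Some i)|by exists None|by left; exact: lC|by right].
split=> [[D1 [D2 [/cP[j ->] /cP[k ->] jk h1 h2]]]|[j [k [jk h1 h2]]]].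
  by exists j, k; split => //; apply/eqP => E; apply: jk; rewrite E.
exists (comp Ca l j), (comp Ca l k); split => //; [by apply/cP; exists j|by apply/cP; exists k|].
by move=> /comp_inj E; rewrite E eqxx in jk.
Qed.
Lemma vpt_intersection p : p \in P -> intersection_points Ca (vpt p).
Proof.
move=> pP; have [j [k [jk jp kp']]] := nf_cross nf pP; apply/intersection_comp.
by exists j, k; split => //; apply/vpt_comp.
Qed.
Lemma intersection_vpt q : intersection_points Ca q -> exists2 p, p \in P & q = vpt p.
Proof.
move=> /intersection_comp[j [k [jk]]]; have [v v0 ->] := projS q.
have w0 : v *m invmx M != 0 by apply: nonzero_mul; rewrite // unitmx_inv.
have vE : v *m invmx M *m M = v by exact: mulmxKV.
rewrite -vE; set u := v *m invmx M in w0 *; rewrite !(nf_comp nf)// => hj hk.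
have u2 : u 0 2%:R != 0.
  apply/negP => /eqP u2.
  have L i : eqn a b (Some i) u = 0 -> u 0 1 = a i * u 0 0.
    by rewrite /= u2 mulr0 subr0 => /eqP; rewrite subr_eq0 => /eqP.
  have Q : eqn a b None u = 0 -> u 0 0 = 0.
    by rewrite /= u2 mulr0 sub0r => /eqP; rewrite oppr_eq0 expf_eq0 => /eqP.
  suff [x0 y0] : u 0 0 = 0 /\ u 0 1 = 0 by case/negP: w0; rewrite -[u]mkv_eta mkv_eq0 x0 y0 u2 eqxx.
  case: j k jk hj hk => [i|] [i'|] // jk.
  - move=> /L e1 /L e2; have ii : i != i' by [].
    have [aii _] := nf_N1 nf ii; have : (a i - a i') * u 0 0 = 0 by rewrite mulrBl -e1 -e2 subrr.
    move=> /eqP; rewrite mulf_eq0 subr_eq0 (negPf aii) /= => /eqP x0; split => //.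
    by rewrite e1 x0 mulr0.
  - by move=> /L e1 /Q x0; rewrite e1 x0 mulr0.
  - by move=> /Q x0 /L e1; rewrite e1 x0 mulr0.
pose x := u 0 0 / u 0 2%:R.
have brE m : eqn a b m u = 0 -> br a b m x = u 0 1 / u 0 2%:R.
  case: m => [i|] /= h; rewrite /x.
    have -> : u 0 1 = a i * u 0 0 + b i * u 0 2%:R by apply/eqP; rewrite -subr_eq0 opprD addrA h.
    by field.
  have h' : u 0 1 * u 0 2%:R = u 0 0 ^+ 2 by apply/eqP; rewrite -subr_eq0 h.
  by rewrite expr_div_n -h'; field.
have jkx : br a b j x = br a b k x by rewrite !brE.
have xP := crossing_in nl jk jkx; exists x; first exact: xP.
rewrite /vpt -(nf_Y1 nf xP jk jkx) (brE _ hj); have p0 := pt0 x (u 0 1 / u 0 2%:R).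
apply/proj_eqP; [exact: nonzero_mul|exact: nonzero_mul|exists (u 0 2%:R) => //].
rewrite scalemxAl; congr (_ *m _).
by rewrite mkvZ mulr1 ![u 0 2%:R * _]mulrC !divfK// mkv_eta.
Qed.
(** In normal coordinates the tangent over [p] is [y = 2 p x - p^2], and a line through the crossing
    is determined by its slope. *)
Lemma tangent_slope p i : br a b (Some i) p = y p -> br a b None p = y p ->
  tangent_at Ca (l i) (vpt p) <-> a i = 2%:R * p.
Proof.
move=> ip qp; set v := mkv p (y p) 1 : 'rV[C]_3.
have v0 : v *m M != 0 by apply: nonzero_mul => //; exact: pt0.
have [c c0 hE] := hcoord_proj v0.
have tE u : u != 0 -> line_of (hcoord (vpt p) *m qform Ca) (proj (u *m M)) <-> 2%:R * p * u 0 0 - u 0 1 - p ^+ 2 * u 0 2%:R = 0.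
  move=> u0; rewrite line_ofE ?nonzero_mul// /vpt -/v hE -scalemxAl dtZr dtC -/(Bf (qform Ca) _ _) (nf_Bf nf) /v !mkvE -qp /=.
  have -> : 2%:R * p * u 0 0 - p ^+ 2 * u 0 2%:R - 1 * u 0 1 = 2%:R * p * u 0 0 - u 0 1 - p ^+ 2 * u 0 2%:R by ring.
  split=> [/eqP|->]; last by rewrite !mulr0.
  by rewrite mulf_eq0 (negPf c0) mulf_eq0 (negPf (nf_kp nf)) => /eqP.
have lE u : u != 0 -> l i (proj (u *m M)) <-> u 0 1 - a i * u 0 0 - b i * u 0 2%:R = 0.
  by move=> u0; exact: (nf_comp nf (Some i) u0).
split=> [[_ E]|ai].
  have u0 : mkv 1 (a i) 0 != 0 :> 'rV[C]_3 by rewrite mkv_eq0 oner_eq0.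
  have := (lE _ u0).2; rewrite E => h; have := (tE _ u0).1 (h _); rewrite !mkvE; last first.
  move=> h2; apply/esym/eqP; rewrite -subr_eq0; apply/eqP; rewrite -[RHS]h2 ?mkvE; [ring|].
  by ring.
have bi : b i = - p ^+ 2.
  have : a i * p + b i = p ^+ 2 by rewrite [LHS]ip -qp.
  by move=> e; apply: (@addrI _ (a i * p)); rewrite e ai; ring.
split; first by apply/(vpt_comp None).
apply/seteqP; split => q; have [w w0 ->] := projS q; rewrite -[w](mulmxKV uM);
  have u0 : w *m invmx M != 0 by [apply: nonzero_mul; rewrite // unitmx_inv]; set u := w *m _ in u0 *.
  move=> /(lE _ u0) e; apply/(tE _ u0); rewrite ai bi in e.
  by rewrite -[RHS]oppr0 -[in RHS]e; ring.
move=> /(tE _ u0) e; apply/(lE _ u0); rewrite ai bi.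
by rewrite -[RHS]oppr0 -[in RHS]e; ring.
Qed.
End OneForm.
Lemma nat_of_asbool_iff (Q Q' : Prop) : nat_of_bool `[< Q >] = `[< Q' >] -> Q <-> Q'.
Proof. by case: asboolP => h; case: asboolP. Qed.
Lemma char_conic (C1 C2 : arrangement (R := R) n) p q : char C2 q = char C1 p -> conic C2 q <-> conic C1 p.
Proof. by move=> /(congr1 (fun c : nat * nat * nat => c.1.2)) h; apply: nat_of_asbool_iff; exact: h. Qed.
Lemma char_tangent (C1 C2 : arrangement (R := R) n) p q : char C2 q = char C1 p ->
  (exists2 L, lines C2 L & tangent_at C2 L q) <-> (exists2 L, lines C1 L & tangent_at C1 L p).
Proof. by move=> /(congr1 (fun c : nat * nat * nat => c.1.1)) h; apply: nat_of_asbool_iff; exact: h. Qed.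
Lemma combinatorial_homeo (C1 C2 : arrangement (R := R) n) l1 l2 (b : CP2 R -> CP2 R) :
  line_indexing C1 l1 -> line_indexing C2 l2 -> set_bij (intersection_points C1) (intersection_points C2) b ->
  (forall p, intersection_points C1 p -> [/\ char C2 (b p) = char C1 p, [set i | l2 i (b p)] = [set i | l1 i p]
      & forall i, tangent_at C1 (l1 i) p -> tangent_at C2 (l2 i) (b p)]) ->
  nbhd_homeo (curve C1) (curve C2) /\ small_tubes (curve C1).
Proof.
move=> hl1 hl2 [bI binj bS] bP.
have [M1 [k1 [a1 [b1 [P1 [y1 [nf1 nl1]]]]]]] := normal_form hl1.
have [M2 [k2 [a2 [b2 [P2 [y2 [nf2 nl2]]]]]]] := normal_form hl2.
have h1 := bihomeo_nbhd (curve_of a1 b1 (br a1 b1)) (linmap_bihomeo (nf_unit nf1)).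
have h2 := bihomeo_nbhd (curve_of a2 b2 (br a2 b2)) (linmap_bihomeo (nf_unit nf2)).
rewrite (nform_curve hl1 nf1) in h1; rewrite (nform_curve hl2 nf2) in h2.
split; last by apply: small_tubes_homeo h1 _; exact: normal_tubes nl1.
apply: nbhd_homeo_trans (nbhd_homeo_sym h1) _; apply: nbhd_homeo_trans _ h2.
have I1 p (pP : p \in P1) : intersection_points C1 (vpt M1 y1 p) := vpt_intersection hl1 nf1 pP.
have I2 p (pP : p \in P2) : intersection_points C2 (vpt M2 y2 p) := vpt_intersection hl2 nf2 pP.
have J1 := intersection_vpt hl1 nf1 nl1; have J2 := intersection_vpt hl2 nf2 nl2.
have /choice[s sP] : forall p, exists x, p \in P1 -> x \in P2 /\ b (vpt M1 y1 p) = vpt M2 y2 x.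
  move=> p; have [pP|pP] := boolP (p \in P1); last by exists 0.
  by have [x xP E] := J2 _ (bI _ (I1 _ pP)); exists x.
have compB j p : p \in P1 -> comp C1 l1 j (vpt M1 y1 p) <-> comp C2 l2 j (vpt M2 y2 (s p)).
  move=> pP; have [_ <-] := sP _ pP; have := I1 _ pP; move: (vpt M1 y1 p) => q Iq.
  have [ch st _] := bP _ Iq; case: j => [i|]; last first.
    by change (conic C1 q <-> conic C2 (b q)); exact: (iff_sym (char_conic ch)).
  have E : l2 i (b q) = l1 i q := congr1 (fun A : set 'I_n => A i) st.
  by change (l1 i q <-> l2 i (b q)); rewrite E; exact: iff_refl.
have Y2 p j : p \in P1 -> br a1 b1 j p = y1 p <-> br a2 b2 j (s p) = y2 (s p).
  by move=> pP; rewrite -(vpt_comp nf1) -(vpt_comp nf2); exact: compB.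
apply: (@normal_transport _ _ a1 b1 a2 b2 P1 P2 s y1 y2) => //.
- move=> p q pP qP E; apply: (vpt_inj nf1); apply: binj; [exact: mem_set (I1 _ pP)|exact: mem_set (I1 _ qP)|].
  by have [_ ->] := sP _ pP; have [_ ->] := sP _ qP; rewrite E.
- move=> p' p'P; have [q Iq qE] := bS _ (I2 _ p'P); have [p pP pE] := J1 _ Iq.
  exists p => //; apply: (vpt_inj nf2); rewrite -qE pE.
  by have [_ ->] := sP _ pP.
- by move=> p j k pP jk E; exact: nf_Y1 nf1 _ _ _ pP jk E.
- by move=> p j k pP jk E; exact: nf_Y1 nf2 _ _ _ pP jk E.
- move=> p i pP ip qp; have ip' := (Y2 p (Some i) pP).1 ip; have qp' := (Y2 p None pP).1 qp.
  rewrite -(tangent_slope nf1 ip qp) -(tangent_slope nf2 ip' qp').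
  have [_ <-] := sP _ pP; have := I1 _ pP; move: (vpt M1 y1 p) => q Iq.
  have [ch _ tg] := bP _ Iq; split=> [|t2]; first exact: tg.
  have [lC2 lI2 _] := hl2; have [_ _ lS1] := hl1.
  (* Condition (iii) goes only forwards. Conversely the first entry of [char] yields a line [k]
     tangent at [q]; its partner is tangent at [b q], where the tangent is unique, so [k = i]. *)
  have /(char_tangent ch)[D /lS1[k _ <-] tk] : exists2 L, lines C2 L & tangent_at C2 L (b q) by exists (l2 i); [exact: lC2|].
  have -> : i = k by apply: (lI2 i k (mem_set I) (mem_set I)); have [_ ->] := t2; have [_ <-] := tg _ tk.
  exact: tk.
Qed.
End Combinatorics.

(** * Homeomorphisms permute the components *)
Section PuncturedPlane.
Variable R : realType.
Notation C := R[i].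
Lemma small_avoid (A : set C) (s : seq C) : nbhs (0 : C) A -> exists2 u, A u & u \notin s.
Proof.
move=> /nbhsC[e e0 eA]; have [m /andP[m0 _] ms] := pos_lower_bound (map (@cabs R) s).
pose t := Num.min e m / 2; have t0 : 0 < t by rewrite divr_gt0// lt_min e0.
have tm : t < Num.min e m by rewrite ltr_pdivrMr// ltr_pMr ?lt_min ?e0//; lra.
have ct : cabs t%:C = t by rewrite cabs_real gtr0_norm.
exists t%:C; first by apply: eA; rewrite subr0 ct; apply: lt_le_trans tm _; rewrite ge_min lexx.
apply/negP => ts; have := ms _ (map_f (@cabs R) ts); rewrite ct => /(_ t0).
by rewrite leNgt (lt_le_trans tm)// ge_min lexx orbT.
Qed.
(* Two points are joined by a family of parabolic arcs that only meet at their ends, so one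
   of these avoids s. *)
Lemma complement_connected (s : seq C) : connected [set z : C | z \notin s].
Proof.
have [z0 _ z0s] := @small_avoid setT s (filterT).
pose gam (w : C) (t u : R) : C := z0 + (w - z0) * (u +i* (t * (u * (1 - u)))).
have [T hT] : exists T : C -> R, forall w u, w \notin s -> 0 <= u <= 1 -> gam w (T w) u \notin s.
  suff /choice[T hT] : forall w, exists t, forall u, w \notin s -> 0 <= u <= 1 -> gam w t u \notin s.
    by exists T.
  move=> w.
  pose q e : C := (e - z0) / (w - z0).
  (* The parameter whose arc passes through [e] between its ends; a value above all of them avoids
     [s]. *)
  pose bad (e : C) : R := complex.Im (q e) / (complex.Re (q e) * (1 - complex.Re (q e))).
  have [M Mb] : exists M : R, forall e, e \in s -> bad e < M.
    exists (1 + \sum_(e <- s) `|bad e|) => e es; rewrite (big_rem e es) /= addrCA ltr_pwDr//.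
      by rewrite ltr_pwDl// sumr_ge0.
    exact: ler_norm.
  exists M => u ws /andP[u0 u1]; apply/negP => es.
  have [u00|un0] := eqVneq u 0.
    by move: es; rewrite /gam u00 mul0r mulr0 mulr0 addr0; apply/negP.
  have [u11|un1] := eqVneq u 1.
    by move: es; rewrite /gam u11 subrr !mulr0 mulr1 addrC subrK; apply/negP.
  have [wz|wz] := eqVneq w z0.
    by move: es; rewrite /gam wz subrr mul0r addr0; apply/negP.
  have := Mb _ es; rewrite /bad; have -> : q (gam w M u) = u +i* (M * (u * (1 - u))).
    by rewrite /q /gam addrC addKr mulrC mulKf// subr_eq0.
  rewrite /= mulfK ?ltxx// mulf_neq0// subr_eq0 eq_sym//.
pose arc w := (fun u : R => gam w (T w) u) @` `[0, 1].
have -> : [set z : C | z \notin s] = \bigcup_(w in [set z : C | z \notin s]) arc w.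
  apply/seteqP; split => [w ws|_ [w ws [u /= uI <-]]].
    exists w => //; exists 1; first by rewrite /= in_itv /= lexx ler01.
    by rewrite /gam subrr !mulr0 mulr1 addrC subrK.
  by apply: hT => //; move: uI; rewrite in_itv.
apply: bigcup_connected.
  exists z0 => w ws; exists 0; first by rewrite /= in_itv /= lexx ler01.
  by rewrite /gam mul0r mulr0 mulr0 addr0.
move=> w _; apply: connected_continuous_connected; first exact: segment_connected.
by apply: continuous_subspaceT => u; rewrite /gam; tendsto.
Qed.
(** Each piece is closed, and open in [A] because the other pieces are finitely many closed sets
    disjoint from it on [A]. *)
Lemma connected_in_one (X : topologicalType) (I : finType) (A : set X) (B : I -> set X) :
  connected A -> A !=set0 -> (forall i, closed (B i)) -> A `<=` \bigcup_i B i ->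
  (forall i k x, A x -> B i x -> B k x -> i = k) -> exists i, A `<=` B i.
Proof.
move=> cA [x Ax] cB AB inj; have [i _ Bi] := AB _ Ax; exists i.
suff <- : A `&` B i = A by exact: subIsetr.
apply: cA; first by exists x.
  exists (~` \bigcup_(k in [set k | k != i]) B k).
    by apply: closed_openC; apply: closed_bigcup => //; exact: finite_finset.
  apply/seteqP; split => z [Az h]; split => //.
    by move=> [k /= ki Bk]; rewrite (inj k i z Az Bk h) eqxx in ki.
  have [k _ Bk] := AB _ Az; have [<-//|ki] := eqVneq k i.
  by exfalso; apply: h; exists k.
by exists (B i).
Qed.
End PuncturedPlane.

Section Components.
Variables (R : realType) (n : nat).
Notation C := R[i].
Notation J := (option 'I_n).

Section OneCurve.
Variables (Ca : arrangement (R := R) n) (l : 'I_n -> set (CP2 R)).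
Hypothesis hl : line_indexing Ca l.
Variables (M : 'M[C]_3) (kp : C) (a b : 'I_n -> C) (P : seq C) (y : C -> C).
Hypothesis nf : nform Ca l M kp a b P y.
Hypothesis nl : normal_lines a b P.
Let uM : M \in unitmx := nf_unit nf.
Definition param (j : J) (x : C) : CP2 R := linmap M (affpt (x, br a b j x)).
Lemma paramE j x : param j x = proj (mkv x (br a b j x) 1 *m M).
Proof. by rewrite /param /affpt (linmap_proj nf)// mkv_eq0 oner_eq0 !andbF. Qed.
Lemma param_comp j k x : comp Ca l k (param j x) <-> br a b k x = br a b j x.
Proof. by rewrite paramE; exact: (affine_comp nf). Qed.
Lemma linmap_continuous : continuous (linmap M).
Proof. by have [k []] := linmap_bihomeo uM. Qed.
Lemma linmap_inj : injective (linmap M).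
Proof. exact: bihomeo_inj (linmap_bihomeo uM). Qed.
Lemma br_continuous j : continuous (br a b j).
Proof. case: j => [i|] x.
  change (tends (nbhs x) (fun x => a i * x + b i) (a i * x + b i)); tendsto.
change (tends (nbhs x) (fun x => x ^+ 2) (x ^+ 2)); tendsto.
Qed.
Lemma proj_continuous (T : topologicalType) (f g h : T -> C) t :
  mkv (f t) (g t) (h t) != 0 -> tends (nbhs t) f (f t) -> tends (nbhs t) g (g t) -> tends (nbhs t) h (h t) ->
  tends (nbhs t) (fun u => proj (mkv (f u) (g u) (h u))) (proj (mkv (f t) (g t) (h t))).
Proof.
move=> nz cf cg ch; apply: (tends_comp _ (cvg_proj nz)).
by apply: tends_mkv.
Qed.
Lemma param_continuous j : continuous (param j).
Proof.
move=> x; have h : tends (nbhs x) (br a b j) (br a b j x) := @br_continuous j x.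
have c : tends (nbhs x) (fun x => affpt (x, br a b j x)) (affpt (x, br a b j x)).
  by apply: proj_continuous; [rewrite mkv_eq0 oner_eq0 !andbF|exact: tends_id|exact: h|exact: tends_cst].
exact: (tends_comp c (@linmap_continuous _)).
Qed.
Lemma param_inj j : injective (param j).
Proof. by move=> x x' /linmap_inj /affpt_inj[]. Qed.
(** The point at infinity is included, as the limit for [x = 1 / u] and [u] tending to 0. *)
Lemma param_dense j q (s : seq C) (B : set (CP2 R)) : comp Ca l j q -> nbhs q B ->
  exists2 x, x \notin s & B (param j x).
Proof.
rewrite (comp_branch nf) => -[_ [[x ->]|->] <-] nB.
  have c : tends (nbhs (0 : C)) (fun u => param j (x + u)) (param j x).
    have c1 : tends (nbhs (0 : C)) (fun u => x + u) x by rewrite -[X in tends _ _ X]addr0; tendsto.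
    by apply: (tends_comp c1); exact: param_continuous.
  have [u Bu us] := small_avoid [seq z - x | z <- s] (c _ nB); exists (x + u) => //.
  by apply: contra us => us; apply/mapP; exists (x + u) => //; rewrite addrC addKr.
pose e (u : C) : CP2 R := if j is Some i then affptx (a i + b i * u, u) else affpty (u, u ^+ 2).
have e0 : e 0 = chartI a b j (0, 0).
  by rewrite /e /chartI; case: (j) => [i|]; rewrite ?chartQ0 ?mulr0 ?addr0 ?expr0n.
have ce : tends (nbhs (0 : C)) e (e 0).
  rewrite /e /affptx /affpty; case: (j) => [i|]; apply: proj_continuous => /=; rewrite ?mkv_eq0 ?oner_eq0 ?andbF//; tendsto.
have eE u : u != 0 -> e u = affpt (u^-1, br a b j u^-1).
  move=> u0; rewrite /e /affpt /affptx /affpty; case: (j) => [i|] /=; apply/proj_eqP; rewrite ?mkv_eq0 ?oner_eq0 ?andbF//.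
    by exists u => //; rewrite mkvZ; congr mkv; field.
  by exists (u ^+ 2); rewrite ?expf_neq0// mkvZ; congr mkv; field.
have c : tends (nbhs (0 : C)) (fun u => linmap M (e u)) (linmap M (e 0)).
  by apply: (tends_comp ce); exact: linmap_continuous.
rewrite -e0 in nB; have [u Bu us] := small_avoid (0 :: [seq z^-1 | z <- s]) (c _ nB).
move: us; rewrite inE negb_or => /andP[u0 us]; exists u^-1; last by rewrite /param -eE.
by apply: contra us => us; apply/mapP; exists u^-1; rewrite ?invrK.
Qed.
Lemma intersectionP j k p : j != k -> comp Ca l j p -> comp Ca l k p -> exists2 x, x \in P & p = vpt M y x.
Proof. by move=> jk jp kp'; apply: (intersection_vpt hl nf nl); apply/(intersection_comp hl nf); exists j, k. Qed.
End OneCurve.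

Section Incidence.
Variables (Ca : arrangement (R := R) n) (l : 'I_n -> set (CP2 R)).
Hypothesis hl : line_indexing Ca l.
Lemma comp_closed j : closed (comp Ca l j).
Proof.
have [M [kp [a [b [P [y [nf nl]]]]]]] := normal_form hl.
rewrite (comp_branch nf); apply: compact_closed; first exact: CP2_hausdorff.
apply: continuous_compact; last exact: branch_compact.
by apply: continuous_subspaceT; exact: (linmap_continuous nf).
Qed.
Lemma intersection_finite : finite_set (intersection_points Ca).
Proof.
have [M [kp [a [b [P [y [nf nl]]]]]]] := normal_form hl.
apply: (@sub_finite_set _ _ (vpt M y @` [set` P])); last by apply: finite_image; exact: finite_seq.
by move=> q /(intersection_vpt hl nf nl)[p pP ->]; exists p.
Qed.
Lemma comp_sub_inj j k : comp Ca l j `<=` comp Ca l k -> j = k.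
Proof.
have [M [kp [a [b [P [y [nf nl]]]]]]] := normal_form hl.
move=> h; have [//|jk] := eqVneq j k.
have [x _ xP] := @small_avoid R setT P filterT.
have : comp Ca l k (param M a b j x) by apply: h; apply/(param_comp nf).
by move=> /(param_comp nf) /esym /(crossing_in nl jk); rewrite (negPf xP).
Qed.
Lemma line_meet i k : i != k -> exists2 p, l i p & l k p.
Proof.
have [M [kp [a [b [P [y [nf nl]]]]]]] := normal_form hl.
move=> ik; have [_ [p _ E]] := nf_N1 nf ik; exists (param M a b (Some i) p); first exact/(param_comp nf _ (Some i)).
by apply/(param_comp nf _ (Some k)); rewrite /= E.
Qed.
Lemma conic_meet i : exists2 p, l i p & conic Ca p.
Proof.
have [M [kp [a [b [P [y [nf nl]]]]]]] := normal_form hl.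
have [p [q [_ _ aE bE]]] := nf_N2 nf i; exists (param M a b None p); last exact/(param_comp nf _ None).
by apply/(param_comp nf _ (Some i)); rewrite /= aE bE; ring.
Qed.
Lemma line_meet_unique i k p q : i != k -> l i p -> l k p -> l i q -> l k q -> p = q.
Proof.
have [M [kp [a [b [P [y [nf nl]]]]]]] := normal_form hl.
move=> ik; have sik : Some i != Some k by [].
move=> hip hkp; have [x xP xE] := intersectionP hl nf nl sik (hip : comp Ca l (Some i) p) (hkp : comp Ca l (Some k) p).
move=> hiq hkq; have [z zP zE] := intersectionP hl nf nl sik (hiq : comp Ca l (Some i) q) (hkq : comp Ca l (Some k) q).
move: hip hkp hiq hkq; rewrite xE zE => /(vpt_comp nf (Some i)) + /(vpt_comp nf (Some k)) + /(vpt_comp nf (Some i)) + /(vpt_comp nf (Some k)).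
rewrite /= => <- h1 <- h2; congr (vpt _ _ _); have [ai _] := nf_N1 nf ik.
have a0 : a i - a k != 0 by rewrite subr_eq0.
apply/eqP; rewrite -subr_eq0.
have : (a i - a k) * (x - z) == 0.
  by apply/eqP; transitivity ((a i * x + b i - (a k * x + b k)) - (a i * z + b i - (a k * z + b k))); [ring|rewrite h1 h2 !subrr].
by rewrite mulf_eq0 (negPf a0).
Qed.
(** Expresses tangency by incidence alone, so that it can be transported. A chord meeting the conic
    once has both its roots equal to [x], hence slope [2 x]. *)
Lemma tangent_meet i p : tangent_at Ca (l i) p <->
  [/\ l i p, conic Ca p & forall q, l i q -> conic Ca q -> q = p].
Proof.
have [M [kp [a [b [P [y [nf nl]]]]]]] := normal_form hl.
have main : l i p -> conic Ca p -> tangent_at Ca (l i) p <-> forall q, l i q -> conic Ca q -> q = p.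
  have no : Some i != None :> J by [].
  move=> ip cp; have [x xP xE] := intersectionP hl nf nl no (ip : comp Ca l (Some i) p) (cp : comp Ca l None p).
  move: ip cp; rewrite xE => /(vpt_comp nf (Some i)) ix /(vpt_comp nf None) cx; rewrite (tangent_slope nf ix cx).
  have bE : b i = x ^+ 2 - a i * x by have : a i * x + b i = x ^+ 2 by [rewrite [LHS]ix -cx]; move=> <-; ring.
  have [r [s [rP sP aE bE']]] := nf_N2 nf i.
  split=> [ax q iq cq|uni].
    have [z zP zE] := intersectionP hl nf nl no (iq : comp Ca l (Some i) q) (cq : comp Ca l None q).
    move: iq cq; rewrite zE => /(vpt_comp nf (Some i)) iz /(vpt_comp nf None) cz; congr (vpt _ _ _).
    apply/eqP; rewrite -subr_eq0 -sqrf_eq0; apply/eqP.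
    have : a i * z + b i = z ^+ 2 by rewrite [LHS]iz -cz.
    by move=> h; rewrite -[RHS](subrr (z ^+ 2)) -[in X in _ = _ - X]h bE ax; ring.
  have rt z : z \in P -> (z - r) * (z - s) = 0 -> z = x.
    move=> zP h; have e : br a b (Some i) z = br a b None z by rewrite /= aE bE' -[RHS]subr0 -[in RHS]h; ring.
    have e1 := nf_Y1 nf zP no e; have e2 : br a b None z = y z by rewrite -e.
    by apply: (vpt_inj nf); apply: uni; [apply/(vpt_comp nf (Some i))|apply/(vpt_comp nf None)].
  have rx : r = x by apply: rt => //; rewrite subrr mul0r.
  have sx : s = x by apply: rt => //; rewrite subrr mulr0.
  by rewrite aE rx sx; ring.
split=> [t|[ip cp u]]; last exact/main.
have ip : l i p.
  have [cp E] := t; have [sA _] := qform_smooth Ca; rewrite E /line_of /= trmx_mul sA mulmxA.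
  exact: cp.
by have [cp _] := t; split => //; apply/main.
Qed.
Lemma intersectionE p : intersection_points Ca p <-> exists j k, [/\ j != k, comp Ca l j p & comp Ca l k p].
Proof.
have [M [kp [a [b [P [y [nf nl]]]]]]] := normal_form hl.
exact: (intersection_comp hl nf).
Qed.
End Incidence.
(** Off the finite preimage of the crossings of [C2], a component is parametrised by a punctured
    plane, so its image is connected and lies in one component; density and closedness give the
    remaining points. *)
Lemma component_image (C1 C2 : arrangement (R := R) n) l1 l2 (h : CP2 R -> CP2 R) :
  line_indexing C1 l1 -> line_indexing C2 l2 -> (forall p, curve C1 p -> {for p, continuous h}) ->
  (forall p, curve C1 p -> curve C2 (h p)) -> {in curve C1 &, injective h} ->
  forall j, exists k, forall p, comp C1 l1 j p -> comp C2 l2 k (h p).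
Proof.
move=> hl1 hl2 ch hC hI j.
have [M1 [k1 [a1 [b1 [P1 [y1 [nf1 nl1]]]]]]] := normal_form hl1.
have [M2 [k2 [a2 [b2 [P2 [y2 [nf2 nl2]]]]]]] := normal_form hl2.
pose f x := param M1 a1 b1 j x.
have fc x : comp C1 l1 j (f x) by apply/(param_comp nf1).
have fC x : curve C1 (f x) by apply/(curve_comp hl1); exists j.
have : finite_set ((h \o f) @^-1` intersection_points C2).
  apply: finite_preimage; last exact: (intersection_finite hl2).
  move=> x z _ _ /= E; apply: (param_inj nf1); apply: (hI (f x) (f z)) E; exact: mem_set.
move=> /finite_seqP[s sE].
have sP x : x \notin s -> ~ intersection_points C2 (h (f x)).
  move=> xs hx; have : ((h \o f) @^-1` intersection_points C2) x by [].
  by rewrite sE /= (negPf xs).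
have [k kA] : exists k, (h \o f) @` [set z | z \notin s] `<=` comp C2 l2 k.
  apply: connected_in_one.
  - apply: connected_continuous_connected; first exact: complement_connected.
    apply: continuous_subspaceT => x.
    have c : tends (nbhs x) f (f x) by exact: (param_continuous nf1).
    exact: (tends_comp c (ch _ (fC x))).
  - by have [x _ xs] := @small_avoid R setT s filterT; exists (h (f x)), x.
  - by move=> k; exact: (comp_closed hl2).
  - by move=> _ [x _ <-]; have /(curve_comp hl2)[k hk] := hC _ (fC x); exists k.
  - move=> i k _ [x xs <-] hi hk; have [//|ik] := eqVneq i k.
    by case: (sP _ xs); apply/(intersectionE hl2); exists i, k.
exists k => p jp; apply: contrapT => nk.
have pC : curve C1 p by apply/(curve_comp hl1); exists j.
have nb : nbhs (h p) (~` comp C2 l2 k).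
  by apply: open_nbhs_nbhs; split => //; apply: closed_openC; exact: (comp_closed hl2).
have [x xs] := param_dense nf1 s jp (ch _ pC _ nb); apply.
by apply: kA; exists x.
Qed.
End Components.

(** * Incidence structures *)
Section Incidences.
Variables (R : realType) (n : nat).
Notation J := (option 'I_n).
Lemma indexing_exists (C1 : arrangement (R := R) n) : exists l, line_indexing C1 l.
Proof.
have /card_set_bijP[f [fI finj fS]] : (`I_n #= lines C1)%card by rewrite card_eq_sym; exact: card_lines.
exists (fun i => f i); split.
- by move=> i _; apply: fI; exact: ltn_ord.
- by move=> i k _ _ E; apply: val_inj; apply: finj => //; apply: mem_set => /=; exact: ltn_ord.
- by move=> L /fS[k kn <-]; exists (Ordinal kn).
Qed.
Lemma charE (C1 : arrangement (R := R) n) l p : line_indexing C1 l ->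
  char C1 p = (nat_of_bool `[< exists i, tangent_at C1 (l i) p >], nat_of_bool `[< conic C1 p >], #|[set i | `[< l i p /\ ~ tangent_at C1 (l i) p >]]%SET|).
Proof.
move=> [lC lI lS]; rewrite /char; congr (nat_of_bool _, _, _).
  by apply/asboolP/asboolP => [[L /lS[i _ <-] t]|[i t]]; [exists i|exists (l i) => //; exact: lC].
set S := [set i | _]%SET.
have -> : fset_set [set L | [/\ lines C1 L, L p & ~ tangent_at C1 L p]] = [fset l i | i in S]%fset.
  have E : [set L | [/\ lines C1 L, L p & ~ tangent_at C1 L p]] = l @` [set i | i \in S].
    apply/seteqP; split => [L [/lS[i _ <-] h1 h2]|_ [i + <-]].
      by exists i => //; rewrite /= finset.inE; apply/asboolP.
    by rewrite /= finset.inE => /asboolP[h1 h2]; split => //; exact: lC.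
  apply/fsetP => L; rewrite in_fset_set ?E; last by apply: finite_image; exact: finite_finset.
  apply/idP/imfsetP => /= [/set_mem[i iS <-]|[i iS ->]]; first by exists i.
  by apply: mem_set; exists i.
rewrite card_in_imfset /=; first by rewrite cardE.
by move=> i k _ _; apply: lI; exact: mem_set.
Qed.
Lemma incidence_conditions (C1 C2 : arrangement (R := R) n) l1 l2 b : line_indexing C1 l1 -> line_indexing C2 l2 ->
  set_bij (intersection_points C1) (intersection_points C2) b ->
  (forall p j, intersection_points C1 p -> comp C1 l1 j p <-> comp C2 l2 j (b p)) ->
  forall p, intersection_points C1 p -> [/\ char C2 (b p) = char C1 p, [set i | l2 i (b p)] = [set i | l1 i p]
      & forall i, tangent_at C1 (l1 i) p -> tangent_at C2 (l2 i) (b p)].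
Proof.
move=> hl1 hl2 [bI binj bS] H p Ip.
have T i : tangent_at C1 (l1 i) p <-> tangent_at C2 (l2 i) (b p).
  have E1 := H _ (Some i) Ip; have E2 := H _ None Ip; rewrite /= in E1 E2.
  split=> [/(tangent_meet hl1)|/(tangent_meet hl2)] [h1 h2 u]; first apply/(tangent_meet hl2); last apply/(tangent_meet hl1).
    split; [exact/E1|exact/E2|move=> q' q1 q2].
    have : intersection_points C2 q' by apply/(intersectionE hl2); exists (Some i), None.
    by move=> /bS[q Iq qE]; rewrite -qE in q1 q2 *; congr b; apply: u; [apply/(H _ (Some i) Iq)|apply/(H _ None Iq)].
  split; [exact/E1|exact/E2|move=> q q1 q2].
  have Iq : intersection_points C1 q by apply/(intersectionE hl1); exists (Some i), None.
  apply: binj; [exact: mem_set|exact: mem_set|].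
  by apply: u; [apply/(H _ (Some i) Iq)|apply/(H _ None Iq)].
have L i : l2 i (b p) <-> l1 i p by split => h; apply/(H _ (Some i) Ip).
split; last by move=> i /T.
  rewrite (charE _ hl1) (charE _ hl2); congr (nat_of_bool _, nat_of_bool _, _).
  - by apply/asboolP/asboolP => -[i /T t]; exists i.
  - by apply/asboolP/asboolP => h; apply/(H _ None Ip).
  - apply: eq_card => i; rewrite !finset.inE; apply/asboolP/asboolP => -[/L h1 h2]; split => // /T; exact: h2.
by apply/seteqP; split => i /L.
Qed.
Definition combinatorially_equivalent (C1 C2 : arrangement (R := R) n) := exists (l1 l2 : 'I_n -> set (CP2 R)) (b : CP2 R -> CP2 R),
  [/\ line_indexing C1 l1, line_indexing C2 l2, set_bij (intersection_points C1) (intersection_points C2) b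
    & forall p, intersection_points C1 p -> [/\ char C2 (b p) = char C1 p, [set i | l2 i (b p)] = [set i | l1 i p]
      & forall i, tangent_at C1 (l1 i) p -> tangent_at C2 (l2 i) (b p)]].
(** As the conic is kept, [sg] permutes the lines; reindexing the lines of [C2] by it makes the
    indices match. *)
Lemma conic_preserving_incidence (C1 C2 : arrangement (R := R) n) l1 l2 b (sg : J -> J) : line_indexing C1 l1 -> line_indexing C2 l2 ->
  set_bij (intersection_points C1) (intersection_points C2) b -> injective sg -> sg None = None ->
  (forall p j, intersection_points C1 p -> comp C1 l1 j p <-> comp C2 l2 (sg j) (b p)) ->
  combinatorially_equivalent C1 C2.
Proof.
move=> hl1 hl2 hb sI s0 H.
have /choice[s sE] : forall i, exists k, sg (Some i) = Some k.
  by move=> i; case E: (sg (Some i)) => [k|]; [exists k|move: E; rewrite -s0 => /sI].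
have sinj : injective s by move=> i k E; have := sE i; rewrite E -sE => /sI[].
have hl : line_indexing C2 (l2 \o s).
  have [lC lI lS] := hl2; split.
  - by move=> i _; exact: lC.
  - by move=> i k _ _ /= E; apply: sinj; apply: (lI _ _ (mem_set I) (mem_set I) E).
  - move=> L /lS[k _ <-]; have /codomP[i ->] : k \in codom s by apply: (inj_card_onto sinj).
    by exists i.
exists l1, (l2 \o s), b; split; [exact: hl1|exact: hl|exact: hb|].
apply: (incidence_conditions hl1 hl hb) => p j Ip.
by rewrite H//; case: j => [i|]; rewrite ?sE ?s0.
Qed.
(** A crossing on exactly one of the conic and the line [al] lies on exactly one further line; its
    partner is where that line meets the other of the two. All other crossings are fixed, and the
    map is an involution. *)
Lemma conic_exchange (C1 : arrangement (R := R) n) l al : line_indexing C1 l ->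
  (forall i p q, i != al -> l i p -> conic C1 p -> l i q -> conic C1 q -> p = q) ->
  (forall i k p X, i != al -> k != al -> X = None \/ X = Some al -> l i p -> l k p -> comp C1 l X p -> i = k) ->
  exists2 rho, set_bij (intersection_points C1) (intersection_points C1) rho
    & forall p j, intersection_points C1 p -> comp C1 l j (rho p) <-> comp C1 l (tperm None (Some al) j) p.
Proof.
move=> hl H1 HF; pose tau := tperm None (Some al) : {perm J}.
have tauE j : tau (tau j) = j by exact: tpermK.
have tauk k : k != al -> tau (Some k) = Some k by move=> ka; rewrite tpermD// eq_sym.
have HE i X : i != al -> X = None \/ X = Some al -> exists2 p, l i p & comp C1 l X p.
  by move=> ia [->|->]; [exact: conic_meet hl i|exact: line_meet hl i al ia].
have HU i X p q : i != al -> X = None \/ X = Some al -> l i p -> comp C1 l X p -> l i q -> comp C1 l X q -> p = q.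
  by move=> ia [->|->]; [exact: H1|exact: (line_meet_unique hl ia)].
have step p X : X = None \/ X = Some al -> intersection_points C1 p -> comp C1 l X p -> ~ comp C1 l (tau X) p ->
    exists i, [/\ i != al, l i p & exists p', intersection_points C1 p' /\ forall j, comp C1 l j p' <-> comp C1 l (tau j) p].
  move=> hX /(intersectionE hl)[j [k [jk hj hk]]] pX nX.
  have hY : tau X = None \/ tau X = Some al by case: hX => ->; rewrite ?tpermL ?tpermR; [right|left].
  have XY : X != tau X by case: hX => ->; rewrite ?tpermL ?tpermR.
  have other m : m = X \/ m = tau X \/ exists2 i, i != al & m = Some i.
    case: m => [i|]; last by case: hX => ->; [left|right; left; rewrite tpermR].
    have [->|ia] := eqVneq i al; last by right; right; exists i.
    by case: hX => ->; [right; left; rewrite tpermL|left].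
  have [i ia ip] : exists2 i, i != al & l i p.
    have [jX|[jY|[i ia E]]] := other j; [|by rewrite jY in hj|by exists i; rewrite // E in hj *].
    have [kX|[kY|[i ia E]]] := other k; [by rewrite jX kX eqxx in jk|by rewrite kY in hk|by exists i; rewrite // E in hk *].
  exists i; split => //; have [p' ip' Yp'] := HE i _ ia hY; exists p'.
  have nXp' : ~ comp C1 l X p' by move=> h; apply: nX; rewrite (HU i X p p' ia hX).
  split.
    apply/(intersectionE hl); exists (Some i), (tau X); split => //.
    by case: hY => ->//; apply: contra ia => /eqP[->].
  move=> m; have [->|[->|[k' ka ->]]] := other m; [by split|by rewrite tauE; split|rewrite tauk//=].
  by split => h; [rewrite -(HF i k' p' _ ia ka hY)|rewrite -(HF i k' p _ ia ka hX)].
have /choice[rho rhoP] : forall p, exists p', intersection_points C1 p ->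
    [/\ intersection_points C1 p', (forall j, comp C1 l j p' <-> comp C1 l (tau j) p)
      & (conic C1 p <-> l al p) -> p' = p].
  move=> p; have [Ip|nI] := pselect (intersection_points C1 p); last by exists p.
  have [E|nE] := pselect (conic C1 p <-> l al p).
    exists p => _; split => // j; case: j => [k|]; last by rewrite tpermL.
    by have [->|ka] := eqVneq k al; [rewrite tpermR; apply: iff_sym|rewrite tauk].
  have [cp|ncp] := pselect (conic C1 p).
    have [] := step p None (or_introl erefl) Ip cp.
      by rewrite tpermL /= => h; apply: nE.
    by move=> i [_ _ [p' [I' h]]]; exists p' => _; split => // /nE.
  have [ap|nap] := pselect (l al p); last by case: nE; split.
  have [] := step p (Some al) (or_intror erefl) Ip ap; first by rewrite tpermR.
  by move=> i [_ _ [p' [I' h]]]; exists p' => _; split => // /nE.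
have inv p : intersection_points C1 p -> rho (rho p) = p.
  move=> Ip; have [I1 h1 e1] := rhoP _ Ip; have [I2 h2 e2] := rhoP _ I1.
  have [E|nE] := pselect (conic C1 p <-> l al p); first by rewrite !e1.
  have h j : comp C1 l j (rho (rho p)) <-> comp C1 l j p by rewrite h2 h1 tauE.
  have [X [hX pX nX]] : exists X, [/\ X = None \/ X = Some al, comp C1 l X p & ~ comp C1 l (tau X) p].
    have [cp|ncp] := pselect (conic C1 p).
      by exists None; split; [left|exact: cp|rewrite tpermL /= => h'; apply: nE].
    have [ap|nap] := pselect (l al p); last by case: nE; split.
    by exists (Some al); split; [right|exact: ap|rewrite tpermR].
  have [i [ia ip _]] := step p X hX Ip pX nX.
  by apply: (HU i X) => //; [apply/(h (Some i))|apply/h].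
exists rho; last by move=> p j /rhoP[].
split=> [p /rhoP[]//|p q /set_mem Ip /set_mem Iq E|p Ip]; first by rewrite -(inv p)// E inv.
by exists (rho p); [have [] := rhoP _ Ip|exact: inv].
Qed.
Lemma homeo_incidence (C1 C2 : arrangement (R := R) n) (h g : CP2 R -> CP2 R) :
  (forall p, curve C1 p -> [/\ curve C2 (h p), {for p, continuous h} & g (h p) = p]) ->
  (forall p, curve C2 p -> [/\ curve C1 (g p), {for p, continuous g} & h (g p) = p]) ->
  combinatorially_equivalent C1 C2.
Proof.
move=> hP gP; have [l1 hl1] := indexing_exists C1; have [l2 hl2] := indexing_exists C2.
have hI : {in curve C1 &, injective h}.
  by move=> p q /set_mem/hP[_ _ ph] /set_mem/hP[_ _ qh] E; rewrite -ph E.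
have gI : {in curve C2 &, injective g}.
  by move=> p q /set_mem/gP[_ _ pg] /set_mem/gP[_ _ qg] E; rewrite -pg E.
have /choice[sg sgP] : forall j, exists k, forall p, comp C1 l1 j p -> comp C2 l2 k (h p).
  by apply: component_image => // p /hP[].
have /choice[sg' sg'P] : forall j, exists k, forall p, comp C2 l2 j p -> comp C1 l1 k (g p).
  by apply: component_image => // p /gP[].
have c1 j p : comp C1 l1 j p -> curve C1 p by move=> jp; apply/(curve_comp hl1); exists j.
have c2 j p : comp C2 l2 j p -> curve C2 p by move=> jp; apply/(curve_comp hl2); exists j.
have K1 : cancel sg sg'.
  move=> j; apply/esym/(comp_sub_inj hl1) => p jp; have [_ _ <-] := hP _ (c1 _ _ jp).
  by apply: sg'P; exact: sgP.
have K2 : cancel sg' sg.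
  move=> j; apply/esym/(comp_sub_inj hl2) => p jp; have [_ _ <-] := gP _ (c2 _ _ jp).
  by apply: sgP; exact: sg'P.
have H j p : curve C1 p -> comp C1 l1 j p <-> comp C2 l2 (sg j) (h p).
  move=> Cp; split; first exact: sgP.
  by move=> /sg'P; rewrite K1; have [_ _ ->] := hP _ Cp.
have IC1 p : intersection_points C1 p -> curve C1 p by move=> /(intersectionE hl1)[j [k [_ /c1]]].
have IC2 p : intersection_points C2 p -> curve C2 p by move=> /(intersectionE hl2)[j [k [_ /c2]]].
have hb : set_bij (intersection_points C1) (intersection_points C2) h.
  split=> [p /(intersectionE hl1)[j [k [jk hj hk]]]|p q /set_mem/IC1 Cp /set_mem/IC1 Cq|q].
  - apply/(intersectionE hl2); exists (sg j), (sg k); split; [by rewrite (can_eq K1)|exact: sgP|exact: sgP].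
  - by apply: hI; exact: mem_set.
  - move=> Iq; have [_ _ qE] := gP _ (IC2 _ Iq); exists (g q) => //.
    have /(intersectionE hl2)[j [k [jk hj hk]]] := Iq.
    apply/(intersectionE hl1); exists (sg' j), (sg' k); split; [by rewrite (can_eq K2)|exact: sg'P|exact: sg'P].
have sI := can_inj K1.
have [s0|s0] := eqVneq (sg None) None.
  by apply: (conic_preserving_incidence hl1 hl2 hb sI s0) => p j /IC1; exact: H.
case E0: (sg' None) => [al|]; last by case/eqP: s0; rewrite -[in sg _]E0 K2.
have sal : sg (Some al) = None by rewrite -E0 K2.
case E1: (sg None) => [be|]; last by rewrite E1 in s0.
have sline i : i != al -> exists2 i', sg (Some i) = Some i' & i' != be.
  move=> ia; case Ei: (sg (Some i)) => [i'|].
    exists i' => //; apply/eqP => ib; have /sI : sg (Some i) = sg None by rewrite Ei E1 ib.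
    by [].
  have /sI[E] : sg (Some i) = sg (Some al) by rewrite Ei sal.
  by rewrite E eqxx in ia.
(* Line [i] and the conic are carried to two distinct lines, which meet only once. *)
have U1 i p q : i != al -> l1 i p -> conic C1 p -> l1 i q -> conic C1 q -> p = q.
  move=> ia ip cp iq cq; have [i' Ei ib] := sline _ ia.
  have [Cp Cq] : curve C1 p /\ curve C1 q by split; [exact: (c1 (Some i))|exact: (c1 (Some i))].
  apply: hI; [exact: mem_set|exact: mem_set|apply: (line_meet_unique hl2 ib)].
  - by have := (H (Some i) p Cp).1 ip; rewrite Ei.
  - by have := (H None p Cp).1 cp; rewrite E1.
  - by have := (H (Some i) q Cq).1 iq; rewrite Ei.
  - by have := (H None q Cq).1 cq; rewrite E1.
(* On the conic both lines are tangent at [p], since each meets it once; on [al] their images are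
   both tangent to the conic of [C2]. The tangent at a point is unique. *)
have F i k p X : i != al -> k != al -> X = None \/ X = Some al -> l1 i p -> l1 k p -> comp C1 l1 X p -> i = k.
  move=> ia ka [->|->] ip kp Xp.
    have t m : m != al -> l1 m p -> tangent_at C1 (l1 m) p.
      by move=> ma mp; apply/(tangent_meet hl1); split => // q mq cq; apply: (U1 m).
    have [_ t1] := t _ ia ip; have [_ t2] := t _ ka kp; have [_ lI _] := hl1.
    by apply: (lI i k (mem_set I) (mem_set I)); rewrite t1 t2.
  have Cp : curve C1 p by exact: (c1 (Some i)).
  have t m : m != al -> l1 m p -> exists2 m', sg (Some m) = Some m' & tangent_at C2 (l2 m') (h p).
    move=> ma mp; have [m' Em _] := sline _ ma; exists m' => //; apply/(tangent_meet hl2); split.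
    - by have := (H (Some m) p Cp).1 mp; rewrite Em.
    - by have := (H (Some al) p Cp).1 Xp; rewrite sal.
    - move=> q mq cq; have Cq := c2 None q cq; have [Cgq _ qE] := gP _ Cq; rewrite -qE in mq cq *; congr h.
      have mgq : l1 m (g q) by apply/(H (Some m) _ Cgq); rewrite Em.
      have agq : l1 al (g q) by apply/(H (Some al) _ Cgq); rewrite sal.
      exact: (line_meet_unique hl1 ma).
  have [i' Ei [_ t1]] := t _ ia ip; have [k' Ek [_ t2]] := t _ ka kp; have [_ lI _] := hl2.
  have ik : i' = k' by apply: (lI i' k' (mem_set I) (mem_set I)); rewrite t1 t2.
  by have /sI[] : sg (Some i) = sg (Some k) by rewrite Ei Ek ik.
have [rho rb rP] := conic_exchange hl1 U1 F.
apply: (@conic_preserving_incidence _ _ l1 l2 (h \o rho) (sg \o tperm None (Some al))) => //.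
- exact: set_bij_comp rb hb.
- exact: inj_comp sI (@perm_inj _ _).
- by rewrite /= tpermL.
- move=> p j Ip; have Irp : intersection_points C1 (rho p) by have [rI _ _] := rb; exact: rI.
  by rewrite /= -H; [rewrite rP// tpermK|exact: IC1].
Qed.
End Incidences.
Theorem theorem1 (R : realType) (n : nat) (C1 C2 : arrangement (R := R) n) :
  (exists (T1 T2 : set (CP2 R)) (h : CP2 R -> CP2 R),
     [/\ tubular_neighborhood T1 (curve C1),
         tubular_neighborhood T2 (curve C2),
         homeomorphism T1 T2 h
       & h @` curve C1 = curve C2])
  <->
  (exists (l1 l2 : 'I_n -> set (CP2 R)) (b : CP2 R -> CP2 R),
     [/\ line_indexing C1 l1,
         line_indexing C2 l2,
         set_bij (intersection_points C1) (intersection_points C2) b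
       & forall p, intersection_points C1 p ->
           [/\ char C2 (b p) = char C1 p,
               [set i | l2 i (b p)] = [set i | l1 i p]
             & forall i, tangent_at C1 (l1 i) p ->
                 tangent_at C2 (l2 i) (b p)]]).
Proof.
split=> [[T1 [T2 [h [[_ S1 _ _] [_ S2 _ _] [hb [g [gK hc gc]]] hE]]]]|[l1 [l2 [b [hl1 hl2 hb bP]]]]]; last first.
  by have [nh st] := combinatorial_homeo hl1 hl2 hb bP; exact: nbhd_homeo_tubular.
(* The curve lies in the interior of its tube, where continuity within the tube is continuity in the
   plane. *)
have interior_continuous (T : set (CP2 R)) f p : {within T, continuous f} -> T° p -> {for p, continuous f}.
  move=> fc Tp; have := fc p.
  by rewrite /continuous_at -(nbhs_subspace_interior Tp).
have gh p : curve C1 p -> g (h p) = p by move=> /S1/interior_subset Tp; apply: gK; exact: mem_set.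
apply: (@homeo_incidence _ _ _ _ h g) => p Cp.
  split; [by rewrite -hE; exists p|exact: interior_continuous hc (S1 _ Cp)|exact: gh].
have : (h @` curve C1) p by rewrite hE.
move=> [q Cq qE]; split; [by rewrite -qE gh|exact: interior_continuous gc (S2 _ Cp)|by rewrite -qE gh].
Qed.
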